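(* Let $(X,\{h,J\})$ be a connected locally conformal Kähler manifold with $\dim_{\mathbb{R}}X=2n\geq4$ whose universal covering manifold (with the lifted metric and complex structure) is not holomorphically conformal to $\mathbb{C}^n$. Then there exists a locally conformal Kähler metric $h'$ on $(X,J)$ conformal to $h$ which satisfies $$\mathrm{Iso}\left(X,\{h',J\}\right)=\mathrm{Conf}(X,\{h,J\}).$$
   Context: A Hermitian metric $h$ on a complex manifold $(X,J)$ is called locally conformal Kähler ($lcK$) if there is an open covering $\{U_\ell\}$ of $X$ and functions $u_\ell:U_\ell\to\mathbb{R}^{>0}$ such that $h=u_\ell\cdot g_\ell$ on $U_\ell$ with $g_\ell$ a Kähler metric on $(U_\ell,J)$. For a Hermitian metric $h$ on $(X,J)$, $\mathrm{Iso}(X,\{h,J\})$ is the group of holomorphic isometries of $h$, and $\mathrm{Conf}(X,\{h,J\})$ is the group of biholomorphic diffeomorphisms $\alpha$ with $\alpha^*h=f\cdot h$ for some $f\in C^\infty(X,\mathbb{R}^{>0})$. $\mathbb{C}^n$ carries its standard flat Kähler metric; ''holomorphically conformal to $\mathbb{C}^n$'' means that there is a biholomorphic conformal diffeomorphism to $\mathbb{C}^n$. $h'$ is conformal to $h$ if $h'=v\cdot h$ with $v\in C^\infty(X,\mathbb{R}^{>0})$. *)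

(* Defs.v *)
From HB Require Import structures.
From mathcomp Require Import all_boot all_order all_algebra.
From mathcomp Require Import all_classical all_reals all_analysis.
From mathcomp Require Import complex.
Set Implicit Arguments.
Unset Strict Implicit.
Unset Printing Implicit Defensive.
Import Order.TTheory GRing.Theory Num.Theory.
Import numFieldNormedType.Exports.
Local Open Scope classical_set_scope.
Local Open Scope ring_scope.
Local Open Scope sesquilinear_scope.
Local Open Scope complex_scope.

(* The ascription lets the norm and topology of a numClosedFieldType be inferred
   on R[i]; then [differentiable] at type 'rV[Cx R]_n is complex
   differentiability. *)
Definition Cx (R : realType) : numClosedFieldType := R[i].

Section Smooth.
Variables (R : realType) (n : nat).
Local Notation V := 'rV[Cx R]_n.

(* Derivative along v with respect to a real parameter; V = C^n is used here as
   a real vector space of dimension 2n. *)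
Definition rderivable (f : V -> R) (v x : V) : Prop :=
  derivable (fun t : R => f (x + t%:C *: v)) 0 1.

Definition rderive (f : V -> R) (v x : V) : R :=
  derive1 (fun t : R => f (x + t%:C *: v)) 0.

Fixpoint Ck_on (k : nat) (U : set V) (f : V -> R) : Prop :=
  (forall x, U x -> {for x, continuous f}) /\
  if k is k'.+1 then
    forall v, (forall x, U x -> rderivable f v x) /\ Ck_on k' U (rderive f v)
  else True.

Definition smooth_on (U : set V) (f : V -> R) : Prop := forall k, Ck_on k U f.

End Smooth.

(* A homeomorphism from the open set [dom] of X onto the open set [cod] of C^n;
   [cmap] and [cinv] are total functions, unspecified off [dom] and [cod]. *)
Record chart (R : realType) (n : nat) (X : topologicalType) := Chart {
  dom : set X;
  cod : set 'rV[Cx R]_n;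
  cmap : X -> 'rV[Cx R]_n;
  cinv : 'rV[Cx R]_n -> X;
  dom_open : open dom;
  cod_open : open cod;
  cmap_cod : forall p, dom p -> cod (cmap p);
  cinv_dom : forall x, cod x -> dom (cinv x);
  cmapK : forall p, dom p -> cinv (cmap p) = p;
  cinvK : forall x, cod x -> cmap (cinv x) = x;
  cmap_continuous : forall p, dom p -> {for p, continuous cmap};
  cinv_continuous : forall x, cod x -> {for x, continuous cinv}
}.

Record complexManifold (R : realType) (n : nat) := ComplexManifold {
  mcarrier :> topologicalType;
  mindex : Type;
  mchart : mindex -> chart R n mcarrier;
  chart_at : mcarrier -> mindex;
  dom_chart_at : forall p, dom (mchart (chart_at p)) p;
  transition_holomorphic : forall i j p,
    dom (mchart i) p -> dom (mchart j) p ->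
    differentiable (cmap (mchart j) \o cinv (mchart i)) (cmap (mchart i) p);
  manifold_hausdorff : hausdorff_space mcarrier;
  manifold_second_countable : @second_countable mcarrier
}.

Section Maps.
Variables (R : realType) (n : nat).
Implicit Types X Y : complexManifold R n.

Definition local_rep X Y (F : X -> Y) (i : mindex X) (j : mindex Y) :=
  cmap (mchart j) \o F \o cinv (mchart i).

Definition holomorphic_on X Y (U : set X) (F : X -> Y) : Prop :=
  (forall p, U p -> {for p, continuous F}) /\
  (forall p i j, U p -> dom (mchart i) p -> dom (mchart j) (F p) ->
    differentiable (local_rep F i j) (cmap (mchart i) p)).

Definition biholomorphic X Y (F : X -> Y) : Prop :=
  holomorphic_on setT F /\
  exists G : Y -> X, [/\ holomorphic_on setT G, cancel F G & cancel G F].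

Definition smooth_fun_on X (U : set X) (f : X -> R) : Prop :=
  forall i, smooth_on (cmap (mchart i) @` (U `&` dom (mchart i)))
                      (f \o cinv (mchart i)).

(* Each sheet is biholomorphic to the evenly covered open set U, with inverse s k:
   the complex structure of Y is the one lifted from X. *)
Definition holomorphic_covering Y X (p : Y -> X) : Prop :=
  holomorphic_on setT p /\
  forall x, exists U : set X, [/\ open U, U x &
    exists (K : Type) (V : K -> set Y) (s : K -> X -> Y),
      [/\ forall k, open (V k),
          trivIset setT V,
          p @^-1` U = \bigcup_k V k &
          forall k, [/\ holomorphic_on U (s k),
                        forall a, U a -> V k (s k a),
                        forall a, U a -> p (s k a) = a &
                        forall y, V k y -> s k (p y) = y]]].

End Maps.

Definition path_connected (R : realType) (T : topologicalType) : Prop :=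
  [set: T] !=set0 /\
  forall x y : T, exists c : R -> T,
    [/\ {within `[0, 1], continuous c}, c 0 = x & c 1 = y].

Definition simply_connected (R : realType) (T : topologicalType) : Prop :=
  path_connected R T /\
  forall c : R -> T, {within `[0, 1], continuous c} -> c 0 = c 1 ->
  exists H : R * R -> T,
    [/\ {within `[0, 1] `*` `[0, 1], continuous H},
        forall t, `[0, 1]%classic t -> H (0, t) = c t,
        forall t, `[0, 1]%classic t -> H (1, t) = c 0 &
        forall s, `[0, 1]%classic s -> H (s, 0) = c 0 /\ H (s, 1) = c 0].

Definition universal_covering (R : realType) (n : nat)
    (Y X : complexManifold R n) (p : Y -> X) : Prop :=
  simply_connected R Y /\ holomorphic_covering p.

(* Matrices (h_jk) of the field of Hermitian forms
   h(u, v) = u *m h *m v ^t* = \sum_jk h_jk u_j (v_k)^*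
   in each chart: the value at (i, p) is meaningful only for p in the domain of
   the i-th chart. The associated Riemannian metric is the real part g of h, so
   that J-invariance, g(Ju, Jv) = g(u, v), is built in, and conversely every
   J-invariant real symmetric form is such a real part. *)
Definition tensor (R : realType) (n : nat) (X : complexManifold R n) :=
  mindex X -> X -> 'M[Cx R]_n.

Section Metrics.
Variables (R : realType) (n : nat).
Implicit Types X Y : complexManifold R n.

Definition herm (A : 'M[Cx R]_n) (u v : 'rV[Cx R]_n) : Cx R :=
  (u *m A *m v ^t*) 0 0.

Definition posdef_hermitian (A : 'M[Cx R]_n) : Prop :=
  A ^t* = A /\ forall u, u != 0 -> 0 < herm A u u.

Definition tensor_eq_on X (U : set X) (g h : tensor X) : Prop :=
  forall i p, U p -> dom (mchart i) p -> g i p = h i p.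

Definition scale_tensor X (f : X -> R) (h : tensor X) : tensor X :=
  fun i p => (f p)%:C *: h i p.

(* F^* h; for a genuine tensor h on Y the choice of chart at F p is irrelevant. *)
Definition pullback X Y (F : X -> Y) (h : tensor Y) : tensor X :=
  fun i p =>
    let j := chart_at (F p) in
    let J := jacobian (local_rep F i j) (cmap (mchart i) p) in
    J *m h j (F p) *m J ^t*.

(* Vectors are rows: the differential of a coordinate change is v |-> v *m J. *)
Definition hermitian_metric_on X (U : set X) (h : tensor X) : Prop :=
  [/\ forall i p, U p -> dom (mchart i) p -> posdef_hermitian (h i p),
      forall i j p, U p -> dom (mchart i) p -> dom (mchart j) p ->
        let J := jacobian (cmap (mchart j) \o cinv (mchart i))
                          (cmap (mchart i) p) in
        h i p = J *m h j p *m J ^t* &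
      forall i (k l : 'I_n),
        let S := cmap (mchart i) @` (U `&` dom (mchart i)) in
        smooth_on S (fun x => complex.Re (h i (cinv (mchart i) x) k l)) /\
        smooth_on S (fun x => complex.Im (h i (cinv (mchart i) x) k l))].

(* omega(u, v) = g(Ju, v) in the i-th chart, as a function of the coordinates. *)
Definition fundamental_form X (h : tensor X) (i : mindex X)
    (u v x : 'rV[Cx R]_n) : R :=
  complex.Re (herm (h i (cinv (mchart i) x)) ('i *: u) v).

(* Exterior derivative of a 2-form on C^n evaluated at constant vector fields. *)
Definition dform (om : 'rV[Cx R]_n -> 'rV[Cx R]_n -> 'rV[Cx R]_n -> R)
    (u v w x : 'rV[Cx R]_n) : R :=
  rderive (om v w) u x + rderive (om w u) v x + rderive (om u v) w x.

Definition kahler_on X (U : set X) (h : tensor X) : Prop :=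
  hermitian_metric_on U h /\
  forall i p, U p -> dom (mchart i) p ->
    forall u v w, dform (fundamental_form h i) u v w (cmap (mchart i) p) = 0.

Definition smooth_pos_on X (U : set X) (f : X -> R) : Prop :=
  smooth_fun_on U f /\ forall p, U p -> 0 < f p.

Definition lcK X (h : tensor X) : Prop :=
  hermitian_metric_on setT h /\
  exists (L : Type) (U : L -> set X) (u : L -> X -> R) (g : L -> tensor X),
    [/\ forall l, open (U l),
        \bigcup_l U l = setT &
        forall l, [/\ smooth_pos_on (U l) (u l),
                      kahler_on (U l) (g l) &
                      tensor_eq_on (U l) h (scale_tensor (u l) (g l))]].

Definition conformal_metric X (h h' : tensor X) : Prop :=
  exists v : X -> R,
    smooth_pos_on setT v /\ tensor_eq_on setT h' (scale_tensor v h).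

Definition Iso X (h : tensor X) : set (X -> X) :=
  [set a | biholomorphic a /\ tensor_eq_on setT (pullback a h) h].

Definition Conf X (h : tensor X) : set (X -> X) :=
  [set a | biholomorphic a /\ conformal_metric h (pullback a h)].

Definition holomorphically_conformal X Y (h : tensor X) (k : tensor Y) : Prop :=
  exists F : X -> Y, biholomorphic F /\ conformal_metric h (pullback F k).

End Metrics.

Section ComplexSpace.
Variables (R : realType) (n : nat).
Local Notation V := 'rV[Cx R]_n.

Lemma rV_second_countable : @second_countable V.
Proof.
pose c (q : rat * rat) : Cx R := (ratr q.1 : R) +i* (ratr q.2 : R).
pose b (a : 'rV[rat * rat]_n * nat) : set V :=
  ball (map_mx c a.1) ((a.2.+1%:R^-1 : R)%:C : Cx R).
exists (range b); first exact: (sub_countable (card_image_le _ _) (countableP _)).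
split=> [_ [a _ <-]|x A]; first exact: ball_open.
rewrite -nbhs_ballE => -[e /= e0 eA].
have eE : e = (complex.Re e)%:C by rewrite [e]complexE; case: e e0 {eA} => a d /=;
  rewrite ltcE /= => /andP[/eqP -> _]; simpc.
have re0 : 0 < complex.Re e by rewrite -ltcR -eE.
have [k ke] : exists k, (k.+1%:R^-1 : R) < complex.Re e / 2.
  have e2 : 0 < complex.Re e / 2 by rewrite divr_gt0.
  have [k _ /(_ k (leqnn _))] := near_infty_natSinv_lt (PosNum e2).
  by exists k.
set d : R := k.+1%:R^-1 in ke.
have d0 : 0 < d by rewrite invr_gt0.
have rat_near (y : R) : exists q : rat, `|ratr q - y| < d / 2.
  have /rat_in_itvoo[q] : y - d / 2 < y + d / 2.
    by rewrite ltrBlDr -addrA ltrDl addr_gt0 // divr_gt0.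
  rewrite in_itv /= => /andP[q1 q2]; exists q.
  by rewrite ltr_norml ltrBlDr ltrBrDr addrC q1 addrC q2.
have [q qP] : exists q : 'rV[rat * rat]_n, forall j,
    `|c (q 0 j) - x 0 j| < (d%:C : Cx R).
  have /choice[f fP] (j : 'I_n) :
      exists q : rat * rat, `|c q - x 0 j| < (d%:C : Cx R).
    have [[q1 q1P] [q2 q2P]] :=
      (rat_near (complex.Re (x 0 j)), rat_near (complex.Im (x 0 j))).
    exists (q1, q2).
    case: (x 0 j) q1P q2P => y1 y2 /= q1P q2P.
    have -> : c (q1, q2) - (y1 +i* y2) =
        (ratr q1 - y1)%:C + (ratr q2 - y2)%:C * 'i%C :> R[i] by rewrite /c; simpc.
    apply: (le_lt_trans (ler_normD _ _)).
    have -> : `|(ratr q2 - y2)%:C * 'i%C : R[i]| = `|(ratr q2 - y2)%:C : R[i]|.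
      by rewrite normrM [`|'i%C|]normc_def /= expr0n expr1n add0r sqrtr1 mulr1.
    rewrite !normc_def /= !expr0n /= !addr0 !sqrtr_sqr.
    by rewrite -rmorphD ltcR [ltRHS]splitr ltrD.
  by exists (\row_j f j) => j; rewrite mxE.
exists (b (q, k)).
  split; first by exists (q, k).
  by split=> [|i j]; rewrite ?ltcR // ord1 mxE -ball_normE /ball_ /= qP.
move=> y [_ yq]; apply: eA; split=> // i j.
have := yq i j; rewrite ord1 mxE -!ball_normE /ball_ /= => yqj.
rewrite -(subrK (c (q 0 j)) (x 0 j)) -addrA.
apply: (le_lt_trans (ler_normD _ _)).
have -> : e = (complex.Re e / 2)%:C + (complex.Re e / 2)%:C.
  by rewrite [LHS]eE -[in RHS]rmorphD -splitr.
have dlt : (d%:C : Cx R) < (complex.Re e / 2)%:C by rewrite ltcR.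
by rewrite ltrD // (lt_trans _ dlt) // distrC.
Qed.

Definition id_chart : chart R n V :=
  @Chart R n V setT setT id id openT openT
    (fun _ _ => I) (fun _ _ => I) (fun _ _ => erefl) (fun _ _ => erefl)
    (fun p _ => @cvg_id _ (nbhs p)) (fun p _ => @cvg_id _ (nbhs p)).

Definition complex_space : complexManifold R n :=
  @ComplexManifold R n V unit (fun=> id_chart) (fun=> tt)
    (fun _ => I) (fun _ _ p _ _ => ex_diff (f := @id V))
    (@norm_hausdorff _ V) rV_second_countable.

Definition flat_metric : tensor complex_space := fun _ _ => 1%:M.

End ComplexSpace.

Arguments complex_space R n : clear implicits.
Arguments flat_metric R n : clear implicits.

(* Main.v *)
(* On the universal covering Y the local Kähler metrics patch by monodromy to a global Kähler
   metric g = w p^*h. A lift to Y of an element of Conf(X) is conformal for g, and for n >= 2 the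
   conformal factor of two Kähler metrics is constant, so the lift is a homothety al of g, of some
   ratio s. Hence it suffices to find u > 0 smooth on Y with u(al y) s^2 = u(y) for all holomorphic
   homotheties: u w p^*h is then invariant under all lifts and descends to h'.

   If some closed ball of g is not compact, the supremum of the radii of the compact balls at y is
   finite and positive, 1-Lipschitz in y and multiplied by s under al. The homotheties then act
   properly, and u is obtained by averaging bump functions over the group with respect to an
   invariant functional. If all closed balls are compact and some homothety has s <> 1, it (or its
   inverse) has a fixed point, and its Koenigs linearization there is a holomorphic isometry of
   (Y, g) onto flat C^n, which is excluded. If all s are 1, take u = 1. *)
Require Import Defs.
From HB Require Import structures.
From mathcomp Require Import all_boot all_order all_algebra.
From mathcomp Require Import all_classical all_reals all_analysis.
From mathcomp Require Import complex.
From mathcomp Require Import ring lra zify.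
Set Implicit Arguments.
Unset Strict Implicit.
Unset Printing Implicit Defensive.
Import Order.TTheory GRing.Theory Num.Theory.
Import numFieldNormedType.Exports.
Local Open Scope classical_set_scope.
Local Open Scope ring_scope.
Local Open Scope complex_scope.

(** * Real-valued norms *)

(* The required u is a positive function of weight -2 for the group of homotheties. A homothety with
   s <> 1 and a fixed point rules it out, since there u(y) s^2 = u(y); when closed balls are compact
   the contraction principle produces such a point, and this is how flat C^n enters. Otherwise the
   radius r of compactness satisfies r(al y) = s r(y), so r^-2 has the right weight, but r is only
   Lipschitz and has to be smoothed compatibly with a group that carries no given topology or Lie
   structure. What makes averaging possible is that r bounds above and below the ratios of all
   homotheties bringing a given point near z0: by the Arzelà-Ascoli argument these form a totally
   bounded family. Averages are smooth because homotheties are holomorphic: a uniform bound on a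
   family bounds all its derivatives, which is why Cauchy estimates are developed with explicit
   constants and for families. The same estimates give symmetry of second derivatives (pullbacks of
   closed forms are closed), strict differentiability, and limits of holomorphic maps. Deck
   transformations need no separate treatment: they are lifts of the identity. *)
Tactic Notation "lraH" hyp_list(hs) := revert hs; clear; intros; lra.
Section RealNorm.
Variable R : realType.
Local Notation C := (Cx R).

(** Norms over [Cx R] take values in the complex field, which is only partially ordered. Their real
    parts make total order and real arithmetic available in estimates. *)
Definition rn (W : normedModType C) (w : W) : R := complex.Re (`|w| : C).

Lemma real_of_ge0 (z : C) : 0 <= z -> z = (complex.Re z)%:C.
Proof. by case: z => a b; rewrite lecE /= => /andP[/eqP -> _]. Qed.

Lemma lecR_ (a b : R) : ((a%:C : C) <= b%:C) = (a <= b).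
Proof. exact: lecR. Qed.
Lemma ltcR_ (a b : R) : ((a%:C : C) < b%:C) = (a < b).
Proof. exact: ltcR. Qed.

Section W.
Variable W : normedModType C.
Implicit Types v w : W.

Lemma rnE w : (rn w)%:C = `|w| :> C.
Proof. by rewrite /rn -real_of_ge0 ?normr_ge0. Qed.

Lemma rn_ge0 w : 0 <= rn w.
Proof. by rewrite -lecR_ rnE normr_ge0. Qed.

Lemma rn0 : rn (0 : W) = 0.
Proof. by apply: complexI; rewrite rnE normr0. Qed.

Lemma rn_eq0 w : rn w = 0 -> w = 0.
Proof. by move=> w0; apply/eqP; rewrite -normr_eq0 -rnE w0. Qed.

Lemma rn_gt0 w : w != 0 -> 0 < rn w.
Proof. by move=> w0; rewrite -ltcR_ rnE normr_gt0. Qed.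

Lemma rnD v w : rn (v + w) <= rn v + rn w.
Proof. by rewrite -lecR_ rmorphD /= !rnE ler_normD. Qed.

Lemma rnN w : rn (- w) = rn w.
Proof. by apply: complexI; rewrite !rnE normrN. Qed.

Lemma rnB v w : rn (v - w) = rn (w - v).
Proof. by rewrite -opprB rnN. Qed.

Lemma rnZ (a : C) w : rn (a *: w) = rn a * rn w.
Proof. by apply: complexI; rewrite rmorphM /= !rnE normrZ. Qed.

Lemma rn_trans v w u : rn (v - w) <= rn (v - u) + rn (u - w).
Proof. by have := rnD (v - u) (u - w); rewrite addrA subrK. Qed.

Lemma rn_dist v w : `|rn v - rn w| <= rn (v - w).
Proof.
have h (a b : W) : rn a <= rn b + rn (a - b) by have := rnD b (a - b); rewrite addrC subrK.
by have := h v w; have := h w v; rewrite (rnB w v) ler_norml => h1 h2; apply/andP; split; lra.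
Qed.

(** A positive element of [Cx R] is real, so balls of complex radius and balls for [rn] give the
    same neighbourhoods. *)
Lemma nbhs_rnP (x : W) (A : set W) :
  nbhs x A <-> exists2 d : R, 0 < d & forall y, rn (y - x) < d -> A y.
Proof.
split=> [|[d d0 dA]].
  rewrite -nbhs_ballE => -[e /= e0 eA].
  have eE := real_of_ge0 (ltW e0).
  exists (complex.Re e); first by rewrite -ltcR_ -eE.
  by move=> y ye; apply: eA; rewrite -ball_normE /ball_ /= eE -rnE ltcR_ rnB.
rewrite -nbhs_ballE; exists (d%:C) => /=; first by rewrite ltcR_.
by move=> y; rewrite -ball_normE /ball_ /= -rnE ltcR_ rnB; exact: dA.
Qed.

Lemma openrnP (U : set W) :
  open U <-> forall x, U x -> exists2 d : R, 0 < d & forall y, rn (y - x) < d -> U y.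
Proof.
rewrite openE; split=> h x Ux; first exact/nbhs_rnP/h.
exact/nbhs_rnP/h.
Qed.

Lemma open_rball (x : W) (r : R) : open [set z | rn (z - x) < r].
Proof.
apply/openrnP => z /= zr; exists (r - rn (z - x)) => [|y yr]; first by rewrite subr_gt0.
by apply: le_lt_trans (rn_trans y x z) _; rewrite -ltrBrDr.
Qed.

End W.

Lemma rnM (a b : C) : rn (a * b) = rn a * rn b.
Proof. exact: rnZ. Qed.

Lemma rn1 : rn (1 : C) = 1.
Proof. by apply: complexI; rewrite rnE normr1. Qed.

Lemma rnV (a : C) : rn (a^-1) = (rn a)^-1.
Proof. by apply: complexI; rewrite fmorphV /= !rnE normfV. Qed.

Lemma rnR (t : R) : rn (t%:C : C) = `|t|.
Proof. by rewrite /rn normc_def /= expr0n addr0 sqrtr_sqr. Qed.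

Lemma rnRe (z : C) : `|complex.Re z| <= rn z.
Proof.
by case: z => a b; rewrite /rn normc_def /= -sqrtr_sqr ler_sqrt ?addr_ge0 ?sqr_ge0 // lerDl sqr_ge0.
Qed.

Lemma rnIm (z : C) : `|complex.Im z| <= rn z.
Proof.
by case: z => a b; rewrite /rn normc_def /= -sqrtr_sqr ler_sqrt ?addr_ge0 ?sqr_ge0 // lerDr sqr_ge0.
Qed.

Lemma rn_le_ReIm (z : C) : rn z <= `|complex.Re z| + `|complex.Im z|.
Proof.
case: z => a b; rewrite /rn normc_def /= -[leRHS]ger0_norm ?addr_ge0 // -sqrtr_sqr.
rewrite ler_sqrt ?sqr_ge0 // sqrrD !real_normK ?num_real //.
have : 0 <= `|a| * `|b| *+ 2 by rewrite mulrn_wge0 // mulr_ge0.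
lra.
Qed.

Section Row.
Variable n : nat.
Implicit Types w : 'rV[C]_n.

(** Together with [rn_le] this identifies [rn] on rows with the maximum over the coordinates, so
    that vector estimates reduce to scalar ones. *)
Lemma rn_coord w k : rn (w 0 k) <= rn w.
Proof.
rewrite -lecR_ !rnE [leRHS]/Num.Def.normr /=.
have : mx_norm w <= mx_norm w by [].
rewrite {1}mx_normE num_le => /bigmax_leP[_ /(_ (0, k) isT)].
by rewrite -num_le.
Qed.

Lemma rn_le w (e : R) : 0 <= e -> (forall k, rn (w 0 k) <= e) -> rn w <= e.
Proof.
move=> e0 h; rewrite -lecR_ rnE [leLHS]/Num.Def.normr /= mx_normE.
have e0' : 0 <= (e%:C : C) by rewrite lecR_.
rewrite (_ : e%:C = (NngNum e0')%:num :> C) // num_le.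
apply/bigmax_leP; split=> [|[i k] _]; first by rewrite -num_le /= lecR_.
by rewrite -num_le /= -rnE lecR_ ord1.
Qed.

End Row.
End RealNorm.

(** * Goursat's theorem and Cauchy estimates *)

Section Bisection.
Variable R : realType.

(** If P fails on a rectangle, it fails on one of its quarters; the nested quarters shrink to a
    point, where the local hypothesis is contradicted. The principle serves both Goursat's theorem
    and the lifting of homotopies. *)
Lemma quadrisection (P : R -> R -> R -> R -> Prop) (a0 b0 c0 d0 : R) :
  a0 <= b0 -> c0 <= d0 ->
  (forall a b c d, a <= b -> c <= d ->
     let m := (a + b) / 2 in let k := (c + d) / 2 in
     P a m c k -> P m b c k -> P a m k d -> P m b k d -> P a b c d) ->
  (forall x y, a0 <= x <= b0 -> c0 <= y <= d0 -> exists2 e : R, 0 < e &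
     forall a b c d, a0 <= a -> a <= x -> x <= b -> b <= b0 ->
       c0 <= c -> c <= y -> y <= d -> d <= d0 ->
       b - a < e -> d - c < e -> P a b c d) ->
  P a0 b0 c0 d0.
Proof.
move=> ab0 cd0 join loc; apply: contrapT => nP.
pose P' (q : (R * R) * (R * R)) := P q.1.1 q.1.2 q.2.1 q.2.2.
pose step (q : (R * R) * (R * R)) :=
  let: ((a, b), (c, d)) := q in let m := (a + b) / 2 in let k := (c + d) / 2 in
  if ~~ `[< P a m c k >] then ((a, m), (c, k)) else
  if ~~ `[< P m b c k >] then ((m, b), (c, k)) else
  if ~~ `[< P a m k d >] then ((a, m), (k, d)) else ((m, b), (k, d)).
pose q i := iter i step ((a0, b0), (c0, d0)).
pose ok (q : (R * R) * (R * R)) := [/\ q.1.1 <= q.1.2, q.2.1 <= q.2.2 & ~ P' q].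
pose sub (q' q : (R * R) * (R * R)) := [/\ q.1.1 <= q'.1.1, q'.1.2 <= q.1.2,
  q.2.1 <= q'.2.1, q'.2.2 <= q.2.2 &
  (q'.1.2 - q'.1.1 = (q.1.2 - q.1.1) / 2) /\ (q'.2.2 - q'.2.1 = (q.2.2 - q.2.1) / 2)].
have stepP z : ok z -> ok (step z) /\ sub (step z) z.
  case: z => [[a b] [c d]] [] /= ab cd; rewrite /P' /= => nPz.
  rewrite /step /=; set m := (a + b) / 2; set k := (c + d) / 2.
  have [am mb ck kd] : [/\ a <= m, m <= b, c <= k & k <= d].
    by rewrite /m /k; split; lra.
  case: ifPn => [/asboolPn h1|/negPn /asboolP h1].
    by rewrite /ok /sub /P' /= /m /k; split; split => //; split; lra.
  case: ifPn => [/asboolPn h2|/negPn /asboolP h2].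
    by rewrite /ok /sub /P' /= /m /k; split; split => //; split; lra.
  case: ifPn => [/asboolPn h3|/negPn /asboolP h3].
    by rewrite /ok /sub /P' /= /m /k; split; split => //; split; lra.
  rewrite /ok /sub /P' /=; split; split => //; last by rewrite /m /k; split; lra.
  by move=> h4; apply: nPz; exact: join.
have qok i : ok (q i) by elim: i => [//|i /stepP[]].
have qsub i : sub (q i.+1) (q i) by have [] := stepP _ (qok i).
have mono i j : (i <= j)%N -> [/\ (q i).1.1 <= (q j).1.1, (q j).1.2 <= (q i).1.2,
    (q i).2.1 <= (q j).2.1 & (q j).2.2 <= (q i).2.2].
  move=> /subnKC <-; elim: (j - i)%N => [|l [h1 h2 h3 h4]]; first by rewrite addn0.
  rewrite addnS; have [g1 g2 g3 g4 _] := qsub (i + l)%N.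
  by split; [exact: le_trans g1|exact: le_trans h2|exact: le_trans g3|exact: le_trans h4].
have sz i : (q i).1.2 - (q i).1.1 = (b0 - a0) / 2 ^+ i /\
            (q i).2.2 - (q i).2.1 = (d0 - c0) / 2 ^+ i.
  elim: i => [|i [h1 h2]]; first by rewrite expr0 !divr1.
  have [_ _ _ _ [-> ->]] := qsub i; rewrite h1 h2 exprSr invfM.
  by split; rewrite -!mulrA.
(* Lower endpoints increase and stay below all upper endpoints, so their suprema give a point common
   to all the rectangles. *)
pose x := sup (range (fun i => (q i).1.1)); pose y := sup (range (fun i => (q i).2.1)).
have xP i : (q i).1.1 <= x <= (q i).1.2.
  have ub j : ubound (range (fun i => (q i).1.1)) ((q j).1.2).
    move=> _ [l _ <-]; have [h _ _ _] := mono _ _ (leq_maxr j l).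
    have [_ h' _ _] := mono _ _ (leq_maxl j l); have [h2 _ _] := qok (maxn j l).
    exact: le_trans (le_trans h h2) h'.
  apply/andP; split; last by apply: ge_sup; [exists (q 0%N).1.1, 0%N|exact: ub].
  by apply: ub_le_sup; [exists (q 0%N).1.2; exact: ub|exists i].
have yP i : (q i).2.1 <= y <= (q i).2.2.
  have ub j : ubound (range (fun i => (q i).2.1)) ((q j).2.2).
    move=> _ [l _ <-]; have [_ _ h _] := mono _ _ (leq_maxr j l).
    have [_ _ _ h'] := mono _ _ (leq_maxl j l); have [_ h2 _] := qok (maxn j l).
    exact: le_trans (le_trans h h2) h'.
  apply/andP; split; last by apply: ge_sup; [exists (q 0%N).2.1, 0%N|exact: ub].
  by apply: ub_le_sup; [exists (q 0%N).2.2; exact: ub|exists i].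
have [e e0 eP] := loc x y (xP 0%N) (yP 0%N).
(* Since 2^i > i, every index above l / e will do. *)
have small (l : R) : 0 <= l -> exists N, forall i, (N <= i)%N -> l / 2 ^+ i < e.
  move=> l0; exists (Num.trunc (l / e)).+1 => i Ni.
  rewrite ltr_pdivrMr ?exprn_gt0 // -ltr_pdivrMl // mulrC.
  apply: (lt_le_trans (truncnS_gt _)).
  apply: (@le_trans _ _ (i%:R)); first by rewrite ler_nat.
  rewrite -natrX ler_nat; exact: ltnW (ltn_expl _ _).
have [N1 h1] := small (b0 - a0) ltac:(by rewrite subr_ge0).
have [N2 h2] := small (d0 - c0) ltac:(by rewrite subr_ge0).
pose i := maxn N1 N2; have [_ _] := qok i; apply; rewrite /P'.
have [g1 g2 g3 g4] := mono 0%N i (leq0n _); have [s1 s2] := sz i.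
have /andP[? ?] := xP i; have /andP[? ?] := yP i.
apply: eP => //; rewrite ?s1 ?s2; [apply: h1|apply: h2].
  exact: leq_maxl.
exact: leq_maxr.
Qed.

Lemma bisection (P : R -> R -> Prop) (a0 b0 : R) : a0 <= b0 ->
  (forall a m b, a <= m -> m <= b -> P a m -> P m b -> P a b) ->
  (forall x, a0 <= x <= b0 -> exists2 e : R, 0 < e &
     forall a b, a0 <= a -> a <= x -> x <= b -> b <= b0 -> b - a < e -> P a b) ->
  P a0 b0.
Proof.
move=> ab join loc.
(* An interval is a rectangle of height 0. *)
apply: (@quadrisection (fun a b _ _ => P a b) a0 b0 0 0) => //.
  by move=> a b c d ab' _ /= h1 h2 _ _; apply: join h1 h2; lra.
move=> x y xP _; have [e e0 h] := loc x xP; exists e => // a b *.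
exact: h.
Qed.

(** A mean value inequality obtained by bisection: the local bounds at the single point x add up on
    both sides of x. The abstract subadditive even N covers real and complex normed targets at
    once. *)
Lemma lipschitz_of_local (W : zmodType) (N : W -> R) (f : R -> W) (M a b : R) :
  (forall u v, N (u + v) <= N u + N v) -> (forall u, N (- u) = N u) -> a <= b ->
  (forall x, a <= x <= b -> exists2 e : R, 0 < e & forall y, a <= y <= b ->
     `|y - x| < e -> N (f y - f x) <= M * `|y - x|) ->
  N (f b - f a) <= M * (b - a).
Proof.
move=> ND NN ab loc; apply: (@bisection (fun a b => N (f b - f a) <= M * (b - a))) => //.
  move=> x m y _ _ h1 h2; rewrite -[f y](subrK (f m)) -addrA.
  by apply: le_trans (ND _ _) _; lraH h1 h2.
move=> x xP; have [e e0 h] := loc x xP; exists e => // x1 x2 h1 h2 h3 h4 h5.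
have n1 : x1 - x <= 0 by lraH h2.
have n2 : 0 <= x2 - x by lraH h3.
have x1P : a <= x1 <= b by lraH h1 h2 h3 h4.
have x2P : a <= x2 <= b by lraH h1 h2 h3 h4.
have := h x2 x2P; rewrite (ger0_norm n2) => /(_ ltac:(lraH h2 h3 h5)) g2.
have := h x1 x1P; rewrite (ler0_norm n1) => /(_ ltac:(lraH h2 h3 h5)).
rewrite -NN opprB => g1.
rewrite -[f x2](subrK (f x)) -addrA; apply: le_trans (ND _ _) _; lraH g1 g2.
Qed.

End Bisection.

(** * Integrals of complex-valued functions over an interval *)

Section ComplexIntegral.
Variable R : realType.
Local Notation C := (Cx R).
Local Notation mu := (@lebesgue_measure R).

(** The nearby y may lie outside the interval, so that restriction to subintervals is immediate and
    no subspace topology occurs. *)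
Definition con (a b : R) (F : R -> C) := forall x, a <= x <= b ->
  forall e, 0 < e -> exists2 d : R, 0 < d & forall y, `|y - x| < d -> rn (F y - F x) < e.

Definition cint (a b : R) (F : R -> C) : C :=
  (\int[mu]_(x in `[a, b]) complex.Re (F x))%R +i* (\int[mu]_(x in `[a, b]) complex.Im (F x))%R.

Lemma ReB (x y : C) : complex.Re (x - y) = complex.Re x - complex.Re y.
Proof. by case: x y => [? ?] [? ?]. Qed.
Lemma ImB (x y : C) : complex.Im (x - y) = complex.Im x - complex.Im y.
Proof. by case: x y => [? ?] [? ?]. Qed.
Lemma ReM (x y : C) : complex.Re (x * y) = complex.Re x * complex.Re y - complex.Im x * complex.Im y.
Proof. by case: x y => [? ?] [? ?]. Qed.
Lemma ImM (x y : C) : complex.Im (x * y) = complex.Re x * complex.Im y + complex.Im x * complex.Re y.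
Proof. by case: x y => [? ?] [? ?]. Qed.
Lemma ReD (x y : C) : complex.Re (x + y) = complex.Re x + complex.Re y.
Proof. by case: x y => [? ?] [? ?]. Qed.
Lemma ImD (x y : C) : complex.Im (x + y) = complex.Im x + complex.Im y.
Proof. by case: x y => [? ?] [? ?]. Qed.

Lemma continuous_itv_integrable (a b : R) (f : R -> R) :
  (forall x, a <= x <= b -> {for x, continuous f}) ->
  mu.-integrable `[a, b] (EFin \o f).
Proof.
move=> h; apply: continuous_compact_integrable; first exact: segment_compact.
apply: continuous_in_subspaceT => x; rewrite inE /= in_itv /= => xab; exact: h.
Qed.

Lemma continuous_eps (f : R -> R) x : {for x, continuous f} <->
  forall e, 0 < e -> exists2 d : R, 0 < d & forall y, `|y - x| < d -> `|f y - f x| < e.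
Proof.
split=> [/cvgrPdist_lt h e e0|h].
  have /nbhs_ballP[d /= d0 dP] := h e e0.
  by exists d => // y yd; rewrite distrC; apply: dP; rewrite /ball /= distrC.
apply/cvgrPdist_lt => e e0; have [d d0 dP] := h e e0.
apply/nbhs_ballP; exists d => //= y; rewrite /ball /= distrC => yd.
by rewrite distrC; exact: dP.
Qed.

Lemma con_Re a b F : con a b F -> forall x, a <= x <= b -> {for x, continuous (fun x => complex.Re (F x))}.
Proof.
move=> h x xab; apply/continuous_eps => e e0; have [d d0 dP] := h x xab e e0.
by exists d => // y yd; rewrite -ReB (le_lt_trans (rnRe _)) // dP.
Qed.

Lemma con_Im a b F : con a b F -> forall x, a <= x <= b -> {for x, continuous (fun x => complex.Im (F x))}.
Proof.
move=> h x xab; apply/continuous_eps => e e0; have [d d0 dP] := h x xab e e0.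
by exists d => // y yd; rewrite -ImB (le_lt_trans (rnIm _)) // dP.
Qed.

Lemma con_sub a b a' b' F : a <= a' -> b' <= b -> con a b F -> con a' b' F.
Proof. by move=> h1 h2 h x xab; apply: h; lra. Qed.

Lemma con_cst a b c : con a b (fun=> c).
Proof. by move=> x _ e e0; exists 1 => // y _; rewrite subrr rn0. Qed.

Lemma conB a b F G : con a b F -> con a b G -> con a b (fun x => F x - G x).
Proof.
move=> hF hG x xab e e0; have e2 : 0 < e / 2 by rewrite divr_gt0.
have [d d0 dP] := hF x xab _ e2; have [d' d0' dP'] := hG x xab _ e2.
exists (Num.min d d'); first by rewrite lt_min d0.
move=> y; rewrite lt_min => /andP[/dP h1 /dP' h2].
rewrite (_ : _ - _ = (F y - F x) - (G y - G x)); last by rewrite !opprB; ring.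
by apply: le_lt_trans (rnD _ _) _; rewrite rnN; lra.
Qed.

Lemma conM a b F G : con a b F -> con a b G -> con a b (fun x => F x * G x).
Proof.
move=> hF hG x xab e e0.
pose K := 1 + rn (F x) + rn (G x).
have K0 : 0 < K by rewrite /K; have := rn_ge0 (F x); have := rn_ge0 (G x); lra.
pose e' := Num.min 1 (e / (2 * K)).
have e0' : 0 < e' by rewrite lt_min ltr01 divr_gt0 // mulr_gt0.
have [d d0 dP] := hF x xab _ e0'; have [d' d0' dP'] := hG x xab _ e0'.
exists (Num.min d d'); first by rewrite lt_min d0.
move=> y; rewrite lt_min => /andP[/dP h1 /dP' h2].
rewrite (_ : _ - _ = (F y - F x) * (G y - G x) + (F y - F x) * G x + F x * (G y - G x)); last by ring.
have e1 : e' <= 1 by rewrite /e' ge_min lexx.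
have eK : e' * (2 * K) <= e by rewrite -ler_pdivlMr ?mulr_gt0 // /e' ge_min lexx orbT.
apply: le_lt_trans (rnD _ _) _; rewrite rnM.
have := rnD ((F y - F x) * (G y - G x)) ((F y - F x) * G x); rewrite !rnM.
have := rn_ge0 (F x); have := rn_ge0 (G x); have := rn_ge0 (F y - F x); have := rn_ge0 (G y - G x).
move: eK; rewrite /K; move: (rn _) (rn _) (rn (F x)) (rn (G x)) h1 h2 => p1 p2 f g h1 h2 *.
nra.
Qed.

Lemma cint_ext a b F G : (forall x, a <= x <= b -> F x = G x) -> cint a b F = cint a b G.
Proof.
move=> h; rewrite /cint; congr (_ +i* _); apply: eq_Rintegral => x;
  by rewrite inE /= in_itv /= => /h ->.
Qed.

Lemma cintB a b F G : con a b F -> con a b G ->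
  cint a b (fun x => F x - G x) = cint a b F - cint a b G.
Proof.
move=> hF hG; rewrite /cint.
under eq_Rintegral do rewrite ReB.
under [X in _ +i* X]eq_Rintegral do rewrite ImB.
by rewrite !RintegralB //; apply: continuous_itv_integrable; 
  do [exact: con_Re|exact: con_Im].
Qed.

Lemma cintZ a b k F : con a b F -> cint a b (fun x => k * F x) = k * cint a b F.
Proof.
move=> hF; have iR := continuous_itv_integrable (con_Re hF).
have iI := continuous_itv_integrable (con_Im hF).
have hZ c : forall f : R -> R, mu.-integrable `[a, b] (EFin \o f) ->
  mu.-integrable `[a, b] (EFin \o (fun x => c * f x)).
  move=> f hf; have := @integrableZl _ _ _ mu `[a, b]%classic _ c _ hf; exact.
rewrite /cint.
under eq_Rintegral do rewrite ReM.
under [X in _ +i* X]eq_Rintegral do rewrite ImM.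
rewrite RintegralB ?RintegralD ?RintegralZl //; try exact: hZ.
by case: k.
Qed.

Lemma fine_mu_itv (a b : R) : a <= b -> fine (mu `[a, b]) = b - a.
Proof.
move=> ab; rewrite lebesgue_measure_itv /= lte_fin.
by case: ltgtP ab => // -> _; rewrite subrr.
Qed.

Lemma cint_cst a b c : a <= b -> cint a b (fun=> c) = c * (b - a)%:C.
Proof.
move=> ab; rewrite /cint (Rintegral_cst _ _ (complex.Re c)) // (Rintegral_cst _ _ (complex.Im c)) //.
by rewrite fine_mu_itv //; case: c => u v /=; apply/eqP; rewrite eq_complex /= !mulr0 subr0 add0r !eqxx.
Qed.

Lemma cint_split a m b F : a <= m -> m <= b -> con a b F ->
  cint a b F = cint a m F + cint m b F.
Proof.
move=> am mb hF.
have h f : mu.-integrable `[a, b] (EFin \o f) ->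
   (\int[mu]_(x in `[a, b]) f x = \int[mu]_(x in `[a, m]) f x + \int[mu]_(x in `[m, b]) f x)%R.
  move=> hf; have /= := Rintegral_itvB hf (x := m); rewrite !bnd_simp => /(_ am mb) h.
  rewrite -(@Rintegral_itv_obnd_cbnd _ m); first by rewrite -h addrC subrK.
  apply: integrableS hf => //; apply: subset_itv; rewrite bnd_simp //.
by rewrite /cint !h //; apply: continuous_itv_integrable; do [exact: con_Re|exact: con_Im].
Qed.

(** The factor 2 comes from bounding real and imaginary parts separately; it propagates into the
    constants of the Cauchy estimates below, where only the homogeneity matters. *)
Lemma cint_bound a b F M : a <= b -> con a b F -> (forall x, a <= x <= b -> rn (F x) <= M) ->
  rn (cint a b F) <= 2 * M * (b - a).
Proof.
move=> ab hF hM.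
have hcst : mu.-integrable `[a, b] (EFin \o (fun=> M)).
  by apply: continuous_itv_integrable => x _; exact: cst_continuous.
have key f : (forall x, a <= x <= b -> {for x, continuous f}) ->
   (forall x, a <= x <= b -> `|f x| <= M) -> `|(\int[mu]_(x in `[a, b]) f x)%R| <= M * (b - a).
  move=> cf fM; have if_ := continuous_itv_integrable cf.
  apply: le_trans (le_normr_Rintegral _ if_) _ => //.
  have inorm : mu.-integrable `[a, b] (EFin \o (fun x => `|f x|)).
    by apply: continuous_itv_integrable => x xab; apply: continuous_comp; [exact: cf|exact: norm_continuous].
  rewrite -(fine_mu_itv ab) -(Rintegral_cst mu _ M) //.
  by apply: le_Rintegral => // x; rewrite /= in_itv /=; exact: fM.
have h1 := key _ (con_Re hF) (fun x xab => le_trans (rnRe _) (hM x xab)).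
have h2 := key _ (con_Im hF) (fun x xab => le_trans (rnIm _) (hM x xab)).
apply: le_trans (rn_le_ReIm _) _; rewrite -mulrA mulr_natl mulr2n; exact: lerD.
Qed.

End ComplexIntegral.

Section Goursat.
Variable R : realType.
Local Notation C := (Cx R).

Definition cderiv (g : C -> C) (z D : C) := forall e : R, 0 < e -> exists2 d : R, 0 < d &
  forall h, rn h < d -> rn (g (z + h) - g z - D * h) <= e * rn h.

Definition cpt (s t : R) : C := s +i* t.

Lemma cderiv_cont g z D : cderiv g z D -> forall e, 0 < e -> exists2 d : R, 0 < d &
  forall h, rn h < d -> rn (g (z + h) - g z) < e.
Proof.
move=> hD e e0; have [d d0 dP] := hD 1 ltr01.
pose K := 1 + rn D; have K0 : 0 < K by rewrite /K; have := rn_ge0 D; lra.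
exists (Num.min d (e / K)); first by rewrite lt_min d0 divr_gt0.
move=> h; rewrite lt_min ltr_pdivlMr // => /andP[/dP h1 h2].
rewrite -[g _ - _](subrK (D * h)); apply: le_lt_trans (rnD _ _) _.
by rewrite rnM; apply: le_lt_trans (lerD h1 (lexx _)) _; move: h2; rewrite /K; lra.
Qed.

Lemma cpt_subl s s' t : cpt s' t = cpt s t + (s' - s)%:C.
Proof. by rewrite /cpt; simpc; rewrite subrKC. Qed.
Lemma cpt_subr s t t' : cpt s t' = cpt s t + 'i * (t' - t)%:C.
Proof. by rewrite /cpt; simpc; rewrite subrKC. Qed.

Lemma rni : rn ('i : C) = 1.
Proof. by apply: complexI; rewrite rnE normCi. Qed.

(** The counterclockwise integral of g dz along the boundary of a rectangle, with opposite sides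
    combined so that only differences of values of g occur. *)
Definition rect_bd (g : C -> C) (a b c d : R) : C :=
  cint a b (fun s => g (cpt s c) - g (cpt s d)) +
  'i * cint c d (fun t => g (cpt b t) - g (cpt a t)).

Lemma cint_subc (a b : R) F (k : C) : a <= b -> con a b F ->
  cint a b F = cint a b (fun x => F x - k) + k * (b - a)%:C.
Proof. by move=> ab cF; rewrite cintB ?cint_cst ?subrK //; exact: con_cst. Qed.

(** A bound e1 (width + height)^2 is reproduced by quadrisection, as four quarters of half the size
    add up to the whole. On small rectangles it follows from the first order expansion of g, whose
    affine part integrates to 0; and e1 is arbitrary. *)
Theorem goursat (g : C -> C) (a0 b0 c0 d0 : R) : a0 <= b0 -> c0 <= d0 ->
  (forall s t, a0 <= s <= b0 -> c0 <= t <= d0 -> exists D, cderiv g (cpt s t) D) ->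
  rect_bd g a0 b0 c0 d0 = 0.
Proof.
move=> ab0 cd0 hg.
have ch t : c0 <= t <= d0 -> con a0 b0 (fun s => g (cpt s t)).
  move=> tP s sP e e0; have [D hD] := hg s t sP tP; have [d d0' dP] := cderiv_cont hD e0.
  by exists d => // y yd; rewrite (cpt_subl s) dP // rnR.
have cv s : a0 <= s <= b0 -> con c0 d0 (fun t => g (cpt s t)).
  move=> sP t tP e e0; have [D hD] := hg s t sP tP; have [d d0' dP] := cderiv_cont hD e0.
  by exists d => // y yd; rewrite (cpt_subr s t) dP // rnM rni mul1r rnR.
apply: rn_eq0; apply/eqP; rewrite eq_le rn_ge0 andbT.
apply/ler_addgt0Pr => e e0; rewrite add0r.
pose L := (b0 - a0) + (d0 - c0).
pose e1 := e / (1 + L ^+ 2).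
have L0 : 0 < 1 + L ^+ 2 by rewrite ltr_pwDl // sqr_ge0.
have e10 : 0 < e1 by rewrite divr_gt0.
(* The trivial inequalities give the goal the form of the property that is bisected, which only
   speaks of rectangles inside the original one. *)
suff H : a0 <= a0 -> b0 <= b0 -> c0 <= c0 -> d0 <= d0 ->
    rn (rect_bd g a0 b0 c0 d0) <= e1 * ((b0 - a0) + (d0 - c0)) ^+ 2.
  apply: le_trans (H _ _ _ _) _ => //; rewrite -/L /e1 -mulrA ger_pMr //.
  by rewrite mulrC ler_pdivrMr // mul1r lerDr.
apply: (@quadrisection _ (fun a b c d => a0 <= a -> b <= b0 -> c0 <= c -> d <= d0 ->
  rn (rect_bd g a b c d) <= e1 * ((b - a) + (d - c)) ^+ 2)) => //.
  move=> a b c d ab cd /= h1 h2 h3 h4 ha hb hc hd.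
  set m := (a + b) / 2 in h1 h2 h3 h4; set k := (c + d) / 2 in h1 h2 h3 h4.
  have hm : a <= m <= b by rewrite /m; lraH ab.
  have hk : c <= k <= d by rewrite /k; lraH cd.
  have /andP[hm1 hm2] := hm; have /andP[hk1 hk2] := hk.
  have a0m := le_trans ha hm1; have mb0 := le_trans hm2 hb.
  have c0k := le_trans hc hk1; have kd0 := le_trans hk2 hd.
  have {}h1 := h1 ha mb0 hc kd0; have {}h2 := h2 a0m hb hc kd0.
  have {}h3 := h3 ha mb0 c0k hd; have {}h4 := h4 a0m hb c0k hd.
  have E : rect_bd g a b c d = rect_bd g a m c k + rect_bd g m b c k +
                               (rect_bd g a m k d + rect_bd g m b k d).
    rewrite /rect_bd.
    have c1 t a' b' : c <= t <= d -> a <= a' -> b' <= b -> con a' b' (fun s => g (cpt s t)).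
      move=> ht ha' hb'; have tt : c0 <= t <= d0 by lraH ht hc hd.
      by apply: con_sub (ch t tt); [lraH ha ha'|lraH hb hb'].
    have c2 s c' d' : a <= s <= b -> c <= c' -> d' <= d -> con c' d' (fun t => g (cpt s t)).
      move=> hs hc' hd'; have ss : a0 <= s <= b0 by lraH hs ha hb.
      by apply: con_sub (cv s ss); [lraH hc hc'|lraH hd hd'].
    have [cc dd] : c <= c <= d /\ c <= d <= d by rewrite !lexx cd.
    have [aa bb] : a <= a <= b /\ a <= b <= b by rewrite !lexx ab.
    rewrite !cintB; try by [apply: c1|apply: c2].
    rewrite (cint_split hm1 hm2 (c1 c a b cc (lexx _) (lexx _))).
    rewrite (cint_split hm1 hm2 (c1 d a b dd (lexx _) (lexx _))).
    rewrite (cint_split hk1 hk2 (c2 a c d aa (lexx _) (lexx _))).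
    rewrite (cint_split hk1 hk2 (c2 b c d bb (lexx _) (lexx _))).
    ring.
  rewrite E; apply: le_trans (rnD _ _) _.
  have r1 := rnD (rect_bd g a m c k) (rect_bd g m b c k).
  have r2 := rnD (rect_bd g a m k d) (rect_bd g m b k d).
  have q : b - a + (d - c) = 2 * (m - a + (k - c)) by rewrite /m /k; clear; lra.
  have q1 : b - m = m - a by rewrite /m; clear; lra.
  have q2 : d - k = k - c by rewrite /k; clear; lra.
  move: h1 h2 h3 h4; rewrite q q1 q2.
  have -> : e1 * (2 * (m - a + (k - c))) ^+ 2 = 4 * (e1 * (m - a + (k - c)) ^+ 2) by ring.
  move: (e1 * _) => T.
  by move: (rn _) (rn _) (rn _) (rn _) (rn _) (rn _) r1 r2 => u1 u2 u3 u4 u5 u6 r1 r2 h1 h2 h3 h4;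
    lraH h1 h2 h3 h4 r1 r2.
move=> x y xP yP; have [D hD] := hg x y xP yP.
have e40 : 0 < e1 / 8 by rewrite divr_gt0.
have [dl dl0 dlP] := hD _ e40.
exists (dl / 2); first by rewrite divr_gt0.
move=> a b c d ha hax hxb hb hc hcy hyd hd lab lcd _ _ _ _.
pose r z := g z - g (cpt x y) - D * (z - cpt x y).
have rb s t : a <= s <= b -> c <= t <= d -> rn (r (cpt s t)) <= e1 / 8 * (b - a + (d - c)).
  move=> sP tP; have hh : rn (cpt s t - cpt x y) <= b - a + (d - c).
    apply: le_trans (rn_le_ReIm _) _; rewrite /cpt /=.
    by apply: lerD; rewrite ler_norml; [lraH sP hax hxb|lraH tP hcy hyd].
  have hl : rn (cpt s t - cpt x y) < dl by lraH hh lab lcd.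
  have := dlP _ hl; rewrite subrKC => /le_trans; apply.
  by rewrite ler_pM2l.
have ab : a <= b by lraH hax hxb. have cd : c <= d by lraH hcy hyd.
have c1 t : c <= t <= d -> con a b (fun s => g (cpt s t)).
  by move=> ht; apply: con_sub (ch t ltac:(lraH ht hc hd)).
have c2 s : a <= s <= b -> con c d (fun t => g (cpt s t)).
  by move=> hs; apply: con_sub (cv s ltac:(lraH hs ha hb)).
have [cc dd] : c <= c <= d /\ c <= d <= d by rewrite !lexx cd.
have [aa bb] : a <= a <= b /\ a <= b <= b by rewrite !lexx ab.
have E1 : cint a b (fun s => g (cpt s c) - g (cpt s d)) =
   cint a b (fun s => (g (cpt s c) - g (cpt s d)) - D * (cpt 0 c - cpt 0 d)) + 
   D * (cpt 0 c - cpt 0 d) * (b - a)%:C.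
  by apply: cint_subc => //; apply: conB; exact: c1.
have E2 : cint c d (fun t => g (cpt b t) - g (cpt a t)) =
   cint c d (fun t => (g (cpt b t) - g (cpt a t)) - D * (b - a)%:C) + 
   D * (b - a)%:C * (d - c)%:C.
  by apply: cint_subc => //; apply: conB; exact: c2.
(* The linear part D z contributes - i D (d - c)(b - a) through the horizontal sides and the
   opposite through the vertical ones. *)
have E3 : D * (cpt 0 c - cpt 0 d) * (b - a)%:C + 'i * (D * (b - a)%:C * (d - c)%:C) = 0.
  rewrite (cpt_subr 0 d) addrAC subrr add0r !rmorphB /=; ring.
rewrite /rect_bd E1 E2 (mulrDr 'i) addrACA E3 addr0.
have [ba dc] : 0 <= b - a /\ 0 <= d - c by rewrite !subr_ge0.
have B1 : rn (cint a b (fun s => (g (cpt s c) - g (cpt s d)) - D * (cpt 0 c - cpt 0 d))) <=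
    2 * (e1 / 4 * (b - a + (d - c))) * (b - a).
  apply: cint_bound => //.
    by apply: conB; last exact: con_cst; apply: conB; exact: c1.
  move=> s sP; rewrite (_ : _ - _ = r (cpt s c) - r (cpt s d)).
    apply: le_trans (rnD _ _) _; rewrite rnN.
    have k1 := rb s c sP cc; have k2 := rb s d sP dd; lraH k1 k2.
  rewrite /r (cpt_subr 0 c d) (cpt_subr s c d) !rmorphB /=; ring.
have B2 : rn (cint c d (fun t => (g (cpt b t) - g (cpt a t)) - D * (b - a)%:C)) <=
    2 * (e1 / 4 * (b - a + (d - c))) * (d - c).
  apply: cint_bound => //.
    by apply: conB; last exact: con_cst; apply: conB; exact: c2.
  move=> t tP; rewrite (_ : _ - _ = r (cpt b t) - r (cpt a t)).
    apply: le_trans (rnD _ _) _; rewrite rnN.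
    have k1 := rb a t aa tP; have k2 := rb b t bb tP; lraH k1 k2.
  rewrite /r (cpt_subl a b t); ring.
apply: le_trans (rnD _ _) _; rewrite rnM rni mul1r.
apply: le_trans (lerD B1 B2) _.
have := mulr_ge0 (ltW e10) (sqr_ge0 (b - a + (d - c))).
by clearbody e1; move: (b - a) (d - c) => u w; clear; lra.
Qed.

End Goursat.

Section DiffRn.
Variable R : realType.
Local Notation C := (Cx R).
Variables V W : normedModType C.

Lemma differentiable_rn (f : V -> W) x : differentiable f x ->
  forall e : R, 0 < e -> exists2 d : R, 0 < d &
    forall h, rn h < d -> rn (f (x + h) - f x - 'd f x h) <= e * rn h.
Proof.
move=> /diff_locally/eqaddoP df e e0.
have e0' : 0 < (e%:C : C) by rewrite ltcR_.
have /nbhs_rnP[d d0 dP] := df _ e0'.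
exists d => // h hd; rewrite -lecR_ rmorphM /= !rnE.
have := dP h; rewrite subr0 => /(_ hd) /=.
rewrite (_ : (f \o _ - _) h = f (x + h) - f x - 'd f x h) //.
by rewrite [x + h]addrC -addrA -opprD.
Qed.

Lemma rn_differentiable (f : V -> W) x (L : {linear V -> W}) : continuous L ->
  (forall e : R, 0 < e -> exists2 d : R, 0 < d &
    forall h, rn h < d -> rn (f (x + h) - f x - L h) <= e * rn h) ->
  differentiable f x /\ 'd f x = L :> (V -> W).
Proof.
move=> cL est.
have H : f \o shift x = cst (f x) + L +o_ 0 id.
  apply/eqaddoP => e e0; have eE := real_of_ge0 (ltW e0).
  have e0' : 0 < complex.Re e by rewrite -ltcR_ -eE.
  have [d d0 dP] := est _ e0'; apply/nbhs_rnP; exists d => // h; rewrite subr0 => hd /=.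
  rewrite (_ : (f \o _ - _) h = f (x + h) - f x - L h).
    by rewrite eE -!rnE -rmorphM lecR_; exact: dP.
  by rewrite [x + h]addrC -addrA -opprD.
have E := diff_unique cL H; split=> //.
by apply/diff_locallyP; rewrite E.
Qed.

End DiffRn.

Section CDeriv.
Variable R : realType.
Local Notation C := (Cx R).

Lemma diffC1 (g : C -> C) z h : differentiable g z -> 'd g z h = 'd g z 1 * h.
Proof. by move=> dg; rewrite -[h in LHS]mulr1 -[h * 1]/(h *: (1 : C)) linearZ /= mulrC. Qed.

Lemma differentiable_cderiv (g : C -> C) z : differentiable g z -> cderiv g z ('d g z 1).
Proof.
move=> dg e e0; have [d d0 dP] := differentiable_rn dg e0.
by exists d => // h hd; rewrite -diffC1 // dP.
Qed.

Lemma cderiv_differentiable (g : C -> C) z D : cderiv g z D -> differentiable g z.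
Proof.
move=> gD.
have lin : linear ( *%R D : C -> C) by move=> a u v; rewrite mulrDr -scalerAr.
pose L : {linear C -> C} := HB.pack ( *%R D : C -> C) (GRing.isLinear.Build _ _ _ _ _ lin).
have [] // := @rn_differentiable _ C C g z L _ gD.
  by move=> y; apply: (@mulrl_continuous C D).
Qed.

Definition cexp (w : C) : C := (expR (complex.Re w))%:C * (cos (complex.Im w) +i* sin (complex.Im w)).

Lemma cexpD w h : cexp (w + h) = cexp w * cexp h.
Proof.
rewrite /cexp ReD ImD expRD cosD sinD rmorphM /=.
set a := cos _; set b := cos _; set c := sin _; set d := sin _.
rewrite (_ : _ +i* _ = (a +i* c) * (b +i* d) :> C); last by apply/eqP; rewrite eq_complex /=; apply/andP; split; apply/eqP; ring.
by rewrite -mulrA [RHS]mulrACA -mulrA.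
Qed.

Lemma rn_cexp w : rn (cexp w) = expR (complex.Re w).
Proof.
rewrite /cexp rnM rnR ger0_norm ?expR_ge0 //.
rewrite [X in _ * X](_ : _ = 1) ?mulr1 //.
by rewrite /rn normc_def /= cos2Dsin2 sqrtr1.
Qed.

Lemma cexp0 : cexp 0 = 1.
Proof. by rewrite /cexp /= expR0 cos0 sin0 mul1r. Qed.

Lemma cexp_neq0 w : cexp w != 0.
Proof. by apply/eqP => h; have := expR_gt0 (complex.Re w); rewrite -rn_cexp h rn0 ltxx. Qed.

Lemma cexpN w : cexp (- w) = (cexp w)^-1.
Proof. by apply: (mulfI (cexp_neq0 w)); rewrite -cexpD subrr cexp0 divff ?cexp_neq0. Qed.

Lemma is_derive_eps (f : R -> R) x l : is_derive x (1 : R) f l -> forall e, 0 < e ->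
  exists2 d : R, 0 < d & forall h, `|h| < d -> `|f (x + h) - f x - l * h| <= e * `|h|.
Proof.
move=> [df dl] e e0; have := df; rewrite /derivable => /cvg_ex[l' hl'].
have El : l = l'.
  by rewrite -dl /derive; apply: cvg_lim.
move/cvgrPdist_lt: hl' => /(_ e e0); rewrite near_withinE => /nbhs_ballP[d /= d0 dP].
exists d => // h hd; have [->|h0] := eqVneq h 0; first by rewrite addr0 subrr mulr0 subr0 normr0 mulr0.
have := dP h; rewrite /ball /= sub0r normrN => /(_ hd h0).
rewrite -El /= => /ltW; rewrite [h%:A]mulr1 [h + x]addrC.
rewrite (_ : l - h^-1 *: (f (x + h) - f x) = - h^-1 * (f (x + h) - f x - l * h)).
  by rewrite normrM normrN normfV mulrC ler_pdivrMr ?normr_gt0.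
by rewrite -[h^-1 *: _]/(h^-1 * _); field.
Qed.

Lemma eps_is_derive (f : R -> R) x l : (forall e, 0 < e ->
  exists2 d : R, 0 < d & forall h, `|h| < d -> `|f (x + h) - f x - l * h| <= e * `|h|) ->
  is_derive x (1 : R) f l.
Proof.
move=> est.
have H : h^-1 *: ((f \o shift x) (h *: 1) - f x) @[h --> 0^'] --> l.
  apply/cvgrPdist_le => e e0; rewrite near_withinE; have [d d0 dP] := est e e0.
  apply/nbhs_ballP; exists d => // h; rewrite /ball /= sub0r normrN => hd h0.
  rewrite [h%:A]mulr1 [h + x]addrC.
  rewrite (_ : l - h^-1 *: (f (x + h) - f x) = - h^-1 * (f (x + h) - f x - l * h)).
    by rewrite normrM normrN normfV mulrC ler_pdivrMr ?normr_gt0 // dP.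
  by rewrite -[h^-1 *: _]/(h^-1 * _); field.
split; first by apply/cvg_ex; exists l.
by rewrite /derive; apply: cvg_lim.
Qed.

(** First order expansions of the real exponential, cosine and sine at 0 are multiplied out. By
    [cexpD] the point 0 is the only one needing an estimate. *)
Lemma cexp_cderiv0 : cderiv cexp 0 1.
Proof.
move=> e e0; pose e1 := Num.min 1 (e / 8).
have e10 : 0 < e1 by rewrite lt_min ltr01 divr_gt0.
have e11 : e1 <= 1 by rewrite /e1 ge_min lexx.
have e18 : e1 <= e / 8 by rewrite /e1 ge_min lexx orbT.
clearbody e1.
have [d1 d10 h1] := is_derive_eps (is_derive_expR (0 : R)) e10.
have [d2 d20 h2] := is_derive_eps (is_derive_cos (0 : R)) e10.
have [d3 d30 h3] := is_derive_eps (is_derive_sin (0 : R)) e10.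
exists (Num.min d1 (Num.min d2 (Num.min d3 e1))); first by rewrite !lt_min d10 d20 d30 e10.
move=> h; rewrite !lt_min => /and4P[hd1 hd2 hd3 he].
have hR := rnRe h; have hI := rnIm h.
have := h1 _ (le_lt_trans hR hd1); have := h2 _ (le_lt_trans hI hd2); have := h3 _ (le_lt_trans hI hd3).
rewrite !add0r expR0 cos0 sin0 !subr0 oppr0 !mul0r !subr0 !mul1r => k3 k2 k1.
rewrite cexp0; set s := complex.Re h in hR k1; set t := complex.Im h in hI k2 k3.
apply: le_trans (rn_le_ReIm _) _.
have -> : complex.Re (cexp h - 1 - h) = (expR s - 1 - s) * cos t + (1 + s) * (cos t - 1) + s - s.
  by rewrite !ReB /cexp ReM /= -/s -/t; ring.
have -> : complex.Im (cexp h - 1 - h) = (expR s - 1 - s) * sin t + (1 + s) * (sin t - t) + s * t.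
  by rewrite !ImB /cexp ImM /= -/s -/t; ring.
have c1 : `|cos t| <= 1 by rewrite ler_norml cos_geN1 cos_le1.
have s1 : `|sin t| <= 1 by rewrite ler_norml sin_geN1 sin_le1.
have e1p := ltW e10.
have ss : `|1 + s| <= 2 by apply: le_trans (ler_normD _ _) _; rewrite normr1; lraH e11 he hR.
have prod (a b u v : R) : `|a| <= u -> `|b| <= v -> `|a * b| <= u * v.
  by move=> au bv; rewrite normrM; exact: ler_pM.
have p1 := prod _ _ _ _ k1 c1; have p2 := prod _ _ _ _ ss k2.
have p3 := prod _ _ _ _ k1 s1; have p4 := prod _ _ _ _ ss k3.
have p5 : `|s * t| <= e1 * rn h.
  by apply: prod; [exact: le_trans hR (ltW he)|].
have q1 : e1 * `|s| <= e1 * rn h by rewrite ler_wpM2l.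
have q2 : e1 * `|t| <= e1 * rn h by rewrite ler_wpM2l.
have q3 : e1 * rn h <= e / 8 * rn h by rewrite ler_wpM2r ?rn_ge0.
rewrite addrK.
apply: le_trans (lerD (ler_normD _ _) (ler_normD _ _)) _.
have := ler_normD ((expR s - 1 - s) * sin t) ((1 + s) * (sin t - t)).
have q4 : 0 <= e1 * rn h by rewrite mulr_ge0 ?rn_ge0.
move: p1 p2 p3 p4 p5 q1 q2 q3 q4; rewrite !mulr1.
move: `|_ * _| `|_ * _| `|_ * _ + _| => u1 u2 u3.
move: `|_ * _| `|_ * _| `|_ * _| => u4 u5 u6.
clear; lra.
Qed.

Lemma cexp_differentiable w : differentiable cexp w.
Proof.
apply: (@cderiv_differentiable cexp w (cexp w)) => e e0.
have e1 : 0 < e / expR (complex.Re w) by rewrite divr_gt0 ?expR_gt0.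
have [d d0 dP] := cexp_cderiv0 e1; exists d => // h /dP.
rewrite add0r cexp0 mul1r => hh.
rewrite cexpD (_ : _ - _ = cexp w * (cexp h - 1 - h)); last by rewrite !mulrBr mulr1.
rewrite rnM rn_cexp; apply: le_trans (ler_wpM2l (expR_ge0 _) hh) _.
by rewrite mulrA mulrCA mulfV ?mulr1 // gt_eqF ?expR_gt0.
Qed.

Lemma cexp_periodic s : cexp (cpt s (2 * pi)) = cexp (cpt s 0).
Proof.
rewrite /cexp /=; congr (_ * _).
by rewrite -[2 * pi]add0r mulr_natl cosD2pi sinD2pi.
Qed.

Definition circle (r t : R) : C := cexp (cpt (ln r) t).

Lemma rn_circle r t : 0 < r -> rn (circle r t) = r.
Proof. by move=> r0; rewrite /circle rn_cexp /= lnK. Qed.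

Lemma con_circle r a b : con a b (circle r).
Proof.
move=> x _ e e0; have [d d0 dP] := cderiv_cont (differentiable_cderiv (cexp_differentiable (cpt (ln r) x))) e0.
by exists d => // y yd; rewrite /circle (cpt_subr _ x y) dP // rnM rni mul1r rnR.
Qed.

Lemma con_circleV r a b : con a b (fun t => (circle r t)^-1).
Proof.
move=> x _ e e0; have [d d0 dP] := cderiv_cont (differentiable_cderiv (cexp_differentiable (cpt (- ln r) (- x)))) e0.
exists d => // y yd; rewrite /circle -!cexpN.
have E t : - cpt (ln r) t = cpt (- ln r) (- t) by rewrite /cpt; simpc.
rewrite !E (cpt_subr _ (- x) (- y)) dP // rnM rni mul1r rnR -opprD normrN distrC.
by rewrite distrC.
Qed.

(* Goursat is applied in the coordinate log z: circles become segments, so rectangles are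
   the only contours needed. *)
Theorem cauchy_derivative (phi : C -> C) (r : R) : 0 < r ->
  (forall z, rn z <= r -> differentiable phi z) ->
  cint 0 (2 * pi) (fun t => (phi (circle r t) - phi 0) * (circle r t)^-1) =
  'd phi (0 : C) 1 * (2 * pi)%:C.
Proof.
move=> r0 dphi.
pose g w := (phi (cexp w) - phi 0) * cexp (- w).
have tpi : 0 <= 2 * pi :> R by rewrite mulr_ge0 // pi_ge0.
have dg s t : s <= ln r -> differentiable g (cpt s t).
  move=> sr; apply: differentiableM.
    apply: differentiableB => //; apply: differentiable_comp; first exact: cexp_differentiable.
    by apply: dphi; rewrite rn_cexp /= -[leRHS]lnK // ler_expR.
  have -> : (fun w => cexp (- w)) = cexp \o -%R by [].
  apply: differentiable_comp; first exact: differentiableN.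
  exact: cexp_differentiable.
have cg s a b : s <= ln r -> con a b (fun t => g (cpt s t)).
  move=> sr x _ e e0; have [d d0 dP] := cderiv_cont (differentiable_cderiv (dg s x sr)) e0.
  by exists d => // y yd; rewrite (cpt_subr _ x y) dP // rnM rni mul1r rnR.
pose m s := cint 0 (2 * pi) (fun t => g (cpt s t)).
have per s : g (cpt s (2 * pi)) = g (cpt s 0).
  by rewrite /g !cexpN cexp_periodic.
(* The sides Im = 0 and Im = 2 pi cancel by periodicity, so the integral over the circle of radius
   exp s does not depend on s. It is then compared with the derivative for s near minus infinity. *)
have mE s : s <= ln r -> m s = m (ln r).
  move=> sr; have := goursat sr tpi (g := g).
  have h : forall s0 t, s <= s0 <= ln r -> 0 <= t <= 2 * pi -> exists D, cderiv g (cpt s0 t) D.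
    by move=> s' t /andP[_ h'] _; exists ('d g (cpt s' t) 1); apply: differentiable_cderiv; exact: dg.
  move=> /(_ h); rewrite /rect_bd (cint_ext (G := fun=> 0)); last by move=> x _; rewrite per subrr.
  rewrite (cint_cst _ sr) mul0r add0r (cintB (cg _ 0 (2 * pi) (lexx (ln r))) (cg _ 0 (2 * pi) sr)).
  move=> /eqP; rewrite mulf_eq0 -[('i == 0)]negbK neq0Ci /= subr_eq0 => /eqP.
  exact: esym.
suff -> : 'd phi (0 : C) 1 * (2 * pi)%:C = m (ln r).
  by apply: cint_ext => t _; rewrite /g cexpN.
apply/eqP; rewrite -subr_eq0; apply/eqP/rn_eq0/eqP; rewrite eq_le rn_ge0 andbT.
apply/ler_addgt0Pr => e e0; rewrite add0r.
have e1 : 0 < e / (1 + 2 * (2 * pi)) by rewrite divr_gt0 // ltr_pwDl // mulr_ge0.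
have rn00 : rn (0 : C) <= r by rewrite rn0 ltW.
have [d d0 dP] := differentiable_cderiv (dphi 0 rn00) e1.
pose s := Num.min (ln r) (ln (d / 2)).
have sr : s <= ln r by rewrite /s ge_min lexx.
have d2 : 0 < d / 2 by rewrite divr_gt0.
have sd : expR s < d.
  apply: (@le_lt_trans _ _ (d / 2)); last by lraH d0.
  by rewrite -[leRHS]lnK // ler_expR /s ge_min lexx orbT.
rewrite -(mE s sr) rnB /m -[(2 * pi)%:C]/((2 * pi)%:C : C) -[2 * pi]subr0 -cint_cst ?subr0 //.
rewrite -(cintB (cg _ 0 (2 * pi) sr) (@con_cst _ 0 (2 * pi) ('d phi (0 : C) 1))).
apply: le_trans (cint_bound (M := e / (1 + 2 * (2 * pi))) _ _ _) _ => //.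
  by apply: conB; [exact: cg|exact: con_cst].
  move=> t _; have hd : rn (cexp (cpt s t)) < d by rewrite rn_cexp.
  have := dP _ hd; rewrite add0r => hh.
  have E : g (cpt s t) - 'd phi (0 : C) 1 =
    (phi (cexp (cpt s t)) - phi 0 - 'd phi (0 : C) 1 * cexp (cpt s t)) * (cexp (cpt s t))^-1.
    by rewrite /g cexpN [RHS]mulrBl mulfK ?cexp_neq0.
  rewrite E rnM rnV ler_pdivrMr //; rewrite rn_cexp; exact: expR_gt0.
rewrite subr0; move: (2 * pi) tpi => q q0; clear - q0 e0.
have q1 : 0 < 1 + 2 * q by rewrite ltr_pwDl // mulr_ge0.
have -> : 2 * (e / (1 + 2 * q)) * q = 2 * q * e / (1 + 2 * q) by ring.
by rewrite ler_pdivrMr // mulrDr mulr1 [2 * q * e]mulrC lerDr ltW.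
Qed.

End CDeriv.

Lemma addr_sub3 (Z : zmodType) (a b c d e f : Z) :
  a + b - (c + d) - (e + f) = (a - c - e) + (b - d - f).
Proof. by rewrite (opprD c d) (addrACA a b) (opprD e f) (addrACA (a - c)). Qed.

Section HasCd.
Variable R : realType.
Local Notation C := (Cx R).

(** Locked to keep conversion from unfolding the differential; values are obtained through
    [has_cd]. *)
Definition cd (V W : normedModType C) := locked (fun (f : V -> W) x v => 'd f x v).

(** The candidate c is a bare function, with linearity and boundedness as propositions, so that
    differentials can be written as explicit formulas and verified afterwards. *)
Definition has_cd (V W : normedModType C) (f : V -> W) x (c : V -> W) :=
  [/\ forall (a : C) u v, c (a *: u + v) = a *: c u + c v,
      exists K : R, forall v, rn (c v) <= K * rn v &
      forall e : R, 0 < e -> exists2 d : R, 0 < d &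
        forall h, rn h < d -> rn (f (x + h) - f x - c h) <= e * rn h].

Section VW.
Variables V W : normedModType C.
Implicit Types (f g : V -> W) (x v w : V).

Lemma cdE f x v : cd f x v = 'd f x v.
Proof. by rewrite /cd -lock. Qed.

Lemma has_cdP f x c : has_cd f x c -> differentiable f x /\ forall v, cd f x v = c v.
Proof.
move=> [lc [K bK] est].
pose L : {linear V -> W} := HB.pack c (GRing.isLinear.Build _ _ _ _ _ lc).
have [|d e] := @rn_differentiable _ V W f x L _ est.
  have K1 : 0 < 1 + `|K| by rewrite ltr_pwDl.
  move=> y; apply/cvgrPdist_lt => e e0; have eE := real_of_ge0 (ltW e0).
  have e0' : 0 < complex.Re e by rewrite -ltcR_ -eE.
  apply/nbhs_rnP; exists (complex.Re e / (1 + `|K|)); first exact: divr_gt0.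
  move=> z; rewrite ltr_pdivlMr // => zy; rewrite eE -rnE ltcR_ -(linearB L).
  apply: le_lt_trans (bK _) _; rewrite rnB; apply: le_lt_trans zy.
  by rewrite mulrC ler_wpM2l ?rn_ge0 // (le_trans (ler_norm _)) // lerDr.
by split=> // v; rewrite cdE e.
Qed.

Lemma has_cd_diff f x c : has_cd f x c -> differentiable f x.
Proof. by case/has_cdP. Qed.
Lemma has_cd_val f x c v : has_cd f x c -> cd f x v = c v.
Proof. by case/has_cdP. Qed.

Lemma differentiable_has_cd f x : differentiable f x -> has_cd f x (cd f x).
Proof.
move=> df; split.
- by move=> a u v; rewrite !cdE linearP.
- have [k k0 kP] := linear_lipschitz (diff_continuous df).
  have kE := real_of_ge0 (ltW k0); exists (complex.Re k) => v.
  by rewrite cdE -lecR_ rmorphM /= !rnE -kE.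
- move=> e e0; have [d d0 dP] := differentiable_rn df e0.
  by exists d => // h hd; rewrite cdE; exact: dP.
Qed.

Lemma cdP f x (a : C) u v : cd f x (a *: u + v) = a *: cd f x u + cd f x v.
Proof. by rewrite !cdE linearP. Qed.
Lemma cdD f x u v : cd f x (u + v) = cd f x u + cd f x v.
Proof. by rewrite -[u]scale1r cdP !scale1r. Qed.
Lemma cd0 f x : cd f x 0 = 0.
Proof. by rewrite !cdE linear0. Qed.
Lemma cdZ f x (a : C) u : cd f x (a *: u) = a *: cd f x u.
Proof. by rewrite -[a *: u]addr0 cdP cd0 addr0. Qed.
Lemma cdN f x u : cd f x (- u) = - cd f x u.
Proof. by rewrite -scaleN1r cdZ scaleN1r. Qed.
Lemma cdB f x u v : cd f x (u - v) = cd f x u - cd f x v.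
Proof. by rewrite cdD cdN. Qed.

Lemma has_cd_lin (c : V -> W) x : (forall (a : C) u v, c (a *: u + v) = a *: c u + c v) ->
  (exists K : R, forall v, rn (c v) <= K * rn v) -> has_cd c x c.
Proof.
move=> lc bc; split=> // e e0; exists 1 => // h _.
have cD u v : c (u + v) = c u + c v by rewrite -[u in LHS]scale1r lc scale1r.
by rewrite cD [c x + _]addrC addrK subrr rn0 mulr_ge0 ?rn_ge0 // ltW.
Qed.

Lemma has_cd_cst (k : W) x : has_cd (fun=> k) x (fun=> 0).
Proof.
split; first by move=> a u v; rewrite scaler0 addr0.
  by exists 0 => v; rewrite rn0 mul0r.
by move=> e e0; exists 1 => // h _; rewrite subrr subr0 rn0 mulr_ge0 ?rn_ge0 // ltW.
Qed.

Lemma has_cdD f g x c d : has_cd f x c -> has_cd g x d ->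
  has_cd (fun z => f z + g z) x (fun v => c v + d v).
Proof.
move=> [lc [K bK] ef] [ld [K' bK'] eg]; split.
- by move=> a u v; rewrite lc ld scalerDr addrACA.
- exists (K + K') => v; apply: le_trans (rnD _ _) _; rewrite mulrDl; exact: lerD.
move=> e e0; have e2 : 0 < e / 2 by rewrite divr_gt0.
have [d1 d10 h1] := ef _ e2; have [d2 d20 h2] := eg _ e2.
exists (Num.min d1 d2); first by rewrite lt_min d10.
move=> h; rewrite lt_min => /andP[/h1 k1 /h2 k2].
rewrite addr_sub3.
by apply: le_trans (rnD _ _) _; lraH k1 k2.
Qed.

Lemma has_cdZ f x c (a : C) : has_cd f x c -> has_cd (fun z => a *: f z) x (fun v => a *: c v).
Proof.
move=> [lc [K bK] ef]; split.
- by move=> b u v; rewrite lc scalerDr !scalerA mulrC.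
- by exists (rn a * K) => v; rewrite rnZ -mulrA ler_wpM2l ?rn_ge0.
move=> e e0; have a1 : 0 < 1 + rn a by rewrite ltr_pwDl // rn_ge0.
have [d1 d10 h1] := ef _ (divr_gt0 e0 a1); exists d1 => // h /h1 k1.
rewrite -!scalerBr rnZ; apply: le_trans (ler_wpM2l (rn_ge0 a) k1) _.
rewrite mulrA ler_wpM2r ?rn_ge0 // mulrCA ger_pMr // ler_pdivrMr // mul1r lerDr //.
Qed.

Lemma has_cdB f g x c d : has_cd f x c -> has_cd g x d ->
  has_cd (fun z => f z - g z) x (fun v => c v - d v).
Proof.
move=> hf hg; have := has_cdD hf (has_cdZ (-1) hg).
have E (u : V -> W) : (fun z => -1 *: u z) = (fun z => - u z).
  by apply/funext => z; rewrite scaleN1r.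
by under [X in has_cd X]eq_fun do rewrite scaleN1r;
   under [X in has_cd _ _ X]eq_fun do rewrite scaleN1r.
Qed.

End VW.

Lemma has_cd_comp (U V W : normedModType C) (f : U -> V) (g : V -> W) x c d :
  has_cd f x c -> has_cd g (f x) d -> has_cd (g \o f) x (d \o c).
Proof.
move=> hf hg; have df := has_cd_diff hf; have dg := has_cd_diff hg.
have := differentiable_has_cd (differentiable_comp df dg).
have -> // : cd (g \o f) x = d \o c.
by apply/funext => v; rewrite cdE diff_comp //= -!cdE (has_cd_val _ hf) (has_cd_val _ hg).
Qed.

End HasCd.

Section Holo.
Variables (R : realType) (n : nat).
Local Notation C := (Cx R).
Local Notation V := 'rV[C]_n.
Implicit Types (f : V -> C) (x v w : V).

Lemma ler_eps_mul (a b c : R) : 0 <= c -> (forall e, 0 < e -> a <= b + e * c) -> a <= b.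
Proof.
move=> c0 h; apply/ler_addgt0Pr => e e0.
have c1 : 0 < c + 1 by rewrite ltr_wpDl.
have := h (e / (c + 1)) (divr_gt0 e0 c1); move/le_trans; apply.
by rewrite lerD2l mulrAC ler_pdivrMr // mulrDr mulr1 lerDl ltW.
Qed.

Lemma differentiable_line x v (z : C) : differentiable (fun z : C => x + z *: v) z.
Proof.
have -> : (fun z : C => x + z *: v) = cst x + ( *:%R^~ v) by [].
by apply: differentiableD.
Qed.

Lemma cderiv_diff (g : C -> C) z D : cderiv g z D -> 'd g z 1 = D.
Proof.
move=> gD.
have lin : linear ( *%R D : C -> C) by move=> a u v; rewrite mulrDr -scalerAr.
pose L : {linear C -> C} := HB.pack ( *%R D : C -> C) (GRing.isLinear.Build _ _ _ _ _ lin).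
have [] // := @rn_differentiable _ C C g z L _ gD.
  by move=> y; apply: (@mulrl_continuous C D).
by move=> _ ->; rewrite /= mulr1.
Qed.

Lemma rn_scale_small (v : V) (d : R) (z : C) : rn z < d / (1 + rn v) -> rn (z *: v) < d.
Proof.
have v1 : 0 < 1 + rn v by rewrite ltr_pwDl // rn_ge0.
rewrite ltr_pdivlMr // rnZ; apply: le_lt_trans.
by rewrite ler_wpM2l ?rn_ge0 // lerDr.
Qed.

Lemma diff_line f x v : differentiable f x ->
  'd (fun z : C => f (x + z *: v)) (0 : C) 1 = cd f x v.
Proof.
move=> df; apply: cderiv_diff => e e0.
have [_ _ est] := differentiable_has_cd df.
have v1 : 0 < 1 + rn v by rewrite ltr_pwDl // rn_ge0.
have [d d0 dP] := est _ (divr_gt0 e0 v1).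
exists (d / (1 + rn v)); first exact: divr_gt0.
move=> h hd; rewrite add0r scale0r addr0.
have := dP _ (rn_scale_small hd); rewrite cdZ [cd f x v * h]mulrC => /le_trans; apply.
rewrite rnZ -mulrA ler_wpM2l ?(ltW e0) // mulrC ler_pdivrMr //.
by rewrite ler_wpM2l ?rn_ge0 // lerDr.
Qed.

Lemma differentiable_cont (W : normedModType C) (f : V -> W) x : differentiable f x ->
  forall e, 0 < e -> exists2 d : R, 0 < d & forall y, rn (y - x) < d -> rn (f y - f x) < e.
Proof.
move=> /differentiable_continuous /cvgrPdist_lt h e e0.
have e0' : 0 < (e%:C : C) by rewrite ltcR_.
have /nbhs_rnP[d d0 dP] := h _ e0'; exists d => // y /dP.
by rewrite /= -rnE ltcR_ rnB.
Qed.

Definition contp (W : normedModType C) (f : V -> W) x := forall e : R, 0 < e ->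
  exists2 d : R, 0 < d & forall y, rn (y - x) < d -> rn (f y - f x) < e.

Lemma con_quot_cont f x v (r a b : R) : (forall t, contp f (x + circle r t *: v)) ->
  con a b (fun t => (f (x + circle r t *: v) - f x) * (circle r t)^-1).
Proof.
move=> df; apply: conM; last exact: con_circleV.
apply: conB; last exact: con_cst.
move=> t tab e e0; have [d d0 dP] := df t _ e0.
have v1 : 0 < 1 + rn v by rewrite ltr_pwDl // rn_ge0.
have [d' d0' dP'] := con_circle r tab (divr_gt0 d0 v1).
exists d' => // y /dP' h; apply: dP; rewrite opprD addrACA subrr add0r -scalerBl.
exact: rn_scale_small.
Qed.

Lemma con_quot f x v (r a b : R) : (forall t, differentiable f (x + circle r t *: v)) ->
  con a b (fun t => (f (x + circle r t *: v) - f x) * (circle r t)^-1).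
Proof. by move=> df; apply: con_quot_cont => t; exact: differentiable_cont. Qed.

(** The one-variable formula on the complex line through x in the direction v. Several variables are
    always treated one direction at a time. *)
Lemma cauchyV f x v (r : R) : 0 < r -> (forall z : C, rn z <= r -> differentiable f (x + z *: v)) ->
  cint 0 (2 * pi) (fun t => (f (x + circle r t *: v) - f x) * (circle r t)^-1) =
  cd f x v * (2 * pi)%:C.
Proof.
move=> r0 df.
have dx : differentiable f x.
  by rewrite -[x]addr0 -(scale0r v); apply: df; rewrite rn0 ltW.
rewrite -(diff_line v dx) -(cauchy_derivative r0 (phi := fun z => f (x + z *: v))).
  by apply: cint_ext => t _; rewrite scale0r addr0.
move=> z zr; have -> : (fun z : C => f (x + z *: v)) = f \o (fun z : C => x + z *: v) by [].
by apply: differentiable_comp; [exact: differentiable_line|exact: df].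
Qed.

Lemma twopi_gt0 : 0 < 2 * pi :> R.
Proof. by rewrite mulr_gt0 // pi_gt0. Qed.

Lemma twopi_bound (u : C) (M : R) : rn (u * (2 * pi)%:C) <= 2 * M * (2 * pi - 0) -> rn u <= 2 * M.
Proof.
by rewrite subr0 rnM rnR ger0_norm ?(ltW twopi_gt0) // ler_pM2r ?twopi_gt0.
Qed.

Definition bholo f x0 (r M : R) := forall x, rn (x - x0) < r -> differentiable f x /\ rn (f x) <= M.

Lemma rn_line x0 x v (z : C) : rn (x + z *: v - x0) <= rn (x - x0) + rn z * rn v.
Proof. by rewrite -rnZ addrAC rnD. Qed.

Lemma bholo_ge0 f x0 r M : 0 < r -> bholo f x0 r M -> 0 <= M.
Proof. by move=> r0 /(_ x0); rewrite subrr rn0 => /(_ r0)[_]; apply: le_trans; exact: rn_ge0. Qed.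

(** Cauchy estimate on a circle of radius r' = r / (4 rn v) in the line through x, which stays in
    the ball. The constant is the 2 of [cint_bound], times 2 M for a difference of two values, times
    4 / r. *)
Lemma bholo_diff f x0 r M : 0 < r -> bholo f x0 r M ->
  forall x v, rn (x - x0) < r / 2 -> rn (cd f x v) <= 16 * M / r * rn v.
Proof.
move=> r0 hf x v xr; have M0 := bholo_ge0 r0 hf.
have r2 : r / 2 < r by lraH r0.
have [->|v0] := eqVneq v 0.
  by rewrite cd0 !rn0 mulr0.
have nv := rn_gt0 v0.
pose r' := r / (4 * rn v).
have r'0 : 0 < r' by rewrite divr_gt0 // mulr_gt0.
have rv : r' * rn v = r / 4 by rewrite /r' invfM mulrA mulrVK // unitfE gt_eqF.
have hz (z : C) : rn z <= r' -> rn (x + z *: v - x0) < r.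
  move=> zr; apply: le_lt_trans (rn_line _ _ _ _) _.
  have : rn z * rn v <= r / 4 by rewrite -rv ler_wpM2r // rn_ge0.
  by move=> h; lraH h xr r0.
have C1 := cauchyV r'0 (fun z zr => (hf _ (hz z zr)).1).
have circ t : rn (circle r' t) <= r' by rewrite rn_circle.
rewrite (_ : 16 * M / r * rn v = 2 * ((M + M) / r')); last first.
  by rewrite /r'; field; rewrite !gt_eqF.
apply: twopi_bound; rewrite -C1; apply: cint_bound; first exact: ltW twopi_gt0.
  by apply: con_quot => t; exact: (hf _ (hz _ (circ t))).1.
move=> t _; rewrite rnM rnV rn_circle // ler_wpM2r ?invr_ge0 ?(ltW r'0) //.
apply: le_trans (rnD _ _) _; rewrite rnN; apply: lerD; first exact: (hf _ (hz _ (circ t))).2.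
by apply: (hf _ _).2; lraH xr r2.
Qed.

Lemma diff_bound_lipschitz (W : normedModType C) (F : V -> W) x y (K : R) :
  (forall t : R, 0 <= t <= 1 -> let z := x + t%:C *: (y - x) in
      differentiable F z /\ rn (cd F z (y - x)) <= K) ->
  rn (F y - F x) <= K.
Proof.
move=> h.
have H e : 0 < e -> rn (F y - F x) <= (K + e) * (1 - 0).
  move=> e0; pose G (t : R) := F (x + t%:C *: (y - x)).
  have -> : F y = G 1 by rewrite /G scale1r subrKC.
  have -> : F x = G 0 by rewrite /G scale0r addr0.
  apply: (@lipschitz_of_local R W (@rn R W) G) => //.
  - exact: rnD.
  - exact: rnN.
  move=> t t01; have [dF bF] := h t t01.
  have w1 : 0 < 1 + rn (y - x) by rewrite ltr_pwDl // rn_ge0.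
  have [_ _ est] := differentiable_has_cd dF; have [d d0 dP] := est _ (divr_gt0 e0 w1).
  exists (d / (1 + rn (y - x))); first exact: divr_gt0.
  move=> s _; rewrite ltr_pdivlMr // => st.
  have nE : rn ((s - t)%:C *: (y - x)) = `|s - t| * rn (y - x) by rewrite rnZ rnR.
  have nl : `|s - t| * rn (y - x) <= `|s - t| * (1 + rn (y - x)) by rewrite ler_wpM2l // lerDr.
  have := dP ((s - t)%:C *: (y - x)); rewrite nE => /(_ (le_lt_trans nl st)).
  have -> : x + t%:C *: (y - x) + (s - t)%:C *: (y - x) = x + s%:C *: (y - x).
    by rewrite -addrA -scalerDl -rmorphD /= subrKC.
  move=> hs.
  rewrite -[X in rn X](subrK (cd F (x + t%:C *: (y - x)) ((s - t)%:C *: (y - x)))).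
  apply: le_trans (rnD _ _) _; rewrite cdZ rnZ rnR mulrDl addrC; apply: lerD; first by rewrite mulrC ler_wpM2r.
  move: hs; rewrite cdZ => /le_trans; apply.
  rewrite -mulrA; apply: (@le_trans _ _ (e / (1 + rn (y - x)) * (`|s - t| * (1 + rn (y - x))))).
    by rewrite -mulrA ler_wpM2l ?(ltW e0) // ler_wpM2l // invr_ge0 ltW.
  by rewrite mulrCA mulrVK ?unitfE ?gt_eqF // mulrC.
by apply/ler_addgt0Pr => e /H; rewrite subr0 mulr1.
Qed.

Lemma convex_seg x0 x y (r : R) (t : R) : 0 <= t <= 1 ->
  rn (x - x0) < r -> rn (y - x0) < r -> rn (x + t%:C *: (y - x) - x0) < r.
Proof.
move=> /andP[t0 t1] hx hy.
have -> : x + t%:C *: (y - x) - x0 = (1 - t)%:C *: (x - x0) + t%:C *: (y - x0).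
  rewrite rmorphB /= !scalerBr scalerBl scale1r scalerBl scale1r.
  rewrite !opprB !addrA; apply/rowP => k; rewrite !mxE; ring.
apply: le_lt_trans (rnD _ _) _; rewrite !rnZ !rnR !ger0_norm ?subr_ge0 //.
have [->|tn0] := eqVneq t 0; first by rewrite subr0 mul1r mul0r addr0.
have tp : 0 < t by rewrite lt_def tn0.
have h1 : (1 - t) * rn (x - x0) <= (1 - t) * r by rewrite ler_wpM2l ?subr_ge0 // ltW.
have h2 : t * rn (y - x0) < t * r by rewrite ltr_pM2l.
lraH h1 h2.
Qed.

Lemma bholo_lip f x0 r M : 0 < r -> bholo f x0 r M ->
  forall x y, rn (x - x0) < r / 2 -> rn (y - x0) < r / 2 ->
  rn (f y - f x) <= 16 * M / r * rn (y - x).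
Proof.
move=> r0 hf x y hx hy; apply: diff_bound_lipschitz => t t01 /=.
have hz := convex_seg t01 hx hy.
split; last exact: bholo_diff hz.
by apply: (hf _ _).1; lraH hz r0.
Qed.

(** Subtracting Cauchy's formulas on two parallel circles around x and y leaves differences of
    values of f, which [bholo_lip] controls. This bounds the second derivative before it is known to
    exist. *)
Lemma bholo_difflip f x0 r M : 0 < r -> bholo f x0 r M ->
  forall x y v, rn (x - x0) < r / 4 -> rn (y - x0) < r / 4 ->
  rn (cd f y v - cd f x v) <= 16 * (32 * M) / r ^+ 2 * rn (y - x) * rn v.
Proof.
move=> r0 hf x y v hx hy; have M0 := bholo_ge0 r0 hf.
have [->|v0] := eqVneq v 0.
  by rewrite !cd0 subr0 !rn0 mulr0.
have nv := rn_gt0 v0.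
pose r' := r / (8 * rn v).
have r'0 : 0 < r' by rewrite divr_gt0 // mulr_gt0.
have rv : r' * rn v = r / 8 by rewrite /r' invfM mulrA mulrVK // unitfE gt_eqF.
have hz u (z : C) : rn (u - x0) < r / 4 -> rn z <= r' -> rn (u + z *: v - x0) < r / 2.
  move=> hu zr; apply: le_lt_trans (rn_line _ _ _ _) _.
  have : rn z * rn v <= r / 8 by rewrite -rv ler_wpM2r // rn_ge0.
  by move=> h; lraH h hu r0.
have dz u (z : C) : rn (u - x0) < r / 4 -> rn z <= r' -> differentiable f (u + z *: v).
  by move=> hu zr; apply: (hf _ _).1; have := hz u z hu zr; lraH r0.
have Cx_ := cauchyV r'0 (fun z => dz x z hx).
have Cy := cauchyV r'0 (fun z => dz y z hy).
have circ t : rn (circle r' t) <= r' by rewrite rn_circle.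
have cx := con_quot (a := 0) (b := 2 * pi) (fun t => dz x _ hx (circ t)).
have cy := con_quot (a := 0) (b := 2 * pi) (fun t => dz y _ hy (circ t)).
pose K := 16 * M / r * rn (y - x).
have -> : 16 * (32 * M) / r ^+ 2 * rn (y - x) * rn v = 2 * ((K + K) / r').
  by rewrite /K /r'; field; rewrite !gt_eqF.
apply: twopi_bound; rewrite mulrBl -Cx_ -Cy -cintB //.
apply: cint_bound; [exact: ltW twopi_gt0|exact: conB|].
move=> t _; rewrite -mulrBl rnM rnV rn_circle // ler_wpM2r ?invr_ge0 ?(ltW r'0) //.
have -> : f (y + circle r' t *: v) - f y - (f (x + circle r' t *: v) - f x) =
  f (y + circle r' t *: v) - f (x + circle r' t *: v) - (f y - f x).
  by rewrite !opprB; ring.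
apply: le_trans (rnD _ _) _; rewrite rnN; apply: lerD.
  have := bholo_lip r0 hf (hz x _ hx (circ t)) (hz y _ hy (circ t)).
  by rewrite opprD addrACA subrr addr0.
by apply: (bholo_lip r0 hf); [lraH hx r0|lraH hy r0].
Qed.

(** The mean value inequality for f minus its differential at x: along the segment the differential
    of this function is small by [bholo_difflip]. *)
Lemma bholo_taylor f x0 r M : 0 < r -> bholo f x0 r M ->
  forall x w, rn (x - x0) < r / 4 -> rn (x + w - x0) < r / 4 ->
  rn (f (x + w) - f x - cd f x w) <= 16 * (32 * M) / r ^+ 2 * rn w ^+ 2.
Proof.
move=> r0 hf x w hx hw; have M0 := bholo_ge0 r0 hf.
have dfx : differentiable f x by apply: (hf _ _).1; lraH hx r0.
have hx' := differentiable_has_cd dfx.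
pose F (z : V) : C := f z - cd f x z.
have dF z : differentiable f z -> has_cd F z (fun v => cd f z v - cd f x v).
  move=> /differentiable_has_cd dz; apply: has_cdB => //.
  by have [? ? _] := hx'; exact: has_cd_lin.
have -> : f (x + w) - f x - cd f x w = F (x + w) - F x.
  by rewrite /F cdD; ring.
apply: diff_bound_lipschitz => t t01 /=.
have E : x + w - x = w by rewrite addrC addKr.
have hz := convex_seg t01 hx hw; move: hz; rewrite E => hz.
have hz' : rn (x + t%:C *: w - x0) < r by lraH hz r0.
have [d1 d2] := has_cdP (dF _ (hf _ hz').1).
split; first exact: d1.
rewrite d2; apply: le_trans (bholo_difflip r0 hf _ hx hz) _.
have E2 : x + t%:C *: w - x = t%:C *: w by rewrite addrC addKr.
move/andP: t01 => [t0 t1].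
rewrite E2 rnZ rnR (ger0_norm t0) -mulrA [rn w ^+ 2]expr2; apply: ler_wpM2l.
  by rewrite divr_ge0 ?exprn_ge0 ?(ltW r0) // !mulr_ge0.
by rewrite ler_wpM2r ?rn_ge0 // ler_piMl // rn_ge0.
Qed.

End Holo.

Section HoloDeriv.
Variables (R : realType) (n : nat).
Local Notation C := (Cx R).
Local Notation V := 'rV[C]_n.
Implicit Types (f : V -> C) (x v w : V).

(** Cauchy's integral for the derivative at x in the direction v, as a linear operator on continuous
    g; it gives the derivative when g is holomorphic near the disc. *)
Definition cavg (v x : V) (r : R) (g : V -> C) : C :=
  cint 0 (2 * pi) (fun t => (g (x + circle r t *: v) - g x) * (circle r t)^-1) / (2 * pi)%:C.

Lemma twopiC : (2 * pi)%:C != 0 :> C.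
Proof. by apply/eqP => /complexI h; have := @twopi_gt0 R; rewrite h ltxx. Qed.

Lemma cavg_cd f x v (r : R) : 0 < r -> (forall z : C, rn z <= r -> differentiable f (x + z *: v)) ->
  cavg v x r f = cd f x v.
Proof. by move=> r0 df; rewrite /cavg cauchyV // mulfK // twopiC. Qed.

Lemma cavg_bound g x v (r M : R) : 0 < r -> (forall t, contp g (x + circle r t *: v)) ->
  (forall t, rn (g (x + circle r t *: v) - g x) <= M) -> rn (cavg v x r g) <= 2 * (M / r).
Proof.
move=> r0 cg gM; apply: twopi_bound; rewrite /cavg divfK ?twopiC //.
apply: cint_bound; [exact: ltW (twopi_gt0 R)|exact: con_quot_cont|].
by move=> t _; rewrite rnM rnV rn_circle // ler_wpM2r ?invr_ge0 ?(ltW r0).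
Qed.

Lemma cavgB g h x v (r : R) :
  (forall t, contp g (x + circle r t *: v)) -> (forall t, contp h (x + circle r t *: v)) ->
  cavg v x r (fun y => g y - h y) = cavg v x r g - cavg v x r h.
Proof.
move=> cg ch; rewrite /cavg -mulrBl -cintB; [|exact: con_quot_cont|exact: con_quot_cont].
by congr (_ / _); apply: cint_ext => t _; rewrite -mulrBl; congr (_ * _); ring.
Qed.

Lemma cavgZ g x v (r : R) (k : C) : (forall t, contp g (x + circle r t *: v)) ->
  cavg v x r (fun y => k * g y) = k * cavg v x r g.
Proof.
move=> cg; rewrite /cavg mulrA -cintZ; last exact: con_quot_cont.
by congr (_ / _); apply: cint_ext => t _; rewrite mulrA mulrBr.
Qed.

Lemma contpB (W : normedModType C) (g h : V -> W) x : contp g x -> contp h x -> contp (fun y => g y - h y) x.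
Proof.
move=> cg ch e e0; have e2 : 0 < e / 2 by rewrite divr_gt0.
have [d d0 dP] := cg _ e2; have [d' d0' dP'] := ch _ e2.
exists (Num.min d d'); first by rewrite lt_min d0.
move=> y; rewrite lt_min => /andP[/dP h1 /dP' h2].
rewrite opprD addrACA -opprD; apply: le_lt_trans (rnD _ _) _; rewrite rnN.
by lraH h1 h2.
Qed.

Lemma contpZ g x (k : C) : contp g x -> contp (fun y => k * g y) x.
Proof.
move=> cg e e0; have k1 : 0 < 1 + rn k by rewrite ltr_pwDl // rn_ge0.
have [d d0 dP] := cg _ (divr_gt0 e0 k1); exists d => // y /dP.
rewrite ltr_pdivlMr // -mulrBr rnM [rn (g y - g x) * _]mulrC; apply: le_lt_trans.
by rewrite ler_wpM2r ?rn_ge0 // lerDr.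
Qed.

Lemma contp_lip (W : normedModType C) (g : V -> W) x0 x (r K : R) : rn (x - x0) < r ->
  (forall y, rn (y - x0) < r -> rn (g y - g x) <= K * rn (y - x)) -> contp g x.
Proof.
move=> hx hg e e0; have K1 : 0 < 1 + `|K| by rewrite ltr_pwDl.
exists (Num.min (r - rn (x - x0)) (e / (1 + `|K|))).
  by rewrite lt_min subr_gt0 hx divr_gt0.
move=> y; rewrite lt_min ltr_pdivlMr // => /andP[h1 h2].
have hy : rn (y - x0) < r by apply: le_lt_trans (rn_trans y x0 x) _; rewrite -ltrBrDr.
apply: le_lt_trans (hg _ hy) _; apply: le_lt_trans h2.
by rewrite mulrC ler_wpM2l ?rn_ge0 // (le_trans (ler_norm _)) // lerDr.
Qed.

(** Differentiation under the integral sign in Cauchy's formula for [cd f x v]. The quadratic Taylor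
    bound holds uniformly on the circle, so the error of the average is again quadratic in h. *)
Lemma has_cd_cd f x0 (r M : R) v : 0 < r -> bholo f x0 r M ->
  exists2 r' : R, 0 < r' & has_cd (fun x => cd f x v) x0 (fun w => cavg v x0 r' (fun y => cd f y w)) /\
    forall z : C, rn z <= r' -> rn (x0 + z *: v - x0) < r / 4.
Proof.
move=> r0 hf; have M0 := bholo_ge0 r0 hf.
have v1 : 0 < 1 + rn v by rewrite ltr_pwDl // rn_ge0.
pose r' := r / (8 * (1 + rn v)).
have r'0 : 0 < r' by rewrite divr_gt0 // mulr_gt0.
have rv : r' * (1 + rn v) = r / 8 by rewrite /r'; field; rewrite gt_eqF.
exists r' => //.
have zv (z : C) : rn z <= r' -> rn (z *: v) <= r / 8.
  move=> hz; rewrite rnZ -rv; apply: ler_pM => //; rewrite ?rn_ge0 // lerDr //.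
have hz (h : V) (z : C) : rn h < r / 16 -> rn z <= r' -> rn (x0 + h + z *: v - x0) < r / 4.
  move=> hh /zv k; rewrite addrAC (addrAC x0) subrr add0r; apply: le_lt_trans (rnD _ _) _; lraH k hh r0.
have hz0 (z : C) : rn z <= r' -> rn (x0 + z *: v - x0) < r / 4.
  by move=> k; have := @hz 0 z; rewrite addr0 rn0; apply => //; lraH r0.
split; last exact: hz0.
have circ t : rn (circle r' t : C) <= r' by rewrite rn_circle.
have x00 : rn (x0 - x0) < r / 4 by rewrite subrr rn0; lraH r0.
pose K := 16 * (32 * M) / r ^+ 2.
have K0 : 0 <= K by rewrite divr_ge0 ?exprn_ge0 ?(ltW r0) // !mulr_ge0.
have dl := bholo_difflip r0 hf.
have cdc w t : contp (fun y => cd f y w) (x0 + circle r' t *: v).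
  apply: (@contp_lip _ _ x0 _ (r / 4) (K * rn w)); first exact: hz0.
  by move=> y hy; rewrite mulrAC; apply: dl => //; exact: hz0.
have r4 : r / 4 < r by lraH r0.
have dif x : rn (x - x0) < r / 4 -> differentiable f x.
  by move=> hx; apply: (hf _ _).1; exact: lt_trans hx r4.
split.
- move=> a u w; rewrite -[a *: cavg _ _ _ _]/(a * cavg _ _ _ _).
  have -> : cavg v x0 r' (fun y => cd f y w) = - (-1 * cavg v x0 r' (fun y => cd f y w)).
    by rewrite mulN1r opprK.
  rewrite -(cavgZ _ (cdc w)) -(cavgZ _ (cdc u)) -cavgB.
  + by congr cavg; apply/funext => y; rewrite cdP mulN1r opprK.
  + by move=> t; exact: contpZ.
  + by move=> t; exact: contpZ.
- exists (2 * (K * (r / 8) / r')) => w.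
  rewrite -mulrA [K * _ / _ * _]mulrAC; apply: cavg_bound => // t.
  have h := dl _ _ w x00 (hz0 _ (circ t)); apply: le_trans h _.
  rewrite -/K ler_wpM2r ?rn_ge0 // ler_wpM2l // addrC addKr; exact: zv.
move=> e e0.
(* The first bound keeps the displaced circle in the ball of radius r / 4; the second turns the
   error 4 K (rn h)^2 / r' into at most e rn h. *)
pose dlt := Num.min (r / 16) (e * r' / (4 * (1 + K))).
have K1 : 0 < 1 + K by rewrite ltr_pwDl.
have d0 : 0 < dlt.
  rewrite lt_min; apply/andP; split; first by apply: divr_gt0.
  by apply: divr_gt0; apply: mulr_gt0.
exists dlt => // h; rewrite lt_min => /andP[h16 he].
have dx t : contp f (x0 + circle r' t *: v) by apply: differentiable_cont; exact/dif/hz0.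
have dxh t : contp f (x0 + h + circle r' t *: v).
  by apply: differentiable_cont; exact/dif/hz.
rewrite -(cavg_cd r'0 (fun z k => dif _ (hz h z h16 k))) -(cavg_cd r'0 (fun z k => dif _ (hz0 z k))).
pose g1 y := f (y + h).
have cg1 t : contp g1 (x0 + circle r' t *: v).
  move=> e1 e10; have [d d0' dP] := dxh t _ e10; exists d => // y yd.
  have E : x0 + circle r' t *: v + h = x0 + h + circle r' t *: v by rewrite addrAC.
  rewrite /g1 E; apply: dP.
  have -> // : y + h - (x0 + h + circle r' t *: v) = y - (x0 + circle r' t *: v).
  by rewrite -E (opprD _ h) addrACA subrr addr0.
have -> : cavg v (x0 + h) r' f = cavg v x0 r' g1.
  by rewrite /cavg /g1; congr (_ / _); apply: cint_ext => t _; rewrite addrAC.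
rewrite -cavgB // -cavgB //; last by move=> t; exact: contpB.
apply: le_trans (cavg_bound (M := K * rn h ^+ 2 + K * rn h ^+ 2) r'0 _ _) _.
- by move=> t; apply: contpB => //; exact: contpB.
- have tay x : rn (x - x0) < r / 4 -> rn (x + h - x0) < r / 4 ->
     rn (g1 x - f x - cd f x h) <= K * rn h ^+ 2 by exact: (bholo_taylor r0 hf).
  move=> t; apply: le_trans (rnD _ _) _; rewrite rnN; apply: lerD.
    apply: tay; first exact: hz0.
    have -> : x0 + circle r' t *: v + h = x0 + h + circle r' t *: v by rewrite addrAC.
    exact: hz.
  apply: tay => //; rewrite addrC addKr; lraH h16 r0.
have hr0 := rn_ge0 h.
have E1 : 2 * ((K * rn h ^+ 2 + K * rn h ^+ 2) / r') = (4 * K * rn h / r') * rn h by ring.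
rewrite E1 ler_wpM2r // ler_pdivrMr //.
move: he; rewrite ltr_pdivlMr ?mulr_gt0 // => he; apply: le_trans (ltW he).
by rewrite mulrC; apply: ler_wpM2l => //; lra.
Qed.

Lemma local_bholo f (U : set V) x0 : open U -> U x0 -> (forall x, U x -> differentiable f x) ->
  exists2 r : R, 0 < r & bholo f x0 r (rn (f x0) + 1) /\ forall x, rn (x - x0) < r -> U x.
Proof.
move=> /openrnP oU Ux hf; have [d d0 dP] := oU _ Ux.
have [d' d0' dP'] := differentiable_cont (hf _ Ux) ltr01.
exists (Num.min d d'); first by rewrite lt_min d0.
split=> x; rewrite lt_min => /andP[/dP Ux' /dP' h] //.
by split; [exact: hf|have := rn_dist (f x) (f x0); rewrite ler_norml => /andP[_]; lraH h].
Qed.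

Theorem differentiable_cd f (U : set V) v : open U -> (forall x, U x -> differentiable f x) ->
  forall x, U x -> differentiable (fun x => cd f x v) x.
Proof.
move=> oU hf x Ux; have [r r0 [hb _]] := local_bholo oU Ux hf.
by have [r' _ [/has_cd_diff]] := has_cd_cd v r0 hb.
Qed.

(** The derivative of [cd f y v] in the direction w is, by [has_cd_cd], the Cauchy integral in the
    direction v of [cd f y w], that is, the derivative of the latter in the direction v. *)
Theorem cd_sym f (U : set V) v w : open U -> (forall x, U x -> differentiable f x) ->
  forall x, U x -> cd (fun y => cd f y v) x w = cd (fun y => cd f y w) x v.
Proof.
move=> oU hf x Ux; have [r r0 [hb rU]] := local_bholo oU Ux hf.
have [r' r'0 [h hz]] := has_cd_cd v r0 hb.
rewrite (has_cd_val _ h) (cavg_cd r'0) // => z zr; apply: (differentiable_cd _ oU) => //.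
by apply: rU; apply: lt_le_trans (hz _ zr) _; lraH r0.
Qed.

End HoloDeriv.

(** * Uniform limits of holomorphic maps *)

Section Weierstrass.
Variables (R : realType) (n : nat).
Local Notation C := (Cx R).
Local Notation V := 'rV[C]_n.

Definition cvgs (W : normedModType C) (a : nat -> W) (l : W) := forall e : R, 0 < e ->
  exists N, forall i, (N <= i)%N -> rn (a i - l) <= e.

Lemma cvgs_uniq (W : normedModType C) (a : nat -> W) l l' : cvgs a l -> cvgs a l' -> l = l'.
Proof.
move=> h h'; apply/eqP; rewrite -subr_eq0; apply/eqP/rn_eq0/eqP.
rewrite eq_le rn_ge0 andbT; apply/ler_addgt0Pr => e e0; rewrite add0r.
have e2 : 0 < e / 2 by rewrite divr_gt0.
have [N hN] := h _ e2; have [N' hN'] := h' _ e2.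
have := hN _ (leq_maxl N N'); have := hN' _ (leq_maxr N N').
have := rn_trans l l' (a (maxn N N')); rewrite [rn (l - a _)]rnB.
by move=> k1 k2 k3; lraH k1 k2 k3.
Qed.

Lemma real_cauchy_lim (a : nat -> R) :
  (forall e, 0 < e -> exists N, forall i j, (N <= i)%N -> (N <= j)%N -> `|a i - a j| <= e) ->
  exists l, forall e, 0 < e -> exists N, forall i, (N <= i)%N -> `|a i - l| <= e.
Proof.
move=> h; have /cvg_ex[l al] : cvg (a @ \oo).
  apply: cauchy_cvg; apply: cauchy_exP => e e0.
  have [N hN] := h _ (divr_gt0 e0 (ltr0Sn R 1)).
  exists (a N); exists N => // i /= Ni; rewrite /ball /=.
  by apply: le_lt_trans (hN _ _ (leqnn _) Ni) _; lraH e0.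
exists l => e e0; move/cvgrPdist_le: al => /(_ e e0)[N _ hN].
by exists N => i /hN; rewrite /= distrC.
Qed.

Lemma cauchy_lim (a : nat -> C) :
  (forall e, 0 < e -> exists N, forall i j, (N <= i)%N -> (N <= j)%N -> rn (a i - a j) <= e) ->
  exists l, cvgs a l.
Proof.
move=> h.
have [|u hu] := @real_cauchy_lim (fun i => complex.Re (a i)).
  move=> e /h[N hN]; exists N => i j Ni Nj; rewrite -ReB.
  by apply: le_trans (rnRe _) _; exact: hN.
have [|v hv] := @real_cauchy_lim (fun i => complex.Im (a i)).
  move=> e /h[N hN]; exists N => i j Ni Nj; rewrite -ImB.
  by apply: le_trans (rnIm _) _; exact: hN.
exists (u +i* v) => e e0; have e2 : 0 < e / 2 by rewrite divr_gt0.
have [N hN] := hu _ e2; have [N' hN'] := hv _ e2.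
exists (maxn N N') => i; rewrite geq_max => /andP[/hN k1 /hN' k2].
apply: le_trans (rn_le_ReIm _) _; rewrite ReB ImB /=; lraH k1 k2.
Qed.

Lemma cvgs_le (W : normedModType C) (a : nat -> W) l (K : R) : cvgs a l ->
  (exists N, forall i, (N <= i)%N -> rn (a i) <= K) -> rn l <= K.
Proof.
move=> al [N hK]; apply/ler_addgt0Pr => e e0; have [N' hN'] := al _ e0.
have k1 := hN' _ (leq_maxr N N'); have k2 := hK _ (leq_maxl N N').
have := rn_dist l (a (maxn N N')); rewrite ler_norml rnB => /andP[_ k3].
lraH k1 k2 k3.
Qed.

Lemma cvgsD (W : normedModType C) (a b : nat -> W) l m : cvgs a l -> cvgs b m ->
  cvgs (fun i => a i + b i) (l + m).
Proof.
move=> h h' e e0; have e2 : 0 < e / 2 by rewrite divr_gt0.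
have [N hN] := h _ e2; have [N' hN'] := h' _ e2.
exists (maxn N N') => i; rewrite geq_max => /andP[/hN k1 /hN' k2].
by rewrite opprD addrACA; apply: le_trans (rnD _ _) _; lraH k1 k2.
Qed.

Lemma cvgsZ (W : normedModType C) (k : C) (a : nat -> W) l : cvgs a l ->
  cvgs (fun i => k *: a i) (k *: l).
Proof.
move=> h e e0; have k1 : 0 < 1 + rn k by rewrite ltr_pwDl // rn_ge0.
have [N hN] := h _ (divr_gt0 e0 k1); exists N => i /hN.
rewrite ler_pdivlMr // -scalerBr rnZ mulrC; apply: le_trans.
by rewrite ler_wpM2r ?rn_ge0 // lerDr.
Qed.

Lemma cvgsB (W : normedModType C) (a b : nat -> W) l m : cvgs a l -> cvgs b m ->
  cvgs (fun i => a i - b i) (l - m).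
Proof.
move=> h h'; have := cvgsD h (cvgsZ (-1) h'); rewrite scaleN1r.
by under eq_fun do rewrite scaleN1r.
Qed.

Lemma bholoB (f g : V -> C) x0 r M M' : bholo f x0 r M -> bholo g x0 r M' ->
  forall e, (forall x, rn (x - x0) < r -> rn (f x - g x) <= e) -> bholo (fun x => f x - g x) x0 r e.
Proof.
move=> hf hg e h x xr; split; last exact: h.
have [df _] := hf _ xr; have [dg _] := hg _ xr.
exact: (has_cd_diff (has_cdB (differentiable_has_cd df) (differentiable_has_cd dg))).
Qed.

(** Cauchy estimates for differences make the differentials at x0 a Cauchy sequence. The Taylor
    bounds of the approximants have a common constant, so they pass to the limit and show that the
    limit of the differentials is the differential of f. *)
Theorem weierstrass (fk : nat -> V -> C) (f : V -> C) x0 r M : 0 < r ->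
  (forall k, bholo (fk k) x0 r M) ->
  (forall e, 0 < e -> exists N, forall k, (N <= k)%N -> forall x, rn (x - x0) < r -> rn (fk k x - f x) <= e) ->
  differentiable f x0 /\ forall v, cvgs (fun k => cd (fk k) x0 v) (cd f x0 v).
Proof.
move=> r0 hk hf; have M0 := bholo_ge0 r0 (hk 0%N).
have x00 : rn (x0 - x0) < r by rewrite subrr rn0.
have pt x : rn (x - x0) < r -> cvgs (fun k => fk k x) (f x).
  by move=> xr e /hf[N hN]; exists N => i /hN; apply.
have /choice[c hc] w : exists l, cvgs (fun k => cd (fk k) x0 w) l.
  apply: cauchy_lim => e e0.
  have w1 : 0 < 1 + rn w by rewrite ltr_pwDl // rn_ge0.
  (* The denominator 32 absorbs the 16 of [bholo_diff] and the bound e1 + e1 on the difference of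
     two approximants. *)
  pose e1 := e * r / (32 * (1 + rn w)).
  have e10 : 0 < e1 by apply: divr_gt0; apply: mulr_gt0.
  have [N hN] := hf _ e10; exists N => i j Ni Nj.
  have hb : bholo (fun x => fk i x - fk j x) x0 r (e1 + e1).
    apply: bholoB (hk i) (hk j) _ _ => x xr.
    have := rn_trans (fk i x) (fk j x) (f x); rewrite [rn (f x - _)]rnB => k.
    by apply: le_trans k _; apply: lerD; [exact: hN|exact: hN].
  have [di _] := hk i _ x00; have [dj _] := hk j _ x00.
  have x02 : rn (x0 - x0) < r / 2 by rewrite subrr rn0 divr_gt0.
  have := bholo_diff r0 hb w x02.
  rewrite (has_cd_val _ (has_cdB (differentiable_has_cd di) (differentiable_has_cd dj))).
  move=> /le_trans; apply.
  have -> : 16 * (e1 + e1) / r * rn w = e * (rn w / (1 + rn w)).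
    by rewrite /e1; field; rewrite !gt_eqF.
  by rewrite ler_piMr ?(ltW e0) // ler_pdivrMr // mul1r lerDr.
have lc (a : C) u v : c (a *: u + v) = a *: c u + c v.
  apply: cvgs_uniq (hc _) _; have := cvgsD (cvgsZ a (hc u)) (hc v).
  by under eq_fun do rewrite -cdP.
have H : has_cd f x0 c.
  split=> //.
    exists (16 * M / r) => w; apply: cvgs_le (hc w) _; exists 0%N => i _.
    by apply: (bholo_diff r0 (hk i)); rewrite subrr rn0 divr_gt0.
  move=> e e0; pose K := 16 * (32 * M) / r ^+ 2.
  have K0 : 0 <= K by rewrite divr_ge0 ?exprn_ge0 ?(ltW r0) // !mulr_ge0.
  have K1 : 0 < 1 + K by rewrite ltr_pwDl.
  exists (Num.min (r / 4) (e / (1 + K))).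
    by rewrite lt_min; apply/andP; split; apply: divr_gt0.
  move=> h; rewrite lt_min => /andP[h4]; rewrite ltr_pdivlMr // => he.
  have xh : x0 + h - x0 = h by rewrite addrC addKr.
  have hr : rn (x0 + h - x0) < r by rewrite xh; lraH h4 r0.
  apply: (@le_trans _ _ (K * rn h ^+ 2)); last first.
    rewrite expr2 mulrA ler_wpM2r ?rn_ge0 //; apply: le_trans (ltW he).
    by rewrite mulrC ler_wpM2l ?rn_ge0 // lerDr.
  apply: cvgs_le (cvgsB (cvgsB (pt _ hr) (pt _ x00)) (hc h)) _; exists 0%N => i _.
  by apply: (bholo_taylor r0 (hk i)); rewrite ?xh // subrr rn0 divr_gt0.
split; first exact: has_cd_diff H.
by move=> v; rewrite (has_cd_val _ H).
Qed.

End Weierstrass.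

Section Vectorial.
Variables (R : realType) (n : nat).
Local Notation C := (Cx R).
Local Notation V := 'rV[C]_n.
Implicit Types (F : V -> V) (c : V -> V).

Lemma has_cd_coord F x (c : V -> V) k : has_cd F x c -> has_cd (fun y => F y 0 k : C) x (fun v => c v 0 k).
Proof.
move=> [lc [K bK] est]; split.
- by move=> a u v; rewrite lc !mxE.
- by exists K => v; apply: le_trans (rn_coord _ _) (bK v).
move=> e /est[d d0 dP]; exists d => // h /dP; apply: le_trans.
by have := rn_coord (F (x + h) - F x - c h) k; rewrite !mxE.
Qed.

Lemma has_cd_row F x (c : V -> V) : (forall k, has_cd (fun y => F y 0 k : C) x (fun v => c v 0 k)) -> has_cd F x c.
Proof.
move=> h; split.
- move=> a u v; apply/rowP => k; have [lc _ _] := h k; rewrite !mxE.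
  exact: lc.
- have /choice[K hK] k : exists K : R, forall v, rn (c v 0 k) <= K * rn v by have [_ ? _] := h k.
  exists (\sum_k `|K k|) => v; apply: rn_le.
    by rewrite mulr_ge0 ?rn_ge0 // sumr_ge0.
  move=> k; apply: le_trans (hK k v) _; apply: ler_wpM2r; first exact: rn_ge0.
  by apply: le_trans (ler_norm _) _; rewrite (bigD1 k) //= lerDl sumr_ge0.
move=> e e0.
have /choice[d hd] k : exists d : R, 0 < d /\ forall h, rn h < d ->
    rn (F (x + h) 0 k - F x 0 k - c h 0 k) <= e * rn h.
  by have [_ _ /(_ e e0)[d d0 dP]] := h k; exists d.
exists (\big[Num.min/1]_k d k).
  by elim/big_ind: _ => // [a b a0 b0|k _]; [rewrite lt_min a0|have [] := hd k].
move=> u ud; apply: rn_le; first by rewrite mulr_ge0 ?rn_ge0 // ltW.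
move=> k; have [_ hk] := hd k; rewrite !mxE; apply: hk.
by apply: lt_le_trans ud _; rewrite (bigD1 k) //= ge_min lexx.
Qed.

Lemma differentiable_coordP F x : differentiable F x <->
  forall k, differentiable (fun y => F y 0 k : C) x.
Proof.
split=> [/differentiable_has_cd h k|h]; first exact: has_cd_diff (has_cd_coord k h).
apply: (@has_cd_diff _ _ _ _ _ (fun v => \row_k cd (fun y => F y 0 k : C) x v)).
apply: has_cd_row => k.
have := differentiable_has_cd (h k).
by have -> // : cd (fun y => F y 0 k : C) x = fun v => (\row_k cd (fun y => F y 0 k : C) x v) 0 k
  by apply/funext => v; rewrite mxE.
Qed.

Lemma cd_coord F x v k : differentiable F x -> cd F x v 0 k = cd (fun y => F y 0 k : C) x v.
Proof. by move=> /differentiable_has_cd/(has_cd_coord k)/has_cd_val ->. Qed.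

Lemma cd_jacobian F x v : v *m jacobian F x = cd F x v.
Proof. by rewrite cdE /jacobian mul_rV_lin1. Qed.

End Vectorial.

(** * Smooth functions and equismooth families *)

Lemma eq_leW (R : realType) (a b : R) : a = b -> a <= b.
Proof. by move=> ->. Qed.

Lemma increment_split (R : realType) (f1 f0 c l s s' a : R) :
  f1 - c * (s' * a) - (f0 - c * (s * a)) = (f1 - f0 - l * ((s' - s) * a)) + (l - c) * ((s' - s) * a).
Proof. by ring. Qed.

Section RealDeriv.
Variables (R : realType) (n : nat).
Local Notation C := (Cx R).
Local Notation V := 'rV[C]_n.
Implicit Types (f g : V -> R) (v x : V).

Definition hasr f v x (l : R) := forall e, 0 < e -> exists2 d : R, 0 < d &
  forall t : R, `|t| < d -> `|f (x + t%:C *: v) - f x - l * t| <= e * `|t|.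

Lemma line0 v x : x + (0 : R)%:C *: v = x.
Proof. by rewrite scale0r addr0. Qed.

Lemma hasrP f v x l : hasr f v x l <-> rderivable f v x /\ rderive f v x = l.
Proof.
rewrite /rderivable /rderive derive1E; split=> [h|[h1 h2]].
  have [] : is_derive (0 : R) (1 : R) (fun t : R => f (x + t%:C *: v)) l.
    apply: eps_is_derive => e e0; have [d d0 dP] := h e e0; exists d => // t td.
    by rewrite add0r line0; exact: dP.
  by [].
move=> e e0; have [d d0 dP] := is_derive_eps (DeriveDef h1 h2) e0.
by exists d => // t /dP; rewrite add0r line0.
Qed.

Lemma hasr_derivable f v x l : hasr f v x l -> rderivable f v x.
Proof. by case/hasrP. Qed.
Lemma hasr_val f v x l : hasr f v x l -> rderive f v x = l.
Proof. by case/hasrP. Qed.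
Lemma hasr_rderive f v x : rderivable f v x -> hasr f v x (rderive f v x).
Proof. by move=> h; apply/hasrP. Qed.

Lemma hasr_ext f g v x l (d : R) : 0 < d -> (forall y, rn (y - x) < d -> f y = g y) -> hasr f v x l -> hasr g v x l.
Proof.
move=> d0 fg h e e0; have [d' d'0 dP] := h e e0.
have v1 : 0 < 1 + rn v by rewrite ltr_pwDl // rn_ge0.
exists (Num.min d' (d / (1 + rn v))); first by rewrite lt_min d'0 divr_gt0.
move=> t; rewrite lt_min => /andP[/dP td ht].
rewrite -!fg //; first by rewrite subrr rn0.
by rewrite addrC addKr; apply: rn_scale_small; rewrite rnR.
Qed.

Lemma hasr_cont f v x l : hasr f v x l -> forall e, 0 < e -> exists2 d : R, 0 < d &
  forall t : R, `|t| < d -> `|f (x + t%:C *: v) - f x| < e.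
Proof.
move=> h e e0; have [d d0 dP] := h _ ltr01.
have l1 : 0 < 1 + `|l| by rewrite ltr_pwDl.
exists (Num.min d (e / (1 + `|l|))); first by rewrite lt_min d0 divr_gt0.
move=> t; rewrite lt_min ltr_pdivlMr // => /andP[/dP h1 h2].
have h3 := ler_normD (f (x + t%:C *: v) - f x - l * t) (l * t).
rewrite subrK normrM in h3; lraH h1 h2 h3.
Qed.

Lemma hasr_cst (c : R) v x : hasr (fun=> c) v x 0.
Proof. by move=> e e0; exists 1 => // t _; rewrite subrr mul0r subr0 normr0 mulr_ge0 // ltW. Qed.

Lemma hasrD f g v x l m : hasr f v x l -> hasr g v x m -> hasr (fun y => f y + g y) v x (l + m).
Proof.
move=> hf hg e e0; have e2 : 0 < e / 2 by rewrite divr_gt0.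
have [d d0 dP] := hf _ e2; have [d' d0' dP'] := hg _ e2.
exists (Num.min d d'); first by rewrite lt_min d0.
move=> t; rewrite lt_min => /andP[/dP h1 /dP' h2].
rewrite mulrDl addr_sub3; apply: le_trans (ler_normD _ _) _; lraH h1 h2.
Qed.

Lemma hasrM f g v x l m : hasr f v x l -> hasr g v x m ->
  hasr (fun y => f y * g y) v x (l * g x + f x * m).
Proof.
move=> hf hg e e0.
pose K := 1 + `|f x| + `|g x| + `|l|.
have K0 : 0 < K by rewrite /K -!addrA ltr_pwDl // !addr_ge0.
pose e1 := Num.min 1 (e / (3 * K)).
have e10 : 0 < e1 by rewrite lt_min ltr01 divr_gt0 // mulr_gt0.
have [d d0 dP] := hf _ e10; have [d' d0' dP'] := hg _ e10.
have [d2 d20 dP2] := hasr_cont hg e10.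
exists (Num.min d (Num.min d' d2)); first by rewrite !lt_min d0 d0'.
move=> t; rewrite !lt_min => /and3P[/dP h1 /dP' h2 /dP2 h3].
set a := f _ in h1 *; set b := g _ in h2 h3 *.
have -> : a * b - f x * g x - (l * g x + f x * m) * t =
  (a - f x - l * t) * g x + f x * (b - g x - m * t) + (a - f x - l * t) * (b - g x) + l * t * (b - g x).
  by ring.
have e11 : e1 <= 1 by rewrite /e1 ge_min lexx.
have e1K : e1 * (3 * K) <= e by rewrite -ler_pdivlMr ?mulr_gt0 // /e1 ge_min lexx orbT.
have t0 := normr_ge0 t.
have p1 : `|(a - f x - l * t) * g x| <= e1 * `|t| * `|g x| by rewrite normrM ler_wpM2r.
have p2 : `|f x * (b - g x - m * t)| <= `|f x| * (e1 * `|t|) by rewrite normrM ler_wpM2l.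
have p3 : `|(a - f x - l * t) * (b - g x)| <= e1 * `|t| * 1.
  by rewrite normrM; apply: ler_pM => //; exact: le_trans (ltW h3) e11.
have p4 : `|l * t * (b - g x)| <= `|l| * `|t| * e1.
  by rewrite !normrM; apply: ler_wpM2l; [rewrite mulr_ge0|exact: ltW].
apply: le_trans (ler_normD _ _) _; apply: le_trans (lerD (ler_normD _ _) p4) _.
apply: le_trans (lerD (lerD (ler_normD _ _) (lexx _)) (lexx _)) _.
apply: le_trans (lerD (lerD (lerD p1 p2) p3) (lexx _)) _.
apply: (@le_trans _ _ (e1 * K * `|t|)); first by rewrite /K; apply: eq_leW; ring.
rewrite ler_wpM2r //; apply: le_trans e1K; rewrite ler_wpM2l ?(ltW e10) //.
by rewrite ler_peMl ?(ltW K0) // ler1n.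
Qed.

Lemma hasr_comp f v x l (E : R -> R) m : hasr f v x l -> is_derive (f x) (1 : R) E m ->
  hasr (fun y => E (f y)) v x (m * l).
Proof.
move=> hf hE e e0.
pose K := 1 + `|m| + `|l|.
have K0 : 0 < K by rewrite /K -addrA ltr_pwDl // addr_ge0.
pose e1 := Num.min 1 (e / (2 * K)).
have e10 : 0 < e1 by rewrite lt_min ltr01 divr_gt0 // mulr_gt0.
have [d d0 dP] := hf _ e10; have [d' d0' dP'] := is_derive_eps hE e10.
have [d2 d20 dP2] := hasr_cont hf d0'.
exists (Num.min d d2); first by rewrite !lt_min d0.
move=> t; rewrite !lt_min => /andP[/dP h1 /dP2 h2].
have := dP' _ h2; rewrite subrKC => h3.
set a := f _ in h1 h2 h3 *.
have -> : E a - E (f x) - m * l * t = (E a - E (f x) - m * (a - f x)) + m * (a - f x - l * t) by ring.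
have e11 : e1 <= 1 by rewrite /e1 ge_min lexx.
have e1K : e1 * (2 * K) <= e by rewrite -ler_pdivlMr ?mulr_gt0 // /e1 ge_min lexx orbT.
have h4 : `|a - f x| <= (1 + `|l|) * `|t|.
  rewrite -(subrK (l * t) (a - f x)); apply: le_trans (ler_normD _ _) _.
  rewrite mulrDl normrM lerD2r; apply: le_trans h1 _; rewrite ler_wpM2r //.
have p1 : `|E a - E (f x) - m * (a - f x)| <= e1 * ((1 + `|l|) * `|t|).
  by apply: le_trans h3 _; rewrite ler_wpM2l // ltW.
have p2 : `|m * (a - f x - l * t)| <= `|m| * (e1 * `|t|) by rewrite normrM ler_wpM2l.
apply: le_trans (ler_normD _ _) _; apply: le_trans (lerD p1 p2) _.
apply: (@le_trans _ _ (e1 * K * `|t|)); first by rewrite /K; apply: eq_leW; ring.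
rewrite ler_wpM2r //; apply: le_trans e1K; rewrite ler_wpM2l ?(ltW e10) //.
by rewrite ler_peMl ?(ltW K0) // ler1n.
Qed.

Lemma hasr_shift f v x l (s : R) : hasr f v (x + s%:C *: v) l ->
  forall e, 0 < e -> exists2 d : R, 0 < d & forall t : R, `|t - s| < d ->
    `|f (x + t%:C *: v) - f (x + s%:C *: v) - l * (t - s)| <= e * `|t - s|.
Proof.
move=> h e e0; have [d d0 dP] := h e e0; exists d => // t /dP.
have -> // : x + s%:C *: v + (t - s)%:C *: v = x + t%:C *: v.
by rewrite -addrA -scalerDl -rmorphD /= subrKC.
Qed.

(** The function f minus c times the parameter has derivative at most e in absolute value along the
    segment, hence is e-Lipschitz there. *)
Lemma line_mvt f v z (a c e : R) : 
  (forall t : R, `|t| <= `|a| -> exists2 l, hasr f v (z + t%:C *: v) l & `|l - c| <= e) ->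
  `|f (z + a%:C *: v) - f z - c * a| <= e * `|a|.
Proof.
move=> h; have e0 : 0 <= e.
  have h0 : `|0 : R| <= `|a| by rewrite normr0.
  by have [l _] := h 0 h0; exact: le_trans.
have H eta : 0 < eta -> `|f (z + a%:C *: v) - f z - c * a| <= (e * `|a| + eta * `|a|) * (1 - 0).
  move=> eta0; pose G (s : R) := f (z + (s * a)%:C *: v) - c * (s * a).
  have -> : f (z + a%:C *: v) - f z - c * a = G 1 - G 0.
    by rewrite /G mul1r mul0r line0 mulr0 subr0 addrAC.
  apply: (@lipschitz_of_local R R Num.norm G) => //; first exact: ler_normD.
    exact: normrN.
  move=> s /andP[s0 s1].
  have sa : `|s * a| <= `|a| by rewrite normrM ger0_norm // ler_piMl.
  have [l hl lc] := h _ sa.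
  have [d d0 dP] := hasr_shift hl eta0.
  have a1 : 0 < 1 + `|a| by rewrite ltr_pwDl.
  exists (d / (1 + `|a|)); first exact: divr_gt0.
  move=> s' _; rewrite ltr_pdivlMr // => ss.
  have E : s' * a - s * a = (s' - s) * a by rewrite mulrBl.
  have /dP : `|s' * a - s * a| < d.
    by rewrite E normrM; apply: le_lt_trans ss; rewrite ler_wpM2l // lerDr.
  rewrite E normrM /G => h1.
  have -> : f (z + (s' * a)%:C *: v) - c * (s' * a) - (f (z + (s * a)%:C *: v) - c * (s * a)) =
    (f (z + (s' * a)%:C *: v) - f (z + (s * a)%:C *: v) - l * ((s' - s) * a)) + (l - c) * ((s' - s) * a).
    exact: increment_split.
  apply: le_trans (ler_normD _ _) _.
  have h2 : `|(l - c) * ((s' - s) * a)| <= e * (`|s' - s| * `|a|).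
    by rewrite !normrM ler_wpM2r // mulr_ge0.
  by apply: le_trans (lerD h1 h2) _; apply: eq_leW; ring.
apply: (@ler_eps_mul _ _ _ `|a|) => // eta /H; rewrite subr0 mulr1; exact.
Qed.

End RealDeriv.

Section SmoothFamilies.
Variables (R : realType) (n : nat).
Local Notation C := (Cx R).
Local Notation V := 'rV[C]_n.

Definition lbd (Om : Type) (S : set Om) (U : set V) (f : Om -> V -> R) := forall x, U x ->
  (forall e, 0 < e -> exists2 d : R, 0 < d & forall w y, S w -> rn (y - x) < d -> `|f w y - f w x| <= e) /\
  (exists M, forall w, S w -> `|f w x| <= M).

(* C^k with bounds and moduli of continuity uniform over w in S: this is what makes an
   average of the f w over w again C^k (smooth_functional). *)
Fixpoint ECk (Om : Type) (S : set Om) (k : nat) (U : set V) (f : Om -> V -> R) : Prop :=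
  lbd S U f /\
  if k is k'.+1 then
    forall v, (forall w x, S w -> U x -> rderivable (f w) v x) /\ ECk S k' U (fun w => rderive (f w) v)
  else True.

Lemma continuous_rn (f : V -> R) x : {for x, continuous f} <->
  forall e, 0 < e -> exists2 d : R, 0 < d & forall y, rn (y - x) < d -> `|f y - f x| <= e.
Proof.
split=> [/cvgrPdist_le h e e0|h].
  by have /nbhs_rnP[d d0 dP] := h e e0; exists d => // y /dP; rewrite /= distrC.
have FF : Filter (nbhs x) := nbhs_filter x.
apply/(@cvgrPdist_le _ _ _ _ FF) => e e0; have [d d0 dP] := h e e0.
by apply/nbhs_rnP; exists d => // y /dP; rewrite distrC.
Qed.

(** A single function is a family over [unit], so the closure properties are proved once, for
    families. *)
Lemma Ck_onP k (U : set V) (f : V -> R) : Ck_on k U f <-> ECk [set: unit] k U (fun _ => f).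
Proof.
elim: k f => [|k IH] f /=; split=> -[h1 h2]; split=> //.
- move=> x Ux; split; last by exists `|f x|.
  by move=> e e0; have /continuous_rn/(_ e e0)[d d0 dP] := h1 x Ux; exists d => // _ y _; exact: dP.
- move=> x Ux; apply/continuous_rn => e e0; have [/(_ e e0)[d d0 dP] _] := h1 x Ux.
  by exists d => // y; exact: (dP tt).
- move=> x Ux; split; last by exists `|f x|.
  by move=> e e0; have /continuous_rn/(_ e e0)[d d0 dP] := h1 x Ux; exists d => // _ y _; exact: dP.
- by move=> v; have [h3 h4] := h2 v; split; [move=> _ x _; exact: h3|apply/IH].
- move=> x Ux; apply/continuous_rn => e e0; have [/(_ e e0)[d d0 dP] _] := h1 x Ux.
  by exists d => // y; exact: (dP tt).
- by move=> v; have [h3 h4] := h2 v; split; [move=> x; exact: (h3 tt)|apply/IH].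
Qed.

Section Basic.
Variables (Om : Type).
Implicit Types (S : set Om) (U : set V) (f g : Om -> V -> R).

Lemma ECk_lbd S k U f : ECk S k U f -> lbd S U f.
Proof. by case: k => [[]|k []]. Qed.

Lemma ECkS S k U f : ECk S k.+1 U f -> ECk S k U f.
Proof.
elim: k f => [|k IH] f [h1 h2]; split=> // v.
by have [h3 h4] := h2 v; split=> //; exact: IH.
Qed.

Lemma ECk_ext S k U f g : open U -> (forall w x, S w -> U x -> f w x = g w x) -> ECk S k U f -> ECk S k U g.
Proof.
move=> /openrnP oU; elim: k f g => [|k IH] f g fg [h1 h2]; split.
1,3: move=> x Ux; have [h3 [M hM]] := h1 x Ux; split; last by exists M => w Sw; rewrite -fg //; exact: hM.
1,2: move=> e e0; have [d d0 dP] := h3 e e0; have [d' d'0 dP'] := oU _ Ux;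
     exists (Num.min d d'); [by rewrite lt_min d0|move=> w y Sw; rewrite lt_min => /andP[yd /dP' Uy]];
     rewrite -!fg //; exact: dP.
  by [].
move=> v; have [h3 h4] := h2 v.
have H w x : S w -> U x -> hasr (g w) v x (rderive (f w) v x).
  move=> Sw Ux; have [d d0 dP] := oU _ Ux.
  by apply: (hasr_ext d0 _ (hasr_rderive (h3 w x Sw Ux))) => y /dP Uy; exact: fg.
split; first by move=> w x Sw Ux; exact: hasr_derivable (H w x Sw Ux).
by apply: IH h4 => w x Sw Ux; rewrite (hasr_val (H w x Sw Ux)).
Qed.

Lemma ECk_sub S S' k U U' f : S' `<=` S -> U' `<=` U -> ECk S k U f -> ECk S' k U' f.
Proof.
move=> SS UU; elim: k f => [|k IH] f [h1 h2]; split.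
1,3: move=> x /UU Ux; have [h3 [M hM]] := h1 x Ux; split; last by exists M => w /SS; exact: hM.
1,2: by move=> e /h3[d d0 dP]; exists d => // w y /SS; exact: dP.
  by [].
by move=> v; have [h3 h4] := h2 v; split; [move=> w x /SS Sw /UU; exact: h3|exact: IH].
Qed.

Lemma ECk_local S k U f : (forall x, U x -> exists2 U', U' x & ECk S k U' f) -> ECk S k U f.
Proof.
elim: k f => [|k IH] f h; split => //.
1,2: by move=> x /h[U' U'x /ECk_lbd]; exact.
move=> v; split.
  by move=> w x Sw /h[U' U'x [_ /(_ v)[h3 _]]]; exact: h3.
by apply: IH => x /h[U' U'x [_ /(_ v)[_ h4]]]; exists U'.
Qed.

Lemma ECk_cst S k U (a : Om -> R) : (exists M, forall w, S w -> `|a w| <= M) -> ECk S k U (fun w _ => a w).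
Proof.
elim: k a => [|k IH] a bM; split => //.
1,2: by move=> x _; split=> // e e0; exists 1 => // w y _ _; rewrite subrr normr0 ltW.
move=> v; split; first by move=> w x _ _; exact: hasr_derivable (hasr_cst (a w) v x).
have -> : (fun w : Om => rderive (fun=> a w) v) = (fun w _ => (fun=> 0) w).
  by apply/funext => w; apply/funext => x; exact: hasr_val (hasr_cst (a w) v x).
by apply: IH; exists 0 => w _; rewrite normr0.
Qed.

Lemma lbdD S U f g : lbd S U f -> lbd S U g -> lbd S U (fun w x => f w x + g w x).
Proof.
move=> hf hg x Ux; have [hf1 [M hM]] := hf x Ux; have [hg1 [M' hM']] := hg x Ux; split.
  move=> e e0; have e2 : 0 < e / 2 by rewrite divr_gt0.
  have [d d0 dP] := hf1 _ e2; have [d' d'0 dP'] := hg1 _ e2.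
  exists (Num.min d d'); first by rewrite lt_min d0.
  move=> w y Sw; rewrite lt_min => /andP[/(dP _ _ Sw) h1 /(dP' _ _ Sw) h2].
  rewrite opprD addrACA; apply: le_trans (ler_normD _ _) _; lraH h1 h2.
exists (M + M') => w Sw; apply: le_trans (ler_normD _ _) _; apply: lerD; [exact: hM|exact: hM'].
Qed.

Lemma lbdM S U f g : lbd S U f -> lbd S U g -> lbd S U (fun w x => f w x * g w x).
Proof.
move=> hf hg x Ux; have [hf1 [M hM]] := hf x Ux; have [hg1 [M' hM']] := hg x Ux; split.
  move=> e e0; pose K := 1 + `|M| + `|M'|.
  have K0 : 0 < K by rewrite /K -addrA ltr_pwDl // addr_ge0.
  pose e1 := Num.min 1 (e / K).
  have e10 : 0 < e1 by rewrite lt_min ltr01 divr_gt0.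
  have e11 : e1 <= 1 by rewrite /e1 ge_min lexx.
  have e1K : e1 * K <= e by rewrite -ler_pdivlMr // /e1 ge_min lexx orbT.
  have [d d0 dP] := hf1 _ e10; have [d' d'0 dP'] := hg1 _ e10.
  exists (Num.min d d'); first by rewrite lt_min d0.
  move=> w y Sw; rewrite lt_min => /andP[/(dP _ _ Sw) h1 /(dP' _ _ Sw) h2].
  have -> : f w y * g w y - f w x * g w x =
    (f w y - f w x) * (g w y - g w x) + (f w y - f w x) * g w x + f w x * (g w y - g w x) by ring.
  have m1 : `|f w x| <= `|M| by exact: le_trans (hM w Sw) (ler_norm _).
  have m2 : `|g w x| <= `|M'| by exact: le_trans (hM' w Sw) (ler_norm _).
  apply: le_trans (ler_normD _ _) _; apply: le_trans (lerD (ler_normD _ _) (lexx _)) _.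
  rewrite !normrM; apply: le_trans e1K.
  have p1 : `|f w y - f w x| * `|g w y - g w x| <= e1 * 1 by apply: ler_pM => //; exact: le_trans e11.
  have p2 : `|f w y - f w x| * `|g w x| <= e1 * `|M'| by apply: ler_pM.
  have p3 : `|f w x| * `|g w y - g w x| <= `|M| * e1 by apply: ler_pM.
  by apply: le_trans (lerD (lerD p1 p2) p3) _; rewrite /K; apply: eq_leW; ring.
exists (`|M| * `|M'|) => w Sw; rewrite normrM.
by apply: ler_pM => //; [exact: le_trans (hM w Sw) (ler_norm _)|exact: le_trans (hM' w Sw) (ler_norm _)].
Qed.

Lemma ECkD S k U f g : open U -> ECk S k U f -> ECk S k U g -> ECk S k U (fun w x => f w x + g w x).
Proof.
move=> oU; elim: k f g => [|k IH] f g [h1 h2] [g1 g2]; split; [exact: lbdD|by []|exact: lbdD|].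
move=> v; have [h3 h4] := h2 v; have [g3 g4] := g2 v.
have H w x : S w -> U x -> hasr (fun x => f w x + g w x) v x (rderive (f w) v x + rderive (g w) v x).
  by move=> Sw Ux; apply: hasrD; apply: hasr_rderive; [exact: h3|exact: g3].
split; first by move=> w x Sw Ux; exact: hasr_derivable (H w x Sw Ux).
by apply: ECk_ext oU _ (IH _ _ h4 g4) => w x Sw Ux; rewrite (hasr_val (H w x Sw Ux)).
Qed.

Lemma ECkM S k U f g : open U -> ECk S k U f -> ECk S k U g -> ECk S k U (fun w x => f w x * g w x).
Proof.
move=> oU; elim: k f g => [|k IH] f g hf hg.
  by case: hf => h1 h2; case: hg => g1 g2; split; [exact: lbdM|].
have hf' := ECkS hf; have hg' := ECkS hg.
case: hf => h1 h2; case: hg => g1 g2; split; first exact: lbdM.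
move=> v; have [h3 h4] := h2 v; have [g3 g4] := g2 v.
have H w x : S w -> U x -> hasr (fun x => f w x * g w x) v x (rderive (f w) v x * g w x + f w x * rderive (g w) v x).
  by move=> Sw Ux; apply: hasrM; apply: hasr_rderive; [exact: h3|exact: g3].
split; first by move=> w x Sw Ux; exact: hasr_derivable (H w x Sw Ux).
have := ECkD oU (IH _ _ h4 hg') (IH _ _ hf' g4).
by apply: ECk_ext oU _ => w x Sw Ux; rewrite (hasr_val (H w x Sw Ux)).
Qed.

Lemma ECkZ S k U (a : R) f : open U -> ECk S k U f -> ECk S k U (fun w x => a * f w x).
Proof. by move=> oU hf; apply: ECkM oU (ECk_cst _ _ _) hf; exists `|a|. Qed.

Lemma ECkB S k U f g : open U -> ECk S k U f -> ECk S k U g -> ECk S k U (fun w x => f w x - g w x).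
Proof.
move=> oU hf hg; have := ECkD oU hf (ECkZ (-1) oU hg).
by apply: ECk_ext => // w x _ _; rewrite mulN1r.
Qed.

Lemma ECk_sum S k U (I : Type) (s : seq I) (F : I -> Om -> V -> R) : open U ->
  (forall i, ECk S k U (F i)) -> ECk S k U (fun w x => \sum_(i <- s) F i w x).
Proof.
move=> oU hF; elim: s => [|i s IH].
  apply: ECk_ext oU _ (ECk_cst (a := fun=> 0) _ _ _); last by exists 0 => w _; rewrite normr0.
  by move=> w x _ _; rewrite big_nil.
by apply: ECk_ext oU _ (ECkD oU (hF i) IH) => w x _ _; rewrite big_cons.
Qed.

Lemma lipschitz_of_derive (E E' : R -> R) (K : R) : (forall t, is_derive t (1 : R) E (E' t)) ->
  (forall t, `|E' t| <= K) -> forall s t, `|E t - E s| <= K * `|t - s|.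
Proof.
move=> dE hK s t; wlog st : s t / s <= t => [h|].
  by case: (leP s t) => [/h//|/ltW/h]; rewrite distrC [`|s - t|]distrC.
have [|c _ ->] := @MVT_segment R E E' s t st (fun u _ => dE u).
  by apply: derivable_within_continuous => u _; case: (dE u).
by rewrite normrM ler_wpM2r.
Qed.

(* A univariate scale: functions [E m] with [E m]' = E (m+2) - m E (m+1), as for t^-m exp(-1/t). *)
Lemma ECk_scale S k U f (E : nat -> R -> R) (B : nat -> R) : open U ->
  (forall m t, `|E m t| <= B m) ->
  (forall m t, is_derive t (1 : R) (E m) (E m.+2 t - m%:R * E m.+1 t)) ->
  ECk S k U f -> forall m, ECk S k U (fun w x => E m (f w x)).
Proof.
move=> oU bE dE; elim: k f => [|k IH] f hf m.
all: have hl : lbd S U (fun w x => E m (f w x)).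
1,3: move=> x Ux; split; last by exists (B m) => w _; exact: bE.
1,2: move=> e e0; pose K := 1 + (`|B m.+2| + m%:R * `|B m.+1|).
1,2: have K0 : 0 < K by rewrite /K ltr_pwDl // addr_ge0 // mulr_ge0.
1,2: have KE u : `|E m.+2 u - m%:R * E m.+1 u| <= K.
1,3: apply: le_trans (ler_normB _ _) _; rewrite normrM normr_nat /K;
     apply: ler_wpDl => //; apply: lerD;
     [exact: le_trans (bE _ _) (ler_norm _)|
      apply: ler_wpM2l => //; exact: le_trans (bE _ _) (ler_norm _)].
1,2: have lip := lipschitz_of_derive (dE m) KE.
1,2: have [/(_ _ (divr_gt0 e0 K0))[d d0 dP] _] := ECk_lbd hf Ux;
     exists d => // w y Sw /(dP _ _ Sw); rewrite ler_pdivlMr // => h;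
     apply: le_trans (lip _ _) _; rewrite mulrC; exact: h.
  by split.
split=> // v; have hf' := ECkS hf; have [_ /(_ v)[h3 h4]] := hf.
have H w x : S w -> U x ->
    hasr (fun x => E m (f w x)) v x ((E m.+2 (f w x) - m%:R * E m.+1 (f w x)) * rderive (f w) v x).
  by move=> Sw Ux; exact: hasr_comp (hasr_rderive (h3 w x Sw Ux)) (dE m (f w x)).
split; first by move=> w x Sw Ux; exact: hasr_derivable (H w x Sw Ux).
have h5 := ECkM oU (ECkB oU (IH _ hf' m.+2) (ECkZ m%:R oU (IH _ hf' m.+1))) h4.
by apply: ECk_ext oU _ h5 => w x Sw Ux; rewrite (hasr_val (H w x Sw Ux)).
Qed.

Lemma ECkV S k U f : open U -> (forall x, U x -> exists2 c : R, 0 < c & forall w, S w -> c <= f w x) ->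
  ECk S k U f -> ECk S k U (fun w x => (f w x)^-1).
Proof.
move=> oU fc; elim: k f fc => [|k IH] f fc hf.
all: have hl : lbd S U (fun w x => (f w x)^-1).
1,3: move=> x Ux; have [c c0 cP] := fc x Ux; split; last first.
1,3: exists c^-1 => w /cP cw; rewrite normfV ger0_norm ?(le_trans (ltW c0) cw) //;
     by rewrite lef_pV2 // posrE ?(lt_le_trans c0 cw).
1,2: move=> e e0; pose e1 := Num.min (c / 2) (e * (c * (c / 2))).
1,2: have c2 : 0 < c / 2 by rewrite divr_gt0.
1,2: have e10 : 0 < e1 by rewrite lt_min c2 !mulr_gt0 // invr_gt0.
1,2: have [/(_ _ e10)[d d0 dP] _] := ECk_lbd hf Ux; exists d => // w y Sw /(dP _ _ Sw) h.
1,2: have hx := cP w Sw; have hx0 := lt_le_trans c0 hx.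
1,2: have h1 : `|f w y - f w x| <= c / 2 by apply: le_trans h _; rewrite /e1 ge_min lexx.
1,2: have h2 : `|f w y - f w x| <= e * (c * (c / 2)) by apply: le_trans h _; rewrite /e1 ge_min lexx orbT.
1,2: have hy : c / 2 <= f w y by move: h1; rewrite ler_norml => /andP[]; lraH hx.
1,2: have hy0 := lt_le_trans c2 hy.
1,2: have -> : (f w y)^-1 - (f w x)^-1 = (f w x - f w y) / (f w x * f w y)
       by field; rewrite !gt_eqF.
1,2: rewrite normrM normfV [`|f w x * _|]ger0_norm ?mulr_ge0 ?(ltW hx0) ?(ltW hy0) // ler_pdivrMr ?mulr_gt0 // distrC;
     apply: le_trans h2 _; rewrite ler_wpM2l ?(ltW e0) //; apply: ler_pM => //; exact: ltW.
  by split.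
split=> // v; have hf' := ECkS hf; have [_ /(_ v)[h3 h4]] := hf.
have H w x : S w -> U x ->
    hasr (fun x => (f w x)^-1) v x (- ((f w x)^-1 * (f w x)^-1) * rderive (f w) v x).
  move=> Sw Ux; apply: (hasr_comp (E := GRing.inv)); first by apply: hasr_rderive; exact: h3.
  have [c c0 cP] := fc x Ux; have fx := lt_le_trans c0 (cP w Sw).
  apply: is_derive_eq; first by apply: is_deriveV; rewrite gt_eqF.
  by rewrite /= -[_ *: _]/(_ * _) mulr1 -exprVn expr2.
split; first by move=> w x Sw Ux; exact: hasr_derivable (H w x Sw Ux).
have h5 := ECkM oU (ECkZ (-1) oU (ECkM oU (IH _ fc hf') (IH _ fc hf'))) h4.
by apply: ECk_ext oU _ h5 => w x Sw Ux; rewrite (hasr_val (H w x Sw Ux)) mulN1r.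
Qed.

(** A bound locally uniform in w is all that is asked of a holomorphic family: Cauchy estimates pass
    it on to the derivatives, and [ECk_holo] follows by induction. *)
Definition bholo_fam S U (f : Om -> V -> C) := forall x, U x ->
  exists2 r : R, 0 < r & exists M : R, forall w, S w -> bholo (f w) x r M.

Lemma bholo_fam_cd S U (f : Om -> V -> C) v : bholo_fam S U f -> bholo_fam S U (fun w x => cd (f w) x v).
Proof.
move=> hf x Ux; have [r r0 [M hM]] := hf x Ux.
exists (r / 2); first by rewrite divr_gt0.
exists (16 * M / r * rn v) => w Sw y yr; split; last exact: (bholo_diff r0 (hM w Sw)).
apply: (differentiable_cd (U := [set y | rn (y - x) < r])) => /=.
- exact: open_rball.
- by move=> z zr; exact: (hM w Sw z zr).1.
- by lraH yr r0.
Qed.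

Lemma hasr_Re (f : V -> C) v x : differentiable f x ->
  hasr (fun y => complex.Re (f y)) v x (complex.Re (cd f x v)) /\ hasr (fun y => complex.Im (f y)) v x (complex.Im (cd f x v)).
Proof.
move=> /differentiable_has_cd[lc _ est].
have cZ (t : R) : cd f x (t%:C *: v) = cd f x v * t%:C by rewrite cdZ mulrC.
have v1 : 0 < 1 + rn v by rewrite ltr_pwDl // rn_ge0.
have key e : 0 < e -> exists2 d : R, 0 < d & forall t : R, `|t| < d ->
    rn (f (x + t%:C *: v) - f x - cd f x v * t%:C) <= e * `|t|.
  move=> e0; have [d d0 dP] := est _ (divr_gt0 e0 v1); exists (d / (1 + rn v)); first exact: divr_gt0.
  move=> t td; have tv : rn (t%:C *: v) < d by apply: rn_scale_small; rewrite rnR.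
  have := dP _ tv; rewrite cZ => /le_trans; apply.
  rewrite rnZ rnR -mulrA ler_wpM2l ?(ltW e0) // mulrCA ler_piMr // ler_pdivrMl //.
  by rewrite mulr1 lerDr.
split=> e e0; have [d d0 dP] := key e e0; exists d => // t /dP; apply: le_trans.
  apply: le_trans (rnRe _); rewrite !ReB; case: (cd f x v) => a b /=.
  by rewrite mulr0 subr0.
apply: le_trans (rnIm _); rewrite !ImB; case: (cd f x v) => a b /=.
by rewrite mulr0 add0r.
Qed.

Lemma bholo_lbd S U (f : Om -> V -> C) : bholo_fam S U f ->
  lbd S U (fun w x => complex.Re (f w x)) /\ lbd S U (fun w x => complex.Im (f w x)).
Proof.
move=> hf; suff key x : U x -> (forall e, 0 < e -> exists2 d : R, 0 < d & forall w y, S w -> rn (y - x) < d ->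
    rn (f w y - f w x) <= e) /\ exists M, forall w, S w -> rn (f w x) <= M.
  split=> x /key[h1 [M h2]]; split.
  - by move=> e /h1[d d0 dP]; exists d => // w y Sw /(dP _ _ Sw); rewrite -ReB; exact: le_trans (rnRe _).
  - by exists M => w /h2; exact: le_trans (rnRe _).
  - by move=> e /h1[d d0 dP]; exists d => // w y Sw /(dP _ _ Sw); rewrite -ImB; exact: le_trans (rnIm _).
  - by exists M => w /h2; exact: le_trans (rnIm _).
move=> Ux; have [r r0 [M hM]] := hf x Ux; split; last first.
  by exists M => w /hM/(_ x); rewrite subrr rn0 => /(_ r0)[].
move=> e e0; pose K := 1 + `|16 * M / r|.
have K0 : 0 < K by rewrite ltr_pwDl.
exists (Num.min (r / 2) (e / K)); first by rewrite lt_min; apply/andP; split; exact: divr_gt0.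
move=> w y Sw; rewrite lt_min => /andP[y2]; rewrite ltr_pdivlMr // => yK.
have x2 : rn (x - x) < r / 2 by rewrite subrr rn0 divr_gt0.
apply: le_trans (bholo_lip r0 (hM w Sw) x2 y2) _; apply: le_trans (ltW yK).
rewrite mulrC ler_wpM2l ?rn_ge0 //; apply: le_trans (ler_norm _) _.
by rewrite /K lerDr.
Qed.

Lemma ECk_holo S k U (f : Om -> V -> C) : open U -> bholo_fam S U f ->
  ECk S k U (fun w x => complex.Re (f w x)) /\ ECk S k U (fun w x => complex.Im (f w x)).
Proof.
move=> oU; elim: k f => [|k IH] f hf; have [hR hI] := bholo_lbd hf; first by split.
have df w x : S w -> U x -> differentiable (f w) x.
  by move=> Sw Ux; have [r r0 [M /(_ w Sw x)]] := hf x Ux; rewrite subrr rn0 => /(_ r0)[].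
have IHv v := IH _ (bholo_fam_cd v hf).
split; split=> // v; split; first by move=> w x Sw Ux; exact: hasr_derivable (hasr_Re v (df w x Sw Ux)).1.
- apply: ECk_ext oU _ (IHv v).1 => w x Sw Ux.
  by rewrite (hasr_val (hasr_Re v (df w x Sw Ux)).1).
- by move=> w x Sw Ux; exact: hasr_derivable (hasr_Re v (df w x Sw Ux)).2.
apply: ECk_ext oU _ (IH _ (bholo_fam_cd v hf)).2 => w x Sw Ux.
by rewrite (hasr_val (hasr_Re v (df w x Sw Ux)).2).
Qed.

End Basic.
End SmoothFamilies.

Lemma addrAK3 (Z : zmodType) (a b c : Z) : a + b + c - a = b + c.
Proof. by rewrite addrAC (addrAC a) subrr add0r. Qed.

(** * Composition of real smooth functions with holomorphic maps *)

Section RealChain.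
Variables (R : realType) (n : nat).
Local Notation C := (Cx R).
Local Notation V := 'rV[C]_n.

Definition runit (b : bool) : C := if b then 'i else 1.
Definition rbas (j : 'I_n * bool) : V := runit j.2 *: delta_mx 0 j.1.
Definition rcoord (j : 'I_n * bool) (w : V) : R :=
  if j.2 then complex.Im (w 0 j.1) else complex.Re (w 0 j.1).

Lemma rcoord_le j w : `|rcoord j w| <= rn w.
Proof.
rewrite /rcoord; case: ifP => _; apply: le_trans (rn_coord w j.1); [exact: rnIm|exact: rnRe].
Qed.

Lemma rcoordD j u w : rcoord j (u + w) = rcoord j u + rcoord j w.
Proof. by rewrite /rcoord !mxE ReD ImD; case: ifP. Qed.

Lemma rcoordZ j (t : R) w : rcoord j (t%:C *: w) = t * rcoord j w.
Proof. by rewrite /rcoord !mxE; case: (w 0 j.1) => a b; case: ifP => _ /=; ring. Qed.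

Lemma rcoord_sum w : w = \sum_j (rcoord j w)%:C *: rbas j.
Proof.
rewrite [LHS]row_sum_delta -(pair_bigA _ (fun k b => (rcoord (k, b) w)%:C *: rbas (k, b))) /=.
apply: eq_bigr => k _; rewrite big_bool /rbas /rcoord /= !scalerA -scalerDl; congr (_ *: _).
by case: (w 0 k) => a b; apply/eqP; rewrite eq_complex /=; apply/andP; split; apply/eqP; ring.
Qed.

Lemma rn_rbas j : rn (rbas j) <= 1.
Proof.
rewrite /rbas rnZ; have -> : rn (runit j.2) = 1.
  by rewrite /runit; case: ifP; rewrite ?rni ?rn1.
rewrite mul1r; apply: rn_le => // k; rewrite mxE eqxx /=.
by case: eqP; rewrite ?rn1 // rn0.
Qed.

Definition rlin (c : 'I_n * bool -> R) (w : V) : R := \sum_j rcoord j w * c j.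

Lemma rlinD c u w : rlin c (u + w) = rlin c u + rlin c w.
Proof. by rewrite /rlin -big_split; apply: eq_bigr => j _; rewrite rcoordD mulrDl. Qed.
Lemma rlinZ c (t : R) w : rlin c (t%:C *: w) = t * rlin c w.
Proof. by rewrite /rlin mulr_sumr; apply: eq_bigr => j _; rewrite rcoordZ mulrA. Qed.
Lemma rlin_le c w : `|rlin c w| <= (\sum_j `|c j|) * rn w.
Proof.
rewrite mulr_suml; apply: le_trans (ler_norm_sum _ _ _) _; apply: ler_sum => j _.
by rewrite normrM mulrC ler_wpM2l // rcoord_le.
Qed.

(** Continuous directional derivatives give a total differential: x is joined to x + w by a polygon
    with sides along the real basis, and [line_mvt] estimates the increment on each side. *)
Lemma frechet (U : set V) f x : open U -> ECk [set: unit] 1 U (fun _ => f) -> U x ->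
  forall e, 0 < e -> exists2 d : R, 0 < d & forall w, rn w < d ->
    `|f (x + w) - f x - rlin (fun j => rderive f (rbas j) x) w| <= e * rn w.
Proof.
move=> /openrnP oU [_ hf] Ux e e0.
pose N : R := (#|{: 'I_n * bool}|.+1)%:R.
have N0 : 0 < N by rewrite ltr0n.
have e1 : 0 < e / N by rewrite divr_gt0.
have /choice[d hd] j : exists d : R, 0 < d /\ forall y, rn (y - x) < d ->
    hasr f (rbas j) y (rderive f (rbas j) y) /\
    `|rderive f (rbas j) y - rderive f (rbas j) x| <= e / N.
  have [h1 [/(_ x Ux)[h2 _] _]] := hf (rbas j).
  have [d1 d10 dP1] := h2 _ e1; have [d2 d20 dP2] := oU _ Ux.
  exists (Num.min d1 d2); split; first by rewrite lt_min d10.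
  move=> y; rewrite lt_min => /andP[y1 /dP2 Uy].
  by split; [exact/hasr_rderive/(h1 tt)|exact: (dP1 tt)].
pose dd := \big[Num.min/1]_j d j.
have dd0 : 0 < dd.
  by rewrite /dd; elim/big_ind: _ => // [a b a0 b0|k _]; [rewrite lt_min a0|have [] := hd k].
have ddP j y : rn (y - x) < dd -> rn (y - x) < d j.
  by move=> h; apply: lt_le_trans h _; rewrite /dd (bigD1 j) //= ge_min lexx.
exists (dd / N); first exact: divr_gt0.
move=> w; rewrite ltr_pdivlMr // => wN.
have w0 := rn_ge0 w.
(* The vertices of the polygon are the partial sums of the expansion of w in the real basis. *)
pose ps (s : seq ('I_n * bool)) : V := \sum_(j <- s) (rcoord j w)%:C *: rbas j.
have psn s : rn (ps s) <= (size s)%:R * rn w.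
  elim: s => [|j s IH]; first by rewrite /ps big_nil rn0 mul0r.
  rewrite /ps big_cons; apply: le_trans (rnD _ _) _; rewrite -natr1 mulrDl mul1r addrC; apply: lerD => //.
  rewrite rnZ rnR -[leRHS]mulr1; apply: ler_pM => //; rewrite ?rn_ge0 ?rcoord_le ?rn_rbas //.
have H s : ((size s) < #|{: 'I_n * bool}|.+1)%N ->
    `|f (x + ps s) - f x - \sum_(j <- s) rcoord j w * rderive f (rbas j) x| <= e / N * ((size s)%:R * rn w).
  elim: s => [|j s IH] /= hs; first by rewrite /ps !big_nil addr0 subrr subr0 mul0r mulr0 normr0.
  have {}IH := IH (ltnW hs).
  have hsz : (size s)%:R * rn w + rn w < dd.
    apply: le_lt_trans wN; rewrite -[X in _ + X]mul1r -mulrDl natr1 mulrC ler_wpM2l // ler_nat.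
    exact: ltnW.
  have h1 : `|f (x + ps s + (rcoord j w)%:C *: rbas j) - f (x + ps s) - rderive f (rbas j) x * rcoord j w| <= e / N * `|rcoord j w|.
    apply: line_mvt => t tw.
    have hy : rn (x + ps s + t%:C *: rbas j - x) < dd.
      rewrite addrAK3; apply: le_lt_trans (rnD _ _) _.
      apply: le_lt_trans hsz; apply: lerD; first exact: psn.
      rewrite rnZ rnR -[leRHS]mulr1; apply: ler_pM => //; rewrite ?rn_ge0 ?rn_rbas //.
      exact: le_trans tw (rcoord_le _ _).
    have [_ /(_ _ (ddP j _ hy))[h1 h2]] := hd j.
    by exists (rderive f (rbas j) (x + ps s + t%:C *: rbas j)).
  have -> : x + ps (j :: s) = x + ps s + (rcoord j w)%:C *: rbas j.
    by rewrite /ps big_cons addrA addrAC.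
  rewrite big_cons; set A := f (_ + _ *: _) in h1 *; set S := \sum_(j <- s) _ in IH *.
  have -> : A - f x - (rcoord j w * rderive f (rbas j) x + S) =
    (A - f (x + ps s) - rderive f (rbas j) x * rcoord j w) + (f (x + ps s) - f x - S) by ring.
  apply: le_trans (ler_normD _ _) _; apply: le_trans (lerD h1 IH) _.
  rewrite -natr1 mulrDl mul1r mulrDr addrC lerD2l; apply: ler_wpM2l; [exact: ltW|exact: rcoord_le].
have := H (index_enum {: 'I_n * bool}).
have sz : size (index_enum {: 'I_n * bool}) = #|{: 'I_n * bool}|.
  by rewrite cardT enumT.
rewrite sz ltnSn => /(_ isT); rewrite /ps -rcoord_sum => /le_trans; apply.
by rewrite mulrA ler_wpM2r // -mulrA ler_piMr ?(ltW e0) // ler_pdivrMl // mulr1 ler_nat.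
Qed.

Lemma rderive_lin (U : set V) f x v : open U -> ECk [set: unit] 1 U (fun _ => f) -> U x ->
  rderive f v x = rlin (fun j => rderive f (rbas j) x) v.
Proof.
move=> oU hf Ux; apply: hasr_val => e e0.
have v1 : 0 < 1 + rn v by rewrite ltr_pwDl // rn_ge0.
have [d d0 dP] := frechet oU hf Ux (divr_gt0 e0 v1).
exists (d / (1 + rn v)); first exact: divr_gt0.
move=> t td; have tv : rn (t%:C *: v) < d by apply: rn_scale_small; rewrite rnR.
have := dP _ tv; rewrite rlinZ mulrC => /le_trans; apply.
rewrite rnZ rnR -mulrA ler_wpM2l ?(ltW e0) // mulrCA ler_piMr // ler_pdivrMl //.
by rewrite mulr1 lerDr.
Qed.

Lemma hasr_chain (U : set V) f (F : V -> V) x v : open U -> ECk [set: unit] 1 U (fun _ => f) -> U (F x) ->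
  differentiable F x ->
  hasr (fun y => f (F y)) v x (rlin (fun j => rderive f (rbas j) (F x)) (cd F x v)).
Proof.
move=> oU hf Ux dF e e0; pose c j := rderive f (rbas j) (F x).
have [lc [K bK] estF] := differentiable_has_cd dF.
pose Q := \sum_j `|c j|.
have Q0 : 0 <= Q by exact: sumr_ge0.
have v0 := rn_ge0 v.
pose A := 1 + (1 + `|K|) * rn v.
have A0 : 0 < A by rewrite ltr_pwDl // mulr_ge0 // addr_ge0.
have e1 : 0 < e / (2 * A) by rewrite divr_gt0 // mulr_gt0.
have [d d0 dP] := frechet oU hf Ux e1.
pose e2 := Num.min 1 (e / (2 * (1 + Q) * (1 + rn v))).
have e20 : 0 < e2 by rewrite lt_min ltr01 divr_gt0 // !mulr_gt0 // ltr_pwDl.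
have [d' d'0 dP'] := estF _ e20.
exists (Num.min (d' / (1 + rn v)) (d / A)).
  by rewrite lt_min !divr_gt0 // ltr_pwDl.
move=> t; rewrite lt_min => /andP[t1]; rewrite ltr_pdivlMr // => t2.
have tv : rn (t%:C *: v) < d' by apply: rn_scale_small; rewrite rnR.
have := dP' _ tv; set w := F (x + _) - F x => h1; rewrite -/c.
have nv : rn (t%:C *: v) = `|t| * rn v by rewrite rnZ rnR.
have e21 : e2 <= 1 by rewrite /e2 ge_min lexx.
have e2Q : e2 * (2 * (1 + Q) * (1 + rn v)) <= e.
  by rewrite -ler_pdivlMr ?mulr_gt0 ?ltr_pwDl // /e2 ge_min lexx orbT.
have hw : rn w <= `|t| * A.
  have h2 := rnD (w - cd F x (t%:C *: v)) (cd F x (t%:C *: v)); rewrite subrK in h2.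
  have h3 : rn (cd F x (t%:C *: v)) <= `|K| * (`|t| * rn v).
    by apply: le_trans (bK _) _; rewrite nv ler_wpM2r ?mulr_ge0 // ler_norm.
  have h4 : e2 * rn (t%:C *: v) <= 1 * (`|t| * rn v) by rewrite nv ler_wpM2r // mulr_ge0.
  apply: le_trans h2 _; apply: le_trans (lerD (le_trans h1 h4) h3) _.
  by rewrite /A mulrDr mulr1 ler_wpDl // mulrDl mulrDr mul1r; apply: eq_leW; ring.
have := dP w (le_lt_trans hw t2); rewrite -/c /w subrKC -/w => h5.
have -> : f (F (x + t%:C *: v)) - f (F x) - rlin c (cd F x v) * t =
  (f (F (x + t%:C *: v)) - f (F x) - rlin c w) + rlin c (w - cd F x (t%:C *: v)).
  have E : rlin c w = rlin c (w - cd F x (t%:C *: v)) + rlin c (cd F x v) * t.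
    by rewrite [rlin c _ * t]mulrC -rlinZ -cdZ -rlinD subrK.
  by rewrite E; ring.
have h6 : `|rlin c (w - cd F x (t%:C *: v))| <= Q * (e2 * (`|t| * rn v)).
  by apply: le_trans (rlin_le _ _) _; rewrite ler_wpM2l // -nv.
apply: le_trans (ler_normD _ _) _; apply: le_trans (lerD h5 h6) _.
have t0 := normr_ge0 t.
have h7 : e / (2 * A) * rn w <= e / 2 * `|t|.
  apply: le_trans (ler_wpM2l (ltW e1) hw) _; apply: eq_leW; field.
  by rewrite gt_eqF.
have h8 : Q * (e2 * (`|t| * rn v)) <= e / 2 * `|t|.
  have -> : Q * (e2 * (`|t| * rn v)) = (Q * rn v * e2) * `|t| by ring.
  rewrite ler_wpM2r // ler_pdivlMr //; apply: le_trans e2Q.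
  have -> : Q * rn v * e2 * 2 = e2 * (2 * (Q * rn v)) by ring.
  by rewrite ler_wpM2l ?(ltW e20) // -mulrA ler_pM2l // ler_pM // lerDr.
by apply: le_trans (lerD h7 h8) _; rewrite -mulrDl -splitr.
Qed.

Lemma single_bholo (U : set V) (f : V -> C) : open U -> (forall x, U x -> differentiable f x) ->
  bholo_fam [set: unit] U (fun _ => f).
Proof.
move=> oU hf x Ux; have [r r0 [hb _]] := local_bholo oU Ux hf.
by exists r => //; exists (rn (f x) + 1).
Qed.

(** By the chain rule a derivative of f o F is a sum of products of a partial derivative of f at F
    with a coordinate of the differential of F. The first factor is treated by induction, which is
    why f is assumed smooth to all orders; the second is the real or imaginary part of a holomorphic
    function. *)
Theorem Ck_comp (U U' : set V) (f : V -> R) (F : V -> V) : open U -> open U' ->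
  (forall x, U x -> differentiable F x) -> (forall x, U x -> U' (F x)) ->
  (forall k, ECk [set: unit] k U' (fun _ => f)) -> forall k, ECk [set: unit] k U (fun _ x => f (F x)).
Proof.
move=> oU oU' dF FU sf k; elim: k f sf => [|k IH] f sf.
all: have hl : lbd [set: unit] U (fun _ x => f (F x)).
1,3: move=> x Ux; split; last by exists `|f (F x)|.
1,2: move=> e e0; have [/(_ e e0)[d d0 dP] _] := ECk_lbd (sf 0%N) (FU x Ux);
     have [d' d'0 dP'] := differentiable_cont (dF x Ux) d0;
     by exists d' => // w y _ /dP'; exact: (dP w).
  by split.
split=> // v.
have H (w : unit) x : [set: unit] w -> U x ->
    hasr (fun y => f (F y)) v x (rlin (fun j => rderive f (rbas j) (F x)) (cd F x v)).
  by move=> _ Ux; apply: hasr_chain oU' (sf 1%N) (FU x Ux) (dF x Ux).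
split; first by move=> w x Sw Ux; exact: hasr_derivable (H w x Sw Ux).
apply: (ECk_ext (f := fun _ x => \sum_j rcoord j (cd F x v) * rderive f (rbas j) (F x))) => //.
  by move=> w x Sw Ux; rewrite (hasr_val (H w x Sw Ux)).
apply: ECk_sum => // j; apply: ECkM => //; last first.
  apply: (IH (rderive f (rbas j))) => k'.
  by have [_ /(_ (rbas j))[]] := sf k'.+1.
have dc x : U x -> differentiable (fun y => F y 0 j.1 : C) x.
  by move=> /dF/differentiable_coordP.
have hb := single_bholo oU (differentiable_cd v oU dc).
have [hR hI] := ECk_holo k oU hb.
rewrite /rcoord; case: (j.2).
  by apply: ECk_ext hI => // w x _ /dF dFx; rewrite cd_coord.
by apply: ECk_ext hR => // w x _ /dF dFx; rewrite cd_coord.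
Qed.

End RealChain.

(** * The flat function exp(-1/t) *)

Section Bump.
Variable R : realType.

Definition flat (m : nat) (t : R) : R := if 0 < t then t^-1 ^+ m * expR (- t^-1) else 0.

(** With s = 1 / t one has s / (m+1) <= exp(s / (m+1)); raising to the power m leaves (m+1)^m exp(m
    s / (m+1)), and the exponential is at most exp s. *)
Lemma flat_bound m t : `|flat m t| <= m.+1%:R ^+ m.
Proof.
rewrite /flat; case: ifP => [t0|_]; last by rewrite normr0 exprn_ge0.
set s := t^-1; have s0 : 0 < s by rewrite invr_gt0.
rewrite ger0_norm; last by rewrite mulr_ge0 ?exprn_ge0 ?expR_ge0 // ltW.
rewrite expRN ler_pdivrMr ?expR_gt0 //.
have m0 : 0 < m.+1%:R :> R by rewrite ltr0n.
have h : s / m.+1%:R <= expR (s / m.+1%:R).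
  by apply: le_trans (expR_ge1Dx _); rewrite lerDr.
rewrite -ler_pdivrMl ?exprn_gt0 // -exprVn -exprMn mulrC.
apply: (@le_trans _ _ (expR (s / m.+1%:R) ^+ m)).
  by apply: lerXn2r => //; rewrite nnegrE ?divr_ge0 ?expR_ge0 // ltW.
rewrite -expRM_natl ler_expR -[leRHS]mulr1 mulrCA ler_wpM2l ?(ltW s0) //.
by rewrite ler_pdivrMr // mul1r ler_nat.
Qed.

Lemma flatS m t : flat m t = t * flat m.+1 t.
Proof.
rewrite /flat; case: ifP => [t0|_]; last by rewrite mulr0.
by rewrite exprS !mulrA mulfV ?mul1r // gt_eqF.
Qed.

Lemma is_derive_flat m t : is_derive t (1 : R) (flat m) (flat m.+2 t - m%:R * flat m.+1 t).
Proof.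
have [t0|t0|t0] := ltgtP t 0.
- rewrite /flat ltNge (ltW t0) /= mulr0 subr0.
  apply: eps_is_derive => e e0; exists (- t); first by rewrite oppr_gt0.
  move=> h ht; have h1 : t + h <= 0.
    by have := ler_norm h; lraH ht.
  by rewrite ltNge h1 /= ltNge (ltW t0) /= subr0 mul0r subr0 normr0 mulr_ge0 // ltW.
- pose g (u : R) : R := u^-1 ^+ m * expR (- u^-1).
  have tn0 : t != 0 by rewrite gt_eqF.
  have dV := is_deriveV (f := id) tn0 (is_derive_id t (1 : R)).
  have dX := is_deriveX m dV.
  have dN : is_derive t (1 : R) (fun u : R => - u^-1) (- (- t ^- 2 *: 1)) := is_deriveN dV.
  have dE := is_derive1_comp (f := @expR R) (g := fun u : R => - u^-1) (is_derive_expR (- t^-1)) dN.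
  have dg : is_derive t (1 : R) g (flat m.+2 t - m%:R * flat m.+1 t).
    have dM := is_deriveM dX dE.
    have -> : g = (fun y : R => y^-1) ^+ m * (expR \o (fun u : R => - u^-1)).
      by apply/funext => u; rewrite /g -[RHS]/(((fun y : R => y^-1) ^+ m) u * expR (- u^-1)) exprfctE.
    apply: (is_derive_eq dM); rewrite exprfctE /= /flat t0.
    rewrite -![_ *: _]/(_ * _).
    rewrite !mulr1 -exprVn.
    clear; move: (expR (- t^-1)) => E; move: (t^-1) => s; case: m => [|m].
      by rewrite !mul0r !expr0 expr2; ring.
    by rewrite !exprS /=; ring.
  apply: (near_eq_is_derive _ dg).
  near=> u; rewrite /flat /g ifT //; near: u.
  exact: lt_nbhsr.
- rewrite t0 /flat ltxx mulr0 subr0; apply: eps_is_derive => e e0.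
  pose K : R := 1 + m.+3%:R ^+ m.+2.
  have K0 : 0 < K by rewrite ltr_pwDl // exprn_ge0.
  exists (e / K); first exact: divr_gt0.
  move=> h; rewrite ltr_pdivlMr // add0r -/(flat m h) ltxx mul0r !subr0 => hK.
  (* [flat m h] equals h^2 times the bounded function [flat m.+2 h], so the derivative at 0
     vanishes. *)
  rewrite flatS flatS mulrA normrM; apply: le_trans (ler_wpM2l _ (flat_bound _ _)) _ => //.
  rewrite normrM -mulrA [X in _ <= X]mulrC ler_wpM2l //.
  by apply: le_trans (ltW hK); rewrite ler_wpM2l // lerDr.
Unshelve. all: by end_near. Qed.

Lemma flat_ge0 m t : 0 <= flat m t.
Proof. by rewrite /flat; case: ifP => // t0; rewrite mulr_ge0 ?exprn_ge0 ?expR_ge0 // invr_ge0 ltW. Qed.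

Lemma flat_gt0 m t : (0 < flat m t) = (0 < t).
Proof.
rewrite /flat; case: ifP => [t0|]; last by rewrite ltxx.
by rewrite mulr_gt0 ?exprn_gt0 ?invr_gt0 ?expR_gt0.
Qed.

End Bump.

(** * Smoothness of averages *)

Section Functional.
Variables (R : realType) (n : nat) (Om : Type).
Local Notation C := (Cx R).
Local Notation V := 'rV[C]_n.
Variables (S : set Om) (L : set (Om -> R)) (I : (Om -> R) -> R) (K : R).
Hypothesis L_lin : forall (a : R) F G, L F -> L G -> L (fun w => a * F w + G w).
Hypothesis L_lim : forall F, (forall w, ~ S w -> F w = 0) ->
  (forall e, 0 < e -> exists2 G, L G & forall w, `|F w - G w| <= e) -> L F.
Hypothesis I_lin : forall (a : R) F G, L F -> L G -> I (fun w => a * F w + G w) = a * I F + I G.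
Hypothesis I_bound : forall F e, L F -> (forall w, `|F w| <= e) -> `|I F| <= K * e.

(** Equicontinuity of the derivatives makes difference quotients converge uniformly in w. By [L_lim]
    the derivative is in the domain of I, and by [I_bound] the functional commutes with the limit.
    The condition that f vanishes off S makes the estimates hold for every w. *)
Lemma smooth_functional k (U : set V) (f : Om -> V -> R) : open U -> ECk S k U f ->
  (forall w x, ~ S w -> U x -> f w x = 0) -> (forall x, U x -> L (f^~ x)) ->
  ECk [set: unit] k U (fun _ x => I (f^~ x)).
Proof.
move=> oU.
have LB F G : L F -> L G -> L (fun w => F w - G w) /\ I (fun w => F w - G w) = I F - I G.
  move=> lF lG; have E : (fun w => F w - G w) = (fun w => -1 * G w + F w).
    by apply/funext => w; rewrite mulN1r addrC.
  by rewrite E; split; [exact: L_lin|rewrite I_lin // mulN1r addrC].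
have L0 F : L F -> L (fun=> 0).
  by move=> lF; have [] := LB F F lF lF; under eq_fun do rewrite subrr.
have IZ (a : R) F : L F -> L (fun w => a * F w) /\ I (fun w => a * F w) = a * I F.
  move=> lF; have l0 := L0 F lF.
  have E : (fun w => a * F w) = (fun w => a * F w + 0) by apply/funext => w; rewrite addr0.
  have I0 : I (fun=> 0) = 0.
    have := I_lin (-1) l0 l0.
    have -> : (fun w : Om => -1 * 0 + 0) = (fun=> 0 : R) by apply/funext => w; rewrite mulr0 addr0.
    by rewrite mulN1r addNr.
  by rewrite E; split; [exact: L_lin|rewrite I_lin // I0 addr0].
have K1 : 0 < 1 + `|K| by rewrite ltr_pwDl.
have lbdI f' : lbd S U f' -> (forall w x, ~ S w -> U x -> f' w x = 0) -> (forall x, U x -> L (f'^~ x)) ->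
    lbd [set: unit] U (fun _ x => I (f'^~ x)).
  move=> hl f0 lf x Ux; split; last by exists `|I (f'^~ x)|.
  move=> e e0; have [/(_ _ (divr_gt0 e0 K1))[d d0 dP] _] := hl x Ux.
  have [d' d'0 dP'] := (openrnP U).1 oU _ Ux.
  exists (Num.min d d'); first by rewrite lt_min d0.
  move=> _ y _; rewrite lt_min => /andP[yd /dP' Uy].
  have [lB <-] := LB _ _ (lf _ Uy) (lf _ Ux).
  apply: le_trans (I_bound lB (e := e / (1 + `|K|)) _) _.
    move=> w; have [Sw|nSw] := pselect (S w); first exact: dP.
    by rewrite !f0 // subrr normr0 divr_ge0 // ltW.
  by rewrite mulrCA ger_pMr // ler_pdivrMr // mul1r (le_trans (ler_norm _)) // lerDr.
elim: k f => [|k IH] f hf f0 lf.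
  by split=> //; apply: lbdI => //; case: hf.
split; first by apply: lbdI => //; case: hf.
move=> v; have [_ /(_ v)[h3 h4]] := hf.
have hs w x : U x -> hasr (f w) v x (rderive (f w) v x).
  move=> Ux; have [Sw|nSw] := pselect (S w); first exact/hasr_rderive/h3.
  have [d d0 dP] := (openrnP U).1 oU _ Ux.
  have h0 : hasr (f w) v x 0.
    by apply: (hasr_ext d0 _ (hasr_cst 0 v x)) => y /dP Uy; rewrite f0.
  by rewrite (hasr_val h0).
have g0 w x : ~ S w -> U x -> rderive (f w) v x = 0.
  move=> nSw Ux; have [d d0 dP] := (openrnP U).1 oU _ Ux.
  have h0 : hasr (f w) v x 0.
    by apply: (hasr_ext d0 _ (hasr_cst 0 v x)) => y /dP Uy; rewrite f0.
  exact: hasr_val h0.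
have unif x : U x -> forall e, 0 < e -> exists2 d : R, 0 < d & forall t : R, `|t| < d ->
    U (x + t%:C *: v) /\ forall w, `|f w (x + t%:C *: v) - f w x - rderive (f w) v x * t| <= e * `|t|.
  move=> Ux e e0; have [/(_ e e0)[d1 d10 dP1] _] := ECk_lbd h4 Ux.
  have [d2 d20 dP2] := (openrnP U).1 oU _ Ux.
  have v1 : 0 < 1 + rn v by rewrite ltr_pwDl // rn_ge0.
  exists (Num.min d1 d2 / (1 + rn v)); first by rewrite divr_gt0 // lt_min d10.
  have pt t : `|t| < Num.min d1 d2 / (1 + rn v) -> rn (x + t%:C *: v - x) < Num.min d1 d2.
    by move=> td; rewrite addrC addKr; apply: rn_scale_small; rewrite rnR.
  move=> t td; split.
    by apply: dP2; have := pt t td; rewrite lt_min => /andP[].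
  move=> w; apply: line_mvt => s st; have := pt s (le_lt_trans st td).
  rewrite lt_min => /andP[s1 /dP2 Us]; exists (rderive (f w) v (x + s%:C *: v)); first exact: hs.
  have [Sw|nSw] := pselect (S w); first exact: dP1.
  by rewrite !g0 // subrr normr0 ltW.
have lg x : U x -> L (fun w => rderive (f w) v x).
  move=> Ux; apply: L_lim => [w nSw|e e0]; first exact: g0.
  have [d d0 dP] := unif x Ux e e0.
  have d2 : 0 < d / 2 by rewrite divr_gt0.
  have td : `|d / 2| < d by rewrite ger0_norm ?(ltW d2) // ltr_pdivrMr // ltr_pMr // ltr1n.
  have [Ut hw] := dP _ td; exists (fun w => (d / 2)^-1 * (f w (x + (d / 2)%:C *: v) - f w x)).
    by apply: (IZ _ _ _).1; apply: (LB _ _ _ _).1; exact: lf.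
  move=> w; have -> : rderive (f w) v x - (d / 2)^-1 * (f w (x + (d / 2)%:C *: v) - f w x) =
      - ((f w (x + (d / 2)%:C *: v) - f w x - rderive (f w) v x * (d / 2)) / (d / 2)).
    by field; rewrite gt_eqF.
  by rewrite normrN normrM normfV ler_pdivrMr ?normr_gt0 ?gt_eqF.
have H x : U x -> hasr (fun x => I (f^~ x)) v x (I (fun w => rderive (f w) v x)).
  move=> Ux e e0; have [d d0 dP] := unif x Ux _ (divr_gt0 e0 K1).
  exists d => // t /dP[Ut hw].
  have l1 := LB _ _ (lf _ Ut) (lf _ Ux); have l2 := IZ t _ (lg _ Ux).
  have [l3 E3] := LB _ _ l1.1 l2.1.
  rewrite -l1.2 mulrC -l2.2 -E3.
  apply: le_trans (I_bound l3 (e := e / (1 + `|K|) * `|t|) _) _.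
    by move=> w; rewrite [t * _]mulrC.
  rewrite mulrA ler_wpM2r // mulrCA ger_pMr // ler_pdivrMr // mul1r.
  by rewrite (le_trans (ler_norm _)) // lerDr.
split; first by move=> _ x _ Ux; exact: hasr_derivable (H x Ux).
apply: ECk_ext oU _ (IH _ h4 g0 lg) => _ x _ Ux.
by rewrite (hasr_val (H x Ux)).
Qed.

End Functional.

(** * An invariant functional on a filtered group *)

Section UltraLimit.
Variable R : realType.

Definition bdd_seq (a : nat -> R) := exists M, forall m, `|a m| <= M.

(** The limit along an ultrafilter finer than the eventual filter: the image of a bounded sequence
    clusters in a compact interval, and an ultrafilter converges to its cluster points. Only
    eventual inequalities are needed for monotonicity, which superadditivity below relies on. *)
Lemma ultralimit : exists U : (nat -> R) -> R,
  [/\ forall a b, bdd_seq a -> bdd_seq b -> U (fun m => a m + b m) = U a + U b,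
      forall a b, bdd_seq a -> bdd_seq b -> (exists N, forall m, (N <= m)%N -> a m <= b m) -> U a <= U b,
      forall c a, bdd_seq a -> U (fun m => c * a m) = c * U a &
      U (fun=> 1) = 1].
Proof.
have [F [FU oF]] := ultraFilterLemma (F := \oo) _.
have PF : ProperFilter F by exact: ultra_proper.
have ex (a : nat -> R) : bdd_seq a -> exists l, forall e, 0 < e -> F [set m | `|a m - l| <= e].
  move=> [M hM].
  have K : compact `[- M, M]%classic by exact: segment_compact.
  have FK : (a @ F) `[- M, M]%classic.
    by apply: oF; exists 0%N => // m _ /=; rewrite in_itv /= -ler_norml.
  have [l [_ cl]] := K (a @ F) _ FK.
  exists l => e e0; have [//|Fc] := in_ultra_setVsetC [set m | `|a m - l| <= e] FU.
  have [z [/= z1 z2]] := cl (~` [set z | `|z - l| <= e]) (ball l e) Fc (nbhsx_ballx _ _ e0).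
  by case: z1; move: z2; rewrite /ball /= distrC => /ltW.
pose U (a : nat -> R) : R := get [set l | forall e, 0 < e -> F [set m | `|a m - l| <= e]].
have UP a : bdd_seq a -> forall e, 0 < e -> F [set m | `|a m - U a| <= e].
  by move=> /ex h; exact: (@getPex _ [set l | forall e, 0 < e -> F [set m | `|a m - l| <= e]] h).
have mono a b : bdd_seq a -> bdd_seq b -> forall l l',
    (forall e, 0 < e -> F [set m | `|a m - l| <= e]) -> (forall e, 0 < e -> F [set m | `|b m - l'| <= e]) ->
    F [set m | a m <= b m] -> l <= l'.
  move=> ba bb l l' hl hl' hab; apply/ler_addgt0Pr => e e0.
  have e2 : 0 < e / 2 by rewrite divr_gt0.
  have [m [[h1 h2] h3]] := filter_ex (filterI (filterI (hl _ e2) (hl' _ e2)) hab).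
  move: h1 h2 h3 => /=; rewrite !ler_norml => /andP[h1 _] /andP[_ h2] h3; lraH h1 h2 h3.
have uniq a l : bdd_seq a -> (forall e, 0 < e -> F [set m | `|a m - l| <= e]) -> U a = l.
  move=> ba hl; have T : F [set m | a m <= a m] by apply: filterS filterT => m _ /=.
  by apply/eqP; rewrite eq_le (mono a a ba ba _ _ (UP a ba) hl T) (mono a a ba ba _ _ hl (UP a ba) T).
exists U; split.
- move=> a b [M hM] [M' hM']; apply: uniq.
    by exists (M + M') => m; apply: le_trans (ler_normD _ _) _; exact: lerD.
  move=> e e0; have e2 : 0 < e / 2 by rewrite divr_gt0.
  have ba : bdd_seq a by exists M. have bb : bdd_seq b by exists M'.
  apply: filterS (filterI (UP a ba _ e2) (UP b bb _ e2)) => m [/= h1 h2].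
  rewrite opprD addrACA; apply: le_trans (ler_normD _ _) _; lraH h1 h2.
- move=> a b ba bb [N hN]; apply: (mono a b ba bb _ _ (UP a ba) (UP b bb)).
  by apply: oF; exists N => // m /hN.
- move=> c a [M hM]; apply: uniq.
    by exists (`|c| * M) => m; rewrite normrM ler_wpM2l.
  move=> e e0; have c1 : 0 < 1 + `|c| by rewrite ltr_pwDl.
  have ba : bdd_seq a by exists M.
  apply: filterS (UP a ba _ (divr_gt0 e0 c1)) => m /=.
  rewrite ler_pdivlMr // -mulrBr normrM => h; apply: le_trans h; rewrite mulrC ler_wpM2l // lerDr //.
- apply: uniq; first by exists 1 => m; rewrite normr1.
  by move=> e e0; apply: filterS filterT => m _ /=; rewrite subrr normr0 ltW.
Qed.

End UltraLimit.

Lemma max0_lip (R : realType) (a b : R) : `|Num.max a 0 - Num.max b 0| <= `|a - b|.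
Proof.
case: (leP a 0) => ha; case: (leP b 0) => hb.
- by rewrite subrr normr0.
- rewrite sub0r normrN distrC gtr0_norm // ger0_norm; lra.
- rewrite subr0 gtr0_norm // ger0_norm; lra.
- by [].
Qed.

Lemma max0B (R : realType) (x : R) : x = Num.max x 0 - Num.max (- x) 0.
Proof. by case: (leP x 0) => h1; case: (leP (- x) 0) => h2; lraH h1 h2. Qed.

Lemma norm_sub_le (R : realType) (x y K : R) : 0 <= x <= K -> 0 <= y <= K -> `|x - y| <= K.
Proof.
by move=> /andP[h1 h2] /andP[h3 h4]; rewrite ler_norml; apply/andP; split; lraH h1 h2 h3 h4.
Qed.

Lemma sub_eq_of_add (R : realType) (x y a b : R) : x + b = y + a -> a - b = x - y.
Proof. by move=> h; lraH h. Qed.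

Lemma eq_double0 (V : zmodType) (x : V) : x = x + x -> x = 0.
Proof. by rewrite -[X in X = _]addr0 => /addrI. Qed.

Section Haar.
Variables (R : realType) (G : Type) (mul : G -> G -> G) (inv : G -> G) (one : G) (W : nat -> set G).
Hypothesis mulA : forall a b c, mul a (mul b c) = mul (mul a b) c.
Hypothesis mul1 : forall a, mul one a = a.
Hypothesis mulV : forall a, mul (inv a) a = one.
Hypothesis mulV' : forall a, mul a (inv a) = one.
Hypothesis W1 : forall m, W m one.
Hypothesis Wdecr : forall m k, (m <= k)%N -> W k `<=` W m.

(** Total boundedness for the filtration: for each m, finitely many left translates of [W m] cover
    S. It takes the place of relative compactness. *)
Definition small (S : set G) := forall m, exists (N : nat) (s : nat -> G),
  forall g, S g -> exists2 i, (i < N)%N & W m (mul (inv (s i)) g).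
Definition ucont (F : G -> R) := forall e, 0 < e -> exists m, forall s t,
  W m (mul (inv s) t) -> `|F s - F t| <= e.
(** The substitute for continuous functions of compact support, with continuity uniform for left
    translates of the [W m]. *)
Definition Cc (F : G -> R) := [/\ ucont F, exists M, forall g, `|F g| <= M &
  exists2 S, small S & forall g, ~ S g -> F g = 0].

Lemma mulKg a b : mul (inv a) (mul a b) = b.
Proof. by rewrite mulA mulV mul1. Qed.
Lemma mulKVg a b : mul a (mul (inv a) b) = b.
Proof. by rewrite mulA mulV' mul1. Qed.
Lemma invM a b : inv (mul a b) = mul (inv b) (inv a).
Proof.
have h : mul (mul a b) (mul (inv b) (inv a)) = one by rewrite -mulA mulKVg mulV'.
have mulr1 c : mul c one = c by rewrite -(mulV c) mulA mulV' mul1.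
by rewrite -[RHS](mulKg (mul a b)) h mulr1.
Qed.
Lemma mul_one a : mul a one = a.
Proof. by rewrite -(mulV a) mulA mulV' mul1. Qed.
Lemma invK a : inv (inv a) = a.
Proof. by rewrite -[inv (inv a)]mul_one -(mulV a) mulKg. Qed.

Lemma smallU S S' : small S -> small S' -> small (S `|` S').
Proof.
move=> h h' m; have [N [s hs]] := h m; have [N' [s' hs']] := h' m.
exists (N + N')%N, (fun i => if (i < N)%N then s i else s' (i - N)%N).
move=> g [/hs[i iN Wi]|/hs'[i iN Wi]]; first by exists i; [exact: ltn_addr|rewrite iN].
by exists (N + i)%N; [rewrite ltn_add2l|rewrite ltnNge leq_addr /= addKn].
Qed.

Lemma small_translate b S : small S -> small [set g | S (mul (inv b) g)].
Proof.
move=> h m; have [N [s hs]] := h m; exists N, (fun i => mul b (s i)) => g /= /hs[i iN Wi].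
by exists i => //; rewrite invM -mulA.
Qed.

Lemma Cc_lin (a : R) F F' : Cc F -> Cc F' -> Cc (fun g => (a * F g + F' g)%R).
Proof.
move=> [cF [M hM] [S sS F0]] [cF' [M' hM'] [S' sS' F0']]; split.
- move=> e e0; have a1 : 0 < 1 + `|a| by rewrite ltr_pwDl.
  have e1 : 0 < e / 2 / (1 + `|a|) by rewrite !divr_gt0.
  have e2 : 0 < e / 2 by rewrite divr_gt0.
  have [m hm] := cF _ e1; have [m' hm'] := cF' _ e2.
  exists (maxn m m') => s t Wst.
  have h1 := hm _ _ (Wdecr (leq_maxl _ _) Wst); have h2 := hm' _ _ (Wdecr (leq_maxr _ _) Wst).
  have -> : (a * F s + F' s - (a * F t + F' t) = a * (F s - F t) + (F' s - F' t))%R by ring.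
  apply: le_trans (ler_normD _ _) _; rewrite normrM.
  have h3 : `|a| * `|F s - F t| <= e / 2.
    move: h1; rewrite ler_pdivlMr // => h; apply: le_trans h.
    by rewrite mulrC ler_wpM2l // lerDr.
  by rewrite [leRHS](splitr e); exact: lerD.
- exists (`|a| * M + M')%R => g; apply: le_trans (ler_normD _ _) _; rewrite normrM.
  by apply: lerD => //; rewrite ler_wpM2l.
- exists (S `|` S'); first exact: smallU.
  by move=> g /not_orP[/F0 -> /F0' ->]; rewrite mulr0 addr0.
Qed.

Lemma Cc_translate b F : Cc F -> Cc (fun g => F (mul (inv b) g)).
Proof.
move=> [cF [M hM] [S sS F0]]; split.
- move=> e /cF[m hm]; exists m => s t Wst; apply: hm.
  by rewrite invM -mulA mulKg.
- by exists M.
- by exists [set g | S (mul (inv b) g)]; [exact: small_translate|move=> g; exact: F0].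
Qed.

Lemma Cc_ext F F' : F =1 F' -> Cc F -> Cc F'.
Proof. by move=> /funext ->. Qed.

Lemma Cc_max0 F : Cc F -> Cc (fun g => Num.max (F g) 0).
Proof.
move=> [cF [M hM] [S sS F0]]; split.
- move=> e /cF[m hm]; exists m => s t /hm h.
  by apply: le_trans h; exact: max0_lip.
- exists M => g; apply: le_trans (hM g).
  by rewrite /Num.max; case: ltP => // h; rewrite normr0.
- by exists S => // g /F0 ->; rewrite maxxx.
Qed.

Lemma Cc_sum (N : nat) (F : nat -> G -> R) : (forall i, Cc (F i)) -> Cc (F 0%N) ->
  Cc (fun g => (\sum_(i < N) F i g)%R).
Proof.
move=> hF _; elim: N => [|N IH].
  have := Cc_lin (-1) (hF 0%N) (hF 0%N).
  by apply: Cc_ext => g; rewrite big_ord0 mulN1r addNr.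
by apply: Cc_ext (Cc_lin 1 IH (hF N)) => g; rewrite mul1r big_ord_recr.
Qed.

Definition ind (P : Prop) : R := if `[< P >] then 1 else 0.
Lemma ind_ge0 P : 0 <= ind P.
Proof. by rewrite /ind; case: ifP. Qed.
Lemma ind_le1 P : ind P <= 1.
Proof. by rewrite /ind; case: ifP. Qed.
Lemma ind1 (P : Prop) : P -> ind P = 1.
Proof. by rewrite /ind => /asboolP ->. Qed.
Lemma ind0 (P : Prop) : ~ P -> ind P = 0.
Proof. by rewrite /ind => /asboolPn/negbTE ->. Qed.

Definition cover m (F : G -> R) (N : nat) (c : nat -> R) (s : nat -> G) :=
  (forall i, 0 <= c i) /\ forall g, F g <= \sum_(i < N) (c i * ind (W m (mul (inv (s i)) g)))%R.
Definition cost m (F : G -> R) : set R := [set x | exists N c s, cover m F N c s /\ x = \sum_(i < N) c i].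
(** Weil's covering number of F by [W m]: the least total weight of translates of its indicator
    whose sum dominates F. *)
Definition hN m F := inf (cost m F).

Lemma cost_ge0 m F x : cost m F x -> 0 <= x.
Proof. by move=> [N [c [s [[c0 _] ->]]]]; exact: sumr_ge0. Qed.

Lemma cost_lb m F : has_lbound (cost m F).
Proof. by exists 0 => x; exact: cost_ge0. Qed.

Lemma hN_le m F x : cost m F x -> hN m F <= x.
Proof. by move=> h; apply: ge_inf => //; exact: cost_lb. Qed.

Lemma cost_ex m F : Cc F -> cost m F !=set0.
Proof.
move=> [_ [M hM] [S sS F0]]; have [N [s hs]] := sS m.
exists (\sum_(i < N) `|M|), N, (fun=> `|M|), s; split=> //; split=> // g.
have [/hs[i iN Wi]|/F0 ->] := pselect (S g); last first.
  by apply: sumr_ge0 => i _; rewrite mulr_ge0 ?ind_ge0.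
rewrite (bigD1 (Ordinal iN)) //= (ind1 Wi) mulr1.
apply: le_trans (ler_norm _) _; apply: le_trans (hM g) _; apply: le_trans (ler_norm _) _.
by rewrite lerDl; apply: sumr_ge0 => j _; rewrite mulr_ge0 ?ind_ge0.
Qed.

Lemma hN_ge m F x : Cc F -> (forall y, cost m F y -> x <= y) -> x <= hN m F.
Proof. by move=> /(cost_ex m) ne h; apply: lb_le_inf. Qed.

Lemma hN_ge0 m F : Cc F -> 0 <= hN m F.
Proof. by move=> cF; apply: hN_ge => // y; exact: cost_ge0. Qed.

Lemma hN_mono m F F' : Cc F' -> (forall g, F g <= F' g) -> hN m F <= hN m F'.
Proof.
move=> cF' FF; apply: hN_ge => // y [N [c [s [[c0 hc] ->]]]]; apply: hN_le.
by exists N, c, s; split=> //; split=> // g; exact: le_trans (hc g).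
Qed.

Lemma costD m F F' x x' : cost m F x -> cost m F' x' -> cost m (fun g => F g + F' g)%R (x + x')%R.
Proof.
move=> [N [c [s [[c0 hc] ->]]]] [N' [c' [s' [[c0' hc'] ->]]]].
pose cc i := if (i < N)%N then c i else c' (i - N)%N.
pose ss i := if (i < N)%N then s i else s' (i - N)%N.
have sp (T : nat -> R) (T' : nat -> R) : (\sum_(i < N + N') (if (i < N)%N then T i else T' (i - N)%N) =
    \sum_(i < N) T i + \sum_(i < N') T' i)%R.
  rewrite big_split_ord /=; congr (_ + _)%R; apply: eq_bigr => i _; first by rewrite ltn_ord.
  by rewrite ltnNge leq_addr /= addKn.
exists (N + N')%N, cc, ss; split; last by rewrite sp.
split=> [i|g]; first by rewrite /cc; case: ifP.
have -> : (\sum_(i < N + N') cc i * ind (W m (mul (inv (ss i)) g)) =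
  \sum_(i < N + N') (if (i < N)%N then c i * ind (W m (mul (inv (s i)) g)) else
    c' (i - N)%N * ind (W m (mul (inv (s' (i - N)%N)) g))))%R.
  by apply: eq_bigr => i _; rewrite /cc /ss; case: ifP.
by rewrite (sp (fun i => c i * ind (W m (mul (inv (s i)) g))) (fun i => c' i * ind (W m (mul (inv (s' i)) g))))%R lerD.
Qed.

Lemma hND m F F' : Cc F -> Cc F' -> hN m (fun g => F g + F' g)%R <= hN m F + hN m F'.
Proof.
move=> cF cF'; rewrite -lerBlDr; apply: hN_ge => // x hx.
rewrite lerBlDr -lerBlDl; apply: hN_ge => // y hy.
by rewrite lerBlDl; apply: hN_le; exact: costD.
Qed.

Lemma hNZ m (a : R) F : 0 < a -> Cc F -> hN m (fun g => a * F g)%R = (a * hN m F)%R.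
Proof.
move=> a0 cF.
have sub b F' x : 0 < b -> cost m F' x -> cost m (fun g => b * F' g)%R (b * x)%R.
  move=> b0 [N [c [s [[c0 hc] ->]]]]; exists N, (fun i => b * c i)%R, s; split; last by rewrite mulr_sumr.
  split=> [i|g]; first by rewrite mulr_ge0 // ltW.
  by under eq_bigr do rewrite -mulrA; rewrite -mulr_sumr ler_pM2l.
have caF : Cc (fun g => a * F g)%R.
  by apply: Cc_ext (Cc_lin (a - 1) cF cF) => g; ring.
apply/eqP; rewrite eq_le; apply/andP; split.
  rewrite -ler_pdivrMl //; apply: hN_ge => // x hx.
  by rewrite ler_pdivrMl //; apply: hN_le; exact: sub.
apply: hN_ge => // x hx; rewrite -ler_pdivlMl //; apply: hN_le.
have := sub a^-1 _ _ _ hx; rewrite invr_gt0 => /(_ a0).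
have -> // : (fun g => a^-1 * (a * F g))%R = F.
by apply/funext => g; rewrite mulrA mulVf ?mul1r // gt_eqF.
Qed.

Lemma hN_translate m b F : Cc F -> hN m (fun g => F (mul (inv b) g)) = hN m F.
Proof.
have sub b' F' x : cost m F' x -> cost m (fun g => F' (mul (inv b') g)) x.
  move=> [N [c [s [[c0 hc] ->]]]]; exists N, c, (fun i => mul b' (s i)); split=> //; split=> // g.
  apply: le_trans (hc _) _; apply: ler_sum => i _.
  by rewrite invM -mulA.
move=> cF; apply/eqP; rewrite eq_le; apply/andP; split.
  by apply: hN_ge => // x hx; apply: hN_le; exact: sub.
apply: hN_ge; first exact: Cc_translate.
move=> x /(sub (inv b)) hx; apply: hN_le.
by move: hx; under eq_fun do rewrite invK mulKg.
Qed.

Variables (B : G -> R) (m0 : nat).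
Hypothesis CB : Cc B.
Hypothesis B0 : forall g, 0 <= B g.
Hypothesis B1 : forall g, W m0 g -> 1 <= B g.

Lemma hNB_gt0 m : 0 < hN m B.
Proof.
apply: (@lt_le_trans _ _ 1) => //; apply: hN_ge => // y [N [c [s [[c0 hc] ->]]]].
apply: le_trans (B1 (W1 m0)) _; apply: le_trans (hc one) _.
by apply: ler_sum => i _; rewrite ler_piMr // ind_le1.
Qed.

Definition hB (N : nat) (s : nat -> G) (g : G) : R := (\sum_(i < N) B (mul (inv (s i)) g))%R.

Lemma CB_sum N s : Cc (hB N s).
Proof.
by apply: (@Cc_sum N (fun i g => B (mul (inv (s i)) g))) => [i|]; exact: Cc_translate.
Qed.

Lemma hN_sum m (N : nat) (F : nat -> G -> R) : (forall i, Cc (F i)) -> 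
  hN m (fun g => (\sum_(i < N) F i g)%R) <= (\sum_(i < N) hN m (F i))%R.
Proof.
move=> hF; elim: N => [|N IH].
  rewrite big_ord0; apply: hN_le; exists 0%N, (fun=> 0), (fun=> one).
  by rewrite big_ord0; split=> //; split=> // g; rewrite !big_ord0.
rewrite big_ord_recr /=.
have -> : (fun g => \sum_(i < N.+1) F i g)%R = (fun g => (fun g => \sum_(i < N) F i g)%R g + F N g)%R.
  by apply/funext => g; rewrite big_ord_recr.
apply: le_trans (hND m _ (hF N)) _; last exact: lerD.
exact: Cc_sum.
Qed.

(** Finitely many translates of B are together at least 1 on a small set. Subadditivity and
    invariance then compare covering numbers with that of B independently of m, which makes the
    ratios bounded. *)
Lemma hB_cover S : small S -> exists (N : nat) (s : nat -> G),
  [/\ forall g, S g -> 1 <= hB N s g, forall g, 0 <= hB N s g & forall m, hN m (hB N s) <= (N%:R * hN m B)%R].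
Proof.
move=> /(_ m0)[N [s hs]]; exists N, s.
have p g : 0 <= hB N s g by exact: sumr_ge0.
split=> // [g /hs[i iN Wi]|m].
  rewrite /hB (bigD1 (Ordinal iN)) //=; apply: le_trans (B1 Wi) _.
  by rewrite lerDl; exact: sumr_ge0.
apply: le_trans (hN_sum m N (fun i => Cc_translate (s i) CB)) _.
rewrite -[X in X%:R]card_ord -sumr_const mulr_suml; apply: ler_sum => i _.
by rewrite mul1r hN_translate.
Qed.

Definition cover_ratio F m := (hN m F / hN m B)%R.

Lemma hN_dom F : Cc F -> exists K : R, 0 <= K /\ forall m, hN m F <= (K * hN m B)%R.
Proof.
move=> cF; have [_ [M hM] [S sS F0]] := cF.
have [N [s [h1 h2 h3]]] := hB_cover sS.
have M1 : 0 < 1 + `|M| by rewrite ltr_pwDl.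
exists ((1 + `|M|) * N%:R)%R; split; first by rewrite mulr_ge0 // ltW.
move=> m; rewrite -mulrA; apply: (@le_trans _ _ ((1 + `|M|) * hN m (hB N s))%R); last by rewrite ler_pM2l.
rewrite -hNZ //; last exact: CB_sum.
apply: hN_mono.
  by apply: Cc_ext (Cc_lin (1 + `|M| - 1) (CB_sum N s) (CB_sum N s)) => g; ring.
move=> g; have [Sg|/F0 ->] := pselect (S g); last by rewrite mulr_ge0 // ltW.
rewrite -[F g]mulr1; apply: (@le_trans _ _ ((1 + `|M|) * 1)%R); last by rewrite ler_pM2l // h1.
rewrite ler_pM2r //; apply: le_trans (ler_norm _) _; apply: le_trans (hM g) _.
by apply: le_trans (ler_norm _) _; rewrite lerDr.
Qed.

Lemma rho_bdd F : Cc F -> bdd_seq (cover_ratio F).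
Proof.
move=> cF; have [K [K0 hK]] := hN_dom cF; exists K => m.
rewrite /cover_ratio ger0_norm ?divr_ge0 ?hN_ge0 ?(ltW (hNB_gt0 _)) //.
by rewrite ler_pdivrMr ?hNB_gt0.
Qed.

(** Put H = F + F' + e D and q = F / H, q' = F' / H. A cover of H with weights c_i at points s_i
    yields covers of F and F' with weights c_i (q(s_i) + eta) and c_i (q'(s_i) + eta), once m is so
    large that q and q' vary by at most eta on translates of [W m]; and q + q' <= 1. The term e D
    keeps H at least e where a quotient is taken. *)
Lemma hN_superadd F F' D (e eta : R) : Cc F -> Cc F' -> Cc D -> (forall g, 0 <= F g) -> (forall g, 0 <= F' g) ->
  (forall g, 0 <= D g) -> (forall g, F g != 0 \/ F' g != 0 -> 1 <= D g) -> 0 < e -> 0 < eta ->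
  exists m1, forall m, (m1 <= m)%N ->
    (hN m F + hN m F' <= (1 + 2 * eta) * (hN m (fun g => F g + F' g) + e * hN m D))%R.
Proof.
move=> cF cF' cD F0 F0' D0 D1 e0 eta0.
pose H g := (e * D g + (F g + F' g))%R.
have cFF : Cc (fun g => F g + F' g)%R by apply: Cc_ext (Cc_lin 1 cF cF') => g; rewrite mul1r.
have cH : Cc H by exact: Cc_lin.
have HF g : F g <= H g by rewrite /H addrCA lerDl addr_ge0 // mulr_ge0 // ltW.
have HF' g : F' g <= H g by rewrite /H addrA lerDr addr_ge0 // mulr_ge0 // ltW.
have He g : F g != 0 \/ F' g != 0 -> e <= H g.
  move=> /D1 d1; rewrite /H; apply: (@le_trans _ _ (e * D g)); first by rewrite ler_peMr // ltW.
  by rewrite lerDl addr_ge0.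
(* The value 0 is used where E vanishes, since H may vanish there too. Uniform continuity survives
   because H >= e wherever E does not vanish, so a small E gives a small quotient. *)
pose q (E : G -> R) g : R := if E g == 0 then 0 else (E g / H g)%R.
have uq E : Cc E -> (forall g, 0 <= E g) -> (forall g, E g <= H g) -> (forall g, E g != 0 -> e <= H g) ->
    ucont (q E).
  move=> [uE [M hM] _] E0 EH Ee; have [uH _ _] := cH.
  have HP g : E g != 0 -> 0 < H g by move=> /Ee; exact: lt_le_trans.
  move=> a a0; have M1 : 0 < 1 + `|M| by rewrite ltr_pwDl.
  pose a1 := Num.min (a * e) (a * e / 2 * (e / (1 + `|M|)))%R.
  have a10 : 0 < a1.
    by rewrite lt_min; apply/andP; split; rewrite ?mulr_gt0 ?divr_gt0 // ?mulr_gt0 // invr_gt0.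
  pose a2 := Num.min a1 (a * e / 2)%R.
  have a20 : 0 < a2 by rewrite lt_min a10 /= divr_gt0 // mulr_gt0.
  have [m hm] := uE _ a20; have [m' hm'] := uH _ a20.
  exists (maxn m m') => s t Wst.
  have hE := hm _ _ (Wdecr (leq_maxl _ _) Wst); have hH := hm' _ _ (Wdecr (leq_maxr _ _) Wst).
  have a2e : a2 <= a * e by rewrite /a2 /a1 !ge_min lexx.
  have one_side s' t' : E t' = 0 -> E s' != 0 -> `|E s' - E t'| <= a2 -> E s' / H s' <= a.
    move=> t0 sn; rewrite t0 subr0 ger0_norm // => h; rewrite ler_pdivrMr ?HP //.
    apply: le_trans h _; apply: le_trans a2e _; rewrite ler_pM2l //; exact: Ee.
  rewrite /q; case: eqVneq => [s0|sn]; case: eqVneq => [t0|tn].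
  - by rewrite subrr normr0 ltW.
  - rewrite sub0r normrN ger0_norm ?divr_ge0 ?(ltW (HP _ tn)) //; apply: one_side s0 tn _.
    by rewrite distrC.
  - by rewrite subr0 ger0_norm ?divr_ge0 ?(ltW (HP _ sn)) //; apply: one_side t0 sn hE.
  have Hs := HP _ sn; have Ht := HP _ tn.
  have -> : (E s / H s - E t / H t = (E s - E t) / H s + E t / H t * ((H t - H s) / H s))%R.
    by field; rewrite !gt_eqF.
  have a2a : a2 <= a * e / 2 by rewrite /a2 ge_min lexx orbT.
  have qt : `|(E t / H t)%R| <= 1.
    by rewrite ger0_norm ?divr_ge0 ?(ltW Ht) // ler_pdivrMr // mul1r.
  have k1 : `|((E s - E t) / H s)%R| <= a / 2.
    rewrite normrM normfV (gtr0_norm Hs) ler_pdivrMr //; apply: le_trans hE _; apply: le_trans a2a _.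
    by rewrite mulrAC ler_pM2l ?divr_gt0 // Ee.
  have k2 : `|((H t - H s) / H s)%R| <= a / 2.
    rewrite normrM normfV (gtr0_norm Hs) ler_pdivrMr // distrC; apply: le_trans hH _; apply: le_trans a2a _.
    by rewrite mulrAC ler_pM2l ?divr_gt0 // Ee.
  apply: le_trans (ler_normD _ _) _; rewrite [a in leRHS]splitr; apply: lerD => //.
  by rewrite normrM -[leRHS]mul1r; apply: ler_pM.
have [m1 hm1] := uq F cF F0 HF (fun g h => He g (or_introl h)) _ eta0.
have [m2 hm2] := uq F' cF' F0' HF' (fun g h => He g (or_intror h)) _ eta0.
exists (maxn m1 m2) => m mm.
have HHD : hN m H <= (hN m (fun g => F g + F' g) + e * hN m D)%R.
  have ceD : Cc (fun g => e * D g)%R by apply: Cc_ext (Cc_lin (e - 1) cD cD) => g; ring.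
  by rewrite addrC -hNZ //; exact: hND.
have eta1 : 0 < 1 + 2 * eta by rewrite ltr_pwDl // mulr_ge0 // ltW.
apply: le_trans (ler_wpM2l (ltW eta1) HHD).
rewrite -ler_pdivrMl //; apply: hN_ge => // x [N [c [s [[c0 hc] ->]]]].
rewrite ler_pdivrMl //.
have part E m' : (m' <= m)%N -> (forall s t, W m' (mul (inv s) t) -> `|q E s - q E t| <= eta) ->
    (forall g, 0 <= E g) -> (forall g, E g <= H g) -> (forall g, E g != 0 -> e <= H g) ->
    cost m E (\sum_(i < N) c i * (q E (s i) + eta))%R.
  move=> mm' hq E0 EH Ee.
  have q0 g : 0 <= q E g.
    by rewrite /q; case: eqVneq => // /Ee h; rewrite divr_ge0 // (le_trans (ltW e0)).
  exists N, (fun i => c i * (q E (s i) + eta))%R, s; split=> //; split=> [i|g].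
    by rewrite mulr_ge0 // addr_ge0 // ltW.
  have [Eg0|En0] := eqVneq (E g) 0.
    by rewrite Eg0; apply: sumr_ge0 => i _; rewrite !mulr_ge0 ?ind_ge0 // addr_ge0 // ltW.
  have -> : E g = (q E g * H g)%R.
    by rewrite /q (negbTE En0) divfK // gt_eqF // (lt_le_trans e0) // Ee.
  apply: le_trans (ler_wpM2l (q0 g) (hc g)) _; rewrite mulr_sumr; apply: ler_sum => i _.
  have [Wi|nW] := pselect (W m (mul (inv (s i)) g)); last by rewrite (ind0 nW) !mulr0.
  rewrite (ind1 Wi) !mulr1 mulrC ler_wpM2l //.
  have := hq _ _ (Wdecr mm' Wi); rewrite ler_norml => /andP[h _].
  by rewrite -lerBlDl -[q E g - _]opprB lerNl.
have p1 := part F m1 (leq_trans (leq_maxl _ _) mm) hm1 F0 HF (fun g h => He g (or_introl h)).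
have p2 := part F' m2 (leq_trans (leq_maxr _ _) mm) hm2 F0' HF' (fun g h => He g (or_intror h)).
apply: le_trans (lerD (hN_le p1) (hN_le p2)) _.
rewrite -big_split mulr_sumr; apply: ler_sum => i _ /=.
rewrite -mulrDr mulrC ler_wpM2r //.
have : (q F (s i) + q F' (s i) <= 1)%R.
  rewrite /q; case: eqVneq => h1; case: eqVneq => h2; rewrite ?addr0 ?add0r ?ler01 //.
  - by rewrite ler_pdivrMr ?mul1r // (lt_le_trans e0) // He //; right.
  - by rewrite ler_pdivrMr ?mul1r // (lt_le_trans e0) // He //; left.
  rewrite -mulrDl ler_pdivrMr ?mul1r; last by rewrite (lt_le_trans e0) // He //; left.
  by rewrite /H lerDr mulr_ge0 // ltW.
by move=> h; rewrite addrACA -mulr2n mulr_natl lerD2r.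
Qed.

Definition nonneg (F : G -> R) := forall g, 0 <= F g.

Lemma Cc_add F F' : Cc F -> Cc F' -> Cc (fun g => F g + F' g)%R.
Proof. by move=> cF cF'; apply: Cc_ext (Cc_lin 1 cF cF') => g; rewrite mul1r. Qed.

Lemma Cc_scale (a : R) F : Cc F -> Cc (fun g => a * F g)%R.
Proof. by move=> cF; apply: Cc_ext (Cc_lin (a - 1) cF cF) => g; ring. Qed.

(** Subadditivity, homogeneity, invariance and monotonicity hold for the covering ratios at every
    stage m; the missing half of additivity holds only in the limit, by [hN_superadd]. *)
Lemma haar_nonneg : exists J : (G -> R) -> R,
  [/\ forall F F', Cc F -> Cc F' -> nonneg F -> nonneg F' -> J (fun g => F g + F' g)%R = (J F + J F')%R,
      forall a F, 0 < a -> Cc F -> J (fun g => a * F g)%R = (a * J F)%R,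
      forall b F, Cc F -> J (fun g => F (mul (inv b) g)) = J F,
      forall F F', Cc F -> Cc F' -> (forall g, F g <= F' g) -> J F <= J F' &
      J B = 1].
Proof.
have [U [UD Ule UZ U1]] := ultralimit R.
have rB : cover_ratio B = (fun=> 1 : R) by apply/funext => m; rewrite /cover_ratio divff // gt_eqF // hNB_gt0.
have rle F F' m : hN m F <= hN m F' -> cover_ratio F m <= cover_ratio F' m.
  by move=> h; rewrite /cover_ratio ler_pM2r // invr_gt0 hNB_gt0.
have rD F F' m : (cover_ratio F m + cover_ratio F' m = (hN m F + hN m F') / hN m B)%R by rewrite /cover_ratio mulrDl.
have bD F F' : Cc F -> Cc F' -> bdd_seq (fun m => cover_ratio F m + cover_ratio F' m)%R.
  move=> /rho_bdd[M hM] /rho_bdd[M' hM']; exists (M + M')%R => m.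
  by apply: le_trans (ler_normD _ _) _; exact: lerD.
have bZ (a : R) F : Cc F -> bdd_seq (fun m => a * cover_ratio F m)%R.
  by move=> /rho_bdd[M hM]; exists (`|a| * M)%R => m; rewrite normrM ler_wpM2l.
have UDr F F' : Cc F -> Cc F' -> U (fun m => cover_ratio F m + cover_ratio F' m)%R = (U (cover_ratio F) + U (cover_ratio F'))%R.
  by move=> cF cF'; apply: UD; exact: rho_bdd.
have Uge0 F : Cc F -> 0 <= U (cover_ratio F).
  move=> cF; have b0 : bdd_seq (fun m => 0 * cover_ratio F m)%R by exact: bZ.
  have := UZ 0 _ (rho_bdd cF); rewrite mul0r => <-; apply: Ule => //; first exact: rho_bdd.
  by exists 0%N => m _; rewrite mul0r /cover_ratio divr_ge0 ?hN_ge0 // ltW // hNB_gt0.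
exists (fun F => U (cover_ratio F)); split; last by rewrite rB.
- move=> F F' cF cF' F0 F0'; have cS := Cc_add cF cF'.
  apply/eqP; rewrite eq_le; apply/andP; split.
    rewrite -UDr //; apply: Ule; [exact: rho_bdd|exact: bD|].
    exists 0%N => m _; rewrite rD /cover_ratio ler_pM2r ?invr_gt0 ?hNB_gt0 //; exact: hND.
  have [_ _ [S sS SF]] := cF; have [_ _ [S' sS' SF']] := cF'.
  have [N [s [h1 h2 _]]] := hB_cover (smallU sS sS').
  have cD := CB_sum N s.
  have D1 g : F g != 0 \/ F' g != 0 -> 1 <= hB N s g.
    move=> nz; apply: h1; apply: contrapT => /not_orP[n1 n2].
    by move: nz; rewrite SF // SF' // eqxx; case.
  set A := U (cover_ratio (fun g => F g + F' g)%R); set C := U (cover_ratio (hB N s)).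
  have A0 : 0 <= A by exact: Uge0.
  have C0 : 0 <= C by exact: Uge0.
  have key e : 0 < e -> (U (cover_ratio F) + U (cover_ratio F') <= (1 + 2 * e) * (A + e * C))%R.
    move=> e0; have [m1 hm1] := hN_superadd cF cF' cD F0 F0' h2 D1 e0 e0.
    have b1 : bdd_seq (fun m => cover_ratio (fun g => F g + F' g)%R m + e * cover_ratio (hB N s) m)%R.
      have [M hM] := rho_bdd cS; have [M' hM'] := bZ e _ cD.
      exists (M + M')%R => m; apply: le_trans (ler_normD _ _) _; exact: lerD.
    rewrite -UDr // /A /C -(UZ _ _ (rho_bdd cD)) -(UD _ _ (rho_bdd cS) (bZ _ _ cD)).
    rewrite -UZ //; apply: Ule; first exact: bD.
      have [M hM] := b1; exists (`|(1 + 2 * e)%R| * M)%R => m.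
      by rewrite normrM ler_wpM2l.
    exists m1 => m /hm1; rewrite rD /cover_ratio => h.
    by rewrite mulrA -mulrDl mulrA ler_pM2r // invr_gt0 hNB_gt0.
  apply/ler_addgt0Pr => x x0.
  have T0 : 0 < (2 * A + 3 * C + 1)%R by rewrite ltr_wpDl // addr_ge0 // mulr_ge0.
  (* For e <= 1, (1 + 2 e)(A + e C) exceeds A by at most e (2 A + 3 C). *)
  pose e := Num.min 1 (x / (2 * A + 3 * C + 1))%R.
  have e0 : 0 < e by rewrite lt_min ltr01 divr_gt0.
  have e1 : e <= 1 by rewrite /e ge_min lexx.
  have ex : (e * (2 * A + 3 * C + 1) <= x)%R.
    by rewrite -ler_pdivlMr // /e ge_min lexx orbT.
  apply: le_trans (key _ e0) _.
  have eC : (e * e * C <= e * C)%R by rewrite ler_wpM2r // ler_piMl // ltW.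
  have -> : ((1 + 2 * e) * (A + e * C) = A + 2 * (e * A) + e * C + 2 * (e * e * C))%R by ring.
  have ex' : (2 * (e * A) + 3 * (e * C) + e <= x)%R.
    by apply: le_trans ex; rewrite le_eqVlt; apply/orP; left; apply/eqP; ring.
  by lraH eC ex' e0.
- move=> a F a0 cF; rewrite -UZ; last exact: rho_bdd.
  by congr U; apply/funext => m; rewrite /cover_ratio hNZ // mulrA.
- by move=> b F cF; congr U; apply/funext => m; rewrite /cover_ratio hN_translate.
- move=> F F' cF cF' h; apply: Ule; [exact: rho_bdd|exact: rho_bdd|].
  by exists 0%N => m _; apply: rle; exact: hN_mono.
Qed.

Section Signed.
Variable J : (G -> R) -> R.
Hypothesis JD : forall F F', Cc F -> Cc F' -> nonneg F -> nonneg F' -> J (fun g => F g + F' g)%R = (J F + J F')%R.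
Hypothesis JZ : forall a F, 0 < a -> Cc F -> J (fun g => a * F g)%R = (a * J F)%R.
Hypothesis Jinv : forall b F, Cc F -> J (fun g => F (mul (inv b) g)) = J F.
Hypothesis Jle : forall F F', Cc F -> Cc F' -> (forall g, F g <= F' g) -> J F <= J F'.
Hypothesis JB : J B = 1.

Definition pos_part (F : G -> R) g : R := Num.max (F g) 0.
Definition haarI F := (J (pos_part F) - J (pos_part (fun g => - F g)))%R.

Lemma pos_part_ge0 F : nonneg (pos_part F).
Proof. by move=> g; rewrite /pos_part le_max lexx orbT. Qed.

Lemma Cc_opp F : Cc F -> Cc (fun g => - F g).
Proof. by move=> cF; apply: Cc_ext (Cc_scale (-1) cF) => g; rewrite mulN1r. Qed.

Lemma pos_partB F g : F g = (pos_part F g - pos_part (fun g => - F g) g)%R.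
Proof. exact: max0B. Qed.

(** Two decompositions of F into nonnegative parts give, after moving terms, one identity between
    sums of nonnegative functions, where J is additive. *)
Lemma haarI_diff F P N : Cc P -> Cc N -> nonneg P -> nonneg N -> (forall g, F g = P g - N g)%R ->
  haarI F = (J P - J N)%R.
Proof.
move=> cP cN P0 N0 FE.
have cF : Cc F by apply: Cc_ext (Cc_add cP (Cc_opp cN)) => g; rewrite FE.
have c1 := Cc_max0 cF; have c2 := Cc_max0 (Cc_opp cF).
have E : (J P + J (pos_part (fun g => - F g)) = J N + J (pos_part F))%R.
  rewrite -!JD //; try exact: pos_part_ge0.
  congr J; apply/funext => g; apply/eqP; rewrite -subr_eq0 opprD addrACA -FE {1}(pos_partB F g).
  by rewrite -[X in _ + X]opprB subrr.
by rewrite /haarI; exact: sub_eq_of_add.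
Qed.

Lemma haarI_nonneg F : Cc F -> nonneg F -> haarI F = J F.
Proof.
move=> cF F0; have c0 : Cc (fun g => 0 * F g)%R by exact: Cc_scale.
have n0 : nonneg (fun g => 0 * F g)%R by move=> g; rewrite mul0r.
rewrite (haarI_diff cF c0 F0 n0); last by move=> g; rewrite mul0r subr0.
have := JD c0 c0 n0 n0.
have -> : (fun g => 0 * F g + 0 * F g)%R = (fun g => 0 * F g)%R by apply/funext => g; ring.
by move/eq_double0 => ->; rewrite subr0.
Qed.

Lemma haarID F F' : Cc F -> Cc F' -> haarI (fun g => F g + F' g)%R = (haarI F + haarI F')%R.
Proof.
move=> cF cF'.
have c1 := Cc_max0 cF; have c2 := Cc_max0 (Cc_opp cF).
have c3 := Cc_max0 cF'; have c4 := Cc_max0 (Cc_opp cF').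
have n1 F1 F2 : nonneg (fun g => pos_part F1 g + pos_part F2 g)%R.
  by move=> g; rewrite addr_ge0 // pos_part_ge0.
rewrite (haarI_diff (Cc_add c1 c3) (Cc_add c2 c4) (n1 _ _) (n1 _ _)); last first.
  by move=> g; rewrite opprD addrACA; congr (_ + _)%R; exact: pos_partB.
rewrite !JD //; try exact: pos_part_ge0.
by rewrite /haarI opprD addrACA.
Qed.

Lemma haarIN F : Cc F -> haarI (fun g => - F g) = - haarI F.
Proof.
move=> cF; rewrite /haarI opprB; congr (_ - J _)%R.
by congr pos_part; apply/funext => g; rewrite opprK.
Qed.

Lemma haarIZ (a : R) F : Cc F -> haarI (fun g => a * F g)%R = (a * haarI F)%R.
Proof.
have pos b F' : 0 < b -> Cc F' -> haarI (fun g => b * F' g)%R = (b * haarI F')%R.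
  move=> b0 cF.
  have c1 := Cc_max0 cF; have c2 := Cc_max0 (Cc_opp cF).
  have n1 F1 : nonneg (fun g => b * pos_part F1 g)%R.
    by move=> g; rewrite mulr_ge0 // ?pos_part_ge0 // ltW.
  rewrite (haarI_diff (Cc_scale b c1) (Cc_scale b c2) (n1 _) (n1 _)); last first.
    by move=> g; rewrite {1}(pos_partB F') mulrBr.
  by rewrite !JZ // -mulrBr.
move=> cF; have [a0|a0|->] := ltgtP a 0; last first.
- have -> : (fun g => 0 * F g)%R = (fun g => F g + - F g)%R by apply/funext => g; ring.
  by rewrite haarID ?haarIN //; [ring|exact: Cc_opp].
- exact: pos.
have -> : (fun g => a * F g)%R = (fun g => - ((- a) * F g))%R by apply/funext => g; ring.
rewrite haarIN ?pos ?oppr_gt0 //; first by ring.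
exact: Cc_scale.
Qed.

Lemma haarI_translate b F : Cc F -> haarI (fun g => F (mul (inv b) g)) = haarI F.
Proof.
move=> cF; rewrite /haarI.
by rewrite -(Jinv b (Cc_max0 cF)) -(Jinv b (Cc_max0 (Cc_opp cF))).
Qed.

(** Positive and negative parts of F are dominated by e times a fixed sum of translates of B that is
    at least 1 on S. *)
Lemma haarI_bound S : small S -> exists2 K : R, 0 <= K & forall F (e : R), Cc F -> (forall g, ~ S g -> F g = 0) ->
  0 < e -> (forall g, `|F g| <= e) -> `|haarI F| <= K * e.
Proof.
move=> /hB_cover[N [s [h1 h2 _]]]; have cD := CB_sum N s.
have JDge F : Cc F -> nonneg F -> 0 <= J F.
  move=> cF F0; have c0 : Cc (fun g => 0 * F g)%R by exact: Cc_scale.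
  have n0 : nonneg (fun g => 0 * F g)%R by move=> g; rewrite mul0r.
  have h : J (fun g => 0 * F g)%R = 0.
    have := JD c0 c0 n0 n0.
    have -> : (fun g => 0 * F g + 0 * F g)%R = (fun g => 0 * F g)%R by apply/funext => g; ring.
    exact: eq_double0.
  by rewrite -h; apply: Jle => // g; rewrite mul0r.
have half F e : Cc F -> (forall g, ~ S g -> F g = 0) -> 0 < e -> (forall g, F g <= e) ->
    0 <= J (pos_part F) <= (J (hB N s) * e)%R.
  move=> cF F0 e0 Fe; rewrite JDge ?andTb //; [|exact: Cc_max0|exact: pos_part_ge0].
  rewrite mulrC -JZ //; apply: Jle; [exact: Cc_max0|exact: Cc_scale|].
  move=> g; have De : 0 <= (e * hB N s g)%R by rewrite mulr_ge0 // ltW.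
  rewrite /pos_part ge_max De andbT.
  have [Sg|/F0 -> //] := pselect (S g); apply: le_trans (Fe g) _.
  by rewrite ler_peMr // ?h1 // ltW.
exists (J (hB N s)) => [|F e cF F0 e0 Fe]; first exact: JDge.
have a1 := half F e cF F0 e0 (fun g => le_trans (ler_norm _) (Fe g)).
have a3 := half _ e (Cc_opp cF) (fun g h => etrans (congr1 _ (F0 g h)) (oppr0 _)) e0
   (fun g => le_trans (ler_norm _) (le_trans (eq_leW (normrN _)) (Fe g))).
exact: norm_sub_le.
Qed.

(** A multiple of a finite sum of translates of F dominates B, and J B = 1. *)
Lemma haarI_gt0 F (eta : R) s : Cc F -> nonneg F -> 0 < eta ->
  (forall g, W m0 (mul (inv s) g) -> eta <= F g) -> 0 < haarI F.
Proof.
have [_ [M hM] [S sS SB]] := CB.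
move=> cF F0 eta0 hF; rewrite haarI_nonneg //.
have [N [t ht]] := sS m0.
(* Left multiplication by s (t i)^-1 carries the translate of [W m0] at t i to the one at s, where F
   >= eta. *)
pose E i g := F (mul (mul s (inv (t i))) g).
have EE i : E i = (fun g => F (mul (inv (mul (t i) (inv s))) g)).
  by apply/funext => g; rewrite invM invK.
have cE i : Cc (E i) by rewrite EE; exact: Cc_translate.
have M1 : 0 < 1 + `|M| by rewrite ltr_pwDl.
have JE i : J (E i) = J F by rewrite EE Jinv.
have sumJ k : J (fun g => \sum_(i < k) E i g)%R = (k%:R * J F)%R.
  elim: k => [|k IH].
    have c0 : Cc (fun g => 0 * F g)%R by exact: Cc_scale.
    have n0 : nonneg (fun g => 0 * F g)%R by move=> g; rewrite mul0r.
    have := JD c0 c0 n0 n0.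
    have -> : (fun g => 0 * F g + 0 * F g)%R = (fun g => 0 * F g)%R by apply/funext => g; ring.
    have -> : (fun g => 0 * F g)%R = (fun g => \sum_(i < 0) E i g)%R.
      by apply/funext => g; rewrite mul0r big_ord0.
    by move=> h; rewrite mul0r; exact: eq_double0.
  have -> : (fun g => \sum_(i < k.+1) E i g)%R = (fun g => (\sum_(i < k) E i g) + E k g)%R.
    by apply/funext => g; rewrite big_ord_recr.
  rewrite (JD (F := fun g => \sum_(i < k) E i g)) //.
  - by rewrite IH JE -natr1 mulrDl mul1r.
  - exact: Cc_sum.
  - by move=> g; apply: sumr_ge0 => i _; exact: F0.
  - by move=> g; exact: F0.
have cS : Cc (fun g => \sum_(i < N) E i g)%R by exact: Cc_sum.
have le : J B <= ((1 + `|M|) / eta * (N%:R * J F))%R.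
  have a0 : 0 < (1 + `|M|) / eta by rewrite divr_gt0.
  rewrite -sumJ -JZ //; apply: Jle => //; first exact: Cc_scale.
  move=> g; have s0 : 0 <= (\sum_(i < N) E i g)%R by apply: sumr_ge0 => i _; exact: F0.
  have [Sg|/SB ->] := pselect (S g); last by rewrite mulr_ge0 // ltW.
  apply: (@le_trans _ _ (1 + `|M|)).
    by apply: le_trans (ler_norm _) _; apply: le_trans (hM g) _; apply: le_trans (ler_norm _) _; rewrite lerDr.
  rewrite -mulrA ler_peMr // ?(ltW M1) // mulrC ler_pdivlMr // mul1r.
  have [i iN Wi] := ht _ Sg; rewrite (bigD1 (Ordinal iN)) //=.
  apply: (@le_trans _ _ (E i g)); last by rewrite lerDl; apply: sumr_ge0 => j _; exact: F0.
  by apply: hF; rewrite -mulA mulKg.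
move: le; rewrite JB ltNge => le; apply/negP => JF.
have : ((1 + `|M|) / eta * (N%:R * J F))%R <= 0.
  by rewrite mulr_ge0_le0 ?divr_ge0 ?(ltW M1) ?(ltW eta0) // mulr_ge0_le0.
by move=> /(le_trans le); rewrite lt_geF.
Qed.

End Signed.

(* Weil's construction: I is an ultrafilter limit of ratios of covering numbers by
   translates of the W m; no topology on G is needed beyond this filtration. *)
Theorem haar : exists I : (G -> R) -> R,
  [/\ forall a F F', Cc F -> Cc F' -> I (fun g => a * F g + F' g)%R = (a * I F + I F')%R,
      forall b F, Cc F -> I (fun g => F (mul (inv b) g)) = I F,
      forall S, small S -> exists2 K : R, 0 <= K & forall F (e : R), Cc F -> (forall g, ~ S g -> F g = 0) ->
        (forall g, `|F g| <= e) -> `|I F| <= K * e,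
      forall F, Cc F -> nonneg F -> 0 <= I F &
      forall F (eta : R) s, Cc F -> nonneg F -> 0 < eta ->
        (forall g, W m0 (mul (inv s) g) -> eta <= F g) -> 0 < I F].
Proof.
have [J [JD JZ Jinv Jle JB]] := haar_nonneg.
exists (haarI J); split.
- by move=> a F F' cF cF'; rewrite (haarID JD) ?(haarIZ JD JZ) //; exact: Cc_scale.
- by move=> b F; exact: haarI_translate.
- move=> S sS; have [K K0 hK] := haarI_bound JD JZ Jle sS; exists K => // F e cF F0 Fe.
  have : 0 <= e by apply: le_trans (Fe one).
  rewrite le_eqVlt => /orP[/eqP e0|e0]; last exact: hK.
  have -> : F = (fun g => 0 * F g)%R.
    by apply/funext => g; rewrite mul0r; apply/eqP; rewrite -normr_le0 e0.
  by rewrite (haarIZ JD JZ) // mul0r normr0 -e0 mulr0.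
- move=> F cF F0; rewrite (haarI_nonneg JD) //.
  have := Jle _ _ (Cc_scale 0 cF) cF.
  have -> : J (fun g => 0 * F g)%R = 0.
    have c0 := Cc_scale 0 cF.
    have n0 : nonneg (fun g => 0 * F g)%R by move=> g; rewrite mul0r.
    have := JD _ _ c0 c0 n0 n0.
    have -> : (fun g => 0 * F g + 0 * F g)%R = (fun g => 0 * F g)%R by apply/funext => g; ring.
    exact: eq_double0.
  by apply=> g; rewrite mul0r.
- by move=> F eta s; exact: (haarI_gt0 JD JZ Jinv Jle JB).
Qed.

End Haar.

(** * Monodromy *)

Lemma within_continuousP (T T' : topologicalType) (D : set T) (f : T -> T') :
  {within D, continuous f} <-> forall x, D x -> forall N, nbhs (f x) N -> nbhs x [set x' | D x' -> N (f x')].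
Proof. by rewrite -subspace_continuousP. Qed.

Lemma midl (R : realType) (a b : R) : a <= b -> a <= (a + b) / 2.
Proof. by move=> h; lraH h. Qed.
Lemma midr (R : realType) (a b : R) : a <= b -> (a + b) / 2 <= b.
Proof. by move=> h; lraH h. Qed.

Definition rect (R : realType) (a b c d : R) : set (R * R) := [set q | a <= q.1 <= b /\ c <= q.2 <= d].

Lemma near_rect (R : realType) (x y : R) (P : set (R * R)) : nbhs (x, y) P -> exists2 e : R, 0 < e & forall a b c d,
  a <= x -> x <= b -> c <= y -> y <= d -> b - a < e -> d - c < e -> rect a b c d `<=` P.
Proof.
move=> /nbhs_ballP[e /= e0 he]; exists e => // a b c d ax xb cy yd ab cd [u v] [/= /andP[u1 u2] /andP[v1 v2]].
by apply: he; split; rewrite /ball /= ltr_norml; apply/andP; split; [lraH ax xb ab u1 u2|lraH ax xb ab u1 u2|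
  lraH cy yd cd v1 v2|lraH cy yd cd v1 v2].
Qed.

Section Paths.
Variables (R : realType) (Y : topologicalType).
Local Notation I01 := (`[0, 1]%classic : set R).

Lemma I01P (t : R) : I01 t <-> (0 <= t /\ t <= 1).
Proof. by rewrite /= in_itv /=; split=> [/andP[]|[-> ->]]. Qed.

Lemma within_comp (T T' T'' : topologicalType) (D : set T) (D' : set T') (f : T -> T') (g : T' -> T'') :
  (forall x, D x -> D' (f x)) -> {within D, continuous f} -> {within D', continuous g} ->
  {within D, continuous (g \o f)}.
Proof.
move=> h /within_continuousP cf /within_continuousP cg; apply/within_continuousP => x Dx N hN.
by apply: filterS (cf _ Dx _ (cg _ (h _ Dx) _ hN)) => x' /= k Dx'; apply: k => //; exact: h.
Qed.

Lemma I01_0 : I01 0. Proof. by apply/I01P. Qed.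
Lemma I01_1 : I01 1. Proof. by apply/I01P. Qed.

Lemma pair_continuous (f g : R -> R) : continuous f -> continuous g -> continuous (fun t => (f t, g t)).
Proof. by move=> cf cg t; apply: (@cvg_pair _ _ _ _ (nbhs (f t)) (nbhs (g t))); [exact: cf|exact: cg]. Qed.

Lemma affine_fun_continuous (a b : R) : continuous (fun t => a * t + b : R).
Proof. by move=> t; apply: continuousD; [exact: mulrl_continuous|exact: cst_continuous]. Qed.

Lemma affine_I01 (a b t : R) : 0 <= b <= 1 -> 0 <= a + b <= 1 -> I01 t -> I01 (a * t + b).
Proof.
move=> /andP[b0 b1] /andP[ab0 ab1] /I01P[t0 t1]; apply/I01P.
have -> : a * t + b = (1 - t) * b + t * (a + b) by ring.
have t1' : 0 <= 1 - t by rewrite subr_ge0.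
split; first by rewrite addr_ge0 // mulr_ge0.
have h1 : (1 - t) * b <= 1 - t by rewrite ler_piMr.
have h2 : t * (a + b) <= t by rewrite ler_piMr.
by lraH h1 h2.
Qed.

Lemma affine_continuous (a b : R) (D : set R) : {within D, continuous (fun t => a * t + b : R)}.
Proof. by apply: continuous_subspaceT; exact: affine_fun_continuous. Qed.

Lemma half_unit : 0 <= (1 / 2 : R) <= 1.
Proof. by apply/andP; split; lra. Qed.

Definition concat (c1 c2 : R -> Y) (t : R) := if t <= 1 / 2 then c1 (2 * t) else c2 (2 * t - 1).

Lemma half01 : (0 : R) <= 1 / 2 /\ (1 / 2 : R) <= 1.
Proof. by split; lra. Qed.

Lemma concat_continuous c1 c2 : c1 1 = c2 0 -> {within I01, continuous c1} -> {within I01, continuous c2} ->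
  {within I01, continuous (concat c1 c2)}.
Proof.
move=> e h1 h2.
have -> : I01 = `[0, 1 / 2]%classic `|` `[1 / 2, 1]%classic.
  apply/seteqP; split=> t /=; rewrite !in_itv /=.
    by move=> /andP[t0 t1]; case: (leP t (1 / 2)) => h; [left; rewrite t0|right; rewrite t1 (ltW h)].
  have [a b] := half01; by move=> [/andP[t0 t1]|/andP[t0 t1]]; apply/andP; split=> //; [exact: le_trans b|exact: le_trans t0].
apply: withinU_continuous; try exact: interval_closed.
  apply: (@subspace_eq_continuous _ _ _ (c1 \o (fun t => 2 * t))).
    by move=> t; rewrite inE /= in_itv /= => /andP[_ t1]; rewrite /from_subspace /concat t1.
  apply: within_comp h1.
    by move=> t /=; rewrite !in_itv /= => /andP[a b]; apply/andP; split; lraH a b.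
  by apply: continuous_subspaceT; exact: mulrl_continuous.
apply: (@subspace_eq_continuous _ _ _ (c2 \o (fun t => 2 * t - 1))).
  move=> t; rewrite inE /= in_itv /= => /andP[t0 t1]; rewrite /from_subspace /concat.
  case: leP => // h; have -> : t = 1 / 2 by apply/eqP; rewrite eq_le h.
  by rewrite mulrCA mulfV ?pnatr_eq0 // mulr1 subrr e.
apply: within_comp h2.
  by move=> t /=; rewrite !in_itv /= => /andP[a b]; apply/andP; split; lraH a b.
exact: affine_continuous.
Qed.

Lemma concat_l c1 c2 t : I01 t -> concat c1 c2 (1 / 2 * t + 0) = c1 t.
Proof.
move=> /I01P[a b]; rewrite /concat ifT; first by congr c1; field.
by lraH a b.
Qed.

Lemma concat_r c1 c2 t : c1 1 = c2 0 -> I01 t -> concat c1 c2 (1 / 2 * t + 1 / 2) = c2 t.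
Proof.
move=> e /I01P[a b]; rewrite /concat; case: leP => [h|_]; last by congr c2; field.
have -> : t = 0 by apply/eqP; rewrite eq_le a andbT; lraH h.
by rewrite -e; congr c1; field.
Qed.

Lemma concat0 c1 c2 : concat c1 c2 0 = c1 0.
Proof. by rewrite /concat mulr0 ifT // divr_ge0. Qed.

Lemma concat1 c1 c2 : concat c1 c2 1 = c2 1.
Proof.
rewrite /concat ifF; last by apply/negbTE; rewrite -ltNge; lra.
by congr c2; ring.
Qed.

End Paths.

Section Monodromy.
Variables (R : realType) (Y : topologicalType) (F : Type).
Variables (A : Y -> set F) (Flat : set Y -> (Y -> F) -> Prop).
Hypothesis Flat_sub : forall U V s, open V -> V `<=` U -> Flat U s -> Flat V s.
Hypothesis Flat_adm : forall U s b, Flat U s -> U b -> A b (s b).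
Hypothesis Flat_ex : forall b, exists2 U, open U /\ U b &
  forall b' f, U b' -> A b' f -> exists2 s, Flat U s & s b' = f.
Hypothesis Flat_uniq : forall U s s' b, open U -> Flat U s -> Flat U s' -> U b ->
  \forall b' \near b, (s b' = s' b') <-> (s b = s' b).

(** A lift of H over D: locally sg is a flat section composed with H. Neighbourhoods are relative to
    D because the rectangles to be lifted over are closed. *)
Definition sec (T : topologicalType) (D : set T) (H : T -> Y) (sg : T -> F) :=
  forall x, D x -> exists (U : set Y) (s : Y -> F),
    [/\ open U, Flat U s, U (H x) & nbhs x [set x' | D x' -> U (H x') /\ sg x' = s (H x')]].

Lemma sec_comp (T T' : topologicalType) (D : set T) (D' : set T') H sg (phi : T' -> T) :
  (forall x, D' x -> D (phi x)) -> {within D', continuous phi} -> sec D H sg -> sec D' (H \o phi) (sg \o phi).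
Proof.
move=> hD /within_continuousP cp hs x Dx; have [U [s [oU fs Ux hn]]] := hs _ (hD _ Dx).
exists U, s; split=> //.
by apply: filterS (cp x Dx _ hn) => x' /= h D'x'; apply: h => //; exact: hD.
Qed.

Lemma sec_sub (T : topologicalType) (D D' : set T) H sg : D' `<=` D -> sec D H sg -> sec D' H sg.
Proof.
move=> sD hs x Dx; have [U [s [oU fs Ux hn]]] := hs _ (sD _ Dx); exists U, s; split=> //.
by apply: filterS hn => x' /= h /sD.
Qed.

Lemma sec_adm (T : topologicalType) (D : set T) H sg x : sec D H sg -> D x -> A (H x) (sg x).
Proof.
move=> hs Dx; have [U [s [oU fs Ux /nbhs_singleton/= /(_ Dx)[_ ->]]]] := hs _ Dx.
exact: Flat_adm fs Ux.
Qed.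

Lemma sec_near (T : topologicalType) (D : set T) H sg sg' x : {within D, continuous H} ->
  sec D H sg -> sec D H sg' -> D x ->
  nbhs x [set x' | D x' -> (sg x' = sg' x') <-> (sg x = sg' x)].
Proof.
move=> /within_continuousP cH hs hs' Dx.
have [U [s [oU fs Ux hn]]] := hs _ Dx; have [U' [s' [oU' fs' Ux' hn']]] := hs' _ Dx.
have oUU : open (U `&` U') by exact: openI.
have := Flat_uniq oUU (Flat_sub oUU (@subIsetl _ _ _) fs) (Flat_sub oUU (@subIsetr _ _ _) fs') (conj Ux Ux').
move=> /(cH x Dx) hu; have [_ e] := nbhs_singleton hn Dx; have [_ e'] := nbhs_singleton hn' Dx.
apply: filterS (filterI hu (filterI hn hn')) => x' /= [h1 [h2 h3]] Dx'.
by have [_ ->] := h2 Dx'; have [_ ->] := h3 Dx'; rewrite e e'; exact: h1.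
Qed.

(** Near each point, agreement of the two lifts at any place is equivalent to agreement at that
    point; quadrisection spreads this over the rectangle in place of a connectedness argument. *)
Lemma rect_uniq (a0 b0 c0 d0 : R) H sg sg' q q' : {within rect a0 b0 c0 d0, continuous H} ->
  sec (rect a0 b0 c0 d0) H sg -> sec (rect a0 b0 c0 d0) H sg' ->
  rect a0 b0 c0 d0 q -> rect a0 b0 c0 d0 q' -> sg q = sg' q -> sg q' = sg' q'.
Proof.
move=> cH hs hs' Dq Dq'.
have ab : a0 <= b0 by case: Dq => /andP[h1 h2] _; exact: le_trans h2.
have cd : c0 <= d0 by case: Dq => _ /andP[h1 h2]; exact: le_trans h2.
pose P a b c d := a0 <= a -> b <= b0 -> c0 <= c -> d <= d0 ->
  forall q q', rect a b c d q -> rect a b c d q' -> sg q = sg' q -> sg q' = sg' q'.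
have := @quadrisection R P a0 b0 c0 d0 ab cd; apply => //; last first.
- move=> x y xab ycd; have Dxy : rect a0 b0 c0 d0 (x, y) by [].
  have [e e0 he] := near_rect (sec_near cH hs hs' Dxy); exists e => //.
  move=> a b c d a0a ax xb bb0 c0c cy yd dd0 abe cde _ _ _ _ p p' rp rp'.
  have sub : rect a b c d `<=` rect a0 b0 c0 d0.
    move=> [u v] [/= /andP[u1 u2] /andP[v1 v2]].
    by split; apply/andP; split; [exact: le_trans u1|exact: le_trans bb0|exact: le_trans v1|exact: le_trans dd0].
  have h r : rect a b c d r -> (sg r = sg' r) <-> (sg (x, y) = sg' (x, y)).
    by move=> rr; apply: (he a b c d) => //; exact: sub.
  by move=> /(h _ rp) /(h _ rp').
move=> a b c d ab' cd' m k P1 P2 P3 P4 ha hb hc hd.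
have am : a <= m by exact: midl.
have mb : m <= b by exact: midr.
have ck : c <= k by exact: midl.
have kd : k <= d by exact: midr.
have hm : a0 <= m by exact: le_trans am.
have hm' : m <= b0 by exact: le_trans hb.
have hk : c0 <= k by exact: le_trans ck.
have hk' : k <= d0 by exact: le_trans hd.
(* All four quarters contain the centre (m, k), so agreement anywhere is compared with agreement
   there. *)
have toc r : rect a b c d r -> (sg r = sg' r) <-> (sg (m, k) = sg' (m, k)).
  case: r => u v [/= /andP[u1 u2] /andP[v1 v2]].
  have key a' b' c' d' : P a' b' c' d' -> a0 <= a' -> b' <= b0 -> c0 <= c' -> d' <= d0 ->
     a' <= u -> u <= b' -> c' <= v -> v <= d' -> a' <= m -> m <= b' -> c' <= k -> k <= d' ->
     (sg (u, v) = sg' (u, v)) <-> (sg (m, k) = sg' (m, k)).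
    move=> hP i1 i2 i3 i4 j1 j2 j3 j4 j5 j6 j7 j8.
    have r1 : rect a' b' c' d' (u, v) by split; apply/andP; split.
    have r2 : rect a' b' c' d' (m, k) by split; apply/andP; split.
    by split; apply: hP.
  case: (leP u m) => [um|/ltW um]; case: (leP v k) => [vk|/ltW vk].
  - exact: (key _ _ _ _ P1).
  - exact: (key _ _ _ _ P3).
  - exact: (key _ _ _ _ P2).
  - exact: (key _ _ _ _ P4).
by move=> p p' /toc h1 /toc h2; rewrite h1 h2.
Qed.

(** At a point of both pieces the two local sections coincide, hence nearby by [Flat_uniq]. At a
    point of one piece only, closedness keeps the other piece away. *)
Lemma sec_union (T : topologicalType) (D1 D2 : set T) H s1 s2 : closed D1 -> closed D2 ->
  {within D1 `|` D2, continuous H} ->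
  sec D1 H s1 -> sec D2 H s2 -> (forall x, D1 x -> D2 x -> s1 x = s2 x) ->
  sec (D1 `|` D2) H (fun x => if `[< D1 x >] then s1 x else s2 x).
Proof.
move=> cD1 cD2 /within_continuousP cH h1 h2 h12.
have out (D : set T) x : closed D -> ~ D x -> \forall x' \near x, ~ D x'.
  by move=> cD nD; apply: open_nbhs_nbhs; split=> //; exact: closed_openC.
move=> x Dx; case: (pselect (D1 x)) => [D1x|nD1]; last first.
  case: Dx => // D2x; have [U [s [oU fs Ux hn]]] := h2 _ D2x; exists U, s; split=> //.
  apply: filterS (filterI hn (out _ _ cD1 nD1)) => x' [/= k1 k2] [//|D2x'].
  by case: asboolP => // _; exact: k1.
have [U [s [oU fs Ux hn]]] := h1 _ D1x.
case: (pselect (D2 x)) => [D2x|nD2]; last first.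
  exists U, s; split=> //; apply: filterS (filterI hn (out _ _ cD2 nD2)) => x' [/= k1 k2] [D1x'|//].
  by case: asboolP => // _; exact: k1.
have [U' [s' [oU' fs' Ux' hn']]] := h2 _ D2x.
have oUU : open (U `&` U') by exact: openI.
have [_ e1] := nbhs_singleton hn D1x; have [_ e2] := nbhs_singleton hn' D2x.
have e12 : s (H x) = s' (H x) by rewrite -e1 -e2; exact: h12.
have := Flat_uniq oUU (Flat_sub oUU (@subIsetl _ _ _) fs) (Flat_sub oUU (@subIsetr _ _ _) fs') (conj Ux Ux').
move=> hu; have hUU : nbhs (H x) (U `&` U') by exact: open_nbhs_nbhs.
have hh := cH x Dx _ (@filterI _ _ (nbhs_filter _) _ _ hu hUU).
exists (U `&` U'), s; split=> //; first exact: Flat_sub fs.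
apply: filterS (filterI hh (filterI hn hn')) => x' /= [k0 [k1 k2]] Dx'.
have [k3 k4] := k0 Dx'; split=> //; case: asboolP => [/k1[] //|nD1].
by case: Dx' => // /k2[_ ->]; apply/esym/k3.
Qed.

Lemma closed_rect (a b c d : R) : closed (rect a b c d).
Proof.
have -> : rect a b c d = (fst @^-1` `[a, b]) `&` (snd @^-1` `[c, d]).
  by apply/seteqP; split=> q /=; rewrite !in_itv.
apply: closedI; apply: preimage_closed => //; try exact: interval_closed.
- by move=> q _; exact: cvg_fst.
- by move=> q _; exact: cvg_snd.
Qed.

(** Lifts over the quarters are glued first horizontally, then vertically. Along a common edge they
    agree at one end by the choice of initial value, hence on the whole edge by [rect_uniq] for a
    degenerate rectangle. *)
Lemma rect_ex (a0 b0 c0 d0 : R) H q f : {within rect a0 b0 c0 d0, continuous H} ->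
  rect a0 b0 c0 d0 q -> A (H q) f -> exists2 sg, sec (rect a0 b0 c0 d0) H sg & sg q = f.
Proof.
move=> cH Dq.
have ab : a0 <= b0 by case: Dq => /andP[h1 h2] _; exact: le_trans h2.
have cd : c0 <= d0 by case: Dq => _ /andP[h1 h2]; exact: le_trans h2.
have rsub a b c d : a0 <= a -> b <= b0 -> c0 <= c -> d <= d0 -> rect a b c d `<=` rect a0 b0 c0 d0.
  move=> h1 h2 h3 h4 [u v] [/= /andP[u1 u2] /andP[v1 v2]].
  by split; apply/andP; split; [exact: le_trans u1|exact: le_trans h2|exact: le_trans v1|exact: le_trans h4].
have ccH a b c d : a0 <= a -> b <= b0 -> c0 <= c -> d <= d0 -> {within rect a b c d, continuous H}.
  by move=> h1 h2 h3 h4; apply: continuous_subspaceW cH; exact: rsub.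
pose P a b c d := a0 <= a -> b <= b0 -> c0 <= c -> d <= d0 -> 
  forall q f, rect a b c d q -> A (H q) f -> exists2 sg, sec (rect a b c d) H sg & sg q = f.
have := @quadrisection R P a0 b0 c0 d0 ab cd; move=> h; apply: h q f Dq => //; last first.
- move=> x y xab ycd; have Dxy : rect a0 b0 c0 d0 (x, y) by [].
  have [U [oU Ux] hU] := Flat_ex (H (x, y)).
  have /within_continuousP /(_ _ Dxy) := cH.
  move=> /(_ U (open_nbhs_nbhs (conj oU Ux))) /near_rect[e e0 he]; exists e => //.
  move=> a b c d a0a ax xb bb0 c0c cy yd dd0 abe cde _ _ _ _ q f rq Af.
  have sub := rsub a b c d a0a bb0 c0c dd0.
  have HU r : rect a b c d r -> U (H r).
    by move=> rr; apply: (he a b c d) => //; exact: sub.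
  have [s fs sq] := hU _ _ (HU _ rq) Af.
  exists (s \o H) => // r rr; exists U, s; split=> //; first exact: HU.
  by apply: filterS filterT => r' _ /= /HU.
move=> a b c d ab' cd' m k P1 P2 P3 P4 ha hb hc hd q f rq Af.
have am : a <= m by exact: midl.
have mb : m <= b by exact: midr.
have ck : c <= k by exact: midl.
have kd : k <= d by exact: midr.
have hm : a0 <= m by exact: le_trans am.
have hm' : m <= b0 by exact: le_trans hb.
have hk : c0 <= k by exact: le_trans ck.
have hk' : k <= d0 by exact: le_trans hd.
pose join (D1 D2 D : set (R * R)) q0 := [/\ closed D1 /\ closed D2, D1 `|` D2 = D, D `<=` rect a b c d, D1 q0 /\ D2 q0 &
  forall s1 s2, sec (D1 `&` D2) H s1 -> sec (D1 `&` D2) H s2 -> s1 q0 = s2 q0 ->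
    forall r, (D1 `&` D2) r -> s1 r = s2 r].
pose Ex D := forall q f, D q -> A (H q) f -> exists2 sg, sec D H sg & sg q = f.
have joinP D1 D2 D q0 : join D1 D2 D q0 -> Ex D1 -> Ex D2 -> Ex D.
  move=> [[c1 c2] <- Dsub [D1q D2q] un] E1 E2 r g Dr Ag.
  have cD : {within D1 `|` D2, continuous H}.
    by apply: continuous_subspaceW (ccH a b c d ha hb hc hd).
  case: (pselect (D1 r)) => [D1r|nD1r].
    have [s1 hs1 s1r] := E1 _ _ D1r Ag.
    have [s2 hs2 s2q] := E2 _ _ D2q (sec_adm hs1 D1q).
    exists (fun x => if `[< D1 x >] then s1 x else s2 x); last by case: asboolP.
    apply: sec_union => // x D1x D2x; apply: (un s1 s2) => //.
    - by apply: sec_sub hs1 => ? [].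
    - by apply: sec_sub hs2 => ? [].
  have D2r : D2 r by case: Dr.
  have [s2 hs2 s2r] := E2 _ _ D2r Ag.
  have [s1 hs1 s1q] := E1 _ _ D1q (sec_adm hs2 D2q).
  exists (fun x => if `[< D1 x >] then s1 x else s2 x); last by case: asboolP.
  apply: sec_union => // x D1x D2x; apply: (un s1 s2) => //.
  - by apply: sec_sub hs1 => ? [].
  - by apply: sec_sub hs2 => ? [].
have runi a' b' c' d' (D : set (R * R)) q0 : a <= a' -> b' <= b -> c <= c' -> d' <= d -> D = rect a' b' c' d' -> D q0 ->
  forall s1 s2, sec D H s1 -> sec D H s2 -> s1 q0 = s2 q0 -> forall r, D r -> s1 r = s2 r.
  move=> i1 i2 i3 i4 -> Dq0 s1 s2 hs1 hs2 e r Dr; apply: rect_uniq hs1 hs2 Dq0 Dr e.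
  by apply: ccH; [exact: le_trans i1|exact: le_trans hb|exact: le_trans i3|exact: le_trans hd].
have rle a' b' c' d' u v : rect a' b' c' d' (u, v) <-> ((a' <= u /\ u <= b') /\ (c' <= v /\ v <= d')).
  by split=> [[/= /andP[? ?] /andP[? ?]]|[[? ?] [? ?]]] //; split; apply/andP.
have horiz c' d' : c <= c' -> c' <= d' -> d' <= d -> join (rect a m c' d') (rect m b c' d') (rect a b c' d') (m, c').
  move=> i1 i2 i3; split; first by split; exact: closed_rect.
  - apply/seteqP; split=> -[u v]; rewrite /setU /= !rle; first by move=> [[[? ?] ?]|[[? ?] ?]]; split=> //; split=> //; [exact: le_trans mb|exact: le_trans am _].
    by move=> [[? ?] ?]; case: (leP u m) => um; [left|right; split=> //; split=> //; exact: ltW].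
  - move=> [u v]; rewrite !rle => -[[? ?] [? ?]]; split=> //; split; [exact: le_trans i1 _|exact: le_trans i3].
  - by rewrite !rle.
  apply: (runi m m c' d') => //; last by split; rewrite rle.
  apply/seteqP; split=> -[u v]; rewrite /setI /= !rle.
    by move=> [[[? ?] ?] [[? ?] ?]].
  by move=> [[mu um] ?]; split; split=> //; split=> //; [exact: le_trans am mu|exact: le_trans um mb].
have vert : join (rect a b c k) (rect a b k d) (rect a b c d) (a, k).
  split; first by split; exact: closed_rect.
  - apply/seteqP; split=> -[u v]; rewrite /setU /= !rle.
      by move=> [[? [? ?]]|[? [? ?]]]; split=> //; split=> //; [exact: le_trans kd|exact: le_trans ck _].
    by move=> [? [? ?]]; case: (leP v k) => um; [left|right; split=> //; split=> //; exact: ltW].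
  - by [].
  - by rewrite !rle.
  apply: (runi a b k k) => //; last by split; rewrite rle.
  apply/seteqP; split=> -[u v]; rewrite /setI /= !rle.
    by move=> [[? [? ?]] [? [? ?]]].
  by move=> [? [kv vk]]; split; split=> //; split=> //; [exact: le_trans ck kv|exact: le_trans vk kd].
have Pd (a' b' c' d' : R) : P a' b' c' d' -> a0 <= a' -> b' <= b0 -> c0 <= c' -> d' <= d0 -> Ex (rect a' b' c' d') by [].
apply: (joinP _ _ _ _ vert) rq Af.
- by apply: (joinP _ _ _ _ (horiz c k _ _ _)) => //; [exact: P1|exact: P2].
- by apply: (joinP _ _ _ _ (horiz k d _ _ _)) => //; [exact: P3|exact: P4].
Qed.

Lemma sec_eq (T : topologicalType) (D : set T) H H' sg : (forall x, D x -> H x = H' x) -> sec D H sg -> sec D H' sg.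
Proof.
move=> e hs x Dx; have [U [s [oU fs Ux hn]]] := hs _ Dx; exists U, s; split=> //; first by rewrite -e.
by apply: filterS hn => x' /= h Dx'; rewrite -e //; exact: h.
Qed.

Local Notation I01 := (`[0, 1]%classic : set R).

(** A path is treated as a map on a rectangle of height 0. *)
Lemma path_uniq c sg sg' t t' : {within I01, continuous c} -> sec I01 c sg -> sec I01 c sg' ->
  I01 t -> I01 t' -> sg t = sg' t -> sg t' = sg' t'.
Proof.
move=> cc h1 h2 It It' e.
have hD (q : R * R) : rect 0 1 0 0 q -> I01 q.1 by move=> [/andP[? ?] _]; apply/I01P.
have cf : {within rect 0 1 0 0, continuous (fst : R * R -> R)}.
  by apply: continuous_subspaceT => q; exact: cvg_fst.
have r x : I01 x -> rect 0 1 0 0 (x, 0 : R) by move=> /I01P[h3 h4]; split=> /=; rewrite ?h3 ?h4 ?lexx.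
apply: (rect_uniq (within_comp hD cf cc) (sec_comp hD cf h1) (sec_comp hD cf h2) (r _ It) (r _ It')).
exact: e.
Qed.

Lemma path_ex c f : {within I01, continuous c} -> A (c 0) f -> exists2 sg, sec I01 c sg & sg 0 = f.
Proof.
move=> cc Af.
have hD (q : R * R) : rect 0 1 0 0 q -> I01 q.1 by move=> [/andP[? ?] _]; apply/I01P.
have cf : {within rect 0 1 0 0, continuous (fst : R * R -> R)}.
  by apply: continuous_subspaceT => q; exact: cvg_fst.
have r0 : rect 0 1 0 0 (0 : R, 0 : R) by split=> /=; rewrite ?lexx ?ler01.
have [sg hs s0] := rect_ex (within_comp hD cf cc) r0 Af.
exists (sg \o (fun x => (x, 0))) => //.
have : sec I01 ((c \o fst) \o (fun x => (x, 0 : R))) (sg \o (fun x => (x, 0))).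
  apply: sec_comp hs.
  - by move=> x /I01P[h3 h4]; split=> /=; rewrite ?h3 ?h4 ?lexx.
  - by apply: continuous_subspaceT; apply: pair_continuous => x; [exact: cvg_id|exact: cvg_cst].
by [].
Qed.

Lemma concat_sec c1 c2 sg : c1 1 = c2 0 -> sec I01 (concat c1 c2) sg ->
  sec I01 c1 (fun t => sg (1 / 2 * t + 0)) /\ sec I01 c2 (fun t => sg (1 / 2 * t + 1 / 2)).
Proof.
move=> e hs; split.
  have : sec I01 (concat c1 c2 \o (fun t => 1 / 2 * t + 0)) (sg \o (fun t => 1 / 2 * t + 0)).
    apply: sec_comp hs; last exact: affine_continuous.
    by move=> t; apply: affine_I01; rewrite ?addr0 ?lexx ?ler01 ?half_unit.
  by apply: sec_eq => t /(concat_l c1 c2).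
have : sec I01 (concat c1 c2 \o (fun t => 1 / 2 * t + 1 / 2)) (sg \o (fun t => 1 / 2 * t + 1 / 2)).
  apply: sec_comp hs; last exact: affine_continuous.
  by move=> t; apply: affine_I01; rewrite -?splitr ?lexx ?ler01 ?half_unit.
by apply: sec_eq => t /(concat_r e).
Qed.

Lemma sec_cst (T : topologicalType) (D : set T) b f : A b f -> sec D (fun=> b) (fun=> f).
Proof.
move=> Af x Dx; have [U [oU Ub] hU] := Flat_ex b; have [s fs sb] := hU _ _ Ub Af.
by exists U, s; split=> //; apply: filterS filterT => x' _ /= _; rewrite sb.
Qed.

Hypothesis Ysc : simply_connected R Y.
Hypothesis Ylpc : forall (y : Y) U, nbhs y U -> exists2 N, nbhs y N & forall y', N y' ->
  exists c : R -> Y, [/\ {within I01, continuous c}, c 0 = y, c 1 = y' & forall t, I01 t -> U (c t)].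
Variables (b0 : Y) (f0 : F).
Hypothesis A0 : A b0 f0.

Definition transport y f := exists c sg, [/\ {within I01, continuous c}, c 0 = b0 /\ c 1 = y,
  sec I01 c sg, sg 0 = f0 & sg 1 = f].

Lemma transport_ex y : exists f, transport y f.
Proof.
have [[_ pc] _] := Ysc; have [c [cc c0 c1]] := pc b0 y.
have [|sg hs s0] := @path_ex c f0 cc; first by rewrite c0.
by exists (sg 1), c, sg; split.
Qed.

(** A null homotopy of the loop is lifted. It is constant on three sides of the square, so the lift
    is constant there by uniqueness; the fourth side is the loop, whose lift therefore returns to
    f0. *)
Lemma loop_trivial c sg : {within I01, continuous c} -> c 0 = b0 -> c 1 = b0 ->
  sec I01 c sg -> sg 0 = f0 -> sg 1 = f0.
Proof.
move=> cc c0 c1 hs s0.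
have [_ /(_ c cc (etrans c0 (esym c1)))[H [cH H0 H1 Hs]]] := Ysc.
have rE : `[0, 1] `*` `[0, 1] = rect 0 1 0 1 :> set (R * R).
  by apply/seteqP; split=> q /=; rewrite !in_itv.
rewrite rE in cH.
have r00 : rect 0 1 0 1 (0 : R, 0 : R) by split=> /=; rewrite lexx ler01.
have [S hS S0] : exists2 S, sec (rect 0 1 0 1) H S & S (0, 0) = f0.
  apply: rect_ex => //; rewrite H0 ?c0 //; exact: I01_0.
have edge (phi : R -> R * R) g : continuous phi -> (forall t, I01 t -> rect 0 1 0 1 (phi t)) ->
    (forall t, I01 t -> H (phi t) = g t) -> sec I01 g (S \o phi).
  move=> cphi hphi hg; have := sec_comp hphi (continuous_subspaceT cphi) hS; exact: sec_eq.
have hor (x : R) : continuous (fun t : R => (t, x)) by apply: pair_continuous => t; [exact: cvg_id|exact: cvg_cst].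
have ver (x : R) : continuous (fun t : R => (x, t)) by apply: pair_continuous => t; [exact: cvg_cst|exact: cvg_id].
have rh (x : R) t : I01 x -> I01 t -> rect 0 1 0 1 (t, x).
  by move=> /I01P[? ?] /I01P[? ?]; split; apply/andP.
have cb : {within I01, continuous (fun=> b0)} by apply: continuous_subspaceT; exact: cst_continuous.
have cs := @sec_cst R I01 b0 f0 A0.
have e1 : S (1, 0) = f0.
  have h := edge _ (fun=> b0) (hor 0) (fun t It => rh _ _ (I01_0 R) It) _.
  apply: (path_uniq cb (h _) cs (I01_0 R) (I01_1 R)) => // t It.
  by have [-> _] := Hs _ It; rewrite c0.
have e2 : S (1, 1) = f0.
  have h := edge _ (fun=> b0) (ver 1) (fun t It => rh _ _ It (I01_1 R)) _.
  apply: (path_uniq cb (h _) cs (I01_0 R) (I01_1 R)) => // t It.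
  by rewrite H1 // c0.
have e3 : S (0, 1) = f0.
  have h := edge _ (fun=> b0) (hor 1) (fun t It => rh _ _ (I01_1 R) It) _.
  apply: (path_uniq cb (h _) cs (I01_1 R) (I01_0 R)) => // t It.
  by have [_ ->] := Hs _ It; rewrite c0.
have h := edge _ c (ver 0) (fun t It => rh _ _ It (I01_0 R)) (fun t It => H0 t It).
rewrite (path_uniq cc hs h (I01_0 R) (I01_1 R)) //=.
by rewrite s0 S0.
Qed.

(** The first path followed by the reverse of the second is a loop. Its lift closes up, and its two
    halves are the given lifts, the second one reversed. *)
Lemma transport_uniq y f f' : transport y f -> transport y f' -> f = f'.
Proof.
move=> [c [sg [cc [c0 c1] hs s0 s1]]] [c' [sg' [cc' [c0' c1'] hs' s0' s1']]].
pose d t := c' (-1 * t + 1).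
have cd : {within I01, continuous d}.
  apply: (within_comp _ (@affine_continuous R (-1) 1 _) cc') => t.
  by apply: affine_I01; rewrite ?addNr ?lexx ?ler01.
have e : c 1 = d 0 by rewrite c1 /d mulr0 add0r c1'.
have cl := concat_continuous e cc cd.
have l0 : concat c d 0 = b0 by rewrite concat0.
have l1 : concat c d 1 = b0.
  by rewrite concat1 /d -c0'; congr c'; ring.
have [|tau ht t0] := @path_ex _ f0 cl; first by rewrite l0.
have t1 := loop_trivial cl l0 l1 ht t0.
have [h1 h2] := concat_sec e ht.
have E1 : tau (1 / 2 * 1 + 0) = f.
  have := path_uniq cc h1 hs (I01_0 R) (I01_1 R); rewrite s1; apply.
  by rewrite mulr0 addr0 t0.
have h3 : sec I01 c' (fun t => tau (1 / 2 * (-1 * t + 1) + 1 / 2)).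
  have : sec I01 (d \o (fun t => -1 * t + 1)) ((fun t => tau (1 / 2 * t + 1 / 2)) \o (fun t => -1 * t + 1)).
    apply: (sec_comp _ (@affine_continuous R (-1) 1 _) h2) => t.
    by apply: affine_I01; rewrite ?addNr ?lexx ?ler01.
  by apply: sec_eq => t _; rewrite /d /=; congr c'; ring.
have E2 : tau (1 / 2 * (-1 * 1 + 1) + 1 / 2) = f'.
  have := path_uniq cc' h3 hs' (I01_0 R) (I01_1 R); rewrite s1'; apply.
  by rewrite s0' -t1; congr tau; field.
by rewrite -E1 -E2; congr tau; ring.
Qed.

(* Flat U s plays the role of a section over U of a covering space: paths are lifted by
   bisecting the interval, homotopies by bisecting the square. *)
Theorem monodromy : exists S : Y -> F, S b0 = f0 /\
  forall y, exists U s, [/\ open U, U y, Flat U s & forall y', U y' -> S y' = s y'].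
Proof.
have [S hS] := choice transport_ex.
exists S; split.
  have cb : {within I01, continuous (fun=> b0)} by apply: continuous_subspaceT; exact: cst_continuous.
  apply: transport_uniq (hS _) _; exists (fun=> b0), (fun=> f0); split=> //; exact: sec_cst.
move=> y; have [U [oU Uy] hU] := Flat_ex y.
have [c [sg [cc [c0 c1] hs s0 s1]]] := hS y.
have Af : A y (S y) by rewrite -s1 -{1}c1; apply: sec_adm hs (I01_1 R).
have [s fs sy] := hU _ _ Uy Af.
have [N Ny hN] := Ylpc (open_nbhs_nbhs (conj oU Uy)).
move: Ny; rewrite nbhsE => -[V [oV Vy] VN].
have oUV : open (U `&` V) by exact: openI.
exists (U `&` V), s; split=> //; first exact: Flat_sub fs.
move=> y' [Uy' /VN/hN[d [cd d0 d1 dU]]].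
have e : c 1 = d 0 by rewrite c1.
have cl := concat_continuous e cc cd.
have l0 : concat c d 0 = b0 by rewrite concat0.
have [|tau ht t0] := @path_ex _ f0 cl; first by rewrite l0.
have [h1 h2] := concat_sec e ht.
have E1 : tau (1 / 2 * 1 + 0) = S y.
  have := path_uniq cc h1 hs (I01_0 R) (I01_1 R); rewrite s1; apply.
  by rewrite mulr0 addr0 t0.
(* A path inside U is lifted by s itself, so prolonging the path from y to y' carries [S y] to
   [s y']. *)
have h3 : sec I01 d (s \o d).
  move=> t It; exists U, s; split=> //; first exact: dU.
  by apply: filterS filterT => t' _ /= It'; split=> //; exact: dU.
have E2 : tau (1 / 2 * 1 + 1 / 2) = s y'.
  have := path_uniq cd h2 h3 (I01_0 R) (I01_1 R); rewrite /= d1; apply.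
  by rewrite d0 sy -E1; congr tau; ring.
rewrite -E2; apply: transport_uniq (hS y') _.
exists (concat c d), tau; split=> //.
  by rewrite concat1.
by congr tau; field.
Qed.

End Monodromy.

(** * Holomorphic maps between manifolds *)

Lemma has_cd_near (R : realType) (V W : normedModType (Cx R)) (f g : V -> W) x c :
  nbhs x [set z | f z = g z] -> has_cd f x c -> has_cd g x c.
Proof.
move=> /nbhs_rnP[d d0 dP] [h1 h2 h3]; split=> // e e0; have [d' d'0 dP'] := h3 e e0.
exists (Num.min d d'); first by rewrite lt_min d0.
move=> h; rewrite lt_min => /andP[hd hd'].
rewrite -(dP (x + h)); last by rewrite addrC addKr.
by rewrite -(dP x) ?subrr ?rn0 //; exact: dP'.
Qed.

Lemma differentiable_near (R : realType) (V W : normedModType (Cx R)) (f g : V -> W) x :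
  nbhs x [set z | f z = g z] -> differentiable f x -> differentiable g x /\ cd g x = cd f x.
Proof.
move=> h /differentiable_has_cd/(has_cd_near h) hg; split; first exact: has_cd_diff hg.
by apply/funext => v; exact: has_cd_val hg.
Qed.

Section Charts.
Variables (R : realType) (n : nat).
Local Notation C := (Cx R).
Local Notation V := 'rV[C]_n.
Implicit Types X Y Z : complexManifold R n.

Lemma chart_nbhs X (i : mindex X) p N : dom (mchart i) p -> nbhs p N ->
  nbhs (cmap (mchart i) p) [set x | cod (mchart i) x /\ N (cinv (mchart i) x)].
Proof.
move=> dp hN; have cp := cmap_cod dp.
have h1 : nbhs (cmap (mchart i) p) (cod (mchart i)) by apply: open_nbhs_nbhs; split=> //; exact: cod_open.
apply: filterI => //; apply: (cinv_continuous cp); rewrite cmapK //.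
Qed.

Lemma chart_nbhsV X (i : mindex X) p M : dom (mchart i) p -> nbhs (cmap (mchart i) p) M ->
  nbhs p [set q | dom (mchart i) q /\ M (cmap (mchart i) q)].
Proof.
move=> dp hM.
have h1 : nbhs p (dom (mchart i)) by apply: open_nbhs_nbhs; split=> //; exact: dom_open.
by apply: filterI => //; exact: (cmap_continuous dp).
Qed.

Lemma chart_image X (i : mindex X) (U : set X) x :
  (cmap (mchart i) @` (U `&` dom (mchart i))) x <-> cod (mchart i) x /\ U (cinv (mchart i) x).
Proof.
split=> [[q [Uq dq] <-]|[cx Ux]]; first by rewrite cmapK //; split=> //; exact: cmap_cod.
by exists (cinv (mchart i) x); [split=> //; exact: cinv_dom|exact: cinvK].
Qed.

Lemma chart_image_open X (i : mindex X) (U : set X) : open U -> open (cmap (mchart i) @` (U `&` dom (mchart i))).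
Proof.
move=> oU; rewrite openE => x /chart_image[cx Ux].
have := chart_nbhs (cinv_dom cx) (open_nbhs_nbhs (conj oU Ux)); rewrite cinvK //.
by apply: filterS => y /= ?; apply/chart_image.
Qed.

Definition holp X Y (F : X -> Y) p := {for p, continuous F} /\
  forall i j, dom (mchart i) p -> dom (mchart j) (F p) ->
    differentiable (local_rep F i j) (cmap (mchart i) p).

Lemma holomorphic_onP X Y (U : set X) (F : X -> Y) : holomorphic_on U F <-> forall p, U p -> holp F p.
Proof.
split=> [[h1 h2] p Up|h]; first by split=> [|i j]; [exact: h1|exact: h2].
by split=> [p /h[]//|p i j /h[_]]; exact.
Qed.

Lemma cont_nbhs X Y (F : X -> Y) p N : {for p, continuous F} -> nbhs (F p) N -> nbhs p [set q | N (F q)].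
Proof. by move=> h; exact: h. Qed.

Lemma has_cd_local_comp X Y Z (F : X -> Y) (G : Y -> Z) p i j k c d : {for p, continuous F} ->
  dom (mchart i) p -> dom (mchart j) (F p) ->
  has_cd (local_rep F i j) (cmap (mchart i) p) c -> has_cd (local_rep G j k) (cmap (mchart j) (F p)) d ->
  has_cd (local_rep (G \o F) i k) (cmap (mchart i) p) (d \o c).
Proof.
move=> cF di dj hF hG.
have e : local_rep F i j (cmap (mchart i) p) = cmap (mchart j) (F p) by rewrite /local_rep /= cmapK.
have hG' : has_cd (local_rep G j k) (local_rep F i j (cmap (mchart i) p)) d by rewrite e.
apply: has_cd_near (has_cd_comp hF hG').
have hd : nbhs (F p) (dom (mchart j)) by apply: open_nbhs_nbhs; split=> //; exact: dom_open.
apply: filterS (chart_nbhs di (cont_nbhs cF hd)) => x /= [_ dx].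
by rewrite /local_rep /= cmapK.
Qed.

Lemma holp_diff X Y (F : X -> Y) p i j : holp F p -> dom (mchart i) p -> dom (mchart j) (F p) ->
  has_cd (local_rep F i j) (cmap (mchart i) p) (cd (local_rep F i j) (cmap (mchart i) p)).
Proof. by move=> [_ h] di dj; apply: differentiable_has_cd; exact: h. Qed.

Lemma holp_comp X Y Z (F : X -> Y) (G : Y -> Z) p : holp F p -> holp G (F p) -> holp (G \o F) p.
Proof.
move=> hF hG; split=> [|i k di dk].
  by apply: continuous_comp; [exact: hF.1|exact: hG.1].
have dj := dom_chart_at (F p).
exact: has_cd_diff (has_cd_local_comp hF.1 di dj (holp_diff hF di dj) (holp_diff hG dj dk)).
Qed.

Lemma cd_comp X Y Z (F : X -> Y) (G : Y -> Z) p i j k v : holp F p -> holp G (F p) ->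
  dom (mchart i) p -> dom (mchart j) (F p) -> dom (mchart k) (G (F p)) ->
  cd (local_rep (G \o F) i k) (cmap (mchart i) p) v =
  cd (local_rep G j k) (cmap (mchart j) (F p)) (cd (local_rep F i j) (cmap (mchart i) p) v).
Proof.
move=> hF hG di dj dk.
exact: has_cd_val (has_cd_local_comp hF.1 di dj (holp_diff hF di dj) (holp_diff hG dj dk)).
Qed.

Lemma holp_id X p : holp (@id X) p.
Proof. by split=> [|i j]; [exact: cvg_id|exact: transition_holomorphic]. Qed.

Lemma cd_id X p (i : mindex X) v : dom (mchart i) p -> cd (local_rep (@id X) i i) (cmap (mchart i) p) v = v.
Proof.
move=> di; apply: (@has_cd_val _ _ _ _ _ id).
apply: (has_cd_near (f := id : V -> V)); last first.
  by apply: has_cd_lin => //; exists 1 => w; rewrite mul1r.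
have hd : nbhs (cmap (mchart i) p) (cod (mchart i)).
  by apply: open_nbhs_nbhs; split; [exact: cod_open|exact: cmap_cod].
by apply: filterS hd => x /= cx; rewrite /local_rep /= cinvK.
Qed.

Lemma holp_near X Y (F G : X -> Y) p : nbhs p [set q | F q = G q] -> holp F p -> holp G p /\
  forall i j, dom (mchart i) p -> dom (mchart j) (F p) ->
    cd (local_rep G i j) (cmap (mchart i) p) = cd (local_rep F i j) (cmap (mchart i) p).
Proof.
move=> FG hF; have e : F p = G p by exact: (nbhs_singleton FG).
have key i j : dom (mchart i) p -> dom (mchart j) (F p) ->
    differentiable (local_rep G i j) (cmap (mchart i) p) /\
    cd (local_rep G i j) (cmap (mchart i) p) = cd (local_rep F i j) (cmap (mchart i) p).
  move=> di dj; apply: differentiable_near; last exact: hF.2.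
  by apply: filterS (chart_nbhs di FG) => x /= [_]; rewrite /local_rep /= => ->.
split; last by move=> i j di dj; exact: (key i j di dj).2.
split=> [|i j di dj]; last by apply: (key i j di _).1; rewrite e.
move=> N; rewrite -e => hN; have := cont_nbhs hF.1 hN.
by move=> h; apply: filterS (filterI FG h) => q /= [<-].
Qed.

(** Transition maps being holomorphic, one pair of charts decides. *)
Lemma holp1 X Y (F : X -> Y) p i j : {for p, continuous F} -> dom (mchart i) p -> dom (mchart j) (F p) ->
  differentiable (local_rep F i j) (cmap (mchart i) p) -> holp F p.
Proof.
move=> cF di dj dF; split; first exact: cF.
move=> i' j' di' dj'.
have h1 := holp_diff (holp_id p) di' di; have h2 := differentiable_has_cd dF.
have h3 := holp_diff (holp_id (F p)) dj dj'.
have ci : {for p, continuous (@id X)} by exact: cvg_id.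
have := has_cd_local_comp (F := @id X) (G := F) ci di' di h1 h2.
move=> h4; have := has_cd_local_comp (F := F) (G := @id Y) cF di' dj h4 h3.
exact: has_cd_diff.
Qed.

Lemma cd_injective X Y (F : X -> Y) (G : Y -> X) p i j : holp F p -> holp G (F p) ->
  nbhs p [set q | G (F q) = q] -> dom (mchart i) p -> dom (mchart j) (F p) ->
  forall v, cd (local_rep F i j) (cmap (mchart i) p) v = 0 -> v = 0.
Proof.
move=> hF hG GF di dj v v0; have e : G (F p) = p by exact: (nbhs_singleton GF).
have dGF : dom (mchart i) ((G \o F) p) by rewrite /= e.
have [_ h] := holp_near GF (holp_comp hF hG).
have := cd_comp (k := i) v hF hG di dj dGF.
by rewrite v0 cd0 -(h i i di dGF) cd_id // => ->.
Qed.

End Charts.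

(** * Hermitian forms *)

Lemma quad_expand (R : realType) (a b c t : R) : a + t * b + (t * b + t * (t * c)) = a + 2 * t * b + t ^+ 2 * c.
Proof. ring. Qed.

Section HermAlg.
Variables (R : realType) (n : nat).
Local Notation C := (Cx R).
Local Notation V := 'rV[C]_n.
Local Notation M := 'M[C]_n.
Local Open Scope sesquilinear_scope.
Implicit Types (A B J P : M) (u v w : V).

Lemma hermE A u v : herm A u v = \sum_k \sum_l u 0 k * A k l * Num.conj (v 0 l).
Proof.
rewrite /herm mxE exchange_big /=; apply: eq_bigr => l _.
by rewrite !mxE mulr_suml.
Qed.

Lemma herm_pull J A u v : herm (J *m A *m J ^t*) u v = herm A (u *m J) (v *m J).
Proof. by rewrite /herm !mulmxA trmx_mul map_mxM /= !mulmxA. Qed.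

Lemma hermDl A u v w : herm A (u + v) w = herm A u w + herm A v w.
Proof. by rewrite /herm !mulmxDl mxE. Qed.
Lemma hermZl A (a : C) u w : herm A (a *: u) w = a * herm A u w.
Proof. by rewrite /herm -!scalemxAl mxE. Qed.
Lemma hermDr A u v w : herm A w (u + v) = herm A w u + herm A w v.
Proof. by rewrite /herm linearD /= map_mxD mulmxDr mxE. Qed.
Lemma hermZr A (a : C) u w : herm A w (a *: u) = Num.conj a * herm A w u.
Proof. by rewrite /herm linearZ /= map_mxZ -scalemxAr mxE. Qed.
Lemma herm0l A w : herm A 0 w = 0.
Proof. by rewrite -(scale0r 0) hermZl mul0r. Qed.
Lemma herm0r A w : herm A w 0 = 0.
Proof. by rewrite -(scale0r 0) hermZr rmorph0 mul0r. Qed.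
Lemma hermZm (a : C) A u v : herm (a *: A) u v = a * herm A u v.
Proof. by rewrite /herm -scalemxAr -scalemxAl mxE. Qed.
Lemma hermDm A B u v : herm (A + B) u v = herm A u v + herm B u v.
Proof. by rewrite /herm mulmxDr mulmxDl mxE. Qed.

Lemma hermC A u v : A ^t* = A -> herm A v u = Num.conj (herm A u v).
Proof.
move=> hA; rewrite !hermE rmorph_sum /= exchange_big; apply: eq_bigr => k _ /=.
rewrite rmorph_sum; apply: eq_bigr => l _ /=; rewrite !rmorphM /= conjCK.
have -> : Num.conj (A k l) = A l k by rewrite -{2}hA !mxE.
by ring.
Qed.

Lemma herm_delta A k l : herm A (delta_mx 0 k) (delta_mx 0 l) = A k l.
Proof.
rewrite hermE (bigD1 k) //= (bigD1 l) //= big1 => [|j jl]; last first.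
  by rewrite [X in _ * Num.conj X]mxE eqxx (negbTE jl) rmorph0 mulr0.
rewrite big1 => [|i ik]; last first.
  by apply: big1 => j _; rewrite mxE eqxx (negbTE ik) !mul0r.
by rewrite !mxE !eqxx /= conjC1 mul1r mulr1 !addr0.
Qed.

Lemma herm_inj A B : (forall u v, herm A u v = herm B u v) -> A = B.
Proof. by move=> h; apply/matrixP => k l; rewrite -!herm_delta h. Qed.

(** Complex polarization: u + v and u + i v together separate the two mixed terms, so no symmetry of
    A or B is needed. *)
Lemma herm_polar A B : (forall u, herm A u u = herm B u u) -> A = B.
Proof.
move=> h; apply: herm_inj => u v.
have h0 w : herm (A - B) w w = 0 by rewrite hermDm -scaleN1r hermZm mulN1r h subrr.
have h1 : herm (A - B) u v + herm (A - B) v u = 0.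
  by have := h0 (u + v); rewrite !hermDl !hermDr !h0 add0r addr0.
have h2 : 'i * herm (A - B) v u - 'i * herm (A - B) u v = 0.
  have := h0 (u + 'i *: v); rewrite !hermDl !hermDr !hermZl !hermZr !h0 !mulr0 add0r addr0.
  by rewrite conjCi mulNr addrC.
have h3 : herm (A - B) u v = 0.
  have e : herm (A - B) v u = herm (A - B) u v.
    by apply: (@mulfI _ 'i); [exact: neq0Ci|apply/eqP; rewrite -subr_eq0 h2].
  move: h1; rewrite e -mulr2n -mulr_natl => /eqP; rewrite mulf_eq0 pnatr_eq0 /=.
  by move/eqP.
by move: h3; rewrite hermDm -scaleN1r hermZm mulN1r => /eqP; rewrite subr_eq0 => /eqP.
Qed.

(** Unitary diagonalization followed by square roots of the positive eigenvalues. The map v |-> v P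
    then turns the form A into the standard one. *)
Lemma posdef_factor A : posdef_hermitian A -> exists2 P, P \in unitmx & A = P *m P ^t*.
Proof.
move=> [hA pA].
have nA : A \is normalmx by apply/normalmxP; rewrite hA.
have [[Q d] /= uQ AE] := orthomx_spectral_subproof nA.
rewrite invmx_unitary // in AE.
have d0 j : 0 < d 0 j.
  have QQ := unitarymxP uQ.
  have rn0 : row j Q != 0.
    apply/negP => /eqP r0; have : (Q *m Q ^t*) j j = 0.
      by rewrite !mxE big1 // => k _; have := congr1 (fun x : V => x 0 k) r0; rewrite !mxE => ->; rewrite mul0r.
    by rewrite QQ mxE eqxx => /eqP; rewrite oner_eq0.
  have := pA _ rn0; rewrite /herm rowE trmx_mul map_mxM AE /= !mulmxA.
  rewrite -[_ *m Q *m Q ^t*]mulmxA QQ mulmx1 -[_ *m Q *m Q ^t*]mulmxA QQ mulmx1.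
  rewrite mul_mx_diag mxE (bigD1 j) //= big1 => [|k kj]; last by rewrite !mxE eqxx (negbTE kj) !mul0r.
  by rewrite !mxE !eqxx /= conjC1 mulr1 mul1r addr0.
pose s : V := \row_j sqrtC (d 0 j).
have AP : A = (Q ^t* *m diag_mx s) *m (Q ^t* *m diag_mx s) ^t*.
  rewrite trmx_mul map_mxM trmxCK tr_diag_mx map_diag_mx AE !mulmxA; congr (_ *m _).
  rewrite -mulmxA mulmx_diag; congr (_ *m diag_mx _).
  apply/rowP => j; rewrite !mxE -normCK.
  by rewrite ger0_norm ?sqrtC_ge0 ?(ltW (d0 j)) // sqrtCK.
exists (Q ^t* *m diag_mx s) => //.
rewrite -row_free_unit; apply: inj_row_free => v v0; apply/eqP; apply/negP => /negP vn0.
have := pA _ vn0; rewrite /herm AP !mulmxA -[v *m _ *m _]mulmxA v0 mul0mx mul0mx mxE ltxx //.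
Qed.

Definition sqn A u : R := complex.Re (herm A u u).
Definition nH A u : R := Num.sqrt (sqn A u).

Lemma sqn0 A : sqn A 0 = 0.
Proof. by rewrite /sqn herm0l. Qed.

Lemma posdef_sqn A u : posdef_hermitian A -> u != 0 -> 0 < sqn A u.
Proof. by move=> [_ pA] /pA; rewrite ltcE /= => /andP[_]. Qed.

Lemma posdef_sqn_ge0 A u : posdef_hermitian A -> 0 <= sqn A u.
Proof. by move=> pA; have [->|/(posdef_sqn pA)/ltW//] := eqVneq u 0; rewrite sqn0. Qed.

Lemma herm_sqn A u : posdef_hermitian A -> herm A u u = (sqn A u)%:C.
Proof.
move=> [hA pA]; have [->|/pA h] := eqVneq u 0; first by rewrite sqn0 herm0l.
by apply: real_of_ge0; exact: ltW.
Qed.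

Lemma ReR_mul (a : R) (z : C) : complex.Re (a%:C * z) = a * complex.Re z.
Proof. by case: z => x y /=; rewrite mul0r subr0. Qed.

Lemma Re_conj (z : C) : complex.Re (Num.conj z) = complex.Re z.
Proof. by case: z. Qed.

Lemma sqnD_t A u v (t : R) : A ^t* = A ->
  sqn A (u + t%:C *: v) = sqn A u + 2 * t * complex.Re (herm A u v) + t ^+ 2 * sqn A v.
Proof.
move=> hA; rewrite /sqn !hermDl !hermDr !hermZl !hermZr.
have -> : Num.conj (t%:C : C) = t%:C by rewrite conj_Creal //; apply/complex_realP; exists t.
rewrite (hermC u v hA) !ReD !ReR_mul Re_conj.
exact: quad_expand.
Qed.

End HermAlg.

Lemma sqr_le_sq (R : realType) (a b : R) : 0 <= b -> a ^+ 2 <= b ^+ 2 -> a <= b.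
Proof. by move=> b0 h; case: (leP a 0) => [/le_trans->//|a0]; rewrite -(@ler_pXn2r _ 2) // nnegrE ltW. Qed.

Lemma discr_le (R : realType) (a b c : R) : 0 <= b -> (forall t, 0 <= a + 2 * t * c + t ^+ 2 * b) ->
  (b = 0 -> c = 0) -> c ^+ 2 <= a * b.
Proof.
rewrite le_eqVlt => /orP[/eqP <- _ /(_ erefl) ->|b0 h _]; first by rewrite mulr0 expr0n.
have := h (- c / b); rewrite -(pmulr_rge0 _ b0).
have -> : b * (a + 2 * (- c / b) * c + (- c / b) ^+ 2 * b) = a * b - c ^+ 2 by field; rewrite gt_eqF.
by rewrite subr_ge0.
Qed.

Lemma sq_triangle (R : realType) (a b c x y : R) : 0 <= a -> 0 <= b -> c ^+ 2 <= a * b ->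
  x = Num.sqrt a -> y = Num.sqrt b -> a + 2 * c + b <= (x + y) ^+ 2.
Proof.
move=> a0 b0 cab -> ->; have ha := sqr_sqrtr a0; have hb := sqr_sqrtr b0.
have h : c <= Num.sqrt a * Num.sqrt b.
  by apply: sqr_le_sq; rewrite ?mulr_ge0 ?sqrtr_ge0 // exprMn ha hb.
by rewrite sqrrD ha hb -mulr_natl; lraH h.
Qed.

Section HermNorm.
Variables (R : realType) (n : nat).
Local Notation C := (Cx R).
Local Notation V := 'rV[C]_n.
Local Notation M := 'M[C]_n.
Local Open Scope sesquilinear_scope.
Implicit Types (A B J P : M) (u v w : V).

Lemma conjRC (t : R) : Num.conj (t%:C : C) = t%:C.
Proof. by rewrite conj_Creal //; apply/complex_realP; exists t. Qed.

Lemma mul_conj (a : C) : a * Num.conj a = (rn a ^+ 2)%:C.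
Proof. by rewrite -normCK rmorphXn /= rnE. Qed.

Lemma sqnZ A (a : C) u : sqn A (a *: u) = rn a ^+ 2 * sqn A u.
Proof. by rewrite /sqn hermZl hermZr mulrA mul_conj ReR_mul. Qed.

Lemma sqnN A u : sqn A (- u) = sqn A u.
Proof. by rewrite -scaleN1r sqnZ rnN rn1 expr1n mul1r. Qed.

Lemma nHZ A (a : C) u : nH A (a *: u) = rn a * nH A u.
Proof. by rewrite /nH sqnZ sqrtrM ?sqr_ge0 // sqrtr_sqr ger0_norm ?rn_ge0. Qed.

Lemma nHN A u : nH A (- u) = nH A u.
Proof. by rewrite /nH sqnN. Qed.

Lemma nH_ge0 A u : 0 <= nH A u.
Proof. exact: sqrtr_ge0. Qed.

Lemma nH0 A : nH A 0 = 0.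
Proof. by rewrite /nH sqn0 sqrtr0. Qed.

Lemma nH_sqr A u : posdef_hermitian A -> nH A u ^+ 2 = sqn A u.
Proof. by move=> pA; rewrite sqr_sqrtr // posdef_sqn_ge0. Qed.

Lemma nHD A u v : posdef_hermitian A -> nH A (u + v) <= nH A u + nH A v.
Proof.
move=> pA; apply: sqr_le_sq; first by rewrite addr_ge0 ?nH_ge0.
have [hA _] := pA.
have q t := sqnD_t u v t hA.
rewrite nH_sqr //; have := q 1; rewrite rmorph1 scale1r expr1n mul1r mulr1 => ->.
apply: sq_triangle => //; try exact: posdef_sqn_ge0.
apply: discr_le => [|t|]; first exact: posdef_sqn_ge0.
  by rewrite -q; exact: posdef_sqn_ge0.
have [->|vn0] := eqVneq v 0; first by rewrite herm0r.
by move=> v0; have := posdef_sqn pA vn0; rewrite v0 ltxx.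
Qed.

Lemma nHB A u v : nH A (u - v) = nH A (v - u).
Proof. by rewrite -nHN opprB. Qed.

Lemma nH_dist A u v : posdef_hermitian A -> nH A u <= nH A v + nH A (u - v).
Proof. by move=> pA; rewrite -{1}[u](subrK v) addrC; exact: nHD. Qed.

Lemma rn_mulmx (P : M) u : rn (u *m P) <= (\sum_k \sum_l rn (P k l)) * rn u.
Proof.
have s0 : 0 <= \sum_k \sum_l rn (P k l) by apply: sumr_ge0 => k _; apply: sumr_ge0 => l _; exact: rn_ge0.
apply: rn_le => [|l]; first by rewrite mulr_ge0 ?rn_ge0.
rewrite mxE mulr_suml.
have tri (s : seq 'I_n) (f g : 'I_n -> C) : rn (\sum_(k <- s) f k * g k) <= \sum_(k <- s) rn (f k) * rn (g k).
  elim: s => [|k s IH]; first by rewrite !big_nil rn0.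
  by rewrite !big_cons; apply: le_trans (rnD _ _) _; rewrite rnM lerD.
apply: le_trans (tri _ _ _) _; apply: ler_sum => k _; rewrite mulrC; apply: ler_pM; rewrite ?rn_ge0 ?rn_coord //.
by rewrite (bigD1 l) //= lerDl; apply: sumr_ge0 => j _; exact: rn_ge0.
Qed.

Lemma sqn_bound A u : `|sqn A u| <= (\sum_k \sum_l rn (A k l)) * rn u ^+ 2.
Proof.
apply: le_trans (rnRe _) _; rewrite hermE.
have tri (s : seq 'I_n) (f : 'I_n -> C) (g : 'I_n -> R) : (forall k, rn (f k) <= g k) ->
    rn (\sum_(k <- s) f k) <= \sum_(k <- s) g k.
  move=> h; elim: s => [|k s IH]; first by rewrite !big_nil rn0.
  by rewrite !big_cons; apply: le_trans (rnD _ _) _; rewrite lerD.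
rewrite mulr_suml; apply: (tri _ _ _ _) => k; rewrite mulr_suml; apply: (tri _ _ _ _) => l.
rewrite !rnM; have -> : rn (Num.conj (u 0 l) : C) = rn (u 0 l) by rewrite /rn norm_conjC.
rewrite [rn (u 0 k) * _]mulrC -mulrA ler_wpM2l ?rn_ge0 // expr2.
by apply: ler_pM; rewrite ?rn_ge0 ?rn_coord.
Qed.

Lemma nH_upper A : exists2 K : R, 0 < K & forall u, nH A u <= K * rn u.
Proof.
pose S := \sum_k \sum_l rn (A k l).
have S0 : 0 <= S by apply: sumr_ge0 => k _; apply: sumr_ge0 => l _; exact: rn_ge0.
exists (1 + S) => [|u]; first by rewrite ltr_pwDl.
have S1 : 0 <= 1 + S by rewrite addr_ge0.
have -> : (1 + S) * rn u = Num.sqrt (((1 + S) * rn u) ^+ 2).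
  by rewrite sqrtr_sqr ger0_norm // mulr_ge0 ?rn_ge0.
apply: ler_wsqrtr; apply: le_trans (ler_norm _) _; apply: le_trans (sqn_bound _ _) _.
rewrite exprMn ler_wpM2r ?sqr_ge0 // expr2.
apply: (@le_trans _ _ (1 + S)); first by rewrite lerDr.
by rewrite ler_peMr // lerDl.
Qed.

(** With A = P P^* the square of [nH A u] is the sum of the squared coordinates of u P, each of
    which it dominates; then u is recovered through the inverse of P. *)
Lemma nH_lower A : posdef_hermitian A -> exists2 c : R, 0 < c & forall u, c * rn u <= nH A u.
Proof.
move=> pA; have [P uP AE] := posdef_factor pA.
pose S := \sum_k \sum_l rn (invmx P k l).
have S0 : 0 <= S by apply: sumr_ge0 => k _; apply: sumr_ge0 => l _; exact: rn_ge0.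
have S1 : 0 < 1 + S by rewrite ltr_pwDl.
have low u : rn (u *m P) <= nH A u.
  apply: rn_le => [|k]; first exact: nH_ge0.
  apply: sqr_le_sq; first exact: nH_ge0.
  rewrite nH_sqr // /sqn {1}AE /herm.
  rewrite mulmxA -[_ *m _ *m _]mulmxA -map_mxM -trmx_mul.
  move: (u *m P) => x; rewrite mxE (eq_bigr (fun j => (rn (x 0 j) ^+ 2)%:C : C)) => [|j _]; last by rewrite !mxE mul_conj.
  rewrite -rmorph_sum.
  by rewrite /= (bigD1 k) //= lerDl; apply: sumr_ge0 => j _; exact: sqr_ge0.
exists (1 + S)^-1 => [|u]; first by rewrite invr_gt0.
rewrite ler_pdivrMl // -{1}(mulmxK uP u); apply: le_trans (rn_mulmx _ _) _.
apply: ler_pM => //; first exact: rn_ge0.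
by rewrite -/S lerDr.
Qed.

Lemma sq_close (a b e : R) : 0 <= a -> 0 <= b -> 0 < e -> e <= 1 -> `|b ^+ 2 - a ^+ 2| <= e * a ^+ 2 ->
  (1 - e) * a <= b /\ b <= (1 + e) * a.
Proof.
move=> a0 b0 e0 e1; rewrite ler_norml => /andP[h1 h2].
have a2 : 0 <= a ^+ 2 by exact: sqr_ge0.
have e1' : 0 <= 1 - e by rewrite subr_ge0.
split; apply: sqr_le_sq => //; try by rewrite mulr_ge0 // addr_ge0 // ltW.
  rewrite exprMn; apply: (@le_trans _ _ ((1 - e) * a ^+ 2)); last by lraH h1.
  by rewrite ler_wpM2r // expr2 ler_piMr // lerBlDr lerDl ltW.
rewrite exprMn; apply: (@le_trans _ _ ((1 + e) * a ^+ 2)); first by lraH h2.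
by rewrite ler_wpM2r // expr2 ler_peMr ?lerDl ?ltW // addr_gt0.
Qed.

Lemma hermNm A u v : herm (- A) u v = - herm A u v.
Proof. by rewrite /herm mulmxN mulNmx mxE. Qed.

Lemma sqn_sub A B u : sqn B u - sqn A u = sqn (B - A) u.
Proof. by rewrite /sqn hermDm hermNm ReB. Qed.

Lemma sqnE A u : sqn A u = complex.Re (herm A u u).
Proof. by []. Qed.

Global Opaque sqn nH herm.

(** An entrywise error of at most e c^2 / N, with N exceeding the number of entries by 1, changes
    the squared norm by at most e c^2 (rn u)^2, which is at most e times the squared norm itself. *)
Lemma nH_perturb A (e : R) : posdef_hermitian A -> 0 < e -> e <= 1 -> exists2 d : R, 0 < d &
  forall B, posdef_hermitian B -> (forall k l, rn (B k l - A k l) <= d) ->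
    forall u, (1 - e) * nH A u <= nH B u /\ nH B u <= (1 + e) * nH A u.
Proof.
move=> pA e0 e1; have [c c0 hc] := nH_lower pA.
pose N : R := 1 + \sum_(k < n) \sum_(l < n) 1.
have N1 : 0 < N by rewrite ltr_pwDl // sumr_ge0 // => k _; rewrite sumr_ge0.
exists (e * c ^+ 2 / N) => [|B pB hB u].
  by rewrite divr_gt0 // mulr_gt0 // exprn_gt0.
apply: sq_close => //; try exact: nH_ge0.
have h0 := sqn_bound (B - A) u; rewrite -(sqn_sub A B u) in h0.
rewrite (nH_sqr u pA) (nH_sqr u pB).
apply: le_trans h0 _.
have d0 : 0 <= e * c ^+ 2 / N by rewrite !mulr_ge0 ?sqr_ge0 ?invr_ge0 // ltW.
have h : \sum_k \sum_l rn ((B - A) k l) <= e * c ^+ 2.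
  apply: (@le_trans _ _ (\sum_(k < n) \sum_(l < n) (e * c ^+ 2 / N) * 1)).
    by apply: ler_sum => k _; apply: ler_sum => l _; rewrite !mxE mulr1; exact: hB.
  under eq_bigr do rewrite -mulr_sumr.
  rewrite -mulr_sumr mulrAC ler_pdivrMr; last by [].
  by apply: ler_wpM2l; rewrite ?lerDr // mulr_ge0 ?sqr_ge0 // ltW.
apply: le_trans (ler_wpM2r (sqr_ge0 _) h) _.
rewrite -mulrA ler_wpM2l ?(ltW e0) // -exprMn -nH_sqr //.
by rewrite ler_pXn2r ?nnegrE ?nH_ge0 ?mulr_ge0 ?rn_ge0 ?(ltW c0).
Qed.

End HermNorm.

(** * Smooth functions and metrics on manifolds *)

Section SmoothC.
Variables (R : realType) (n : nat).
Local Notation C := (Cx R).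
Local Notation V := 'rV[C]_n.

Definition EC1 k (U : set V) (f : V -> R) := ECk [set: unit] k U (fun _ => f).

Definition Csm k (U : set V) (f : V -> C) := EC1 k U (fun x => complex.Re (f x)) /\ EC1 k U (fun x => complex.Im (f x)).

Lemma smooth_onP (U : set V) (f : V -> R) : smooth_on U f <-> forall k, EC1 k U f.
Proof. by split=> h k; [apply/Ck_onP|apply/Ck_onP; exact: h]. Qed.

Lemma EC1_ext k (U : set V) f g : open U -> (forall x, U x -> f x = g x) -> EC1 k U f -> EC1 k U g.
Proof. by move=> oU fg; apply: ECk_ext => // _ x _; exact: fg. Qed.

Lemma EC1_sub k (U U' : set V) f : U' `<=` U -> EC1 k U f -> EC1 k U' f.
Proof. by move=> s; apply: ECk_sub. Qed.

Lemma EC1D k (U : set V) f g : open U -> EC1 k U f -> EC1 k U g -> EC1 k U (fun x => f x + g x).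
Proof. by move=> oU hf hg; exact: (ECkD oU hf hg). Qed.

Lemma EC1M k (U : set V) f g : open U -> EC1 k U f -> EC1 k U g -> EC1 k U (fun x => f x * g x).
Proof. by move=> oU hf hg; exact: (ECkM oU hf hg). Qed.

Lemma EC1V k (U : set V) f : open U -> (forall x, U x -> 0 < f x) -> EC1 k U f -> EC1 k U (fun x => (f x)^-1).
Proof. by move=> oU f0 hf; apply: (ECkV oU _ hf) => x /f0 fx; exists (f x). Qed.

Lemma Csm_ext k (U : set V) f g : open U -> (forall x, U x -> f x = g x) -> Csm k U f -> Csm k U g.
Proof. by move=> oU fg [h1 h2]; split; [apply: EC1_ext h1|apply: EC1_ext h2] => // x /fg ->. Qed.

Lemma CsmM k (U : set V) f g : open U -> Csm k U f -> Csm k U g -> Csm k U (fun x => f x * g x).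
Proof.
move=> oU [f1 f2] [g1 g2]; split.
  by apply: EC1_ext (ECkB oU (ECkM oU f1 g1) (ECkM oU f2 g2)) => // x _; case: (f x) => a b; case: (g x).
by apply: EC1_ext (ECkD oU (ECkM oU f1 g2) (ECkM oU f2 g1)) => // x _; case: (f x) => a b; case: (g x).
Qed.

Lemma CsmD k (U : set V) f g : open U -> Csm k U f -> Csm k U g -> Csm k U (fun x => f x + g x).
Proof.
move=> oU [f1 f2] [g1 g2]; split.
  by apply: EC1_ext (ECkD oU f1 g1) => // x _; rewrite ReD.
by apply: EC1_ext (ECkD oU f2 g2) => // x _; rewrite ImD.
Qed.

Lemma Csm_cst k (U : set V) (c : C) : Csm k U (fun=> c).
Proof.
split; apply: ECk_cst; first by exists `|complex.Re c|.
by exists `|complex.Im c|.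
Qed.

Lemma Csm_conj k (U : set V) f : open U -> Csm k U f -> Csm k U (fun x => Num.conj (f x)).
Proof.
move=> oU [f1 f2]; split; first by apply: EC1_ext f1 => // x _; case: (f x).
by apply: EC1_ext (ECkZ (-1) oU f2) => // x _; case: (f x) => a b; rewrite mulN1r.
Qed.

Lemma Csm_sum k (U : set V) (I : Type) (s : seq I) (F : I -> V -> C) : open U -> (forall i, Csm k U (F i)) ->
  Csm k U (fun x => \sum_(i <- s) F i x).
Proof.
move=> oU hF; elim: s => [|i s IH]; first by apply: Csm_ext (Csm_cst k U 0) => // x _; rewrite big_nil.
by apply: Csm_ext (CsmD oU (hF i) IH) => // x _; rewrite big_cons.
Qed.

Lemma Csm_real k (U : set V) (f : V -> R) : open U -> EC1 k U f -> Csm k U (fun x => (f x)%:C).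
Proof.
move=> oU hf; split; first exact: hf.
by apply: EC1_ext (Csm_cst k U 0).2.
Qed.

Lemma Csm_hol k (U : set V) (f : V -> C) : open U -> (forall x, U x -> differentiable f x) -> Csm k U f.
Proof. by move=> oU hf; exact: (ECk_holo k oU (single_bholo oU hf)). Qed.

Lemma EC1_comp k (U U' : set V) (f : V -> R) (F : V -> V) : open U -> open U' ->
  (forall x, U x -> differentiable F x) -> (forall x, U x -> U' (F x)) ->
  (forall k, EC1 k U' f) -> EC1 k U (fun x => f (F x)).
Proof. by move=> oU oU' dF FU hf; exact: (Ck_comp oU oU' dF FU hf k). Qed.

Lemma Csm_comp k (U U' : set V) (f : V -> C) (F : V -> V) : open U -> open U' ->
  (forall x, U x -> differentiable F x) -> (forall x, U x -> U' (F x)) ->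
  (forall k, Csm k U' f) -> Csm k U (fun x => f (F x)).
Proof.
move=> oU oU' dF FU hf; split; apply: (EC1_comp k oU oU' dF FU (f := fun x => _ (f x))) => k'.
  exact: (hf k').1.
exact: (hf k').2.
Qed.

End SmoothC.

Section SmoothFun.
Variables (R : realType) (n : nat).
Local Notation C := (Cx R).
Local Notation V := 'rV[C]_n.
Implicit Types X Y : complexManifold R n.

Definition img X (i : mindex X) (U : set X) : set V := cmap (mchart i) @` (U `&` dom (mchart i)).

Lemma img_open X (i : mindex X) (U : set X) : open U -> open (img i U).
Proof. exact: chart_image_open. Qed.

Lemma imgP X (i : mindex X) (U : set X) x : img i U x <-> cod (mchart i) x /\ U (cinv (mchart i) x).
Proof. exact: chart_image. Qed.

Lemma img_sub X (i : mindex X) (U U' : set X) : U `<=` U' -> img i U `<=` img i U'.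
Proof. by move=> s x /imgP[? /s ?]; apply/imgP. Qed.

Lemma smooth_funP X (U : set X) f : smooth_fun_on U f <-> forall i k, EC1 k (img i U) (f \o cinv (mchart i)).
Proof. split=> h i; last by apply/smooth_onP; exact: h.
by move: (h i) => /smooth_onP. Qed.

Lemma hol_open X Y (U : set X) (F : X -> Y) (O : set Y) : open U -> open O -> holomorphic_on U F ->
  open (U `&` F @^-1` O).
Proof.
move=> oU oO hF; rewrite openE => p [Up Op]; apply: filterI; first by apply: open_nbhs_nbhs.
by apply: (hF.1 _ Up); apply: open_nbhs_nbhs.
Qed.

Lemma smooth_fun_local X (U : set X) f : (forall p, U p -> exists2 N : set X, N p & smooth_fun_on N f) -> smooth_fun_on U f.
Proof.
move=> h; apply/smooth_funP => i k; apply: ECk_local => x /imgP[cx Ux].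
have [N Np /smooth_funP/(_ i k) hN] := h _ Ux; exists (img i N) => //; exact/imgP.
Qed.

Lemma smooth_fun_sub X (U U' : set X) f : U' `<=` U -> smooth_fun_on U f -> smooth_fun_on U' f.
Proof. by move=> s /smooth_funP h; apply/smooth_funP => i k; apply: EC1_sub (h i k); exact: img_sub. Qed.

Lemma smooth_fun_ext X (U : set X) f g : open U -> (forall p, U p -> f p = g p) -> smooth_fun_on U f -> smooth_fun_on U g.
Proof.
move=> oU fg /smooth_funP h; apply/smooth_funP => i k; apply: EC1_ext (h i k); first exact: img_open.
by move=> x /imgP[_ /fg].
Qed.

Lemma smooth_funM X (U : set X) f g : open U -> smooth_fun_on U f -> smooth_fun_on U g ->
  smooth_fun_on U (fun p => f p * g p).
Proof.
move=> oU /smooth_funP hf /smooth_funP hg; apply/smooth_funP => i k.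
exact: (EC1M (img_open oU) (hf i k) (hg i k)).
Qed.

Lemma smooth_funD X (U : set X) f g : open U -> smooth_fun_on U f -> smooth_fun_on U g ->
  smooth_fun_on U (fun p => f p + g p).
Proof.
move=> oU /smooth_funP hf /smooth_funP hg; apply/smooth_funP => i k.
exact: (EC1D (img_open oU) (hf i k) (hg i k)).
Qed.

Lemma smooth_fun_cst X (U : set X) (c : R) : smooth_fun_on U (fun=> c).
Proof. by apply/smooth_funP => i k; apply: ECk_cst; exists `|c|. Qed.

Lemma smooth_fun_sum X (U : set X) (N : nat) (F : nat -> X -> R) : open U -> (forall i, smooth_fun_on U (F i)) ->
  smooth_fun_on U (fun p => \sum_(i < N) F i p).
Proof.
move=> oU hF; elim: N => [|N IH].
  by apply: (smooth_fun_ext oU _ (smooth_fun_cst U 0)) => p _; rewrite big_ord0.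
by apply: (smooth_fun_ext oU _ (smooth_funD oU IH (hF N))) => p _; rewrite big_ord_recr.
Qed.

Lemma smooth_fun_prod X (U : set X) (N : nat) (F : nat -> X -> R) : open U -> (forall i, smooth_fun_on U (F i)) ->
  smooth_fun_on U (fun p => \prod_(i < N) F i p).
Proof.
move=> oU hF; elim: N => [|N IH].
  by apply: (smooth_fun_ext oU _ (smooth_fun_cst U 1)) => p _; rewrite big_ord0.
by apply: (smooth_fun_ext oU _ (smooth_funM oU IH (hF N))) => p _; rewrite big_ord_recr.
Qed.

Lemma smooth_funV X (U : set X) f : open U -> smooth_fun_on U f -> (forall p, U p -> 0 < f p) ->
  smooth_fun_on U (fun p => (f p)^-1).
Proof.
move=> oU /smooth_funP hf f0; apply/smooth_funP => i k.
by apply: (EC1V (img_open oU) _ (hf i k)) => x /imgP[_ Ux]; exact: f0.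
Qed.

Lemma smooth_fun_comp X Y (U : set X) (U' : set Y) (F : X -> Y) f : open U -> open U' ->
  holomorphic_on U F -> (forall p, U p -> U' (F p)) -> smooth_fun_on U' f -> smooth_fun_on U (f \o F).
Proof.
move=> oU oU' hF FU /smooth_funP hf.
apply: smooth_fun_local => p Up; pose j := chart_at (F p).
have oN := hol_open oU (dom_open (mchart j)) hF.
exists (U `&` F @^-1` dom (mchart j)); first by split=> //; exact: dom_chart_at.
apply/smooth_funP => i k.
have dF x : img i (U `&` F @^-1` dom (mchart j)) x -> differentiable (local_rep F i j) x.
  move=> /imgP[cx [Ux dx]]; have := hF.2 _ i j Ux (cinv_dom cx) dx.
  by rewrite cinvK.
have FW x : img i (U `&` F @^-1` dom (mchart j)) x -> img j U' (local_rep F i j x).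
  move=> /imgP[cx [Ux dx]]; apply/imgP; rewrite /local_rep /=; split; first exact: cmap_cod.
  by rewrite cmapK //; exact: FU.
apply: (EC1_ext (img_open oN) _ (EC1_comp k (img_open oN) (img_open oU') dF FW (hf j))).
by move=> x /imgP[cx [Ux dx]]; rewrite /local_rep /= cmapK.
Qed.

Lemma smooth_pos_sub X (U U' : set X) f : U' `<=` U -> smooth_pos_on U f -> smooth_pos_on U' f.
Proof. by move=> s [h1 h2]; split; [exact: smooth_fun_sub h1|move=> p /s; exact: h2]. Qed.

Lemma smooth_posM X (U : set X) f g : open U -> smooth_pos_on U f -> smooth_pos_on U g ->
  smooth_pos_on U (fun p => f p * g p).
Proof.
by move=> oU [f1 f2] [g1 g2]; split; [exact: smooth_funM|move=> p Up; rewrite mulr_gt0 ?f2 ?g2].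
Qed.

Lemma smooth_posV X (U : set X) f : open U -> smooth_pos_on U f -> smooth_pos_on U (fun p => (f p)^-1).
Proof. by move=> oU [f1 f2]; split; [exact: smooth_funV|move=> p Up; rewrite invr_gt0 f2]. Qed.

Lemma smooth_pos_comp X Y (U : set X) (U' : set Y) (F : X -> Y) f : open U -> open U' ->
  holomorphic_on U F -> (forall p, U p -> U' (F p)) -> smooth_pos_on U' f -> smooth_pos_on U (f \o F).
Proof. by move=> oU oU' hF FU [f1 f2]; split; [exact: smooth_fun_comp f1|move=> p /FU; exact: f2]. Qed.

Lemma smooth_pos_cst X (U : set X) (c : R) : 0 < c -> smooth_pos_on U (fun=> c).
Proof. by move=> c0; split=> // ; exact: smooth_fun_cst. Qed.

End SmoothFun.

Section Tensors.
Variables (R : realType) (n : nat).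
Local Notation C := (Cx R).
Local Notation V := 'rV[C]_n.
Local Open Scope sesquilinear_scope.
Implicit Types X Y Z : complexManifold R n.

Definition dF X Y (F : X -> Y) (i : mindex X) (j : mindex Y) (p : X) (v : V) : V :=
  cd (local_rep F i j) (cmap (mchart i) p) v.

Lemma herm_eq2 (A : 'M[C]_n) u u' v v' : u = u' -> v = v' -> herm A u v = herm A u' v'.
Proof. by move=> -> ->. Qed.

Lemma herm_jac (f : V -> V) x (A : 'M[C]_n) u v :
  herm (jacobian f x *m A *m (jacobian f x) ^t*) u v = herm A (cd f x u) (cd f x v).
Proof. by rewrite herm_pull !cd_jacobian. Qed.

Lemma metric_compat X (U : set X) (h : tensor X) i j p u v : hermitian_metric_on U h -> U p ->
  dom (mchart i) p -> dom (mchart j) p -> herm (h i p) u v = herm (h j p) (dF id i j p u) (dF id i j p v).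
Proof. by move=> [_ hc _] Up di dj; rewrite (hc i j p Up di dj) herm_jac. Qed.

Lemma dF_comp X Y Z (F : X -> Y) (G : Y -> Z) p i j k v : holp F p -> holp G (F p) ->
  dom (mchart i) p -> dom (mchart j) (F p) -> dom (mchart k) (G (F p)) ->
  dF (G \o F) i k p v = dF G j k (F p) (dF F i j p v).
Proof. exact: cd_comp. Qed.

Lemma dF_id X p (i : mindex X) v : dom (mchart i) p -> dF id i i p v = v.
Proof. exact: cd_id. Qed.

(** The definition of [pullback] uses a chosen chart at F p; compatibility of h under coordinate
    changes allows any other. *)
Lemma pullback_herm X Y (F : X -> Y) (U : set Y) (h : tensor Y) i j p u v :
  hermitian_metric_on U h -> U (F p) -> holp F p -> dom (mchart i) p -> dom (mchart j) (F p) ->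
  herm (pullback F h i p) u v = herm (h j (F p)) (dF F i j p u) (dF F i j p v).
Proof.
move=> hh Up hF di dj; rewrite /pullback herm_jac.
have dk := dom_chart_at (F p).
rewrite (metric_compat _ _ hh Up dk dj).
by rewrite -!(dF_comp (G := id) (k := j) _ hF (holp_id (F p)) di dk dj).
Qed.

Lemma pullback_ext X Y (F : X -> Y) (U : set Y) (h h' : tensor Y) i p : tensor_eq_on U h h' -> U (F p) ->
  pullback F h i p = pullback F h' i p.
Proof. by move=> e Up; rewrite /pullback (e _ _ Up (dom_chart_at _)). Qed.

Lemma pullback_scale X Y (F : X -> Y) (f : Y -> R) (h : tensor Y) i p :
  pullback F (scale_tensor f h) i p = (f (F p))%:C *: pullback F h i p.
Proof. by rewrite /pullback /scale_tensor -scalemxAr -scalemxAl. Qed.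

Lemma pullback_unf X Y (F : X -> Y) (h : tensor Y) i p u v : herm (pullback F h i p) u v =
  herm (h (chart_at (F p)) (F p)) (dF F i (chart_at (F p)) p u) (dF F i (chart_at (F p)) p v).
Proof. exact: herm_jac. Qed.

Lemma pullback_tr X Y (F : X -> Y) (h : tensor Y) i p : h (chart_at (F p)) (F p) ^t* = h (chart_at (F p)) (F p) ->
  pullback F h i p ^t* = pullback F h i p.
Proof. by move=> hA; rewrite /pullback !trmx_mul !map_mxM trmxCK hA mulmxA. Qed.

Global Opaque pullback.

Lemma pullback_comp X Y Z (F : X -> Y) (G : Y -> Z) (U : set Z) (h : tensor Z) i p :
  hermitian_metric_on U h -> U (G (F p)) -> holp F p -> holp G (F p) -> dom (mchart i) p ->
  pullback (G \o F) h i p = pullback F (pullback G h) i p.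
Proof.
move=> hh Up hF hG di; apply: herm_inj => u v.
have dk := dom_chart_at (G (F p)); have dj := dom_chart_at (F p).
apply: (etrans (pullback_unf (G \o F) h i p u v)); apply: esym.
apply: (etrans (pullback_unf F (pullback G h) i p u v)).
apply: (etrans (pullback_herm _ _ hh Up hG dj dk)).
by apply: herm_eq2; apply: esym; exact: (dF_comp _ hF hG di dj dk).
Qed.

Lemma pullback_id X (U : set X) (h : tensor X) i p : hermitian_metric_on U h -> U p -> dom (mchart i) p ->
  pullback id h i p = h i p.
Proof.
move=> hh Up di; apply: herm_inj => u v.
by rewrite (pullback_herm _ _ hh Up (holp_id p) di di) !dF_id.
Qed.

Lemma metric_sub X (U U' : set X) (h : tensor X) : U' `<=` U -> hermitian_metric_on U h -> hermitian_metric_on U' h.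
Proof.
move=> s [h1 h2 h3]; split; first by move=> i p /s; exact: h1.
  by move=> i j p /s; exact: h2.
move=> i k l; have [/= a b] := h3 i k l; split; apply/smooth_onP => m.
  by move/smooth_onP: a => /(_ m); apply: EC1_sub; exact: img_sub.
by move/smooth_onP: b => /(_ m); apply: EC1_sub; exact: img_sub.
Qed.

Lemma metric_smooth X (U : set X) (h : tensor X) i k l m : hermitian_metric_on U h ->
  Csm m (img i U) (fun x => h i (cinv (mchart i) x) k l).
Proof.
by move=> [_ _ h3]; have [/smooth_onP a /smooth_onP b] := h3 i k l; split; [exact: a|exact: b].
Qed.

Lemma metric_of X (U : set X) (h : tensor X) :
  (forall i p, U p -> dom (mchart i) p -> posdef_hermitian (h i p)) ->
  (forall i j p u v, U p -> dom (mchart i) p -> dom (mchart j) p ->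
     herm (h i p) u v = herm (h j p) (dF id i j p u) (dF id i j p v)) ->
  (forall i k l p, U p -> dom (mchart i) p -> exists2 N : set X, N p & forall m, Csm m (img i N) (fun x => h i (cinv (mchart i) x) k l)) ->
  hermitian_metric_on U h.
Proof.
move=> h1 h2 h3; split=> // [i j p Up di dj|i k l].
  by apply: herm_inj => u v; rewrite herm_jac; exact: h2.
split; apply/smooth_onP => m; apply: ECk_local => x /imgP[cx Ux];
  have [N Np hN] := h3 i k l _ Ux (cinv_dom cx); exists (img i N); try exact/imgP.
  exact: (hN m).1.
exact: (hN m).2.
Qed.

Lemma metric_local X (U : set X) (h : tensor X) :
  (forall p, U p -> exists2 N : set X, N p & hermitian_metric_on N h) -> hermitian_metric_on U h.
Proof.
move=> hl; apply: metric_of.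
- by move=> i p /hl[N Np [h1 _ _]]; exact: h1.
- by move=> i j p u v /hl[N Np hN]; exact: metric_compat hN Np.
- by move=> i k l p /hl[N Np hN] _; exists N => // m; exact: metric_smooth.
Qed.

Lemma metric_ext X (U : set X) (h h' : tensor X) : open U -> tensor_eq_on U h h' ->
  hermitian_metric_on U h -> hermitian_metric_on U h'.
Proof.
move=> oU e hh; apply: metric_of.
- by move=> i p Up di; rewrite -e //; case: hh => h1 _ _; exact: h1.
- by move=> i j p u v Up di dj; rewrite -!e //; exact: metric_compat hh Up di dj.
- move=> i k l p Up di; exists U => // m; apply: Csm_ext (metric_smooth i k l m hh); first exact: img_open.
  by move=> x /imgP[cx Ux]; rewrite e //; exact: cinv_dom.
Qed.

Lemma metric_scale X (U : set X) (f : X -> R) (h : tensor X) : open U -> smooth_pos_on U f ->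
  hermitian_metric_on U h -> hermitian_metric_on U (scale_tensor f h).
Proof.
move=> oU [sf f0] hh; apply: metric_of.
- move=> i p Up di; case: hh => h1 _ _; have [e pos] := h1 i p Up di; split.
    apply/matrixP => a b; rewrite /scale_tensor -[in RHS]e !mxE rmorphM /=; congr (_ * _); exact: conjRC.
  move=> u un; rewrite /scale_tensor hermZm mulr_gt0 ?pos //.
  by rewrite ltcR f0.
- by move=> i j p u v Up di dj; rewrite /scale_tensor !hermZm (metric_compat _ _ hh Up di dj).
- move=> i k l p Up di; exists U => // m.
  have oI := img_open (i := i) oU.
  apply: Csm_ext (CsmM oI (Csm_real oI (_ : EC1 m _ (f \o cinv (mchart i)))) (metric_smooth i k l m hh)) => //.
    by move=> x _; rewrite !mxE.
  by move/smooth_funP: sf; exact.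
Qed.

Lemma hol_on_holp X Y (U : set X) (F : X -> Y) p : holomorphic_on U F -> U p -> holp F p.
Proof. by move/holomorphic_onP; exact. Qed.

Definition immersive X Y (F : X -> Y) (U : set X) := forall p i j v, U p -> dom (mchart i) p -> dom (mchart j) (F p) ->
  dF F i j p v = 0 -> v = 0.

Lemma pullback_posdef X Y (F : X -> Y) (U : set X) (U' : set Y) (h : tensor Y) i p : holp F p -> immersive F U ->
  U p -> U' (F p) -> hermitian_metric_on U' h -> dom (mchart i) p -> posdef_hermitian (pullback F h i p).
Proof.
move=> hF iF Up Up' hh di; have dj := dom_chart_at (F p).
have [hp _ _] := hh; have [hA pA] := hp _ _ Up' dj.
split; first exact: pullback_tr.
move=> u un; rewrite (pullback_herm _ _ hh Up' hF di dj); apply: pA.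
by apply: contra un => /eqP /(iF _ _ _ _ Up di dj) ->.
Qed.

Lemma dF_smooth X Y (F : X -> Y) (U : set X) i j v l m : open U -> holomorphic_on U F -> 
  (forall p, U p -> dom (mchart i) p -> dom (mchart j) (F p)) ->
  Csm m (img i U) (fun x => dF F i j (cinv (mchart i) x) v 0 l).
Proof.
move=> oU hF dj; have oI := img_open (i := i) oU.
have dd x : img i U x -> differentiable (local_rep F i j) x.
  move=> /imgP[cx Ux]; have := hF.2 _ i j Ux (cinv_dom cx) (dj _ Ux (cinv_dom cx)).
  by rewrite cinvK.
apply: (Csm_ext (f := fun x => cd (fun y => local_rep F i j y 0 l : C) x v)) => //.
  by move=> x /[dup] Ix /imgP[cx Ux]; rewrite /dF cinvK // cd_coord //; exact: dd.
apply: Csm_hol => // x Ix; apply: (differentiable_cd _ oI) => // y Iy.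
exact: ((differentiable_coordP _ _).1 (dd _ Iy) l).
Qed.

Lemma metric_pullback X Y (F : X -> Y) (U : set X) (U' : set Y) (h : tensor Y) : open U -> open U' ->
  holomorphic_on U F -> (forall p, U p -> U' (F p)) -> immersive F U ->
  hermitian_metric_on U' h -> hermitian_metric_on U (pullback F h).
Proof.
move=> oU oU' hF FU iF hh; apply: metric_of.
- by move=> i p Up di; exact: pullback_posdef (hol_on_holp hF Up) iF Up (FU _ Up) hh di.
- move=> i j p u v Up di dj; have dk := dom_chart_at (F p); have hp := hol_on_holp hF Up.
  apply: (etrans (pullback_herm u v hh (FU _ Up) hp di dk)); apply: esym.
  apply: (etrans (pullback_herm _ _ hh (FU _ Up) hp dj dk)).
  by apply: herm_eq2; apply: esym; exact: (dF_comp (F := id) (G := F) _ (holp_id p) hp di dj dk).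
move=> i k l p Up di; set j := chart_at (F p).
have oN := hol_open oU (dom_open (mchart j)) hF; set N := _ `&` _ in oN.
have Np : N p by split=> //; exact: dom_chart_at.
have NU : N `<=` U by move=> q [].
have hFN : holomorphic_on N F by apply/holomorphic_onP => q /NU; exact: hol_on_holp.
exists N => // m; have oI := img_open (i := i) oN.
pose H a b x := h j (F (cinv (mchart i) x)) a b.
have sH a b : Csm m (img i N) (H a b).
  have dFx x : img i N x -> differentiable (local_rep F i j) x.
    by move=> /imgP[cx [Ux dx]]; have := hF.2 _ i j Ux (cinv_dom cx) dx; rewrite cinvK.
  have FW x : img i N x -> img j U' (local_rep F i j x).
    move=> /imgP[cx [Ux dx]]; apply/imgP; rewrite /local_rep /=; split; first exact: cmap_cod.
    by rewrite cmapK //; exact: FU.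
  apply: (Csm_ext oI _ (Csm_comp m oI (img_open (i := j) oU') dFx FW (fun m => metric_smooth j a b m hh))).
  by move=> x /imgP[cx [Ux dx]]; rewrite /H /local_rep /= cmapK.
have djN q : N q -> dom (mchart i) q -> dom (mchart j) (F q) by move=> [].
pose D k a x := dF F i j (cinv (mchart i) x) (delta_mx 0 k) 0 a.
have sD k' a : Csm m (img i N) (D k' a) by exact: dF_smooth.
apply: (Csm_ext (f := fun x => \sum_a \sum_b D k a x * H a b x * Num.conj (D l b x))) => //.
  move=> x /imgP[cx [Ux dx]]; rewrite -(herm_delta (pullback F h i (cinv (mchart i) x)) k l).
  by rewrite (pullback_herm _ _ hh (FU _ Ux) (hol_on_holp hF Ux) (cinv_dom cx) dx) hermE.
apply: Csm_sum => // a; apply: Csm_sum => // b.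
by apply: CsmM => //; [exact: CsmM|exact: Csm_conj].
Qed.

End Tensors.

(** * Kähler metrics *)

Section ComplexDerivative.
Variables (R : realType) (n : nat).
Local Notation C := (Cx R).
Local Notation V := 'rV[C]_n.
Local Notation M := 'M[C]_n.
Local Open Scope sesquilinear_scope.

Definition hasc (f : V -> C) v x (l : C) :=
  hasr (fun y => complex.Re (f y)) v x (complex.Re l) /\ hasr (fun y => complex.Im (f y)) v x (complex.Im l).

Lemma hasr_eqfun (f g : V -> R) v x l l' : (forall y, f y = g y) -> l = l' -> hasr f v x l -> hasr g v x l'.
Proof. by move=> fg <-; apply: (hasr_ext ltr01). Qed.

Lemma hasc_cst c v x : hasc (fun=> c) v x 0.
Proof. by split; exact: hasr_cst. Qed.

Lemma hascD f g v x l m : hasc f v x l -> hasc g v x m -> hasc (fun y => f y + g y) v x (l + m).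
Proof.
move=> [f1 f2] [g1 g2]; split.
  by apply: (hasr_eqfun _ _ (hasrD f1 g1)) => [y|]; rewrite ReD.
by apply: (hasr_eqfun _ _ (hasrD f2 g2)) => [y|]; rewrite ImD.
Qed.

Lemma hascM f g v x l m : hasc f v x l -> hasc g v x m -> hasc (fun y => f y * g y) v x (l * g x + f x * m).
Proof.
have re (a b : C) : complex.Re (a * b) = complex.Re a * complex.Re b + -1 * (complex.Im a * complex.Im b).
  by case: a b => [? ?] [? ?] /=; rewrite mulN1r.
have im (a b : C) : complex.Im (a * b) = complex.Re a * complex.Im b + complex.Im a * complex.Re b.
  by case: a b => [? ?] [? ?].
move=> [f1 f2] [g1 g2]; split.
  apply: (hasr_eqfun _ _ (hasrD (hasrM f1 g1) (hasrM (hasr_cst (-1) v x) (hasrM f2 g2)))) => [y|]; first by rewrite re.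
  by rewrite ReD !re; ring.
apply: (hasr_eqfun _ _ (hasrD (hasrM f1 g2) (hasrM f2 g1))) => [y|]; first by rewrite im.
by rewrite ImD !im; ring.
Qed.

Lemma hasc_conj f v x l : hasc f v x l -> hasc (fun y => Num.conj (f y)) v x (Num.conj l).
Proof.
move=> [f1 f2]; split.
  by apply: (hasr_eqfun _ _ f1) => [y|]; [case: (f y)|case: l f1 f2].
apply: (hasr_eqfun _ _ (hasrM (hasr_cst (-1) v x) f2)) => [y|]; first by case: (f y) => a b /=; rewrite mulN1r.
by case: l f1 f2 => a b _ _ /=; rewrite mul0r add0r mulN1r.
Qed.

Lemma hasc_sum (I : Type) (s : seq I) (F : I -> V -> C) (D : I -> C) v x : (forall i, hasc (F i) v x (D i)) ->
  hasc (fun y => \sum_(i <- s) F i y) v x (\sum_(i <- s) D i).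
Proof.
move=> h; elim: s => [|i s IH].
  have [a b] := hasc_cst 0 v x.
  split; first by apply: (hasr_eqfun _ _ a) => [y|]; rewrite big_nil.
  by apply: (hasr_eqfun _ _ b) => [y|]; rewrite big_nil.
have [a b] := hascD (h i) IH.
split; first by apply: (hasr_eqfun _ _ a) => [y|]; rewrite big_cons.
by apply: (hasr_eqfun _ _ b) => [y|]; rewrite big_cons.
Qed.

Lemma hasc_hol f v x : differentiable f x -> hasc f v x (cd f x v).
Proof. exact: hasr_Re. Qed.

Lemma hasc_herm (K : V -> M) (a b : V -> V) (K' : M) (a' b' : V) v x :
  (forall k l, hasc (fun y => K y k l) v x (K' k l)) ->
  (forall k, hasc (fun y => a y 0 k) v x (a' 0 k)) -> (forall k, hasc (fun y => b y 0 k) v x (b' 0 k)) ->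
  hasc (fun y => herm (K y) (a y) (b y)) v x (herm (K x) a' (b x) + herm K' (a x) (b x) + herm (K x) (a x) b').
Proof.
move=> hK ha hb.
have h := hasc_sum (index_enum 'I_n) (fun k => hasc_sum (index_enum 'I_n) (fun l =>
  hascM (hascM (ha k) (hK k l)) (hasc_conj (hb l)))).
case: h => h1 h2; split.
  apply: (hasr_eqfun _ _ h1) => [y|]; first by rewrite hermE.
  rewrite !hermE -!big_split /=; congr complex.Re; apply: eq_bigr => k _.
  by rewrite -!big_split /=; apply: eq_bigr => l _; rewrite mulrDl.
apply: (hasr_eqfun _ _ h2) => [y|]; first by rewrite hermE.
rewrite !hermE -!big_split /=; congr complex.Im; apply: eq_bigr => k _.
by rewrite -!big_split /=; apply: eq_bigr => l _; rewrite mulrDl.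
Qed.

Lemma hasc_smooth (U : set V) f v x : U x -> (forall k, Csm k U f) -> hasc f v x (rderive (fun y => complex.Re (f y)) v x +i* rderive (fun y => complex.Im (f y)) v x).
Proof.
move=> Ux /(_ 1%N)[[_ /(_ v)[h1 _]] [_ /(_ v)[h2 _]]].
by split; apply: hasr_rderive; [exact: (h1 tt)|exact: (h2 tt)].
Qed.

Definition cderive (f : V -> C) v x : C := rderive (fun y => complex.Re (f y)) v x +i* rderive (fun y => complex.Im (f y)) v x.

Lemma hasc_comp (U : set V) f (F : V -> V) v x : open U -> (forall k, Csm k U f) -> U (F x) -> differentiable F x ->
  hasc (fun y => f (F y)) v x (cderive f (cd F x v) (F x)).
Proof.
move=> oU hf Ux dF; have [h1 h2] := hf 1%N; split; rewrite /cderive /=.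
  by rewrite (rderive_lin _ oU h1 Ux); exact: hasr_chain oU h1 Ux dF.
by rewrite (rderive_lin _ oU h2 Ux); exact: hasr_chain oU h2 Ux dF.
Qed.

(** Antisymmetry of the fundamental form. *)
Lemma Im_herm_anti (K : M) (a b : V) : K ^t* = K -> complex.Re (herm K ('i *: a) b) = - complex.Re (herm K ('i *: b) a).
Proof.
move=> hK; rewrite !hermZl (hermC a b hK).
have Rei (z : C) : complex.Re ('i * z) = - complex.Im z.
  by rewrite -?complexiE; case: z => x y /=; rewrite mul0r mul1r sub0r.
by rewrite !Rei; case: (herm K a b) => x y /=; rewrite opprK.
Qed.

End ComplexDerivative.

Lemma cyclic_sum (R : realType) (a1 a2 b1 b2 c1 c2 k1 k2 k3 : R) : b2 = - a1 -> c1 = - a2 -> c2 = - b1 ->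
  k1 + k2 + k3 = 0 -> (a1 + a2 + k1) + (b1 + b2 + k2) + (c1 + c2 + k3) = 0.
Proof. by move=> -> -> -> h; lraH h. Qed.

Lemma eq_sum3 (T : zmodType) (a b c a' b' c' : T) : a = a' -> b = b' -> c = c' -> a + b + c = a' + b' + c'.
Proof. by move=> -> -> ->. Qed.

Lemma kahler_cancel (R : realType) (x y w z1 z2 f a b c : R) :
  x + f * a + (y * z1 + f * b) + (w * z2 + f * c) = 0 -> z1 = 0 -> z2 = 0 -> a + b + c = 0 -> x = 0.
Proof.
move=> h e1 e2 k; rewrite e1 e2 !mulr0 !add0r -addrA -addrA -!mulrDr addrA k mulr0 addr0 in h.
exact: h.
Qed.

Section Kahler.
Variables (R : realType) (n : nat).
Local Notation C := (Cx R).
Local Notation V := 'rV[C]_n.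
Local Notation M := 'M[C]_n.
Local Open Scope sesquilinear_scope.
Implicit Types X Y : complexManifold R n.

Definition dmx (H : V -> M) (v x : V) : M := \matrix_(k, l) cderive (fun y => H y k l) v x.

Definition repr X (h : tensor X) i (x : V) : M := h i (cinv (mchart i) x).

Lemma hasr_form X (U : set X) (h : tensor X) i a b v x : hermitian_metric_on U h -> img i U x ->
  hasr (fundamental_form h i a b) v x (complex.Re (herm (dmx (repr h i) v x) ('i *: a) b)).
Proof.
move=> hh Ix.
have hK k l : hasc (fun y => repr h i y k l) v x (dmx (repr h i) v x k l).
  by rewrite mxE; apply: hasc_smooth Ix _ => m; exact: metric_smooth.
have h0 (c : V) k : hasc (fun=> c 0 k : C) v x ((0 : V) 0 k) by rewrite mxE; exact: hasc_cst.
have [h1 _] := hasc_herm hK (h0 ('i *: a)) (h0 b).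
by apply: hasr_eqfun h1 => //; rewrite herm0l herm0r add0r addr0.
Qed.

Lemma dform_val X (U : set X) (h : tensor X) i a b c x : hermitian_metric_on U h -> img i U x ->
  dform (fundamental_form h i) a b c x = complex.Re (herm (dmx (repr h i) a x) ('i *: b) c) +
    complex.Re (herm (dmx (repr h i) b x) ('i *: c) a) + complex.Re (herm (dmx (repr h i) c x) ('i *: a) b).
Proof.
by move=> hh Ix; rewrite /dform !(hasr_val (hasr_form _ _ _ hh Ix)).
Qed.

Lemma kahler_sub X (U U' : set X) (h : tensor X) : U' `<=` U -> kahler_on U h -> kahler_on U' h.
Proof. by move=> s [h1 h2]; split; [exact: metric_sub h1|move=> i p /s; exact: h2]. Qed.

Lemma kahler_local X (U : set X) (h : tensor X) :
  (forall p, U p -> exists2 N : set X, N p & kahler_on N h) -> kahler_on U h.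
Proof.
move=> hl; split; first by apply: metric_local => p /hl[N Np [hN _]]; exists N.
by move=> i p /hl[N Np [_ hN]]; exact: hN.
Qed.

Lemma dform_ext X (U : set X) (h h' : tensor X) i a b c x : open U -> tensor_eq_on U h h' ->
  hermitian_metric_on U h -> img i U x -> dform (fundamental_form h' i) a b c x = dform (fundamental_form h i) a b c x.
Proof.
move=> oU e hh Ix; have hh' := metric_ext oU e hh; rewrite /dform.
have /openrnP/(_ _ Ix)[d d0 dP] := img_open (i := i) oU.
have E (a' b' c' : V) : rderive (fundamental_form h' i a' b') c' x = rderive (fundamental_form h i a' b') c' x.
  apply: hasr_val; apply: (hasr_ext d0) _ (hasr_rderive (hasr_derivable (hasr_form a' b' c' hh Ix))).
  move=> y /dP /imgP[cy Uy]; rewrite /fundamental_form e //; exact: cinv_dom.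
exact: eq_sum3 (E _ _ _) (E _ _ _) (E _ _ _).
Qed.

Lemma kahler_ext X (U : set X) (h h' : tensor X) : open U -> tensor_eq_on U h h' -> kahler_on U h -> kahler_on U h'.
Proof.
move=> oU e [h1 h2]; split; first exact: metric_ext h1.
move=> i p Up di u v w; rewrite (dform_ext _ _ _ oU e h1); first exact: h2.
by apply/imgP; rewrite cmapK //; split=> //; exact: cmap_cod.
Qed.

(** That d commutes with pullback, at the level of coordinates: differentiating the pulled back form
    produces second derivatives of F, which are symmetric and cancel in the cyclic sum against the
    antisymmetric form. What remains is d omega on the images of u, v, w. *)
Theorem kahler_pullback X Y (F : X -> Y) (U : set X) (U' : set Y) (h : tensor Y) : open U -> open U' ->
  holomorphic_on U F -> (forall p, U p -> U' (F p)) -> immersive F U ->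
  kahler_on U' h -> kahler_on U (pullback F h).
Proof.
move=> oU oU' hF FU iF [hh kh]; split; first exact: metric_pullback hh.
move=> i p Up di u v w; set x := cmap _ p; pose j := chart_at (F p).
have oN := hol_open oU (dom_open (mchart j)) hF; set N := _ `&` _ in oN.
have Np : N p by split=> //; exact: dom_chart_at.
have oI := img_open (i := i) oN; set W := img i N in oI.
have Wx : W x by apply/imgP; rewrite /x cmapK //; split=> //; exact: cmap_cod.
pose f := local_rep F i j.
have df y : W y -> differentiable f y.
  by move=> /imgP[cy [Uy dy]]; have := hF.2 _ i j Uy (cinv_dom cy) dy; rewrite cinvK.
have oI' := img_open (i := j) oU'.
have fW y : W y -> img j U' (f y).
  move=> /imgP[cy [Uy dy]]; apply/imgP; rewrite /f /local_rep /=; split; first exact: cmap_cod.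
  by rewrite cmapK //; exact: FU.
pose fk k (y : V) : C := f y 0 k.
have dfk k y : W y -> differentiable (fk k) y by move=> Wy; exact: ((differentiable_coordP f y).1 (df _ Wy) k).
pose D2 (a b : V) : V := \row_k cd (fun y => cd (fk k) y b) x a.
have D2sym a b : D2 a b = D2 b a.
  by apply/rowP => k; rewrite !mxE; exact: (cd_sym b a oI (dfk k) Wx).
have hD (c : C) a b k : hasc (fun y => (c *: (\row_l cd (fk l) y b : V)) 0 k) a x ((c *: D2 a b) 0 k).
  have dd : differentiable (fun y => cd (fk k) y b) x by exact: (differentiable_cd b oI (dfk k) Wx).
  have h0 := hasc_hol a dd.
  have [h1 h2] := hascM (hasc_cst c a x) h0; rewrite mul0r add0r in h1 h2.
  split; first by apply: hasr_eqfun h1 => [y|]; rewrite !mxE.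
  by apply: hasr_eqfun h2 => [y|]; rewrite !mxE.
have rowE y b : W y -> cd f y b = \row_l cd (fk l) y b.
  by move=> Wy; apply/rowP => k; rewrite mxE cd_coord //; exact: df.
pose H := repr h j.
have hH k l m : Csm m (img j U') (fun y => H y k l) by exact: metric_smooth.
have hK a k l : hasc (fun y => H (f y) k l) a x (dmx H (cd f x a) (f x) k l).
  by rewrite mxE; apply: hasc_comp oI' (hH k l) (fW _ Wx) (df _ Wx).
have ffE b c y : W y -> fundamental_form (pullback F h) i b c y =
    complex.Re (herm (H (f y)) ('i *: (\row_l cd (fk l) y b)) (1 *: (\row_l cd (fk l) y c))).
  move=> Wy; have /imgP[cy [Uy dy]] := Wy; rewrite /fundamental_form; congr complex.Re.
  apply: (etrans (pullback_herm _ _ hh (FU _ Uy) (hol_on_holp hF Uy) (cinv_dom cy) dy)).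
  rewrite /H /repr /f /local_rep /= cmapK //; apply: herm_eq2; rewrite /dF cinvK ?cdZ -?rowE //.
  by rewrite scale1r.
have der a b c : rderive (fundamental_form (pullback F h) i b c) a x =
   (complex.Re (herm (H (f x)) ('i *: D2 a b) (cd f x c)) + complex.Re (herm (H (f x)) ('i *: cd f x b) (D2 a c))) +
   complex.Re (herm (dmx H (cd f x a) (f x)) ('i *: cd f x b) (cd f x c)).
  have /openrnP/(_ _ Wx)[d d0 dP] := oI.
  have [h1 _] := hasc_herm (hK a) (hD 'i a b) (hD 1 a c).
  apply: hasr_val; apply: (hasr_ext d0) _ (hasr_eqfun (fun _ => erefl) _ h1).
    by move=> y /dP /ffE ->.
  by rewrite !scale1r -!rowE // !ReD addrAC.
rewrite /dform !der.
have Ifx : img j U' (f x) := fW _ Wx.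
have fx : f x = cmap (mchart j) (F p) by rewrite /f /local_rep /x /= cmapK.
have := kh j (F p) (FU _ Up) (dom_chart_at _) (cd f x u) (cd f x v) (cd f x w).
rewrite -fx (dform_val _ _ _ hh Ifx) -/H => k0.
have [hp _ _] := hh; have [hA _] := hp j (F p) (FU _ Up) (dom_chart_at _).
have hHf : (H (f x)) ^t* = H (f x) by rewrite /H /repr fx cmapK //; exact: dom_chart_at.
apply: cyclic_sum k0.
- by rewrite (D2sym v u); exact: Im_herm_anti.
- by rewrite (D2sym w u); exact: Im_herm_anti.
- by rewrite (D2sym w v); exact: Im_herm_anti.
Qed.

Lemma orth_vector (A : 'M[C]_n) (u : V) : (2 <= n)%N -> exists2 v : V, v != 0 & herm A u v = 0.
Proof.
case: n A u => [//|[//|m]] A u _.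
pose e0 : 'rV[C]_m.+2 := delta_mx 0 0; pose e1 : 'rV[C]_m.+2 := delta_mx 0 1.
have [h0|h0] := eqVneq (herm A u e0) 0.
  exists e0 => //; apply/eqP => /(congr1 (fun x : 'rV[C]_m.+2 => x 0 0)); rewrite !mxE !eqxx /=.
  by apply/eqP; exact: oner_neq0.
exists (Num.conj (herm A u e1) *: e0 - Num.conj (herm A u e0) *: e1).
  apply/eqP => /(congr1 (fun x : 'rV[C]_m.+2 => x 0 1)); rewrite !mxE !eqxx /= mulr0 sub0r mulr1.
  by apply/eqP; rewrite oppr_eq0 conjC_eq0.
rewrite -scaleNr hermDr !hermZr rmorphN /= !conjCK mulNr mulrC subrr //.
Qed.

Lemma Re_iN (z : C) : complex.Re ('i * ('i * z)) = - complex.Re z.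
Proof. by rewrite mulrA -expr2 sqrCi mulN1r; case: z. Qed.

(* With f and f g both Kähler, df /\ omega = 0; testing on (u, v, Jv) with v orthogonal
   to the complex line of u isolates df(u) as soon as n >= 2. *)
Lemma kahler_scale_der X (U : set X) (f : X -> R) (h : tensor X) i p v : (2 <= n)%N -> open U -> smooth_pos_on U f ->
  kahler_on U h -> kahler_on U (scale_tensor f h) -> U p -> dom (mchart i) p ->
  hasr (f \o cinv (mchart i)) v (cmap (mchart i) p) 0.
Proof.
move=> n2 oU [sf f0] [hh kh] [hh' kh'] Up di; set x := cmap _ p.
have Ix : img i U x by apply/imgP; rewrite /x cmapK //; split=> //; exact: cmap_cod.
have df a : hasr (f \o cinv (mchart i)) a x (rderive (f \o cinv (mchart i)) a x).
  apply: hasr_rderive; move/smooth_funP: sf => /(_ i 1%N)[_ /(_ a)[h1 _]]; exact: (h1 tt).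
set D := fun a => rderive (f \o cinv (mchart i)) a x.
suff D0 a : D a = 0 by rewrite -(D0 v); exact: df.
have [b bn0 ab] := orth_vector (h i p) a n2.
pose om (c d : V) := complex.Re (herm (h i p) ('i *: c) d).
have ffE c d : fundamental_form (scale_tensor f h) i c d = fun y => (f \o cinv (mchart i)) y * fundamental_form h i c d y.
  by apply/funext => y; rewrite /fundamental_form /scale_tensor hermZm ReR_mul.
have omE c d : fundamental_form h i c d x = om c d by rewrite /fundamental_form /x cmapK.
have der c d e : rderive (fundamental_form (scale_tensor f h) i c d) e x =
    D e * om c d + f p * rderive (fundamental_form h i c d) e x.
  rewrite ffE; apply: hasr_val.
  have h1 := hasr_form c d e hh Ix; rewrite (hasr_val h1).
  by apply: hasr_eqfun (hasrM (df e) h1) => //; rewrite omE /= /x cmapK.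
have k1 := kh' i p Up di a b ('i *: b); have k2 := kh i p Up di a b ('i *: b).
rewrite /dform !der -/x in k1; rewrite /dform -/x in k2.
have [hp _ _] := hh; have [hA pA] := hp i p Up di.
have o1 : om b ('i *: b) = sqn (h i p) b.
  by rewrite /om sqnE hermZl hermZr conjCi mulrA mulrN -expr2 sqrCi opprK mul1r.
have o2 : om ('i *: b) a = 0.
  rewrite /om !hermZl Re_iN (hermC a b hA) ab rmorph0; by rewrite oppr0.
have o3 : om a b = 0 by rewrite /om hermZl ab mulr0.
have k3 := kahler_cancel k1 o2 o3 k2.
have s0 : 0 < om b ('i *: b) by rewrite o1; exact: posdef_sqn (hp i p Up di) bn0.
by move/eqP: k3; rewrite mulf_eq0 (gt_eqF s0) orbF => /eqP.
Qed.

Theorem kahler_scale_locally_constant X (U : set X) (f : X -> R) (h : tensor X) p : (2 <= n)%N -> open U ->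
  smooth_pos_on U f -> kahler_on U h -> kahler_on U (scale_tensor f h) -> U p -> \forall q \near p, f q = f p.
Proof.
move=> n2 oU sf kh kh' Up; pose i := chart_at p; have di := dom_chart_at p.
have Ix : img i U (cmap (mchart i) p) by apply/imgP; rewrite cmapK //; split=> //; exact: cmap_cod.
have /openrnP/(_ _ Ix)[d d0 dP] := img_open (i := i) oU.
have nb : nbhs (cmap (mchart i) p) [set y | rn (y - cmap (mchart i) p) < d] by apply/nbhs_rnP; exists d.
apply: filterS (chart_nbhsV di nb) => q [/= dq qd].
set x := cmap _ p in dP qd *; set y := cmap _ q in qd *.
have E : x + (1 : R)%:C *: (y - x) = y by rewrite rmorph1 scale1r subrKC.
have : `|(f \o cinv (mchart i)) (x + (1 : R)%:C *: (y - x)) - (f \o cinv (mchart i)) x - 0 * 1| <= 0 * `|1 : R|.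
  apply: line_mvt => t; rewrite normr1 => t1.
  exists 0; last by rewrite subrr normr0.
  have It : img i U (x + t%:C *: (y - x)).
    apply: dP; rewrite addrC addKr rnZ rnR; apply: le_lt_trans qd; rewrite ler_piMl ?rn_ge0 //.
  have /imgP[ct Ut] := It.
  by have := kahler_scale_der (y - x) n2 oU sf kh kh' Ut (cinv_dom ct); rewrite cinvK.
rewrite E mul0r normr1 mul0r subr0 normr_le0 subr_eq0 /x /y /= !cmapK //.
by move/eqP.
Qed.

End Kahler.

(** * Lifts to the universal covering *)

Section FlatUnique.
Variables (R : realType) (Y : topologicalType) (F : Type) (Flat : set Y -> (Y -> F) -> Prop).
Hypothesis Flat_sub : forall U V s, open V -> V `<=` U -> Flat U s -> Flat V s.
Hypothesis Flat_uniq : forall U s s' b, open U -> Flat U s -> Flat U s' -> U b ->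
  \forall b' \near b, (s b' = s' b') <-> (s b = s' b).

Definition flat_global (S : Y -> F) := forall y, exists U s, [/\ open U, U y, Flat U s & forall y', U y' -> S y' = s y'].

Lemma flat_global_uniq S S' b0 : path_connected R Y -> flat_global S -> flat_global S' -> S b0 = S' b0 -> S = S'.
Proof.
move=> [_ pc] hS hS' e; apply/funext => y; have [c [cc c0 c1]] := pc b0 y.
have sc T : flat_global T -> sec Flat (`[0, 1]%classic : set R) c (T \o c).
  move=> hT t It; have [U [s [oU Uy fs Ts]]] := hT (c t); exists U, s; split=> //.
  have /within_continuousP := cc; move=> /(_ t It U (open_nbhs_nbhs (conj oU Uy))).
  by apply: filterS => t' /= h /h Ut'; split=> //; exact: Ts.
have := path_uniq Flat_sub Flat_uniq cc (sc S hS) (sc S' hS') (I01_0 R) (I01_1 R).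
by rewrite /= c0 c1; exact.
Qed.

End FlatUnique.

Section Lifting.
Variables (R : realType) (n : nat).
Local Notation C := (Cx R).
Local Notation V := 'rV[C]_n.
Implicit Types X Y : complexManifold R n.

Lemma line_nbhs (x w : V) (t : R) N : nbhs (x + t%:C *: w) N -> nbhs t [set s | N (x + s%:C *: w)].
Proof.
move=> /nbhs_rnP[d d0 dP]; have w1 : 0 < 1 + rn w by rewrite ltr_pwDl // rn_ge0.
apply/nbhs_ballP; exists (d / (1 + rn w)); first by rewrite /= divr_gt0.
move=> s; rewrite /ball /= distrC ltr_pdivlMr // => st; apply: dP.
have -> : x + s%:C *: w - (x + t%:C *: w) = (s - t)%:C *: w.
  by rewrite opprD addrACA subrr add0r -scalerBl rmorphB.
by rewrite rnZ rnR; apply: le_lt_trans st; rewrite ler_wpM2l // lerDr.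
Qed.

Lemma manifold_lpc Y (y : Y) (U : set Y) : nbhs y U -> exists2 N, nbhs y N & forall y', N y' ->
  exists c : R -> Y, [/\ {within (`[0, 1]%classic : set R), continuous c}, c 0 = y, c 1 = y' &
    forall t : R, (`[0, 1]%classic : set R) t -> U (c t)].
Proof.
move=> hU; pose i := chart_at y; have di := dom_chart_at y.
have [d d0 dP] := (nbhs_rnP _ _).1 (chart_nbhs di hU).
have nb : nbhs (cmap (mchart i) y) [set x | rn (x - cmap (mchart i) y) < d] by apply/nbhs_rnP; exists d.
exists [set q | dom (mchart i) q /\ rn (cmap (mchart i) q - cmap (mchart i) y) < d]; first exact: (chart_nbhsV di nb).
move=> y' [/= dy' yd]; set x := cmap (mchart i) y in dP yd *; set w := cmap (mchart i) y' - x in yd *.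
have hw t : (`[0, 1]%classic : set R) t -> rn (x + t%:C *: w - x) < d.
  rewrite /= in_itv /= => /andP[t0 t1]; rewrite addrC addKr rnZ rnR ger0_norm //.
  by apply: le_lt_trans yd; rewrite ler_piMl ?rn_ge0.
exists (fun t => cinv (mchart i) (x + t%:C *: w)); split.
- apply/within_continuousP => t It N hN; have [ct _] := dP _ (hw t It).
  have := line_nbhs (cinv_continuous ct hN); apply: filterS => s /= Ns _; exact: Ns.
- by rewrite scale0r addr0 /x cmapK.
- by rewrite rmorph1 scale1r /w subrKC cmapK.
- by move=> t It; have [] := dP _ (hw t It).
Qed.

Lemma covering_hol Y X (p : Y -> X) : holomorphic_covering p -> holomorphic_on setT p.
Proof. by case. Qed.

Lemma covering_immersive Y X (p : Y -> X) : holomorphic_covering p -> immersive p setT.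
Proof.
move=> [hp cov] y i j v _ di dj; have [U [oU Ux [K [Vk [s [oV tV pV hs]]]]]] := cov (p y).
have : (p @^-1` U) y by []. rewrite pV => -[k _ Vky].
have [hsk _ _ sp] := hs k.
apply: (cd_injective (hol_on_holp hp I) (hol_on_holp hsk Ux) _ di dj).
have : nbhs y (Vk k) by apply: open_nbhs_nbhs.
by apply: filterS => q /= /sp.
Qed.

Lemma holomorphic_comp X Y (Z : complexManifold R n) (U : set X) (U' : set Y) (F : X -> Y) (G : Y -> Z) :
  holomorphic_on U F -> holomorphic_on U' G -> (forall q, U q -> U' (F q)) -> holomorphic_on U (G \o F).
Proof.
move=> hF hG FU; apply/holomorphic_onP => q Uq; apply: holp_comp; first exact: hol_on_holp hF Uq.
exact: hol_on_holp hG (FU _ Uq).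
Qed.

Lemma hol_sub X Y (U U' : set X) (F : X -> Y) : U' `<=` U -> holomorphic_on U F -> holomorphic_on U' F.
Proof. by move=> s hF; apply/holomorphic_onP => q /s; exact: hol_on_holp. Qed.

(** The flat sections for [monodromy] in this case: local holomorphic lifts of a o p through p,
    values in Y serving as the fibre variable. *)
Definition lift_flat Y X (p : Y -> X) (a : X -> X) (U : set Y) (s : Y -> Y) :=
  holomorphic_on U s /\ forall y, U y -> p (s y) = a (p y).

Lemma lift_flat_sub Y X (p : Y -> X) a (U U' : set Y) s : open U' -> U' `<=` U -> lift_flat p a U s -> lift_flat p a U' s.
Proof. by move=> _ sub [h1 h2]; split; [exact: hol_sub h1|move=> y /sub; exact: h2]. Qed.

Lemma lift_flat_uniq Y X (p : Y -> X) a : holomorphic_covering p -> forall (U : set Y) s s' b, open U -> lift_flat p a U s -> lift_flat p a U s' -> U b ->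
  \forall b' \near b, (s b' = s' b') <-> (s b = s' b).
Proof.
move=> [hp cov] U s s' b oU [h1 h2] [h1' h2'] Ub.
have [W [oW Wx [K [Vk [sk [oV tV pV hs]]]]]] := cov (a (p b)).
have inV t : p t = a (p b) -> exists k, Vk k t.
  by move=> e; have : (p @^-1` W) t; [rewrite /preimage /= e|rewrite pV => -[k _ kt]; exists k].
have [k Vks] := inV _ (h2 _ Ub); have [k' Vks'] := inV _ (h2' _ Ub).
have n1 : \forall b' \near b, Vk k (s b').
  by apply: (h1.1 _ Ub); apply: open_nbhs_nbhs; split.
have n2 : \forall b' \near b, Vk k' (s' b').
  by apply: (h1'.1 _ Ub); apply: open_nbhs_nbhs; split.
have n3 : nbhs b U by apply: open_nbhs_nbhs.
have FF : Filter (nbhs b) := nbhs_filter b.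
apply: filterS (filterI n3 (filterI n1 n2)) => b' /= [Ub' [v1 v2]].
have [kk|nkk] := pselect (k = k').
  subst k'; have [_ _ _ hk] := hs k.
  have e : s b = s' b by rewrite -(hk _ Vks) -(hk _ Vks') h2 ?h2'.
  have e' : s b' = s' b' by rewrite -(hk _ v1) -(hk _ v2) h2 ?h2'.
  by split.
have dis q : Vk k q -> Vk k' q -> False.
  by move=> q1 q2; apply: nkk; apply: (tV k k' I I); exists q.
by split=> e; [rewrite e in v1; case: (dis _ v1 v2)|rewrite e in Vks; case: (dis _ Vks Vks')].
Qed.

Lemma lift_exists Y X (p : Y -> X) (a : X -> X) y0 y1 : universal_covering p -> holomorphic_on setT a ->
  p y1 = a (p y0) -> exists al : Y -> Y, [/\ holomorphic_on setT al, forall y, p (al y) = a (p y), al y0 = y1 &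
    flat_global (lift_flat p a) al].
Proof.
move=> [sc cp] ha e; have [hp cov] := cp.
pose A (b : Y) : set Y := [set f | p f = a (p b)].
have ex b : exists2 U, open U /\ U b & forall b' f, U b' -> A b' f -> exists2 s, lift_flat p a U s & s b' = f.
  have [W [oW Wx [K [Vk [sk [oV tV pV hs]]]]]] := cov (a (p b)).
  have hap : holomorphic_on setT (a \o p) by exact: holomorphic_comp hp ha (fun _ _ => I).
  exists ((a \o p) @^-1` W).
    by split=> //; have := hol_open openT oW hap; rewrite setTI.
  move=> b' f Wb' Af; have : (p @^-1` W) f by rewrite /preimage /= Af.
  rewrite pV => -[k _ Vkf]; have [hsk skV psk skp] := hs k.
  exists (sk k \o (a \o p)); last by rewrite /= -Af skp.
  split; last by move=> y Wy; exact: psk.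
  by apply: holomorphic_comp (hol_sub (@subsetT _ _) hap) hsk _.
have adm (U : set Y) (s : Y -> Y) (b : Y) : lift_flat p a U s -> U b -> A b (s b) by move=> [_ h]; exact: h.
have [S [S0 hS]] := monodromy (@lift_flat_sub Y X p a) adm ex (lift_flat_uniq cp) sc (@manifold_lpc Y) (e : A y0 y1).
exists S; split=> //; last first.
  by move=> y; have [U [s [oU Uy [_ hs] Ss]]] := hS y; rewrite Ss // hs.
apply/holomorphic_onP => y _; have [U [s [oU Uy [hs _] Ss]]] := hS y.
apply: (holp_near _ (hol_on_holp hs Uy)).1; have : nbhs y U by apply: open_nbhs_nbhs.
by apply: filterS => q /= /Ss ->.
Qed.

(** The inverse of a is lifted with base points exchanged; the composites are lifts of the identity
    with a fixed point, hence the identity. The freedom in y1 also gives, for a = id, transitivity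
    of deck transformations on fibres. *)
Theorem lift_biholomorphic Y X (p : Y -> X) (a : X -> X) y0 y1 : universal_covering p -> biholomorphic a ->
  p y1 = a (p y0) -> exists al : Y -> Y, [/\ biholomorphic al, forall y, p (al y) = a (p y) & al y0 = y1].
Proof.
move=> univ [ha [b [hb ab ba]]] e; have [sc cp] := univ.
have [al [hal pal al0 fal]] := lift_exists univ ha e.
have [|be [hbe pbe be1 fbe]] := @lift_exists Y X p b y1 y0 univ hb; first by rewrite e ab.
have comp (a' b' : X -> X) (al' be' : Y -> Y) y : cancel a' b' -> holomorphic_on setT al' -> holomorphic_on setT be' ->
    (forall y, p (al' y) = a' (p y)) -> (forall y, p (be' y) = b' (p y)) -> be' (al' y) = y -> cancel al' be'.
  move=> a'b' h1 h2 p1 p2 e' q.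
  have gl (g : Y -> Y) : holomorphic_on setT g -> (forall y, p (g y) = p y) -> flat_global (lift_flat p id) g.
    by move=> hg pg z; exists setT, g; split=> //; exact: openT.
  have h3 : flat_global (lift_flat p id) (be' \o al').
    by apply: gl => [|z]; [exact: holomorphic_comp h1 h2 (fun _ _ => I)|rewrite /= p2 p1 a'b'].
  have h4 : flat_global (lift_flat p id) id.
    by apply: gl => //; apply/holomorphic_onP => z _; exact: holp_id.
  have := flat_global_uniq (@lift_flat_sub Y X p id) (lift_flat_uniq cp) sc.1 h3 h4 (e' : (be' \o al') y = id y).
  by move=> /(congr1 (fun f => f q)).
exists al; split=> //; split=> //; exists be; split=> //.
- by apply: (comp a b al be y0) => //; rewrite al0.
- by apply: (comp b a be al y1) => //; rewrite be1.
Qed.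

End Lifting.

(** * The global Kähler metric on the covering *)

Section GlobalKahler.
Variables (R : realType) (n : nat).
Local Notation C := (Cx R).
Local Notation V := 'rV[C]_n.
Implicit Types X Y : complexManifold R n.

Lemma locally_constant (Y : topologicalType) (T : Type) (f : Y -> T) p q : path_connected R Y ->
  (forall p, \forall q \near p, f q = f p) -> f q = f p.
Proof.
move=> pc hf; pose Flat (U : set Y) (s : Y -> T) := forall b, U b -> \forall b' \near b, s b' = s b.
have fs (U V : set Y) s : open V -> V `<=` U -> Flat U s -> Flat V s by move=> _ VU h b /VU; exact: h.
have fu (U : set Y) s s' b : open U -> Flat U s -> Flat U s' -> U b -> \forall b' \near b, (s b' = s' b') <-> (s b = s' b).
  move=> _ h h' Ub; have FF : Filter (nbhs b) := nbhs_filter b.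
  by apply: filterS (filterI (h _ Ub) (h' _ Ub)) => b' /= [-> ->].
have g1 : flat_global Flat f by move=> y; exists setT, f; split=> //; exact: openT.
have g2 : flat_global Flat (fun=> f p).
  by move=> y; exists setT, (fun=> f p); split=> //; [exact: openT|by move=> b _; apply: filterS filterT].
by rewrite (flat_global_uniq fs fu pc g1 g2 (erefl : f p = f p)).
Qed.

Lemma kahler_cst X (U : set X) (h : tensor X) (c : R) : 0 < c -> open U -> kahler_on U h ->
  kahler_on U (scale_tensor (fun=> c) h).
Proof.
move=> c0 oU [hh kh]; split; first by apply: metric_scale => //; exact: smooth_pos_cst.
move=> i p Up di u v w; set x := cmap _ p.
have Ix : img i U x by apply/imgP; rewrite /x cmapK //; split=> //; exact: cmap_cod.
have ffE a b : fundamental_form (scale_tensor (fun=> c) h) i a b = fun y => c * fundamental_form h i a b y.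
  by apply/funext => y; rewrite /fundamental_form /scale_tensor hermZm ReR_mul.
have der a b d : rderive (fundamental_form (scale_tensor (fun=> c) h) i a b) d x =
    c * rderive (fundamental_form h i a b) d x.
  rewrite ffE; apply: hasr_val; have h1 := hasr_form a b d hh Ix; rewrite (hasr_val h1).
  by apply: hasr_eqfun (hasrM (hasr_cst c d x) h1) => //; rewrite mul0r add0r.
have k0 := kh i p Up di u v w; rewrite /dform -/x in k0.
apply: etrans (eq_sum3 (der _ _ _) (der _ _ _) (der _ _ _)) _.
by rewrite -!mulrDr k0 mulr0.
Qed.

Lemma scale_comp X (f g : X -> R) (h : tensor X) i p :
  scale_tensor f (scale_tensor g h) i p = scale_tensor (fun q => f q * g q) h i p.
Proof. by rewrite /scale_tensor scalerA rmorphM. Qed.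

Lemma biholo_immersive X Y (F : X -> Y) : biholomorphic F -> immersive F setT.
Proof.
move=> [hF [G [hG FG GF]]] p i j v _ di dj.
apply: (cd_injective (hol_on_holp hF I) (hol_on_holp hG I) _ di dj).
by apply: filterS filterT => q _ /=; rewrite FG.
Qed.

Lemma kahler_conformal_constant Y (g : tensor Y) (al : Y -> Y) (f : Y -> R) : (2 <= n)%N -> path_connected R Y ->
  kahler_on setT g -> biholomorphic al -> smooth_pos_on setT f ->
  (forall i p, dom (mchart i) p -> pullback al g i p = (f p)%:C *: g i p) -> forall p q, f p = f q.
Proof.
move=> n2 pc kg bal sf e p q.
have kp : kahler_on setT (pullback al g).
  by apply: (kahler_pullback openT openT bal.1 _ (biholo_immersive bal) kg).
have kfg : kahler_on setT (scale_tensor f g).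
  by apply: kahler_ext kp; [exact: openT|move=> i x _ dx; exact: e].
apply: locally_constant pc _ => x.
exact: (kahler_scale_locally_constant n2 openT sf kg kfg I).
Qed.

(** The sections for [monodromy] are positive s such that s p^*h is Kähler. They exist locally with
    any prescribed positive value at a point, and the quotient of two of them is locally constant,
    so they behave like sections of a covering. *)
Theorem global_kahler Y X (h : tensor X) (p : Y -> X) : (2 <= n)%N -> lcK h -> universal_covering p ->
  exists2 w : Y -> R, smooth_pos_on setT w & kahler_on setT (scale_tensor w (pullback p h)).
Proof.
move=> n2 [hh [L [Ul [u [g [oUl cov hl]]]]]] [sc cp]; have [hp _] := cp.
pose Flat (U : set Y) (s : Y -> R) := smooth_pos_on U s /\ kahler_on U (scale_tensor s (pullback p h)).
pose A (b : Y) : set R := [set f | 0 < f].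
have fs (U V : set Y) s : open V -> V `<=` U -> Flat U s -> Flat V s.
  by move=> _ VU [h1 h2]; split; [exact: smooth_pos_sub h1|exact: kahler_sub h2].
have fa (U : set Y) s b : Flat U s -> U b -> A b (s b) by move=> [[_ h1] _]; exact: h1.
have fu (U : set Y) s s' b : open U -> Flat U s -> Flat U s' -> U b ->
    \forall b' \near b, (s b' = s' b') <-> (s b = s' b).
  move=> oU [h1 k1] [h2 k2] Ub.
  pose f q := s' q * (s q)^-1.
  have sf : smooth_pos_on U f by apply: smooth_posM => //; exact: smooth_posV.
  have kf : kahler_on U (scale_tensor f (scale_tensor s (pullback p h))).
    apply: kahler_ext k2 => // i q Uq dq; rewrite scale_comp /f /scale_tensor.
    by rewrite divfK // gt_eqF // h1.2.
  have n1 := kahler_scale_locally_constant n2 oU sf k1 kf Ub.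
  have n3 : nbhs b U by apply: open_nbhs_nbhs.
  have FF : Filter (nbhs b) := nbhs_filter b.
  apply: filterS (filterI n3 n1) => b' /= [Ub' e].
  have e1 q : U q -> s q = s' q <-> f q = 1.
    move=> Uq; have sq : s q != 0 by rewrite gt_eqF // h1.2.
    split=> [ee|]; first by rewrite /f -ee divff.
    by rewrite /f => /divr1_eq.
  by rewrite (e1 _ Ub') (e1 _ Ub) e.
have ex b : exists2 U, open U /\ U b & forall b' f, U b' -> A b' f -> exists2 s, Flat U s & s b' = f.
  have : (\bigcup_l Ul l) (p b) by rewrite cov.
  move=> [l _ Ulb]; have [[su u0] kg e] := hl l.
  have oU : open (p @^-1` Ul l) by have := hol_open openT (oUl l) hp; rewrite setTI.
  exists (p @^-1` Ul l) => // b' f Ub' f0.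
  have upos q : (p @^-1` Ul l) q -> 0 < u l (p q) by move=> /u0.
  (* The constant that gives c / u the prescribed value f at b'. *)
  pose c := f * u l (p b').
  have c0 : 0 < c by rewrite mulr_gt0 // upos.
  exists (fun q => c * (u l (p q))^-1); last by rewrite /c mulfK // gt_eqF // upos.
  have hpU : holomorphic_on (p @^-1` Ul l) p by apply: hol_sub hp.
  split.
    apply: smooth_posM => //; first exact: smooth_pos_cst.
    apply: (smooth_posV (f := u l \o p)) => //; apply: (smooth_pos_comp oU (oUl l) hpU _ (conj su u0)) => //.
  have kp : kahler_on (p @^-1` Ul l) (pullback p (g l)).
    apply: (kahler_pullback oU (oUl l) hpU _ _ kg) => //.
    by move=> q i j v _; exact: (covering_immersive cp).
  apply: (kahler_ext oU _ (kahler_cst c0 oU kp)); move=> i q Uq dq.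
  rewrite /scale_tensor (pullback_ext i e Uq) pullback_scale scalerA -rmorphM /=.
  by rewrite -mulrA mulVf ?mulr1 // gt_eqF // upos.
have [[[b0 _] _] _] := sc.
have [S [_ hS]] := monodromy fs fa ex fu sc (@manifold_lpc _ _ Y) (ltr01 : A b0 1).
exists S.
  split; last by move=> q _; have [U [s [oU Uq [[_ s0] _] e]]] := hS q; rewrite e // s0.
  apply: smooth_fun_local => q _; have [U [s [oU Uq [[ss _] _] e]]] := hS q; exists U => //.
  by apply: smooth_fun_ext ss => // x /e.
apply: kahler_local => q _; have [U [s [oU Uq [_ ks] e]]] := hS q; exists U; first exact: Uq.
apply: (kahler_ext oU _ ks); move=> i x Ux dx; rewrite /scale_tensor e; last exact: Ux.
exact: erefl.
Qed.

End GlobalKahler.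

(** * The distance of a Hermitian metric *)

(** If no finite family of the sets B x covered K, the complements of finite unions would generate a
    proper filter containing K, and at a cluster point y the set B y would meet its own
    complement. *)
Lemma compact_net (T : topologicalType) (x0 : T) (K : set T) (B : T -> set T) : compact K -> (forall x, nbhs x (B x)) ->
  exists (N : nat) (s : nat -> T), forall x, K x -> exists2 i, (i < N)%N & B (s i) x.
Proof.
move=> cK hB; apply: contrapT => nex.
pose F : set_system T := [set A | exists (N : nat) (s : nat -> T), forall x, K x ->
   (forall i, (i < N)%N -> ~ B (s i) x) -> A x].
have FP : ProperFilter F.
  apply: Build_ProperFilter_ex.
    move=> A [N [s hA]]; apply: contrapT => nA; apply: nex; exists N, s => x Kx.
    apply: contrapT => nx; apply: nA; exists x; apply: hA => // i iN Bi.
    by apply: nx; exists i.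
  split; first by exists 0%N, (fun=> x0).
  - move=> A A' [N [s hA]] [N' [s' hA']].
    exists (N + N')%N, (fun i => if (i < N)%N then s i else s' (i - N)%N) => x Kx nB; split.
      by apply: hA => // i iN; have := nB i (ltn_addr _ iN); rewrite iN.
    apply: hA' => // i iN'; have := nB (N + i)%N; rewrite ltn_add2l [(N + i < N)%N]ltnNge leq_addr /= addKn; exact.
  - by move=> A A' AA' [N [s hA]]; exists N, s => x Kx /(hA _ Kx)/AA'.
have FK : F K by exists 0%N, (fun=> x0).
have [y [Ky cy]] := cK F FP FK.
have Fc : F (~` B y) by exists 1%N, (fun=> y) => x _ h; exact: (h 0%N).
by have [z [nz Bz]] := cy _ _ Fc (hB y).
Qed.

Section LocalCompactness.
Variables (R : realType) (n : nat).
Local Notation C := (Cx R).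
Local Notation V := 'rV[C]_n.

Lemma complex_box_compact (M : R) : compact [set z : C | `|complex.Re z| <= M /\ `|complex.Im z| <= M].
Proof.
pose f (q : R * R) : C := q.1 +i* q.2.
have -> : [set z : C | `|complex.Re z| <= M /\ `|complex.Im z| <= M] = f @` (`[- M, M] `*` `[- M, M]).
  apply/seteqP; split=> [[a b] /= [h1 h2]|_ [[a b] [/= h1 h2] <-]] /=.
    by exists (a, b) => //=; rewrite !in_itv /= -!ler_norml.
  by move: h1 h2; rewrite !in_itv /= -!ler_norml.
apply: continuous_compact; last by apply: compact_setX; exact: segment_compact.
apply: continuous_subspaceT => -[a b]; move=> N /nbhs_rnP[d d0 dP].
apply/nbhs_ballP; exists (d / 2); first by rewrite /= divr_gt0.
move=> [a' b'] [/= h1 h2]; apply: dP.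
apply: le_lt_trans (rn_le_ReIm _) _ => /=.
move: h1 h2; rewrite /ball /= [`|a - _|]distrC [`|b - _|]distrC => h1 h2.
by rewrite [d]splitr; exact: ltrD.
Qed.

Lemma rn_continuous (x0 : V) : continuous (fun x : V => rn (x - x0)).
Proof.
move=> x N /nbhs_ballP[d /= d0 dP]; apply/nbhs_rnP; exists d => // y yx; apply: dP.
rewrite /ball /=; apply: le_lt_trans (rn_dist _ _) _.
by rewrite opprB addrA subrK rnB.
Qed.

Lemma closed_rball (x0 : V) (r : R) : closed [set x | rn (x - x0) <= r].
Proof.
have -> : [set x | rn (x - x0) <= r] = (fun x : V => rn (x - x0)) @^-1` [set t | t <= r] by [].
apply: preimage_closed; last exact: closed_le.
by move=> x _; exact: rn_continuous.
Qed.

Lemma rball_compact (x0 : V) (r : R) : compact [set x | rn (x - x0) <= r].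
Proof.
pose M := r + rn x0.
have cB : compact [set v : V | forall i, `|complex.Re (v ord0 i)| <= M /\ `|complex.Im (v ord0 i)| <= M].
  exact: (@rV_compact C n (fun=> [set z : C | `|complex.Re z| <= M /\ `|complex.Im z| <= M]) (fun=> @complex_box_compact M)).
apply: (@subclosed_compact V _ _ (@closed_rball x0 r) cB).
move=> x /= xr i.
have h : rn (x 0 i) <= M.
  apply: le_trans (rn_coord _ _) _; rewrite -(subrK x0 x); apply: le_trans (rnD _ _) _.
  by rewrite lerD2r.
by split; apply: le_trans h; [exact: rnRe|exact: rnIm].
Qed.

Lemma chart_ball_compact (X : complexManifold R n) (i : mindex X) (x0 : V) r :
  (forall x, rn (x - x0) <= r -> cod (mchart i) x) -> compact (cinv (mchart i) @` [set x | rn (x - x0) <= r]).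
Proof.
move=> h; apply: continuous_compact; last exact: rball_compact.
apply/within_continuousP => x xr N hN; have hN' : nbhs x [set y | N (cinv (mchart i) y)] := cinv_continuous (h _ xr) hN.
by apply: filterS hN' => y /= ? _.
Qed.

End LocalCompactness.

Section NearNorm.
Variables (R : realType) (n : nat).
Local Notation C := (Cx R).
Local Notation V := 'rV[C]_n.
Implicit Types X Y : complexManifold R n.

(** First order expansion in charts: the remainder is small relative to [rn], hence relative to the
    Hermitian norm, at the cost of the constants K and c. *)
Lemma near_norm X Y (F : X -> Y) p i j (A B : 'M[C]_n) (s e : R) : posdef_hermitian A -> posdef_hermitian B ->
  holp F p -> dom (mchart i) p -> dom (mchart j) (F p) -> 0 < s -> 0 < e -> (forall v, nH B (dF F i j p v) <= s * nH A v) ->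
  \forall q \near p, nH B (cmap (mchart j) (F q) - cmap (mchart j) (F p)) <=
    s * (1 + e) * nH A (cmap (mchart i) q - cmap (mchart i) p).
Proof.
move=> pA pB hF di dj s0 e0 hs; have [K K0 hK] := nH_upper B; have [c c0 hc] := nH_lower pA.
have [_ _ est] := holp_diff hF di dj.
have e1 : 0 < s * e * c / K by rewrite divr_gt0 // !mulr_gt0.
have [d d0 dP] := est _ e1.
set x := cmap (mchart i) p in dP.
have nb : nbhs x [set y | rn (y - x) < d] by apply/nbhs_rnP; exists d.
apply: filterS (chart_nbhsV di nb) => q /= [dq qd].
set h := cmap (mchart i) q - x in qd *.
have := dP _ qd; have -> : x + h = cmap (mchart i) q by rewrite /h subrKC.
rewrite /local_rep /= (cmapK dq) {2}/x (cmapK di) => h1.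
apply: le_trans (nH_dist _ (dF F i j p h) pB) _.
rewrite mulrDr mulr1 mulrDl; apply: lerD; first exact: hs.
apply: le_trans (hK _) _; apply: le_trans (ler_wpM2l (ltW K0) h1) _.
have -> : K * (s * e * c / K * rn h) = s * e * (c * rn h) by field; rewrite gt_eqF.
by apply: ler_wpM2l; [rewrite mulr_ge0 // ltW|exact: hc].
Qed.

Lemma Csm_cont (U : set V) (f : V -> C) x e : U x -> Csm 0 U f -> 0 < e ->
  exists2 d : R, 0 < d & forall y, rn (y - x) < d -> rn (f y - f x) <= e.
Proof.
move=> Ux [[h1 _] [h2 _]] e0; have e2 : 0 < e / 2 by rewrite divr_gt0.
have [/(_ _ e2)[d d0 dP] _] := h1 x Ux; have [/(_ _ e2)[d' d'0 dP'] _] := h2 x Ux.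
exists (Num.min d d'); first by rewrite lt_min d0.
move=> y; rewrite lt_min => /andP[/(dP tt _ I) k1 /(dP' tt _ I) k2].
apply: le_trans (rn_le_ReIm _) _; rewrite [e]splitr; apply: lerD.
  by move: k1; rewrite -ReB.
by move: k2; rewrite -ImB.
Qed.

Lemma metric_near X (U : set X) (g : tensor X) i p (e : R) : open U -> hermitian_metric_on U g -> U p -> dom (mchart i) p ->
  0 < e -> e <= 1 -> \forall q \near p, forall u,
    (1 - e) * nH (g i p) u <= nH (g i q) u /\ nH (g i q) u <= (1 + e) * nH (g i p) u.
Proof.
move=> oU hg Up di e0 e1; have [hp _ _] := hg.
have [d d0 dP] := nH_perturb (hp i p Up di) e0 e1.
set x := cmap (mchart i) p.
have Ix : img i U x by apply/imgP; rewrite /x cmapK //; split=> //; exact: cmap_cod.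
have ex : exists2 r : R, 0 < r & forall y, rn (y - x) < r -> forall k l,
    rn (g i (cinv (mchart i) y) k l - g i p k l) <= d.
  have hkl k l := Csm_cont Ix (metric_smooth i k l 0 hg) d0.
  have /choice[r hr] kl : exists r : R, 0 < r /\ forall y, rn (y - x) < r ->
      rn (g i (cinv (mchart i) y) kl.1 kl.2 - g i (cinv (mchart i) x) kl.1 kl.2) <= d.
    by have [r r0 hr] := hkl kl.1 kl.2; exists r.
  exists (\big[Num.min/1]_(kl : 'I_n * 'I_n) r kl).
    by elim/big_ind: _ => // [a b a0 b0|kl _]; [rewrite lt_min a0|exact: (hr kl).1].
  move=> y yr k l; have := (hr (k, l)).2 y; rewrite /x (cmapK di) /=; apply.
  by apply: lt_le_trans yr _; rewrite (bigD1 (k, l)) //= ge_min lexx.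
have [r r0 hr] := ex.
have nb : nbhs x [set y | rn (y - x) < r] by apply/nbhs_rnP; exists r.
have nU : nbhs p U by apply: open_nbhs_nbhs.
apply: filterS (filterI nU (chart_nbhsV di nb)) => q /= [Uq [dq qr]] u.
apply: (dP _ (hp i q Uq dq)) => k l.
by have := hr _ qr k l; rewrite cmapK.
Qed.

End NearNorm.

Transparent nH.
Lemma nHE (R : realType) n (A : 'M[Cx R]_n) u : nH A u = Num.sqrt (sqn A u).
Proof. by []. Qed.
Opaque nH.

Lemma half_scale (R : realType) (c x b : R) : c * x <= b -> c / 2 * x <= (1 - 2^-1) * b.
Proof. by move=> h; lraH h. Qed.

Lemma half_lt (R : realType) (d : R) : 0 < d -> d / 2 < d.
Proof. by move=> h; lraH h. Qed.

Section Distance.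
Variables (R : realType) (n : nat).
Local Notation C := (Cx R).
Local Notation V := 'rV[C]_n.
Variables (Y : complexManifold R n) (g : tensor Y).
Hypothesis hg : hermitian_metric_on setT g.
Hypothesis pc : path_connected R Y.
Local Notation phi i := (cmap (mchart (i : mindex Y))).

Lemma metric_posdef i p : dom (mchart i) p -> posdef_hermitian (g i p).
Proof. by have [h _ _] := hg; exact: h. Qed.

Lemma nH_compat i j p v : dom (mchart i) p -> dom (mchart j) p -> nH (g j p) (dF id i j p v) = nH (g i p) v.
Proof.
by move=> di dj; rewrite !nHE; congr Num.sqrt; rewrite !sqnE; congr complex.Re; apply: esym; exact: metric_compat hg I di dj.
Qed.

Lemma chart_change i j y (e : R) : dom (mchart i) y -> dom (mchart j) y -> 0 < e ->
  \forall z \near y, nH (g j y) (phi j z - phi j y) <= (1 + e) * nH (g i y) (phi i z - phi i y).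
Proof.
move=> di dj e0.
have h v : nH (g j y) (dF id i j y v) <= 1 * nH (g i y) v by rewrite mul1r nH_compat.
have := near_norm (metric_posdef di) (metric_posdef dj) (holp_id y) di dj ltr01 e0 h.
by rewrite mul1r.
Qed.

(* The 1-Lipschitz functions for g, described infinitesimally, so that no lengths of
   curves are needed; the distance below is the smallest one making them 1-Lipschitz. *)
Definition lip1 (f : Y -> R) := forall y e, 0 < e -> \forall z \near y,
  `|f z - f y| <= (1 + e) * nH (g (chart_at y) y) (phi (chart_at y) z - phi (chart_at y) y).

Lemma sq1e (e : R) : 0 < e -> exists2 e', 0 < e' & (1 + e') * (1 + e') <= 1 + e.
Proof.
move=> e0; exists (Num.min 1 (e / 3)); first by rewrite lt_min ltr01 divr_gt0.
set e' := Num.min _ _.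
have h1 : e' <= 1 by rewrite /e' ge_min lexx.
have h2 : e' <= e / 3 by rewrite /e' ge_min lexx orbT.
have h0 : 0 <= e' by rewrite le_min ler01 divr_ge0 // ltW.
have h3 : e' * e' <= e' by rewrite ler_piMr.
lraH h1 h2 h3.
Qed.

Lemma lip1_change (f : Y -> R) i j y : dom (mchart i) y -> dom (mchart j) y ->
  (forall e, 0 < e -> \forall z \near y, `|f z - f y| <= (1 + e) * nH (g j y) (phi j z - phi j y)) ->
  forall e, 0 < e -> \forall z \near y, `|f z - f y| <= (1 + e) * nH (g i y) (phi i z - phi i y).
Proof.
move=> di dj h e /sq1e[e' e'0 he].
have FF : Filter (nbhs y) := nbhs_filter y.
apply: filterS (filterI (h _ e'0) (chart_change di dj e'0)) => z /= [h1 h2].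
apply: le_trans h1 _; apply: (@le_trans _ _ ((1 + e') * ((1 + e') * nH (g i y) (phi i z - phi i y)))).
  by rewrite ler_wpM2l // addr_ge0 // ltW.
by rewrite mulrA ler_wpM2r ?nH_ge0.
Qed.

Lemma lip1_chart (f : Y -> R) i y e : lip1 f -> dom (mchart i) y -> 0 < e ->
  \forall z \near y, `|f z - f y| <= (1 + e) * nH (g i y) (phi i z - phi i y).
Proof. by move=> hf di; apply: (lip1_change di (dom_chart_at y)) => e' e'0; exact: hf. Qed.

Lemma lip1_intro (f : Y -> R) : (forall y, exists2 i, dom (mchart i) y &
   forall e, 0 < e -> \forall z \near y, `|f z - f y| <= (1 + e) * nH (g i y) (phi i z - phi i y)) -> lip1 f.
Proof.
by move=> h y; have [i di hi] := h y; exact: (lip1_change (dom_chart_at y) di hi).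
Qed.

Lemma lip1_cst (c : R) : lip1 (fun=> c).
Proof.
move=> y e e0; apply: filterS filterT => z _; rewrite subrr normr0 mulr_ge0 ?nH_ge0 //.
by rewrite addr_ge0 // ltW.
Qed.

(** The local bound is the same for all functions in [lip1]. The constant 4 K collects a factor 2
    from taking e = 1 in [lip1], a factor 2 for the norm at nearby points, and K for the norm at
    p. *)
Lemma lip1_local p : exists2 K : R, 0 < K & exists2 N : set Y, nbhs p N & N `<=` dom (mchart (chart_at p)) /\
  forall f, lip1 f -> forall x y, N x -> N y -> `|f x - f y| <= K * rn (phi (chart_at p) x - phi (chart_at p) y).
Proof.
set i := chart_at p; have di : dom (mchart i) p := dom_chart_at p.
have [K K0 hK] := nH_upper (g i p).
have h1 := metric_near openT hg I di ltr01 (lexx 1).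
have [r r0 hr] := (nbhs_rnP _ _).1 (chart_nbhs di h1).
have K4 : 0 < 4 * K by rewrite mulr_gt0.
exists (4 * K) => //.
have nb : nbhs (phi i p) [set x | rn (x - phi i p) < r] by apply/nbhs_rnP; exists r.
exists [set q | dom (mchart i) q /\ rn (phi i q - phi i p) < r]; first exact: (chart_nbhsV di nb).
split; first by move=> q [].
move=> f hf x y [dx xr] [dy yr]; set w := phi i x - phi i y.
pose G (t : R) := f (cinv (mchart i) (phi i y + t%:C *: w)).
have inb t : 0 <= t <= 1 -> rn (phi i y + t%:C *: w - phi i p) < r.
  move=> t01; exact: convex_seg.
have -> : f x - f y = G 1 - G 0.
  by rewrite /G rmorph1 scale1r scale0r addr0 /w subrKC !cmapK.
have -> : 4 * K * rn w = (4 * K * rn w) * (1 - 0) by rewrite subr0 mulr1.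
apply: (@lipschitz_of_local R R Num.norm G) => //; [exact: ler_normD|exact: normrN|].
move=> t t01; set z := phi i y + t%:C *: w.
have [cz hz] := hr _ (inb t t01).
have dz := cinv_dom cz.
have := lip1_chart hf dz ltr01; move=> h2.
have [d d0 hd] := (nbhs_rnP _ _).1 (chart_nbhs dz h2); rewrite cinvK // in hd.
have w1 : 0 < 1 + rn w by rewrite ltr_pwDl // rn_ge0.
exists (d / (1 + rn w)); first by rewrite divr_gt0.
move=> s s01; rewrite ltr_pdivlMr // => st.
have E : phi i y + s%:C *: w - z = (s - t)%:C *: w.
  by rewrite /z opprD addrACA subrr add0r -scalerBl rmorphB.
have sd : rn (phi i y + s%:C *: w - z) < d.
  by rewrite E rnZ rnR; apply: le_lt_trans st; rewrite ler_wpM2l // lerDr.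
have [_] := hd _ sd; rewrite /= cinvK; last by have [] := hr _ (inb s s01).
rewrite E nHZ rnR => h3; apply: le_trans h3 _.
have [_ h4] := hz w.
have h5 : nH (g i (cinv (mchart i) z)) w <= 2 * (K * rn w).
  by apply: le_trans h4 _; rewrite ler_wpM2l // hK.
rewrite mulrCA [4 * _ * _]mulrC; apply: le_trans (ler_wpM2l (normr_ge0 _) (ler_wpM2l _ h5)) _ => //.
by apply: eq_leW; ring.
Qed.

Definition dset x y : set R := [set d | exists2 f, lip1 f & d = `|f x - f y|].
Definition dist x y : R := sup (dset x y).

(** Finiteness of the supremum: along a path between x and y, which need only be continuous, the
    uniform local bounds of [lip1_local] are added up by bisection. *)
Lemma dist_bound x y : exists M : R, forall f, lip1 f -> `|f x - f y| <= M.
Proof.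
have [_ /(_ x y)[c [cc c0 c1]]] := pc.
pose P (a b : R) := 0 <= a -> b <= 1 -> exists M : R, forall f, lip1 f -> `|f (c a) - f (c b)| <= M.
suff : P 0 1 by move=> /(_ (lexx 0) (lexx 1))[M hM]; exists M => f; rewrite -c0 -c1; exact: hM.
apply: (@bisection R P 0 1 ler01).
- move=> a m b am mb h1 h2 a0 b1; have [M hM] := h1 a0 (le_trans mb b1).
  have [M' hM'] := h2 (le_trans a0 am) b1; exists (M + M') => f hf.
  have -> : f (c a) - f (c b) = (f (c a) - f (c m)) + (f (c m) - f (c b)) by ring.
  by apply: le_trans (ler_normD _ _) _; apply: lerD; [exact: hM|exact: hM'].
move=> t t01; have [K K0 [N Nt [_ hN]]] := lip1_local (c t).
have /within_continuousP := cc; move=> /(_ t); rewrite /= in_itv /= => /(_ t01 N Nt).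
move=> /nbhs_ballP[e /= e0 he]; exists e => // a b a0 at' tb b1 ab _ _.
exists (K * rn (phi (chart_at (c t)) (c a) - phi (chart_at (c t)) (c b))) => f hf.
have t0 := le_trans a0 at'.
apply: hN => //; apply: he; rewrite /ball /= ?in_itv /=.
- by rewrite ger0_norm ?subr_ge0 //; lraH ab tb.
- by rewrite a0 (le_trans at') // (le_trans tb).
- by rewrite distrC ger0_norm ?subr_ge0 //; lraH ab at'.
- by rewrite b1 andbT (le_trans t0).
Qed.

Lemma dset_has_sup x y : has_sup (dset x y).
Proof.
split; first by exists `|0 - 0 : R|; exists (fun=> 0) => //; exact: lip1_cst.
by have [M hM] := dist_bound x y; exists M => _ [f /hM h ->].
Qed.

Lemma dist_ub f x y : lip1 f -> `|f x - f y| <= dist x y.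
Proof.
by move=> hf; apply: sup_upper_bound; [exact: dset_has_sup|exists f].
Qed.

Lemma dist_le x y M : (forall f, lip1 f -> `|f x - f y| <= M) -> dist x y <= M.
Proof.
by move=> h; apply: ge_sup; [exact: (dset_has_sup x y).1|move=> _ [f /h hf ->]].
Qed.

Lemma dist_ge0 x y : 0 <= dist x y.
Proof. by have := dist_ub x y (lip1_cst 0); rewrite subrr normr0. Qed.

Lemma dist_xx x : dist x x = 0.
Proof.
by apply/eqP; rewrite eq_le dist_ge0 andbT; apply: dist_le => f _; rewrite subrr normr0.
Qed.

Lemma dist_sym x y : dist x y = dist y x.
Proof.
by rewrite /dist; congr sup; apply/seteqP; split=> d [f hf ->]; exists f => //; rewrite distrC.
Qed.

Lemma dist_tri x y z : dist x z <= dist x y + dist y z.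
Proof.
apply: dist_le => f hf; have -> : f x - f z = (f x - f y) + (f y - f z) by ring.
by apply: le_trans (ler_normD _ _) _; apply: lerD; exact: dist_ub.
Qed.

Lemma dist_upper p : exists2 K : R, 0 < K & exists2 N : set Y, nbhs p N & N `<=` dom (mchart (chart_at p)) /\
  forall x y, N x -> N y -> dist x y <= K * rn (phi (chart_at p) x - phi (chart_at p) y).
Proof.
have [K K0 [N Np [Nd hN]]] := lip1_local p; exists K => //; exists N => //; split=> // x y Nx Ny.
by apply: dist_le => f hf; exact: hN.
Qed.

Lemma near_dist p e : 0 < e -> \forall z \near p, dist p z < e.
Proof.
move=> e0; have [K K0 [N Np [Nd hN]]] := dist_upper p.
have di := dom_chart_at p; set i := chart_at p in Nd hN di.
have nb : nbhs (phi i p) [set x | rn (x - phi i p) < e / K] by apply/nbhs_rnP; exists (e / K) => //; rewrite divr_gt0.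
have FF : Filter (nbhs p) := nbhs_filter p.
apply: filterS (filterI Np (chart_nbhsV di nb)) => z /= [Nz [dz zr]].
apply: le_lt_trans (hN p z (nbhs_singleton Np) Nz) _.
by rewrite rnB mulrC -ltr_pdivlMr.
Qed.

(** The distance is tested on the cone c (r - rn(x - p)) cut off at 0 and extended by 0 outside the
    chart. It belongs to [lip1] because c is small against the metric; the compact coordinate ball
    is closed in the Hausdorff space Y, so the extension vanishes near each point outside it. *)
Lemma dist_lower p : exists2 c : R, 0 < c & exists2 r : R, 0 < r & 
  (forall x, rn (x - phi (chart_at p) p) <= r -> cod (mchart (chart_at p)) x) /\
  forall z, dist p z < c * r ->
    dom (mchart (chart_at p)) z /\ c * rn (phi (chart_at p) z - phi (chart_at p) p) <= dist p z.
Proof.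
set i := chart_at p; have di : dom (mchart i) p := dom_chart_at p.
have [c c0 hc] := nH_lower (metric_posdef di).
have h2 : 0 < (2^-1 : R) by rewrite invr_gt0.
have h21 : (2^-1 : R) <= 1 by rewrite invf_le1 // ler1n.
have h1 := metric_near openT hg I di h2 h21.
have [d d0 hd] := (nbhs_rnP _ _).1 (chart_nbhs di h1).
pose r := d / 2; have r0 : 0 < r by rewrite divr_gt0.
have rd : r < d by exact: half_lt.
(* Half of the constant at p, since on the coordinate ball the norm is at least half of the norm at
   p. *)
pose c' := c / 2; have c'0 : 0 < c' by rewrite divr_gt0.
have bd x : rn (x - phi i p) <= r -> cod (mchart i) x.
  by move=> xr; have [] := hd x (le_lt_trans xr rd).
have low q v : dom (mchart i) q -> rn (phi i q - phi i p) <= r -> c' * rn v <= nH (g i q) v.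
  move=> dq qr; have [_ /=] := hd _ (le_lt_trans qr rd); rewrite cmapK // => /(_ v)[h _].
  by apply: le_trans h; apply: half_scale; exact: hc.
pose K := cinv (mchart i) @` [set x | rn (x - phi i p) <= r].
have cK : compact K by exact: chart_ball_compact.
have clK := compact_closed (@manifold_hausdorff _ _ Y) cK.
have KP q : K q <-> dom (mchart i) q /\ rn (phi i q - phi i p) <= r.
  split=> [[x xr <-]|[dq qr]]; last by exists (phi i q) => //; exact: cmapK.
  by have cx := bd _ xr; rewrite (cinvK cx); split; [exact: cinv_dom|].
pose f q : R := if `[< dom (mchart i) q >] then Num.max (c' * (r - rn (phi i q - phi i p))) 0 else 0.
have fin q : dom (mchart i) q -> f q = Num.max (c' * (r - rn (phi i q - phi i p))) 0.
  by rewrite /f => /asboolP ->.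
have fout q : ~ K q -> f q = 0.
  move=> nK; rewrite /f; case: asboolP => // dq; apply/max_idPr.
  rewrite pmulr_rle0 // subr_le0; case: (leP r (rn (phi i q - phi i p))) => // /ltW qr.
  by case: nK; apply/KP.
have lf : lip1 f.
  apply: lip1_intro => y; have [Ky|nK] := pselect (K y); last first.
    exists (chart_at y); first exact: dom_chart_at.
    move=> e e0; have : nbhs y (~` K) by apply: open_nbhs_nbhs; split=> //; exact: closed_openC.
    apply: filterS => z nKz; rewrite fout // fout // subrr normr0 mulr_ge0 ?nH_ge0 //.
    by rewrite addr_ge0 // ltW.
  have /KP[dy yr] := Ky; exists i => // e e0.
  have : nbhs y (dom (mchart i)) by apply: open_nbhs_nbhs; split=> //; exact: dom_open.
  apply: filterS => z dz; rewrite fin // fin //.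
  apply: le_trans (max0_lip _ _) _; apply: (@le_trans _ _ (c' * rn (phi i z - phi i y))).
    rewrite -mulrBr normrM (gtr0_norm c'0) ler_wpM2l ?(ltW c'0) //.
    have -> : r - rn (phi i z - phi i p) - (r - rn (phi i y - phi i p)) = rn (phi i y - phi i p) - rn (phi i z - phi i p) by ring.
    apply: le_trans (rn_dist _ _) _.
    by rewrite opprB addrA subrK rnB.
  apply: le_trans (low y _ dy yr) _.
  by rewrite ler_peMl ?nH_ge0 // lerDl ltW.
have fp : f p = c' * r.
  by rewrite fin // subrr rn0 subr0; apply/max_idPl; rewrite mulr_ge0 // ltW.
exists c' => //; exists r => //; split=> // z hz.
have h3 := dist_ub p z lf.
have cr0 : 0 <= c' * r by apply: mulr_ge0; exact: ltW.
have Kz : K z.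
  apply: contrapT => nK; move: h3; rewrite (fout _ nK) subr0 fp (ger0_norm cr0).
  by rewrite leNgt hz.
have /KP[dz zr] := Kz; split=> //; apply: le_trans h3.
rewrite fp fin //; have -> : Num.max (c' * (r - rn (phi i z - phi i p))) 0 = c' * (r - rn (phi i z - phi i p)).
  by apply/max_idPl; rewrite mulr_ge0 ?subr_ge0 // ltW.
set rho := rn _; have -> : c' * r - c' * (r - rho) = c' * rho by ring.
exact: ler_norm.
Qed.

Lemma nbhs_dist p N : nbhs p N <-> exists2 e : R, 0 < e & forall z, dist p z < e -> N z.
Proof.
split=> [hN|[e e0 he]]; last by apply: filterS (near_dist p e0).
have di := dom_chart_at p; have [d d0 hd] := (nbhs_rnP _ _).1 (chart_nbhs di hN).
have [c c0 [r r0 [_ hr]]] := dist_lower p.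
exists (Num.min (c * r) (c * d)); first by rewrite lt_min !mulr_gt0.
move=> z; rewrite lt_min => /andP[/hr[dz h] zd].
have [_ /=] : [set x | cod (mchart (chart_at p)) x /\ N (cinv (mchart (chart_at p)) x)] (phi (chart_at p) z).
  by apply: hd; rewrite -(ltr_pM2l c0); exact: le_lt_trans zd.
by rewrite cmapK.
Qed.

Lemma dist_sep x y : dist x y = 0 -> x = y.
Proof.
move=> h; have [c c0 [r r0 [_ hr]]] := dist_lower x.
have [|dy] := hr y; first by rewrite h mulr_gt0.
rewrite h pmulr_rle0 // => h2.
have /eqP : rn (phi (chart_at x) y - phi (chart_at x) x) = 0 by apply/eqP; rewrite eq_le h2 rn_ge0.
move=> /eqP/rn_eq0/eqP; rewrite subr_eq0 => /eqP e.
by rewrite -(cmapK (dom_chart_at x)) -e cmapK.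
Qed.

Definition homothety (al : Y -> Y) (s : R) := [/\ 0 < s, biholomorphic al &
  forall i p, dom (mchart i) p -> pullback al g i p = (s ^+ 2)%:C *: g i p].

Lemma homothety_nH al s i j p v : homothety al s -> dom (mchart i) p -> dom (mchart j) (al p) ->
  nH (g j (al p)) (dF al i j p v) = s * nH (g i p) v.
Proof.
move=> [s0 [hal _] e] di dj.
have h : sqn (g j (al p)) (dF al i j p v) = s ^+ 2 * sqn (g i p) v.
  rewrite !sqnE -ReR_mul; congr complex.Re.
  have e1 := pullback_herm v v hg I (hol_on_holp hal I) di dj.
  by apply: etrans (esym e1) _; rewrite e // hermZm.
by rewrite !nHE h sqrtrM ?sqr_ge0 // sqrtr_sqr gtr0_norm.
Qed.

Lemma homothety_lip1 al s f : homothety al s -> lip1 f -> lip1 (fun z => s^-1 * f (al z)).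
Proof.
move=> hal hf; have [s0 [hol _] _] := hal.
apply: lip1_intro => y; set i := chart_at y; exists i; first exact: dom_chart_at.
move=> e /sq1e[e' e'0 he]; set j := chart_at (al y).
have di : dom (mchart i) y := dom_chart_at y; have dj : dom (mchart j) (al y) := dom_chart_at _.
have hp := hol_on_holp hol (I : setT y).
have h1 : nbhs y [set z | `|f (al z) - f (al y)| <= (1 + e') * nH (g j (al y)) (phi j (al z) - phi j (al y))].
  exact: (cont_nbhs hp.1 (hf (al y) e' e'0)).
have h2 := near_norm (metric_posdef di) (metric_posdef dj) hp di dj s0 e'0
  (fun v => eq_leW (homothety_nH v hal di dj)).
have FF : Filter (nbhs y) := nbhs_filter y.
apply: filterS (filterI h1 h2) => z /= [k1 k2].
have si : 0 < s^-1 by rewrite invr_gt0.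
rewrite -mulrBr normrM (gtr0_norm si) (ler_pdivrMl _ _ s0).
apply: le_trans k1 _; apply: le_trans (ler_wpM2l _ k2) _; first by rewrite addr_ge0 // ltW.
have -> : (1 + e') * (s * (1 + e') * nH (g i y) (phi i z - phi i y)) = s * ((1 + e') * (1 + e') * nH (g i y) (phi i z - phi i y)) by ring.
by rewrite ler_wpM2l ?(ltW s0) // ler_wpM2r ?nH_ge0.
Qed.

Lemma homothety_dist_le al s x y : homothety al s -> dist (al x) (al y) <= s * dist x y.
Proof.
move=> hal; have [s0 _ _] := hal; apply: dist_le => f hf.
have := dist_ub x y (homothety_lip1 hal hf).
by rewrite -mulrBr normrM gtr0_norm ?invr_gt0 // ler_pdivrMl.
Qed.

Lemma homothety_id : homothety id 1.
Proof.
split=> //; last by move=> i p di; rewrite expr1n scale1r; exact: pullback_id hg I di.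
have hid : holomorphic_on setT (@id Y) by apply/holomorphic_onP => p _; exact: holp_id.
by split=> //; exists id.
Qed.

Lemma homothety_comp al be s t : homothety al s -> homothety be t -> homothety (al \o be) (s * t).
Proof.
move=> [s0 [ha [ai [hai aK Ka]]] ea] [t0 [hb [bi [hbi bK Kb]]] eb]; split; first exact: mulr_gt0.
  split; first exact: holomorphic_comp hb ha _.
  exists (bi \o ai); split; first exact: holomorphic_comp hai hbi _.
    by move=> x /=; rewrite aK bK.
  by move=> x /=; rewrite Kb Ka.
move=> i p di.
apply: etrans (pullback_comp hg I (hol_on_holp hb I) (hol_on_holp ha I) di) _.
have -> : pullback be (pullback al g) i p = pullback be (scale_tensor (fun=> s ^+ 2) g) i p.
  by apply: (pullback_ext (U := setT)) => // j q _ dq; rewrite /scale_tensor ea.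
rewrite pullback_scale eb // scalerA -rmorphM /=; congr ((_)%:C *: _); by rewrite exprMn.
Qed.

Lemma homothety_inv al s ai : homothety al s -> holomorphic_on setT ai -> cancel al ai -> cancel ai al -> homothety ai s^-1.
Proof.
move=> [s0 [ha _] ea] hai aK Ka; split; first by rewrite invr_gt0.
  by split=> //; exists al.
move=> i p di.
have e1 : pullback (al \o ai) g i p = g i p.
  have -> : al \o ai = id by apply/funext => x; exact: Ka.
  exact: pullback_id hg I di.
have e2 : pullback (al \o ai) g i p = (s ^+ 2)%:C *: pullback ai g i p.
  apply: etrans (pullback_comp hg I (hol_on_holp hai I) (hol_on_holp ha I) di) _.
  have -> : pullback ai (pullback al g) i p = pullback ai (scale_tensor (fun=> s ^+ 2) g) i p.
    by apply: (pullback_ext (U := setT)) => // j q _ dq; rewrite /scale_tensor ea.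
  by rewrite pullback_scale.
rewrite -e1 e2 scalerA -rmorphM /= -exprMn mulVf ?gt_eqF // expr1n rmorph1 scale1r //.
Qed.

Lemma homothety_dist al s x y : homothety al s -> dist (al x) (al y) = s * dist x y.
Proof.
move=> hal; apply/eqP; rewrite eq_le (homothety_dist_le _ _ hal) /=.
have [s0 [_ [ai [hai aK Ka]]] _] := hal.
have := homothety_dist_le (al x) (al y) (homothety_inv hal hai aK Ka).
by rewrite !aK ler_pdivlMl.
Qed.

End Distance.

(** * Homotheties when some closed ball is not compact *)

Section Radius.
Variables (R : realType) (n : nat).
Local Notation C := (Cx R).
Local Notation V := 'rV[C]_n.
Variables (Y : complexManifold R n) (g : tensor Y).
Hypothesis hg : hermitian_metric_on setT g.
Hypothesis pc : path_connected R Y.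
Local Notation d := (dist g).
Local Notation phi i := (cmap (mchart (i : mindex Y))).

Definition cball (y : Y) (r : R) : set Y := [set z | d y z <= r].

Lemma closed_cball y r : closed (cball y r).
Proof.
rewrite -[cball y r]setCK; apply: open_closedC; rewrite openE => z /= /negP; rewrite -ltNge => rz.
have e0 : 0 < d y z - r by rewrite subr_gt0.
apply: filterS (near_dist hg pc z e0) => z' hz' h; have := dist_tri hg pc y z' z.
by rewrite (dist_sym g z' z) => h2; have := le_lt_trans h2 (ler_ltD h hz'); rewrite subrKC ltxx.
Qed.

Lemma cball_sub y z r s : d y z + s <= r -> cball z s `<=` cball y r.
Proof.
by move=> h w zw; apply: le_trans (dist_tri hg pc y z w) _; apply: le_trans h; rewrite lerD2l.
Qed.

Lemma cball_compact_sub y z r s : d y z + s <= r -> compact (cball y r) -> compact (cball z s).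
Proof. by move=> h cr; apply: subclosed_compact cr (cball_sub h); exact: closed_cball. Qed.

Lemma cball_local y : exists2 r : R, 0 < r & compact (cball y r).
Proof.
have [c c0 [r r0 [rc hr]]] := dist_lower hg pc y.
set i := chart_at y in rc hr.
have cK := chart_ball_compact rc.
exists (c * r / 2); first by rewrite divr_gt0 // mulr_gt0.
apply: (@subclosed_compact Y _ _ (@closed_cball y _) cK) => z zr.
have zlt : d y z < c * r.
  by apply: le_lt_trans zr _; apply: half_lt; rewrite mulr_gt0.
have [dz h] := hr z zlt; exists (phi i z); last exact: cmapK.
by rewrite /= -(ler_pM2l c0); apply: le_trans h (ltW zlt).
Qed.

Lemma homothety_cball al s y r : homothety g al s -> al @` cball y r = cball (al y) (s * r).
Proof.
move=> hal; have [s0 [_ [ai [hai aK Ka]]] _] := hal.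
apply/seteqP; split=> [_ [z zr <-]|w wr].
  by rewrite /cball /= (homothety_dist hg pc _ _ hal) ler_pM2l.
exists (ai w); last exact: Ka.
by rewrite /cball /= -(ler_pM2l s0) -(homothety_dist hg pc _ _ hal) Ka.
Qed.

Hypothesis nonproper : forall y, exists2 r, 0 <= r & ~ compact (cball y r).

Definition cradius y : R := sup [set r | compact (cball y r)].

Lemma cradius_has_sup y : has_sup [set r | compact (cball y r)].
Proof.
split; first by have [r _ cr] := cball_local y; exists r.
have [r r0 nr] := nonproper y; exists r => s cs; rewrite leNgt; apply/negP => rs; apply: nr.
by apply: (cball_compact_sub _ cs); rewrite (dist_xx hg pc) add0r ltW.
Qed.

Lemma cradius_gt0 y : 0 < cradius y.
Proof.
have [r r0 cr] := cball_local y; apply: (lt_le_trans r0).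
by apply: sup_upper_bound; [exact: cradius_has_sup|].
Qed.

Lemma cradius_compact y r : r < cradius y -> compact (cball y r).
Proof.
move=> hr; have e0 : 0 < cradius y - r by rewrite subr_gt0.
have [s cs hs] := sup_adherent e0 (cradius_has_sup y).
apply: (cball_compact_sub _ cs); rewrite (dist_xx hg pc) add0r ltW //.
by move: hs; rewrite -/(cradius y) opprB addrC subrK.
Qed.

Lemma cradius_lip y z : cradius y <= cradius z + d y z.
Proof.
apply: ge_sup; first exact: (cradius_has_sup y).1.
move=> r cr; rewrite -lerBlDr; apply: sup_upper_bound; first exact: cradius_has_sup.
by apply: (cball_compact_sub _ cr); rewrite addrC subrK.
Qed.

Lemma cradius_hom_le al s y : homothety g al s -> s * cradius y <= cradius (al y).
Proof.
move=> hal; have [s0 bal _] := hal; rewrite -ler_pdivlMl //.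
apply: ge_sup; first exact: (cradius_has_sup y).1.
move=> r cr; rewrite ler_pdivlMl //; apply: sup_upper_bound; first exact: cradius_has_sup.
rewrite /mkset -(homothety_cball _ _ hal); apply: continuous_compact => //.
apply/within_continuousP => z _ N hN; have [[cal _] _] := bal.
have hN' : nbhs z [set w | N (al w)] := cal z I _ hN.
by apply: filterS hN' => w /= ? _.
Qed.

Lemma cradius_hom al s y : homothety g al s -> cradius (al y) = s * cradius y.
Proof.
move=> hal; apply/eqP; rewrite eq_le (cradius_hom_le _ hal) andbT.
have [s0 [_ [ai [hai aK Ka]]] _] := hal.
have := cradius_hom_le (al y) (homothety_inv hg hal hai aK Ka).
by rewrite aK mulrC ler_pdivrMr // mulrC.
Qed.

(** The ratio is read off from the finite positive [cradius]; this makes the ratio of a group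
    element independent of the choice in [sc]. *)
Lemma homothety_scale_uniq al s t : homothety g al s -> homothety g al t -> Y -> s = t.
Proof.
move=> h1 h2 y; have := cradius_hom y h1; rewrite (cradius_hom y h2) => /mulIf -> //.
by rewrite gt_eqF // cradius_gt0.
Qed.

(** An e / 2 net of the compact set is moved into the set itself, at the cost of doubling its
    radius; useless centres go to the default point x0. *)
Lemma metric_net (y0 : Y) (K : set Y) e : compact K -> 0 < e -> K !=set0 -> exists (N : nat) (k : nat -> Y),
  (forall a, K (k a)) /\ forall z, K z -> exists2 a, (a < N)%N & d z (k a) <= e.
Proof.
move=> cK e0 [x0 Kx0].
have e2 : 0 < e / 2 by rewrite divr_gt0.
have [N [s hs]] := compact_net y0 cK (fun x => near_dist hg pc x e2).
have /choice[k hk] a : exists k, K k /\ forall z, K z -> d (s a) z < e / 2 -> d z k <= e.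
  have [[k [Kk sk]]|no] := pselect (exists k, K k /\ d (s a) k < e / 2).
    exists k; split=> // z Kz sz; apply: le_trans (dist_tri hg pc z (s a) k) _.
    by rewrite (dist_sym g) [e]splitr; apply: lerD; exact: ltW.
  by exists x0; split=> // z Kz sz; case: no; exists z.
exists N, k; split=> [a|z Kz]; first exact: (hk a).1.
by have [a aN ha] := hs z Kz; exists a => //; exact: (hk a).2.
Qed.

End Radius.

Lemma pow_close1 (R : realType) (k : nat) (e : R) : 0 < e -> exists2 t, 0 < t & forall b, `|b - 1| <= t -> `|b ^+ k - 1| <= e.
Proof.
move=> e0; have c : {for 1, continuous (fun x : R => x ^+ k)} by exact: exprn_continuous.
have h : nbhs (1 ^+ k : R) [set x | `|x - 1| <= e].
  rewrite expr1n; apply/nbhs_ballP; exists e => // x; rewrite /ball /= distrC => /ltW.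
  exact.
have /nbhs_ballP[t /= t0 ht] := c _ h; exists (t / 2); first by rewrite divr_gt0.
move=> b bt; apply: (ht b); rewrite /ball /= distrC; apply: le_lt_trans bt _.
by rewrite ltr_pdivrMr // ltr_pMr // ltr1n.
Qed.

Lemma norm_le_of (R : realType) (a b c : R) : a <= b + c -> b <= a + c -> `|a - b| <= c.
Proof. by move=> h1 h2; rewrite ler_norml; apply/andP; split; lraH h1 h2. Qed.

Lemma near_five (R : realType) (x p : R) : `|x - 5 * p| <= p -> 4 * p <= x /\ x <= 6 * p.
Proof. by rewrite ler_norml => /andP[h1 h2]; split; lraH h1 h2. Qed.

Lemma orbit_diff (R : realType) (p q A B T M e : R) : `|p - q| <= e -> `|q| <= M -> `|A| <= T -> `|B - 1| <= e ->
  `|p * A - q * (A * B)| <= T * (e + M * e).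
Proof.
move=> h1 h2 h3 h4; have -> : p * A - q * (A * B) = A * ((p - q) - q * (B - 1)) by ring.
rewrite normrM; apply: ler_pM => //; apply: le_trans (ler_normB _ _) _; apply: lerD => //.
by rewrite normrM; apply: ler_pM.
Qed.

(** * The group of homotheties and its action *)

Section HomothetyGroup.
Variables (R : realType) (n : nat).
Local Notation C := (Cx R).
Local Notation V := 'rV[C]_n.
Variables (Y : complexManifold R n) (g : tensor Y).
Hypothesis hg : hermitian_metric_on setT g.
Hypothesis pc : path_connected R Y.
Local Notation d := (dist g).
Local Notation cball := (cball g).
Local Notation phi i := (cmap (mchart (i : mindex Y))).

(** The ratio is kept out of the data, so that two elements are equal as soon as they act
    equally. *)
Definition hgroup := {al : Y -> Y | exists s, homothety g al s}.
Definition act (a : hgroup) : Y -> Y := sval a.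
Definition sc (a : hgroup) : R := projT1 (cid (svalP a)).

Lemma scP a : homothety g (act a) (sc a).
Proof. exact: projT2 (cid (svalP a)). Qed.

Lemma sc_gt0 a : 0 < sc a.
Proof. by have [] := scP a. Qed.

Lemma hgroup_eq a b : act a =1 act b -> a = b.
Proof.
case: a b => [a pa] [b pb] /funext; rewrite /act /= => e; subst b.
by congr exist; exact: Prop_irrelevance.
Qed.

Definition hone : hgroup := exist _ id (ex_intro _ 1 (homothety_id hg)).
Definition hmul (a b : hgroup) : hgroup :=
  exist _ (act a \o act b) (ex_intro _ (sc a * sc b) (homothety_comp hg (scP a) (scP b))).

Lemma hinv_ex a : exists b : hgroup, cancel (act a) (act b) /\ cancel (act b) (act a).
Proof.
have [_ [_ [ai [hai aK Ka]]] _] := scP a.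
by exists (exist _ ai (ex_intro _ _ (homothety_inv hg (scP a) hai aK Ka))).
Qed.

Definition hinv a := projT1 (cid (hinv_ex a)).
Lemma actK a : cancel (act a) (act (hinv a)).
Proof. exact: (projT2 (cid (hinv_ex a))).1. Qed.
Lemma actVK a : cancel (act (hinv a)) (act a).
Proof. exact: (projT2 (cid (hinv_ex a))).2. Qed.

Lemma hmulA a b c : hmul a (hmul b c) = hmul (hmul a b) c.
Proof. exact: hgroup_eq. Qed.
Lemma hmul1 a : hmul hone a = a.
Proof. exact: hgroup_eq. Qed.
Lemma hmulV a : hmul (hinv a) a = hone.
Proof. by apply: hgroup_eq => x; exact: actK. Qed.
Lemma hmulV' a : hmul a (hinv a) = hone.
Proof. by apply: hgroup_eq => x; exact: actVK. Qed.

Lemma act_inv_mul a b y : act (hinv (hmul (hinv b) a)) y = act (hinv a) (act b y).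
Proof.
have e : act (hmul (hinv b) a) (act (hinv a) (act b y)) = y by rewrite /= actVK actK.
by rewrite -{1}e actK.
Qed.

Lemma act_dist a x y : d (act a x) (act a y) = sc a * d x y.
Proof. exact: (homothety_dist hg pc x y (scP a)). Qed.

Hypothesis nonproper : forall y, exists2 r, 0 <= r & ~ compact (cball y r).
Local Notation rad := (cradius g).

Lemma rad_gt0 y : 0 < rad y.
Proof. exact: cradius_gt0. Qed.

Lemma act_rad a y : rad (act a y) = sc a * rad y.
Proof. exact: cradius_hom (scP a). Qed.

Lemma rad_lip y z : `|rad y - rad z| <= d y z.
Proof.
have h1 := cradius_lip hg pc nonproper y z; have h2 := cradius_lip hg pc nonproper z y.
by rewrite (dist_sym g z y) in h2; exact: norm_le_of.
Qed.

Lemma sc_mul a b : Y -> sc (hmul a b) = sc a * sc b.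
Proof.
move=> y; have h1 := act_rad (hmul a b) y; have h2 : rad (act (hmul a b) y) = sc a * sc b * rad y.
  by rewrite /= act_rad act_rad mulrA.
by move: h1; rewrite h2 => /mulIf -> //; rewrite gt_eqF // rad_gt0.
Qed.

Lemma sc_inv a : Y -> sc (hinv a) = (sc a)^-1.
Proof.
move=> y; have := act_rad (hinv a) (act a y); rewrite actK act_rad mulrA => h.
have h1 : 1 * rad y = sc (hinv a) * sc a * rad y by rewrite mul1r.
have /esym/eqP := mulIf (lt0r_neq0 (rad_gt0 y)) h1.
by rewrite -(inj_eq (mulIf (invr_neq0 (lt0r_neq0 (sc_gt0 a))))) mulfK ?lt0r_neq0 ?sc_gt0 // mul1r => /eqP.
Qed.

Variable z0 : Y.
(** With rad z0 = 5 rho, the Lipschitz property puts the radius at every point of the rho-ball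
    between 4 rho and 6 rho. This bounds ratios and leaves room for compact balls of radius 2 rho
    inside it. *)
Definition rho : R := rad z0 / 5.
Lemma rho_gt0 : 0 < rho.
Proof. by rewrite divr_gt0 ?rad_gt0. Qed.
Lemma rad_z0 : rad z0 = 5 * rho.
Proof. by rewrite /rho mulrC divfK // pnatr_eq0. Qed.

(* These sets need not shrink to the identity: it suffices that they control the action
   on the ball of radius rho around z0. *)
Definition W (m : nat) : set hgroup := [set w | forall z, d z0 z <= rho ->
  d (act w z) z <= m.+1%:R^-1 /\ d (act (hinv w) z) z <= m.+1%:R^-1].

Lemma hinv_one y : act (hinv hone) y = y.
Proof. by rewrite -[LHS]/(act hone (act (hinv hone) y)) actVK. Qed.

Lemma W_one m : W m hone.
Proof. by move=> z _; rewrite hinv_one /= (dist_xx hg pc) invr_ge0. Qed.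

Lemma W_decr m k : (m <= k)%N -> W k `<=` W m.
Proof.
move=> mk w hw z /hw[h1 h2].
have h : k.+1%:R^-1 <= m.+1%:R^-1 :> R by rewrite lef_pV2 ?posrE ?ltr0n // ler_nat.
by split; [exact: le_trans h1 h|exact: le_trans h2 h].
Qed.

Local Notation hsmall := (small hmul hinv W).
Local Notation hCc := (Cc hmul hinv W).

(** The elements that carry some point of the rho-ball around z0 to y. *)
Definition near_orbit (y : Y) : set hgroup := [set a | d z0 (act (hinv a) y) <= rho].

Lemma rad_near z : d z0 z <= rho -> 4 * rho <= rad z /\ rad z <= 6 * rho.
Proof.
move=> h; have := rad_lip z z0; rewrite (dist_sym g z z0) rad_z0 => /le_trans/(_ h).
exact: near_five.
Qed.

Lemma sc_near y a : near_orbit y a -> (sc a)^-1 <= 6 * rho / rad y /\ sc a <= rad y / (4 * rho).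
Proof.
move=> /rad_near[h1 h2]; have := act_rad a (act (hinv a) y); rewrite actVK => e.
have r0 := rad_gt0 (act (hinv a) y); have s0 := sc_gt0 a; have p0 := rho_gt0.
split.
  rewrite e invfM mulrA mulrAC -[leLHS]mul1r ler_pM2r ?invr_gt0 // ler_pdivlMr // mul1r //.
have p4 : 0 < 4 * rho by rewrite mulr_gt0.
by rewrite (ler_pdivlMr _ _ p4) e (ler_pM2l s0).
Qed.

(** The Arzelà-Ascoli argument. By [sc_near] these elements are uniformly Lipschitz and map the
    rho-ball into the compact ball of radius rad y / 2 at y. Elements are classified by the points
    of a finite net near which they send the points of another; two with the same pattern are close
    on the whole rho-ball, and so are their inverses, because the inverse ratios are bounded too. *)
Lemma small_near_orbit y : hsmall (near_orbit y).
Proof.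
move=> m; have p0 := rho_gt0; have r0 := rad_gt0 y.
pose smax := rad y / (4 * rho); pose tmax := 6 * rho / rad y.
have smax0 : 0 < smax by rewrite divr_gt0 // mulr_gt0.
have tmax0 : 0 < tmax by rewrite divr_gt0 // mulr_gt0.
(* From z to a net point costs smax e for each of the two maps, the images of net points cost e
   twice, and pulling back by an inverse multiplies by at most tmax. *)
pose Q := tmax * (2 * smax + 2).
have Q0 : 0 < Q by rewrite mulr_gt0 // addr_gt0 // mulr_gt0.
pose e : R := m.+1%:R^-1 / Q.
have e0 : 0 < e by rewrite divr_gt0 // invr_gt0.
have cK0 : compact (cball z0 rho).
  apply: (cradius_compact hg pc nonproper); rewrite rad_z0 ltr_pMl // ltr1n //.
have cK2 : compact (cball y (rad y / 2)) by apply: (cradius_compact hg pc nonproper); exact: half_lt.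
have ne0 : cball z0 rho !=set0.
  have h : d z0 z0 <= rho by rewrite (dist_xx hg pc) ltW.
  by exists z0.
have ne2 : cball y (rad y / 2) !=set0.
  have h : d y y <= rad y / 2 by rewrite (dist_xx hg pc) divr_ge0 // ltW.
  by exists y.
have [N [k [kK hk]]] := metric_net hg pc y cK0 e0 ne0.
have [M [l [_ hl]]] := metric_net hg pc y cK2 e0 ne2.
have maps a : near_orbit y a -> forall z, d z0 z <= rho -> d y (act a z) <= rad y / 2.
  move=> na z hz; rewrite -{1}(actVK a y) act_dist.
  have [_ hs] := sc_near na; have s0 := sc_gt0 a.
  have h1 : d (act (hinv a) y) z <= 2 * rho.
    apply: le_trans (dist_tri hg pc _ z0 _) _; rewrite mulr_natl mulr2n; apply: lerD => //.
    by rewrite (dist_sym g).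
  apply: (@le_trans _ _ (smax * (2 * rho))).
    by apply: ler_pM => //; [exact: ltW|exact: dist_ge0].
  by apply: eq_leW; rewrite /smax; field; rewrite gt_eqF.
have cl a : near_orbit y a -> exists f : {ffun 'I_N -> 'I_M.+1}, forall i : 'I_N, d (act a (k i)) (l (f i)) <= e.
  move=> na; have /choice[f hf] (i : 'I_N) : exists j : 'I_M.+1, d (act a (k i)) (l j) <= e.
    have [b bM hb] := hl _ (maps a na (k i) (kK i)).
    by exists (Ordinal (ltnW bM : (b < M.+1)%N)).
  by exists [ffun i => f i] => i; rewrite ffunE.
(* One representative per pattern that occurs, and a default for the others. *)
have /choice[rep hrep] (f : {ffun 'I_N -> 'I_M.+1}) : exists s : hgroup,
    (exists2 a, near_orbit y a & forall i : 'I_N, d (act a (k i)) (l (f i)) <= e) ->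
    near_orbit y s /\ forall i : 'I_N, d (act s (k i)) (l (f i)) <= e.
  have [[a na ha]|no] := pselect (exists2 a, near_orbit y a & forall i : 'I_N, d (act a (k i)) (l (f i)) <= e).
    by exists a.
  by exists hone => h; case: no.
(* The target has M.+1 elements so that a default pattern exists even for M = 0. *)
pose enumf (i : nat) : {ffun 'I_N -> 'I_M.+1} := nth [ffun=> ord0] (enum {: {ffun 'I_N -> 'I_M.+1}}) i.
exists #|{: {ffun 'I_N -> 'I_M.+1}}|, (fun i => rep (enumf i)) => a na.
have [f hf] := cl a na.
exists (index f (enum {: {ffun 'I_N -> 'I_M.+1}})); first by rewrite cardE index_mem mem_enum.
rewrite /enumf nth_index ?mem_enum //.
have [ns hs] := hrep f (ex_intro2 _ _ a na hf).
set s := rep f in ns hs *.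
have close z : d z0 z <= rho -> d (act a z) (act s z) <= (2 * smax + 2) * e.
  move=> hz; have [b bN hb] := hk z hz.
  have ha' := hf (Ordinal bN); have hs' := hs (Ordinal bN); rewrite /= in ha' hs'.
  have [_ sa] := sc_near na; have [_ ss] := sc_near ns.
  apply: le_trans (dist_tri hg pc _ (act a (k b)) _) _.
  have h1 : d (act a z) (act a (k b)) <= smax * e.
    by rewrite act_dist; exact: (ler_pM (ltW (sc_gt0 a)) (dist_ge0 hg pc _ _) sa hb).
  have h2 : d (act a (k b)) (act s (k b)) <= e + e.
    apply: le_trans (dist_tri hg pc _ (l (f (Ordinal bN))) _) _; apply: lerD => //.
    by rewrite (dist_sym g).
  have h3 : d (act s (k b)) (act s z) <= smax * e.
    by rewrite act_dist (dist_sym g); exact: (ler_pM (ltW (sc_gt0 s)) (dist_ge0 hg pc _ _) ss hb).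
  have h4 := dist_tri hg pc (act a (k b)) (act s (k b)) (act s z).
  apply: le_trans (lerD h1 (le_trans h4 (lerD h2 h3))) _.
  by apply: eq_leW; ring.
have fin x : 0 < x -> x <= tmax -> x * ((2 * smax + 2) * e) <= m.+1%:R^-1.
  move=> x0 xt; apply: (@le_trans _ _ (tmax * ((2 * smax + 2) * e))).
    by rewrite ler_wpM2r // mulr_ge0 ?(ltW e0) // addr_ge0 // mulr_ge0 // ltW.
  by rewrite mulrA -/Q /e mulrC divfK // gt_eqF.
move=> z hz; split.
  have -> : d (act (hmul (hinv s) a) z) z = (sc s)^-1 * d (act a z) (act s z).
    by rewrite -(sc_inv s y) -act_dist actK.
  have [hs1 _] := sc_near ns; have si : 0 < (sc s)^-1 by rewrite invr_gt0 sc_gt0.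
  by apply: le_trans (fin _ si hs1); rewrite ler_pM2l //; exact: close.
rewrite act_inv_mul.
have -> : d (act (hinv a) (act s z)) z = (sc a)^-1 * d (act a z) (act s z).
  by rewrite -(sc_inv a y) -act_dist actK (dist_sym g).
have [hs1 _] := sc_near na; have si : 0 < (sc a)^-1 by rewrite invr_gt0 sc_gt0.
by apply: le_trans (fin _ si hs1); rewrite ler_pM2l //; exact: close.
Qed.

(* Averaging over a produces a function of y that is homogeneous of weight -k. *)
Definition orbit_fun (psi : Y -> R) (k : nat) (y : Y) (a : hgroup) : R := psi (act (hinv a) y) * (sc a)^-1 ^+ k.

Definition unif_cont (psi : Y -> R) := forall e, 0 < e -> exists2 t, 0 < t & forall z z', d z z' <= t -> `|psi z - psi z'| <= e.

Lemma near_inv_nat (t : R) : 0 < t -> exists m : nat, m.+1%:R^-1 <= t.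
Proof.
move=> t0; have [k _ /(_ k (leqnn _))] := near_infty_natSinv_lt (PosNum t0).
by exists k; exact: ltW.
Qed.

(** Translating a by an element of some [W m] moves a^-1 y little while that point is in the
    rho-ball, and changes the ratio by a factor near 1, since ratios are quotients of radii at z0.
    The support lies in [near_orbit y], which is small. *)
Lemma orbit_fun_Cc psi k y : unif_cont psi -> (exists M, forall z, `|psi z| <= M) ->
  (forall z, rho / 2 < d z0 z -> psi z = 0) -> hCc (orbit_fun psi k y).
Proof.
move=> uc [M hM] psi0; have p0 := rho_gt0; have r0 := rad_gt0 y.
have M0 : 0 <= M by apply: le_trans (hM y).
pose tmax := 6 * rho / rad y.
have tmax0 : 0 < tmax by rewrite divr_gt0 // mulr_gt0.
have psiz z : psi z != 0 -> d z0 z <= rho / 2 by move=> nz; rewrite leNgt; apply: contra nz => /psi0 ->.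
have half : rho / 2 <= rho by apply: ltW; exact: half_lt.
split.
- move=> e e0.
  pose P := tmax ^+ k * (1 + M); have P0 : 0 < P by rewrite mulr_gt0 ?exprn_gt0 // ltr_pwDl.
  have e1 : 0 < e / P by rewrite divr_gt0.
  pose e2 := Num.min 1 (e / P / 4).
  have e20 : 0 < e2 by rewrite lt_min ltr01 !divr_gt0.
  have [t t0 ht] := uc _ e20; have [b b0 hb] := pow_close1 k e20.
  (* Here m controls psi, m' the ratio through the radius at z0; m2 below prevents points outside
     the rho-ball from being moved into the support of psi. *)
  have [m hm] := near_inv_nat t0; have [m' hm'] := near_inv_nat (mulr_gt0 b0 (rad_gt0 z0)).
  have [m2 hm2] := near_inv_nat (divr_gt0 p0 (ltr0Sn R 1)).
  exists (maxn m (maxn m' m2)) => s t' Wst; set w := hmul (hinv s) t' in Wst.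
  have Wm := W_decr (leq_maxl m (maxn m' m2)) Wst.
  have Wm' := W_decr (leq_trans (leq_maxl m' m2) (leq_maxr m _)) Wst.
  have Wm2 := W_decr (leq_trans (leq_maxr m' m2) (leq_maxr m _)) Wst.
  have tE : t' = hmul s w by rewrite /w hmulA hmulV' hmul1.
  set z := act (hinv s) y.
  have zE : act (hinv t') y = act (hinv w) z by rewrite /w /z act_inv_mul actVK.
  have scE : sc t' = sc s * sc w by rewrite tE (sc_mul _ _ y).
  rewrite /orbit_fun zE scE -/z.
  (* Outside the rho-ball [W] gives no control, but both values vanish there: psi lives in the ball
     of radius rho / 2. *)
  have [hz|hz] := leP (d z0 z) rho; last first.
    have -> : psi z = 0 by apply: psi0; exact: le_lt_trans hz.
    have -> : psi (act (hinv w) z) = 0.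
      apply: contrapT => /eqP/psiz hz'.
      have [h1 _] := Wm2 _ (le_trans hz' half); rewrite actVK in h1.
      have : d z0 z <= rho.
        apply: le_trans (dist_tri hg pc _ (act (hinv w) z) _) _.
        rewrite (dist_sym g _ z) [rho in leRHS]splitr; apply: lerD => //; exact: le_trans hm2.
      by rewrite leNgt hz.
    by rewrite !mul0r subrr normr0 ltW.
  have [_ hd] := Wm _ hz.
  have z00 : d z0 z0 <= rho by rewrite (dist_xx hg pc) ltW.
  have [_ hd2] := Wm' _ z00.
  have wE : (sc w)^-1 = rad (act (hinv w) z0) / rad z0.
    by rewrite act_rad (sc_inv w y) mulfK // gt_eqF // rad_gt0.
  have hw : `|(sc w)^-1 - 1| <= b.
    rewrite wE -[X in _ - X](divff (lt0r_neq0 (rad_gt0 z0))) -mulrBl normrM [`|_^-1|]gtr0_norm ?invr_gt0 ?rad_gt0 //.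
    rewrite ler_pdivrMr ?rad_gt0 //; apply: le_trans (rad_lip _ _) _; exact: le_trans hm'.
  have hB := hb _ hw.
  have hA : `|(sc s)^-1 ^+ k| <= tmax ^+ k.
    have si : 0 < (sc s)^-1 by rewrite invr_gt0 sc_gt0.
    rewrite normrX gtr0_norm //; apply: lerXn2r; [by rewrite nnegrE ltW|by rewrite nnegrE ltW|].
    by have [] := sc_near (y := y) (a := s) hz.
  have E : (sc s * sc w)^-1 ^+ k = (sc s)^-1 ^+ k * (sc w)^-1 ^+ k by rewrite invfM exprMn.
  rewrite (dist_sym g) in hd; have hd3 := ht _ _ (le_trans hd hm).
  rewrite E; apply: le_trans (orbit_diff hd3 (hM _) hA hB) _.
  rewrite -[X in X + _]mul1r -mulrDl mulrA -/P mulrC -ler_pdivlMr //.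
  rewrite /e2 ge_min; apply/orP; right.
  by rewrite ler_pdivrMr // ler_peMr ?(ltW e1) // ler1n.
- exists (M * tmax ^+ k) => a; rewrite /orbit_fun.
  have [->|nz] := eqVneq (psi (act (hinv a) y)) 0; first by rewrite mul0r normr0 mulr_ge0 // exprn_ge0 // ltW.
  have na : near_orbit y a by rewrite /near_orbit /=; apply: le_trans (psiz _ nz) half.
  have si : 0 < (sc a)^-1 by rewrite invr_gt0 sc_gt0.
  rewrite normrM; apply: ler_pM => //; rewrite normrX gtr0_norm //; apply: lerXn2r; [by rewrite nnegrE ltW|by rewrite nnegrE ltW|].
  by have [] := sc_near na.
exists (near_orbit y); first exact: small_near_orbit.
move=> a na; rewrite /orbit_fun psi0 ?mul0r //; rewrite ltNge; apply/negP => h; apply: na.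
exact: le_trans half.
Qed.

End HomothetyGroup.

(** * Bump functions in charts and on the manifold *)

Section VectorBump.
Variables (R : realType) (n : nat).
Local Notation C := (Cx R).
Local Notation V := 'rV[C]_n.

(** The Euclidean square is used because it is polynomial, whereas [rn] is not smooth; hence the
    factor 2 in [vbump_supp]. *)
Definition vbump (x0 : V) (b : R) (v : V) : R := flat 0 (b ^+ 2 -
  \sum_(k < n) ((complex.Re (v 0 k) - complex.Re (x0 0 k)) ^+ 2 + (complex.Im (v 0 k) - complex.Im (x0 0 k)) ^+ 2)).

Lemma vbump_ge0 x0 b v : 0 <= vbump x0 b v.
Proof. exact: flat_ge0. Qed.

Lemma vbump_le1 x0 b v : vbump x0 b v <= 1.
Proof. by apply: le_trans (ler_norm _) _; apply: le_trans (flat_bound 0 _) _. Qed.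

Lemma vbump_center x0 b : 0 < b -> 0 < vbump x0 b x0.
Proof.
move=> b0; rewrite flat_gt0 big1 ?subr0 ?exprn_gt0 // => k _.
by rewrite !subrr expr0n addr0.
Qed.

Lemma vbump_supp x0 b v : 0 <= b -> vbump x0 b v != 0 -> rn (v - x0) <= 2 * b.
Proof.
move=> b0 nz; have : 0 < vbump x0 b v by rewrite lt_def nz vbump_ge0.
rewrite flat_gt0 subr_gt0 => h; apply: rn_le => [|k]; first by rewrite mulr_ge0.
have sq t : t ^+ 2 <= b ^+ 2 -> `|t| <= b by move=> ht; apply: sqr_le_sq => //; rewrite real_normK // num_real.
have hk : (complex.Re (v 0 k) - complex.Re (x0 0 k)) ^+ 2 + (complex.Im (v 0 k) - complex.Im (x0 0 k)) ^+ 2 <= b ^+ 2.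
  apply: le_trans (ltW h); rewrite (bigD1 k) //= lerDl sumr_ge0 // => i _.
  by rewrite addr_ge0 // sqr_ge0.
apply: le_trans (rn_le_ReIm _) _; rewrite mulr_natl mulr2n !mxE ReB ImB.
by apply: lerD; apply: sq; apply: le_trans hk; rewrite ?lerDl ?lerDr sqr_ge0.
Qed.

Lemma vbump_ECk (Om : Type) (S : set Om) m (U : set V) (F : Om -> V -> V) x0 b : open U ->
  (forall k, bholo_fam S U (fun w x => F w x 0 k : C)) -> ECk S m U (fun w x => vbump x0 b (F w x)).
Proof.
move=> oU hF; have cst (c : R) : ECk S m U (fun _ _ => c) by apply: ECk_cst; exists `|c|.
apply: (ECk_scale oU (@flat_bound R) (@is_derive_flat R)); apply: (ECkB oU (cst _)).
apply: ECk_sum => // k; have [h1 h2] := ECk_holo m oU (hF k).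
have g1 := ECkB oU h1 (cst (complex.Re (x0 0 k))); have g2 := ECkB oU h2 (cst (complex.Im (x0 0 k))).
exact: (ECkD oU (ECkM oU g1 g1) (ECkM oU g2 g2)).
Qed.

End VectorBump.

Section ManifoldBump.
Variables (R : realType) (n : nat).
Local Notation C := (Cx R).
Local Notation V := 'rV[C]_n.
Variables (Y : complexManifold R n) (g : tensor Y).
Hypothesis hg : hermitian_metric_on setT g.
Hypothesis pc : path_connected R Y.
Local Notation d := (dist g).
Local Notation cball := (cball g).
Local Notation phi i := (cmap (mchart (i : mindex Y))).

Lemma dist_cont_pt (y : Y) (f : Y -> R) : {for y, continuous f} -> forall e, 0 < e ->
  exists2 t, 0 < t & forall z, d y z < t -> `|f z - f y| <= e.
Proof.
move=> cf e e0; have h : nbhs (f y) [set x | `|x - f y| <= e].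
  apply/nbhs_ballP; exists e => // x; rewrite /ball /= distrC => /ltW; exact.
have h2 : nbhs y [set z | `|f z - f y| <= e] := cf _ h.
by have [t t0 ht] := (nbhs_dist hg pc y _).1 h2; exists t.
Qed.

(** A Lebesgue number argument on the ball of radius 2 tau. The modulus is at most tau, so a point
    close to one outside this ball is outside the support as well. *)
Lemma compact_unif_cont z0 tau (psi : Y -> R) : 0 < tau -> compact (cball z0 (2 * tau)) ->
  (forall y, {for y, continuous psi}) -> (forall z, tau <= d z0 z -> psi z = 0) -> unif_cont g psi.
Proof.
move=> t0 cK cpsi supp e e0; have e2 : 0 < e / 2 by rewrite divr_gt0.
have /choice[t ht] (y : Y) : exists t, 0 < t /\ forall z, d y z < 2 * t -> `|psi z - psi y| <= e / 2.
  have [t t1 ht] := dist_cont_pt (cpsi y) e2; exists (t / 2); split; first by rewrite divr_gt0.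
  by move=> z; rewrite mulrC divfK ?pnatr_eq0 //; exact: ht.
have tp y : 0 < t y by case: (ht y).
have nb y : nbhs y [set z | d y z < t y] by exact: (near_dist hg pc y (tp y)).
have [N [s hs]] := compact_net z0 cK nb.
pose m := \big[Num.min/tau]_(i < N) t (s i).
have mle (i : 'I_N) : m <= t (s i) by exact: bigmin_le.
exists m.
  by apply: (big_ind (fun x => 0 < x)) => // x y x0 y0; rewrite lt_min x0.
have mt : m <= tau by exact: bigmin_le_id.
move=> z z' zz'; have [zK|zK] := leP (d z0 z) (2 * tau).
  have [i iN hz] := hs z zK; have hm := mle (Ordinal iN); rewrite /= in hm.
  have [_ hp] := ht (s i); have tt := tp (s i); rewrite /= in hz.
  have z1 : d (s i) z < 2 * t (s i) by lraH hz tt.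
  have z2 : d (s i) z' < 2 * t (s i).
    by apply: le_lt_trans (dist_tri hg pc _ z _) _; lraH hz zz' hm.
  have := hp _ z1; have := hp _ z2; rewrite distrC => k1 k2.
  by have := ler_normD (psi z - psi (s i)) (psi (s i) - psi z'); rewrite addrA subrK => k3; lraH k1 k2 k3.
rewrite supp; last by lraH zK t0.
rewrite supp ?subrr ?normr0 ?ltW //.
by have := dist_tri hg pc z0 z' z; rewrite (dist_sym g z' z) => k; lraH k zK zz' mt.
Qed.

(** A bump in the chart at z0, extended by 0. The radius 4 tau fits into the chart, which leaves a
    margin around the support of radius tau for moving points; the last clause gives equismoothness
    after composition with bounded holomorphic families. *)
Lemma dist_bump z0 T : 0 < T -> (forall r, r < T -> compact (cball z0 r)) ->
  exists psi : Y -> R, exists2 tau, 0 < tau & exists2 M : R, 4 * tau <= T &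
  [/\ forall z, 0 <= psi z <= 1,
      forall z, tau <= d z0 z -> psi z = 0,
      0 < psi z0, unif_cont g psi &
      [/\ forall z, d z0 z < 4 * tau -> dom (mchart (chart_at z0)) z /\ rn (phi (chart_at z0) z) <= M &
       forall (Om : Type) (S : set Om) m (U : set V) (F : Om -> V -> Y), open U ->
        (forall w x, S w -> U x -> dom (mchart (chart_at z0)) (F w x)) ->
        (forall k, bholo_fam S U (fun w x => phi (chart_at z0) (F w x) 0 k : C)) ->
        ECk S m U (fun w x => psi (F w x))]].
Proof.
move=> T0 hT; have [c c0 [r r0 [hr hd]]] := dist_lower hg pc z0.
set i := chart_at z0 in hr hd *; have di : dom (mchart i) z0 := dom_chart_at z0.
pose q := Num.min T (c * r); have q0 : 0 < q by rewrite lt_min T0 mulr_gt0.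
have qT : q <= T by rewrite ge_min lexx.
have qr : q <= c * r by rewrite ge_min lexx orbT.
pose tau := q / 4; have t0 : 0 < tau by rewrite divr_gt0.
have q4 : q = 4 * tau by rewrite /tau mulrC divfK // pnatr_eq0.
have nd : nbhs z0 [set z | d z0 z < tau] := near_dist hg pc z0 t0.
have [r1 r10 hr1] := (nbhs_rnP _ _).1 (chart_nbhs di nd).
pose b := r1 / 4; have b0 : 0 < b by rewrite divr_gt0.
pose psi z := if `[< dom (mchart i) z >] then vbump (phi i z0) b (phi i z) else 0.
have psiE z : dom (mchart i) z -> psi z = vbump (phi i z0) b (phi i z) by rewrite /psi => /asboolP ->.
have supp z : tau <= d z0 z -> psi z = 0.
  move=> hz; have [dz|ndz] := pselect (dom (mchart i) z); last by rewrite /psi; case: asboolP.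
  rewrite psiE //; apply: contrapT => /eqP/(vbump_supp (ltW b0)) h.
  have h' : rn (phi i z - phi i z0) < r1 by move: h; rewrite /b => h; lraH h r10.
  by have [_] := hr1 _ h'; rewrite /= (cmapK dz) ltNge hz.
have dz z : d z0 z < 4 * tau -> dom (mchart i) z /\ rn (phi i z) <= r + rn (phi i z0).
  rewrite -q4 => /lt_le_trans/(_ qr) hz; have [dz h] := hd z hz; split=> //.
  have h2 : c * rn (phi i z - phi i z0) <= c * r by apply: le_trans h (ltW hz).
  rewrite -(subrK (phi i z0) (phi i z)); apply: le_trans (rnD _ _) _.
  by rewrite lerD2r -(ler_pM2l c0).
have fam (Om : Type) (S : set Om) m (U : set V) (F : Om -> V -> Y) : open U ->
        (forall w x, S w -> U x -> dom (mchart i) (F w x)) ->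
        (forall k, bholo_fam S U (fun w x => phi i (F w x) 0 k : C)) ->
        ECk S m U (fun w x => psi (F w x)).
  move=> oU dF hF; apply: (ECk_ext oU _ (vbump_ECk m (phi i z0) b oU hF)) => w x Sw Ux.
  by rewrite psiE //; exact: dF.
have cpsi y : {for y, continuous psi}.
  have [hy|hy] := ltP tau (d z0 y).
    have e0 : 0 < d z0 y - tau by rewrite subr_gt0.
    have hn : nbhs y [set z | d y z < d z0 y - tau] := near_dist hg pc y e0.
    move=> N /nbhs_singleton hN; rewrite supp ?(ltW hy) // in hN.
    apply: (@filterS _ (nbhs y) _ _ _ _ hn) => z /= hz; rewrite supp //.
    by have := dist_tri hg pc z0 z y; rewrite (dist_sym g z y) => k; lraH k hz.
  have [dy _] : dom (mchart i) y /\ rn (phi i y) <= r + rn (phi i z0) by apply: dz; lraH hy t0.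
  have oc : open (cod (mchart i)) by exact: cod_open.
  have hF k : bholo_fam [set: unit] (cod (mchart i)) (fun _ x => phi i (cinv (mchart i) x) 0 k : C).
    apply: (single_bholo oc) => x cx.
    have nE : nbhs x [set z : V | z 0 k = phi i (cinv (mchart i) z) 0 k].
      have hc : nbhs x (cod (mchart i)) by apply: open_nbhs_nbhs.
      by apply: filterS hc => z cz /=; rewrite cinvK.
    by have [] := differentiable_near nE ((differentiable_coordP id x).1 (ex_diff (f := @id V)) k).
  have [h _] := fam unit [set: unit] 0%N (cod (mchart i)) (fun _ x => cinv (mchart i) x) oc (fun _ x _ cx => cinv_dom cx) hF.
  have [hl _] := h (phi i y) (cmap_cod dy); rewrite (cmapK dy) in hl.
  move=> N /nbhs_ballP[e /= e0 heN]; have e2 : 0 < e / 2 by rewrite divr_gt0.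
  have [dd dd0 hdd] := hl _ e2.
  have nb : nbhs (phi i y) [set x | rn (x - phi i y) < dd] by apply/nbhs_rnP; exists dd.
  have nb' := chart_nbhsV dy nb; apply: (@filterS _ (nbhs y) _ _ _ _ nb') => z /= [dz' hz].
  apply: heN; rewrite /ball /= distrC; have := hdd tt _ I hz; rewrite (cmapK dz') => /le_lt_trans; apply.
  exact: half_lt.
have cK : compact (cball z0 (2 * tau)) by apply: hT; apply: lt_le_trans qT; rewrite q4 ltr_pM2r // ltr_nat.
exists psi; exists tau => //; exists (r + rn (phi i z0)); first by rewrite -q4.
split=> //.
- move=> z; rewrite /psi; case: asboolP => _; last by rewrite lexx ler01.
  by rewrite vbump_ge0 vbump_le1.
- by rewrite psiE //; exact: vbump_center.
- exact: (compact_unif_cont t0 cK cpsi supp).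
Qed.

End ManifoldBump.

Lemma inv_sqr_bound (R : realType) (s q : R) : 0 < s -> s <= q -> q ^- 2 <= s^-1 ^+ 2.
Proof.
move=> s0 sq; rewrite -exprVn; apply: lerXn2r; rewrite ?nnegrE ?invr_ge0.
- by apply: le_trans sq; exact: ltW.
- exact: ltW.
- by rewrite lef_pV2 // posrE //; exact: lt_le_trans sq.
Qed.

Lemma scale_back (R : realType) (s t u : R) : 0 < s -> s^-1 ^+ 2 * u * s ^+ 2 = u.
Proof. by move=> s0; rewrite exprVn mulrAC mulVf ?mul1r // expf_neq0 // gt_eqF. Qed.

Lemma tent_lip (R : realType) (p x y t : R) : 0 < p -> `|x - y| <= t ->
  `|Num.max 0 (2 - 4 * x / p) - Num.max 0 (2 - 4 * y / p)| <= 4 * t / p.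
Proof.
move=> p0 h; have lip (a b : R) : `|Num.max 0 a - Num.max 0 b| <= `|a - b|.
  by rewrite ![Num.max 0 _]maxC; exact: max0_lip.
apply: le_trans (lip _ _) _; have -> : 2 - 4 * x / p - (2 - 4 * y / p) = - (4 / p * (x - y)) by ring.
rewrite normrN normrM gtr0_norm ?divr_gt0 //.
have -> : 4 * t / p = 4 / p * t by ring.
by rewrite ler_pM2l // divr_gt0.
Qed.

(** * Invariants positive near a point, by averaging *)

Section LocalInvariants.
Variables (R : realType) (n : nat).
Local Notation C := (Cx R).
Local Notation V := 'rV[C]_n.
Variables (Y : complexManifold R n) (g : tensor Y).
Hypothesis hg : hermitian_metric_on setT g.
Hypothesis pc : path_connected R Y.
Local Notation d := (dist g).
Local Notation cball := (cball g).
Local Notation phi i := (cmap (mchart (i : mindex Y))).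
Hypothesis nonproper : forall y, exists2 r, 0 <= r & ~ compact (cball y r).
Variable z0 : Y.
Local Notation rad := (cradius g).
Local Notation rho := (rho g z0).
Local Notation G := (hgroup g).
Local Notation mul := (hmul hg).
Local Notation inv := (hinv hg).
Local Notation W := (W hg z0).
Local Notation hsmall := (small mul inv W).
Local Notation hCc := (Cc mul inv W).

(** Its orbit function at z0 is the reference function B of [haar]: at least 1 within rho / 4 of z0,
    zero beyond rho / 2. Being averaged but never differentiated, it need only be Lipschitz. *)
Definition tent (z : Y) : R := Num.max 0 (2 - 4 * d z0 z / rho).

Lemma tent_Cc : hCc (orbit_fun hg tent 0 z0).
Proof.
have p0 := rho_gt0 hg pc nonproper z0.
apply: (orbit_fun_Cc hg pc nonproper).
- move=> e e0; exists (e * rho / 4); first by rewrite divr_gt0 // mulr_gt0.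
  move=> z z' h; have h2 : `|d z0 z - d z0 z'| <= e * rho / 4.
    apply: le_trans h; apply: norm_le_of; first by rewrite (dist_sym g z z'); exact: dist_tri.
    exact: dist_tri.
  by apply: le_trans (tent_lip p0 h2) _; apply: eq_leW; field; rewrite gt_eqF.
- exists 2 => z; rewrite /tent ger0_norm; last by rewrite le_max lexx.
  rewrite ge_max; apply/andP; split=> //; rewrite gerBl divr_ge0 ?(ltW p0) // mulr_ge0 //; exact: dist_ge0.
- move=> z h; apply/max_idPl; rewrite subr_le0 ler_pdivlMr //.
  by lraH h.
Qed.

Lemma sc_homothety al s (h : homothety g al s) : Y -> sc (exist _ al (ex_intro _ s h) : G) = s.
Proof. by move=> y; exact: (homothety_scale_uniq hg pc nonproper (scP (exist _ al (ex_intro _ s h) : G)) h y). Qed.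

Lemma near_sub y0 tau a y eta : near_orbit hg z0 y0 a -> eta * (6 * rho / rad y0) <= tau -> d y0 y <= eta ->
  0 <= eta -> d (act (inv a) y0) (act (inv a) y) <= tau.
Proof.
move=> na he hy eta0; rewrite (act_dist hg pc) (sc_inv hg pc nonproper a y0) mulrC.
apply: le_trans he; apply: ler_pM => //; first exact: dist_ge0.
  by rewrite invr_ge0 ltW // sc_gt0.
by have [] := sc_near pc nonproper na.
Qed.

(** Near y0 only the elements of a fixed small set S1 contribute, and they carry the neighbourhood
    back into one chart at z0 with a common bound M. Thus y |-> a^-1 y is a bounded holomorphic
    family, the integrand is equismooth, and [smooth_functional] applies. *)
Lemma orbit_fun_smooth (psi : Y -> R) (tau M : R) (I : (G -> R) -> R) (k : nat) (y0 : Y) :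
  0 < tau -> 4 * tau <= rho -> (forall z, 0 <= psi z <= 1) -> (forall z, tau <= d z0 z -> psi z = 0) ->
  unif_cont g psi ->
  (forall z, d z0 z < 4 * tau -> dom (mchart (chart_at z0)) z /\ rn (phi (chart_at z0) z) <= M) ->
  (forall (Om : Type) (S : set Om) m (U : set V) (F : Om -> V -> Y), open U ->
        (forall w x, S w -> U x -> dom (mchart (chart_at z0)) (F w x)) ->
        (forall k, bholo_fam S U (fun w x => phi (chart_at z0) (F w x) 0 k : C)) ->
        ECk S m U (fun w x => psi (F w x))) ->
  (forall a F F', hCc F -> hCc F' -> I (fun g => a * F g + F' g) = a * I F + I F') ->
  (forall S, hsmall S -> exists2 K : R, 0 <= K & forall F (e : R), hCc F -> (forall g, ~ S g -> F g = 0) ->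
        (forall g, `|F g| <= e) -> `|I F| <= K * e) ->
  exists2 N : set Y, N y0 & smooth_fun_on N (fun y => I (orbit_fun hg psi k y)).
Proof.
move=> t0 t4 psi01 psi0 uc domM fam Ilin Ibd.
have p0 := rho_gt0 hg pc nonproper z0; have r0 := rad_gt0 hg pc nonproper y0.
(* Twice the bound 6 rho / rad y0 on inverse ratios, so that it also serves at all nearby y, where
   rad y >= rad y0 / 2. *)
pose Q := 12 * rho / rad y0; have Q0 : 0 < Q by rewrite divr_gt0 // mulr_gt0.
pose eta := Num.min (tau / Q) (rad y0 / 2).
have eta0 : 0 < eta by rewrite lt_min; apply/andP; split; exact: divr_gt0.
have etaQ : eta * Q <= tau by rewrite -ler_pdivlMr // ge_min lexx.
have eta2 : eta <= rad y0 / 2 by rewrite ge_min lexx orbT.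
pose N := [set y | d y0 y < eta].
have oN : open N.
  rewrite openE => y /= hy; apply/(nbhs_dist hg pc); exists (eta - d y0 y); first by rewrite subr_gt0.
  by move=> z hz; apply: le_lt_trans (dist_tri hg pc _ y _) _; rewrite -ltrBrDl.
(* Passing from y0 to y moves a^-1 y0 by at most tau: outside S1 the support of radius tau is missed
   for all y in N, and inside S1 one stays within 4 tau of z0. *)
pose S1 : set G := [set a | d z0 (act (inv a) y0) <= 2 * tau].
have S1near a : S1 a -> near_orbit hg z0 y0 a.
  by rewrite /S1 /near_orbit /= => h; lraH h t0 t4.
have sS1 : hsmall S1.
  move=> m; have [NN [s hs]] := small_near_orbit hg pc nonproper z0 y0 m; exists NN, s => a /S1near; exact: hs.
have in4 a y : S1 a -> N y -> d z0 (act (inv a) y) < 4 * tau.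
  move=> Sa Ny; have na := S1near a Sa.
  have h6 : eta * (6 * rho / rad y0) <= tau.
    apply: le_trans etaQ; rewrite ler_pM2l // /Q ler_pM2r ?invr_gt0 // ler_pM2r // ler_nat //.
  have h1 := near_sub na h6 (ltW Ny) (ltW eta0).
  by apply: le_lt_trans (dist_tri hg pc _ (act (inv a) y0) _) _; rewrite /S1 /= in Sa; lraH Sa h1 t0.
have out a y : ~ S1 a -> N y -> psi (act (inv a) y) = 0.
  move=> nS Ny; apply: psi0; rewrite leNgt; apply/negP => hlt; apply: nS.
  have na : near_orbit hg z0 y a by rewrite /near_orbit /=; lraH hlt t0 t4.
  have ry0 : rad y0 / 2 <= rad y.
    by have := rad_lip hg pc nonproper y0 y; rewrite ler_norml => /andP[_ h]; move: Ny; rewrite /N /= => h2; lraH h h2 eta2.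
  have ry : 0 < rad y by apply: lt_le_trans ry0; rewrite divr_gt0.
  have h6 : eta * (6 * rho / rad y) <= tau.
    apply: le_trans etaQ; rewrite ler_pM2l // /Q ler_pdivrMr //.
    apply: (@le_trans _ _ (12 * rho / rad y0 * (rad y0 / 2))).
      by apply: eq_leW; field; rewrite gt_eqF.
    by rewrite ler_pM2l.
  have Ny' : d y y0 <= eta by rewrite (dist_sym g); exact: ltW.
  have h1 := near_sub na h6 Ny' (ltW eta0).
  have h2 := dist_tri hg pc z0 (act (inv a) y) (act (inv a) y0); rewrite /S1 /=; lraH h1 h2 hlt.
have cc y : hCc (orbit_fun hg psi k y).
  apply: (orbit_fun_Cc hg pc nonproper) => //.
    by exists 1 => z; have /andP[h1 h2] := psi01 z; rewrite ger0_norm.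
  by move=> z hz; apply: psi0; lraH hz t4 t0.
have [K K0 hK] := Ibd S1 sS1.
pose L : set (G -> R) := [set F | hCc F /\ forall a, ~ S1 a -> F a = 0].
have Llin (a : R) F F' : L F -> L F' -> L (fun w => a * F w + F' w).
  move=> [c1 z1] [c2 z2]; split; last by move=> w nw; rewrite z1 // z2 // mulr0 addr0.
  exact: (Cc_lin (@W_decr _ _ _ _ hg z0) a c1 c2).
have Llim F : (forall w, ~ S1 w -> F w = 0) ->
    (forall e, 0 < e -> exists2 F', L F' & forall w, `|F w - F' w| <= e) -> L F.
  move=> F0 hF; split=> //; split.
  - move=> e e0; have e3 : 0 < e / 3 by rewrite divr_gt0.
    have [F' [[ucF' _ _] _] hF'] := hF _ e3; have [m hm] := ucF' _ e3; exists m => s t /hm h.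
    have h1 := hF' s; have h2 := hF' t; rewrite distrC in h2.
    have h3 := ler_normD (F s - F' s) (F' s - F' t + (F' t - F t)).
    have h4 := ler_normD (F' s - F' t) (F' t - F t).
    have E : F s - F t = F s - F' s + (F' s - F' t + (F' t - F t)) by ring.
    by rewrite E; lraH h h1 h2 h3 h4.
  - have [F' [[_ [M' hM'] _] _] hF'] := hF 1 ltr01; exists (1 + M') => a.
    have := hF' a; have := hM' a; have := ler_normD (F a - F' a) (F' a); rewrite subrK => h1 h2 h3.
    by lraH h1 h2 h3.
  - by exists S1.
have LI (a : R) F F' : L F -> L F' -> I (fun w => a * F w + F' w) = a * I F + I F'.
  by move=> [c1 _] [c2 _]; exact: Ilin.
have LB F e : L F -> (forall w, `|F w| <= e) -> `|I F| <= K * e by move=> [c1 z1]; exact: hK.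
exists N; first by rewrite /N /= (dist_xx hg pc).
apply/smooth_funP => i m; have oU := img_open (i := i) oN.
have fam1 : ECk S1 m (img i N) (fun a x => psi (act (inv a) (cinv (mchart i) x))).
  apply: fam => // [a x Sa /imgP[cx Nx]|l x /[dup] Ux /imgP[cx Nx]].
    by have [] := domM _ (in4 _ _ Sa Nx).
  have [e e0 he] := (openrnP (img i N)).1 oU x Ux.
  exists e => //; exists M => a Sa x' /he /imgP[cx' Nx'].
  have [dx' Mx'] := domM _ (in4 _ _ Sa Nx'); split; last by apply: le_trans (rn_coord _ _) _.
  have [_ [ha _] _] := scP (inv a).
  have := ha.2 _ i (chart_at z0) Logic.I (cinv_dom cx') dx'; rewrite (cinvK cx') => hdf.
  exact: (differentiable_coordP _ _).1 hdf l.
have fam2 : ECk S1 m (img i N) (fun a _ => (sc a)^-1 ^+ k).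
  apply: ECk_cst; exists ((6 * rho / rad y0) ^+ k) => a /S1near na.
  have [h1 _] := sc_near pc nonproper na; have s0 := sc_gt0 a.
  have si : 0 < (sc a)^-1 by rewrite invr_gt0.
  by rewrite normrX gtr0_norm //; apply: lerXn2r; rewrite ?nnegrE ?(ltW si) //; apply: le_trans h1; exact: ltW.
have fam3 := ECkM oU fam1 fam2.
apply: (smooth_functional Llin Llim LI LB oU fam3).
  by move=> a x na /imgP[cx Nx]; rewrite out // mul0r.
move=> x /imgP[cx Nx]; split; first exact: cc.
by move=> a na; rewrite out // mul0r.
Qed.

(** The averages of [orbit_fun] with k = 0 and k = 2. The second has the weight that is wanted; the
    first is invariant and allows cutting off without spoiling the weight when the local functions
    are patched. *)
Lemma local_invariants : exists m u : Y -> R,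
  [/\ smooth_fun_on setT m, smooth_fun_on setT u, 0 < m z0 &
   [/\ forall y, 0 <= m y, forall y, 0 <= u y, forall y, 0 < m y -> 0 < u y &
   forall al s y, homothety g al s -> m (al y) = m y /\ u (al y) * s ^+ 2 = u y]].
Proof.
have p0 := rho_gt0 hg pc nonproper z0.
have hcp r : r < rho -> compact (cball z0 r).
  move=> hr; apply: (cradius_compact hg pc nonproper); rewrite (rad_z0 g z0); lraH hr p0.
have [psi [tau t0 [M t4 [psi01 psi0 psip uc [domM fam]]]]] := dist_bump hg pc p0 hcp.
have cc k y : hCc (orbit_fun hg psi k y).
  apply: (orbit_fun_Cc hg pc nonproper) => //.
    by exists 1 => z; have /andP[h1 h2] := psi01 z; rewrite ger0_norm.
  by move=> z hz; apply: psi0; lraH hz t4 t0.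
have psi2 : 0 < psi z0 / 2 by rewrite divr_gt0.
have [t tp ht] := uc _ psi2.
have r4 : 0 < rho / 4 by rewrite divr_gt0.
have [m1 hm1] := near_inv_nat tp; have [m2 hm2] := near_inv_nat r4.
(* On [W m0] the index m2 makes the reference function at least 1, and m1 keeps psi above half its
   value at z0. *)
pose m0 := maxn m1 m2.
have z00 : d z0 z0 <= rho by rewrite (dist_xx hg pc) ltW.
have B0 a : 0 <= orbit_fun hg tent 0 z0 a by rewrite /orbit_fun expr0 mulr1 /tent le_max lexx.
have B1 a : W m0 a -> 1 <= orbit_fun hg tent 0 z0 a.
  move=> /(W_decr (leq_maxr m1 m2))/(_ z0 z00)[_]; rewrite (dist_sym g) => /le_trans/(_ hm2) h.
  rewrite /orbit_fun expr0 mulr1 /tent le_max; apply/orP; right.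
  rewrite lerBrDr -lerBrDl ler_pdivrMr //; lraH h.
have [I [Ilin Itr Ibd Ige0 Ipos]] := haar (hmulA hg) (hmul1 hg) (hmulV hg) (hmulV' hg) (@W_one _ _ _ _ hg pc z0)
  (@W_decr _ _ _ _ hg z0) tent_Cc B0 B1.
have sm k : smooth_fun_on setT (fun y => I (orbit_fun hg psi k y)).
  by apply: smooth_fun_local => y _; exact: (orbit_fun_smooth k y t0 t4 psi01 psi0 uc domM fam Ilin Ibd).
have IZ c F : hCc F -> I (fun a => c * F a) = c * I F.
  move=> cF; have E : (fun a => c * F a) = (fun a => (c - 1) * F a + F a) by apply/funext => a; ring.
  by rewrite E Ilin //; ring.
(* Replacing a by b^-1 a turns a^-1 (b y) into a^-1 y up to the factor of the ratio, and I is
   invariant under this substitution. *)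
have inv_u k al s y : homothety g al s -> I (orbit_fun hg psi k (al y)) = (s^-1) ^+ k * I (orbit_fun hg psi k y).
  move=> h; have [b ab sb] : exists2 b : G, act b = al & sc b = s.
    by exists (exist _ al (ex_intro _ s h)) => //; exact: sc_homothety.
  have E : orbit_fun hg psi k (al y) = (fun a => s^-1 ^+ k * orbit_fun hg psi k y (mul (inv b) a)).
    apply/funext => a; rewrite /orbit_fun.
    have E1 : act (inv (mul (inv b) a)) y = act (inv a) (al y) by rewrite -ab; exact: (act_inv_mul hg a b y).
    have E2 : sc (mul (inv b) a) = s^-1 * sc a by rewrite (@sc_mul _ _ _ _ hg pc nonproper (inv b) a y) (sc_inv hg pc nonproper b y) sb.
    rewrite E1 E2 mulrCA; congr (_ * _); rewrite -exprMn invfM invrK mulrA mulVf ?mul1r //.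
    by rewrite -sb gt_eqF //; exact: sc_gt0.
  have ct : hCc (fun a => orbit_fun hg psi k y (mul (inv b) a)).
    exact: (Cc_translate (hmulA hg) (hmul1 hg) (hmulV hg) (hmulV' hg) b (cc k y)).
  exact: (etrans (congr1 I E) (etrans (IZ _ _ ct) (congr1 (fun x => s^-1 ^+ k * x) (Itr b _ (cc k y))))).
have Fge0 k y a : 0 <= orbit_fun hg psi k y a.
  by rewrite /orbit_fun mulr_ge0 //; [case/andP: (psi01 (act (inv a) y))|rewrite exprn_ge0 // invr_ge0 ltW // sc_gt0].
exists (fun y => I (orbit_fun hg psi 0 y)), (fun y => I (orbit_fun hg psi 2 y)); split.
- exact: sm.
- exact: sm.
- apply: (Ipos _ (psi z0 / 2) (hone hg) (cc 0%N z0) (Fge0 0%N z0) psi2) => a.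
  have -> : mul (inv (hone hg)) a = a by apply: hgroup_eq => z /=; exact: hinv_one.
  move=> /(W_decr (leq_maxl m1 m2))/(_ z0 z00)[_] /le_trans/(_ hm1)/ht h.
  by rewrite /orbit_fun expr0 mulr1; move: h; rewrite ler_norml => /andP[h _]; lraH h.
split.
- by move=> y; apply: Ige0 => // a; exact: Fge0.
- by move=> y; apply: Ige0 => // a; exact: Fge0.
(* Where psi does not vanish, [sc_near] gives sc a <= q, so the weight (sc a)^-2 is at least c =
   q^-2, and the second average is at least c times the first. *)
- move=> y my; pose q := rad y / (4 * rho); pose c := q ^- 2.
  have q0 : 0 < q by rewrite divr_gt0 ?mulr_gt0 //; exact: rad_gt0.
  have c0 : 0 < c by rewrite /c -exprVn exprn_gt0 // invr_gt0.
  suff : 0 <= I (orbit_fun hg psi 2 y) - c * I (orbit_fun hg psi 0 y).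
    by rewrite subr_ge0; apply: lt_le_trans; rewrite mulr_gt0.
  have E : I (orbit_fun hg psi 2 y) - c * I (orbit_fun hg psi 0 y) =
      I (fun a => (- c) * orbit_fun hg psi 0 y a + orbit_fun hg psi 2 y a) by rewrite Ilin //; ring.
  rewrite E; apply: Ige0 => [|a]; first exact: (Cc_lin (@W_decr _ _ _ _ hg z0) (- c) (cc 0%N y) (cc 2%N y)).
  rewrite /orbit_fun expr0 mulr1 mulNr addrC subr_ge0 mulrC.
  have [->|nz] := eqVneq (psi (act (inv a) y)) 0; first by rewrite !mul0r.
  have na : near_orbit hg z0 y a.
    rewrite /near_orbit /= leNgt; apply: contra nz => h; apply/eqP/psi0; lraH h t4 t0.
  rewrite ler_wpM2l //; first by case/andP: (psi01 (act (inv a) y)).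
  have [_ h] := sc_near pc nonproper na.
  exact: inv_sqr_bound (sc_gt0 a) h.
- move=> al s y h; rewrite !(inv_u _ _ _ _ h) expr0 mul1r; split=> //.
  by have [s0 _ _] := h; exact: scale_back.
Qed.

End LocalInvariants.

(** For each set of a countable basis contained in some P z, one such z is retained. *)
Lemma lindelof (T : topologicalType) (x0 : T) (P : T -> set T) : @second_countable T -> (forall x, nbhs x (P x)) ->
  exists s : nat -> T, forall x, exists i, P (s i) x.
Proof.
move=> [B /countable_injP[f finj] [_ bB]] hP.
have /choice[s hs] (i : nat) : exists z : T, forall b : set T, B b -> f b = i -> (exists z', b `<=` P z') -> b `<=` P z.
  have [[b [Bb fb [z bz]]]|no] := pselect (exists b : set T, [/\ B b, f b = i & exists z, b `<=` P z]).
    by exists z => b' Bb' fb' _; have -> : b' = b by apply: finj; rewrite ?inE // fb fb'.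
  by exists x0 => b Bb fb ex; case: no; exists b.
exists s => x; have [b [Bb bx] bP] := bB x _ (hP x).
by exists (f b); apply: (hs (f b) b) => //; exists x.
Qed.

Section GlobalInvariant.
Variables (R : realType) (n : nat).
Variables (Y : complexManifold R n) (g : tensor Y).
Hypothesis hg : hermitian_metric_on setT g.
Hypothesis pc : path_connected R Y.

Lemma smooth_flat (f : Y -> R) : smooth_fun_on setT f -> smooth_fun_on setT (fun y => flat 0 (f y)).
Proof.
move=> /smooth_funP hf; apply/smooth_funP => i k; have oU := img_open (i := i) (@openT Y).
exact: (ECk_scale oU (@flat_bound R) (@is_derive_flat R) (hf i k) 0%N).
Qed.

Lemma smooth_cont (f : Y -> R) y e : smooth_fun_on setT f -> 0 < e -> \forall z \near y, `|f z - f y| <= e.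
Proof.
move=> /smooth_funP hf e0; pose i := chart_at y; have dy : dom (mchart i) y := dom_chart_at y.
have [hl _] := hf i 0%N; have ci : img i setT (cmap (mchart i) y) by apply/imgP; split=> //; exact: cmap_cod.
have [/(_ _ e0)[d d0 hd] _] := hl _ ci.
have nb : nbhs (cmap (mchart i) y) [set x | rn (x - cmap (mchart i) y) < d] by apply/nbhs_rnP; exists d.
have nb' := chart_nbhsV dy nb; apply: (@filterS _ (nbhs y) _ _ _ _ nb') => z /= [dz hz].
by have := hd tt _ Logic.I hz; rewrite /= !cmapK.
Qed.

Hypothesis nonproper : forall y, exists2 r, 0 <= r & ~ compact (cball g y r).

(* u = \sum_i u_i \prod_(j < i) flat 0 (1 - i m_j), with m_i and u_i the local invariants of
   weights 0 and -2: where m_j > 0 the products vanish for large i, so the sum is locally finite. *)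
Theorem nonproper_invariant : exists2 u : Y -> R, smooth_pos_on setT u &
  forall al s y, homothety g al s -> u (al y) * s ^+ 2 = u y.
Proof.
have /choice[m /choice[u0 hmu]] z := local_invariants hg pc nonproper z.
have msm z : smooth_fun_on setT (m z) by case: (hmu z).
have usm z : smooth_fun_on setT (u0 z) by case: (hmu z).
have mz z : 0 < m z z by case: (hmu z).
have m0 z y : 0 <= m z y by case: (hmu z) => _ _ _ [].
have u00 z y : 0 <= u0 z y by case: (hmu z) => _ _ _ [].
have mu z y : 0 < m z y -> 0 < u0 z y by case: (hmu z) => _ _ _ [_ _ h _]; exact: h.
have hinvr z al s y : homothety g al s -> m z (al y) = m z y /\ u0 z (al y) * s ^+ 2 = u0 z y.
  by case: (hmu z) => _ _ _ [_ _ _ h]; exact: h.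
have nbm z y : 0 < m z y -> nbhs y [set y' | m z y / 2 <= m z y'].
  move=> p; have p2 : 0 < m z y / 2 by rewrite divr_gt0.
  have h := smooth_cont y (msm z) p2; apply: (@filterS _ (nbhs y) _ _ _ _ h) => y' /=.
  by rewrite ler_norml => /andP[k _]; lraH k.
have nbz z : nbhs z [set y' | 0 < m z y'].
  have h := nbm z z (mz z); apply: (@filterS _ (nbhs z) _ _ _ _ h) => y' /=; apply: lt_le_trans.
  by rewrite divr_gt0.
have [[y00 _] _] := pc.
have [s hs] := lindelof y00 (@manifold_second_countable _ _ Y) nbz.
pose F (i : nat) (y : Y) : R := u0 (s i) y * \prod_(j < i) flat 0 (1 - i%:R * m (s j) y).
pose U (K : nat) (y : Y) : R := \sum_(i < K) F i y.
have Fsm i : smooth_fun_on setT (F i).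
  apply: smooth_funM => //; first exact: openT.
  have hj j : smooth_fun_on setT (fun y => flat 0 (1 - i%:R * m (s j) y)).
    apply: smooth_flat; have h := smooth_funM openT (smooth_fun_cst setT (- i%:R)) (msm (s j)).
    have := smooth_funD openT (smooth_fun_cst setT 1) h.
    by apply: smooth_fun_ext => [|y _]; [exact: openT|rewrite mulNr].
  exact: (@smooth_fun_prod _ _ Y setT i _ openT hj).
have Usm K : smooth_fun_on setT (U K) by apply: smooth_fun_sum => //; exact: openT.
have F0 i y : 0 <= F i y by rewrite mulr_ge0 // prodr_ge0 // => j _; exact: flat_ge0.
have stab (y : Y) : exists K0, nbhs y [set y' | forall K, (K0 <= K)%N -> U K y' = U K0 y'].
  have [j mj] : exists j, 0 < m (s j) y := hs y.
  have c0 : 0 < m (s j) y / 2 by rewrite divr_gt0.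
  (* For i >= k+1 and i > j, the factor of index j has argument 1 - i m_j <= 0 near y, because m_j
     stays above 1 / (k+1) there; so the i-th term vanishes. *)
  have [k hk] := near_inv_nat c0; exists (maxn k.+1 j.+1).
  have h := nbm (s j) y mj; apply: (@filterS _ (nbhs y) _ _ _ _ h) => y' /= hy' K hK.
  have Fz i : (maxn k.+1 j.+1 <= i)%N -> F i y' = 0.
    rewrite geq_max => /andP[ki ji]; rewrite /F (bigD1 (Ordinal ji)) //=.
    have -> : flat 0 (1 - i%:R * m (s j) y') = 0.
      rewrite /flat subr_gt0 ltNge; have -> // : 1 <= i%:R * m (s j) y'.
      apply: (@le_trans _ _ (k.+1%:R * k.+1%:R^-1)); first by rewrite divff // pnatr_eq0.
      apply: ler_pM; rewrite ?invr_ge0 // ?ler_nat //.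
      exact: le_trans hy'.
    by rewrite mul0r mulr0.
  rewrite -(subnKC hK); elim: (K - maxn k.+1 j.+1)%N => [|q IH]; first by rewrite addn0.
  by rewrite addnS /U big_ord_recr /= -/(U _ _) IH Fz ?addr0 // leq_addr.
have /choice[K0 hK0] := stab.
pose u y := U (K0 y) y.
have uE y K : (K0 y <= K)%N -> U K y = u y by move=> h; exact: (nbhs_singleton (hK0 y)).
have unear (y : Y) : nbhs y [set y' | u y' = U (K0 y) y'].
  apply: (@filterS _ (nbhs y) _ _ _ _ (hK0 y)) => y' /= h.
  by rewrite -(uE y' (maxn (K0 y) (K0 y'))) ?leq_maxr // h // leq_maxl.
exists u.
  split.
    apply: smooth_fun_local => y _; have := unear y; rewrite nbhsE => -[N [oN Ny] hN].
    exists N => //; apply: (smooth_fun_ext oN _ (smooth_fun_sub (@subsetT _ N) (Usm (K0 y)))) => y' /hN.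
    exact: esym.
  move=> y _; have ex : exists i, 0 < m (s i) y by exact: hs.
  (* For the least such i all earlier m_j vanish at y, so each factor of the product is [flat 0 1],
     which is positive. *)
  pose i := ex_minn ex; have [mi imin] : 0 < m (s i) y /\ forall j, 0 < m (s j) y -> (i <= j)%N.
    by rewrite /i; case: ex_minnP.
  have Fi : 0 < F i y.
    rewrite mulr_gt0 ?mu // prodr_gt0 // => j _; rewrite flat_gt0.
    have -> : m (s j) y = 0.
      by apply/eqP; rewrite eq_le m0 andbT leNgt; apply/negP => /imin; rewrite leqNgt ltn_ord.
    by rewrite mulr0 subr0.
  rewrite -(uE y (maxn (K0 y) i.+1)) ?leq_maxl //.
  have iK : (i < maxn (K0 y) i.+1)%N by rewrite leq_max ltnSn orbT.
  rewrite /U (bigD1 (Ordinal iK)) //=; apply: ltr_pwDl => //; exact: sumr_ge0.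
move=> al t y h; have FE i : F i (al y) * t ^+ 2 = F i y.
  rewrite /F mulrAC (hinvr _ _ _ _ h).2; congr (_ * _); apply: eq_bigr => j _.
  by rewrite (hinvr _ _ _ _ h).1.
pose K := maxn (K0 y) (K0 (al y)).
rewrite -(uE (al y) K) ?leq_maxr // -(uE y K) ?leq_maxl // /U mulr_suml.
by apply: eq_bigr => i _; exact: FE.
Qed.

End GlobalInvariant.

(** * Linearization of a contracting homothety *)

Lemma geo_half (R : realType) (s e D : R) : 0 < s -> s < 1 -> 0 < e -> exists N, forall k, (N <= k)%N -> s ^+ k * D <= e.
Proof.
move=> s0 s1 e0; have D1 : 0 < 1 + `|D| by rewrite ltr_pwDl.
have sn : `|s| < 1 by rewrite gtr0_norm.
have h : \forall k \near \oo, `|s ^+ k - 0| < e / (1 + `|D|).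
  by have /cvgrPdist_lt := cvg_expr sn; move=> /(_ _ (divr_gt0 e0 D1)); apply: filterS => k; rewrite distrC.
have [N _ hN] := h; exists N => k /hN /=; rewrite subr0 ltr_pdivlMr // => h2.
apply: le_trans (ltW h2); apply: le_trans (ler_norm _) _; rewrite normrM ler_wpM2l //.
by rewrite lerDr.
Qed.

(** A cluster point of the orbit in the compact set K is fixed, since consecutive points of the
    orbit approach each other. Stated for an abstract distance, as it serves both in C^n and on
    Y. *)
Lemma contraction_fixpoint (R : realType) (T : topologicalType) (dd : T -> T -> R) (K : set T) (f : T -> T) (x0 : T) (s : R) :
  (forall x y, 0 <= dd x y) -> (forall x y, dd x y = dd y x) -> (forall x y z, dd x z <= dd x y + dd y z) ->
  (forall x y, dd x y = 0 -> x = y) -> (forall x e, 0 < e -> \forall z \near x, dd x z < e) ->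
  compact K -> K x0 -> (forall x, K x -> K (f x)) -> 0 < s -> s < 1 ->
  (forall x y, K x -> K y -> dd (f x) (f y) <= s * dd x y) -> exists2 y, K y & f y = y.
Proof.
move=> d0 dS dT d1 dN cK Kx0 fK s0 s1 con.
pose x k := iter k f x0; have Kx k : K (x k) by elim: k => //= k; exact: fK.
have step k : dd (x k) (x k.+1) <= s ^+ k * dd x0 (f x0).
  elim: k => [|k IH]; first by rewrite expr0 mul1r.
  apply: le_trans (con _ _ (Kx k) (Kx k.+1)) _; rewrite exprS -mulrA.
  by rewrite ler_wpM2l // ltW.
pose F : set_system T := [set A | exists N, forall k, (N <= k)%N -> A (x k)].
have FP : ProperFilter F.
  apply: Build_ProperFilter_ex; first by move=> A [N hN]; exists (x N); exact: hN.
  split; first by exists 0%N.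
  - move=> A B [N hN] [M hM]; exists (maxn N M) => k; rewrite geq_max => /andP[/hN ? /hM].
    by split.
  - by move=> A B AB [N hN]; exists N => k /hN; exact: AB.
have FK : F K by exists 0%N => k _; exact: Kx.
have [y [Ky cy]] := cK F FP FK; exists y => //.
apply: d1; apply/eqP; rewrite eq_le d0 andbT; apply/ler_addgt0Pr => e e0; rewrite add0r.
have e4 : 0 < e / 4 by rewrite divr_gt0.
have [N hN] := geo_half (dd x0 (f x0)) s0 s1 e4.
have FN : F [set z | exists2 k, (N <= k)%N & z = x k] by exists N => k Nk; exists k.
have [_ [[k Nk ->] hk]] := cy _ _ FN (dN y _ e4); rewrite /= in hk.
have h1 : dd (f y) (x k.+1) <= s * dd y (x k) := con _ _ Ky (Kx k); have h2 := le_trans (step k) (hN k Nk).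
have h3 := dT (f y) (x k.+1) y; have h4 := dT (x k.+1) (x k) y.
have h6 : s * dd y (x k) <= dd y (x k) by rewrite ler_piMl // ltW.
rewrite (dS _ (x k)) (dS (x k) y) in h4.
have h7 := le_trans (le_trans h1 h6) (ltW hk); have h8 := le_trans h3 (lerD h7 (le_trans h4 (lerD h2 (ltW hk)))).
by apply: le_trans h8 _; lraH e0.
Qed.

Lemma half_sum (R : realType) (a b c t : R) : a <= 2^-1 * c -> b <= t / 2 -> c <= t -> a + b <= t.
Proof. by move=> h1 h2 h3; lraH h1 h2 h3. Qed.

Lemma half_lip (R : realType) (a b c : R) : c <= 2^-1 * a -> a <= c + b -> a <= 2 * b.
Proof. by move=> h1 h2; lraH h1 h2. Qed.

(** * Local inversion of holomorphic maps *)

Section LocalInverse.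
Variables (R : realType) (n : nat).
Local Notation C := (Cx R).
Local Notation V := 'rV[C]_n.
Implicit Types (F G : V -> V).

(** By Cauchy estimates the differential is Lipschitz, hence on the ball of radius t it differs from
    the one at x0 by at most K t. The explicit factor t is what later yields a quadratic error. *)
Lemma strict_diff F (x0 : V) : nbhs x0 [set x | differentiable F x] -> exists2 r : R, 0 < r & exists2 K : R, 0 <= K &
  (forall x, rn (x - x0) < r -> differentiable F x) /\
  forall (t : R) x y, t < r -> rn (x - x0) <= t -> rn (y - x0) <= t ->
    rn (F y - F x - cd F x0 (y - x)) <= K * t * rn (y - x).
Proof.
move=> /nbhs_rnP[d d0 hd].
have oU := open_rball x0 d.
have Ux0 : rn (x0 - x0) < d by rewrite subrr rn0.
have dk k x : rn (x - x0) < d -> differentiable (fun y => F y 0 k : C) x.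
  by move=> /hd/differentiable_coordP; exact.
have /choice[q hq] (k : 'I_n) : exists r : R, 0 < r /\ bholo (fun y => F y 0 k : C) x0 r (rn (F x0 0 k : C) + 1).
  by have [r r0 [hb _]] := local_bholo oU Ux0 (dk k); exists r.
pose B k : R := 16 * (32 * (rn (F x0 0 k : C) + 1)) / q k ^+ 2.
have q0 k : 0 < q k by case: (hq k).
have B0 k : 0 <= B k.
  by rewrite divr_ge0 ?exprn_ge0 ?(ltW (q0 k)) // !mulr_ge0 // addr_ge0 // rn_ge0.
pose K := \sum_k B k; pose r := Num.min d (\big[Num.min/1]_k (q k / 4)).
have r0 : 0 < r.
  by rewrite lt_min d0 /=; elim/big_ind: _ => // [a b a0 b0|k _]; [rewrite lt_min a0|rewrite divr_gt0].
have rd : r <= d by rewrite ge_min lexx.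
have rq k : r <= q k / 4 by rewrite ge_min (bigD1 k) //= ge_min lexx /= orbT.
have K0 : 0 <= K by exact: sumr_ge0.
exists r => //; exists K => //; split=> [x xr|t x y tr xt yt].
  by apply: hd; exact: lt_le_trans rd.
have der z v : rn (z - x0) <= t -> rn (cd F z v - cd F x0 v) <= K * t * rn v.
  move=> zt; have zr := le_lt_trans zt tr.
  have t0 : 0 <= t by apply: le_trans zt; exact: rn_ge0.
  apply: rn_le => [|k]; first by rewrite !mulr_ge0 // rn_ge0.
  rewrite !mxE cd_coord; last by apply: hd; exact: lt_le_trans rd.
  rewrite cd_coord; last exact: hd.
  have hz : rn (z - x0) < q k / 4 by exact: lt_le_trans (rq k).
  have h0 : rn (x0 - x0) < q k / 4 by rewrite subrr rn0 divr_gt0.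
  apply: le_trans (bholo_difflip (q0 k) (hq k).2 v h0 hz) _.
  apply: ler_wpM2r; first exact: rn_ge0.
  by apply: ler_pM => //; [exact: (B0 k)|exact: rn_ge0|rewrite /K (bigD1 k) //= lerDl sumr_ge0].
pose G z := F z - cd F x0 z.
have -> : F y - F x - cd F x0 (y - x) = G y - G x by rewrite /G cdB; apply/rowP => j; rewrite !mxE; ring.
have dG z : differentiable F z -> has_cd G z (fun v => cd F z v - cd F x0 v).
  move=> /differentiable_has_cd dz; have [l1 l2 _] := differentiable_has_cd (hd _ Ux0).
  exact: (has_cdB dz (has_cd_lin _ l1 l2)).
apply: diff_bound_lipschitz => u u01 /=.
have zt : rn (x + u%:C *: (y - x) - x0) <= t.
  apply/ler_addgt0Pr => e e0; apply: ltW; apply: (convex_seg u01).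
    by apply: le_lt_trans xt _; rewrite ltrDl.
  by apply: le_lt_trans yt _; rewrite ltrDl.
have [h1 h2] := has_cdP (dG _ (hd _ (lt_le_trans (le_lt_trans zt tr) rd))).
by split=> //; rewrite h2; exact: der.
Qed.

(** The equation F z = w is solved by the fixed point of x |-> x - (F x - w), which contracts a
    small ball by 1/2 and preserves it when w is within half its radius of F x0. *)
Lemma local_inverse F (x0 : V) (D : set V) : nbhs x0 D -> (forall x, D x -> differentiable F x) -> (forall v, cd F x0 v = v) ->
  exists2 r : R, 0 < r & exists G : V -> V,
  [/\ forall x, rn (x - x0) <= r -> D x,
      forall x y, rn (x - x0) <= r -> rn (y - x0) <= r -> rn (y - x) <= 2 * rn (F y - F x) &
      forall w, rn (w - F x0) <= r / 2 -> rn (G w - x0) <= r /\ F (G w) = w].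
Proof.
move=> hD dD hid; have hd : nbhs x0 [set x | differentiable F x] by apply: filterS hD.
have [r1 r10 [K K0 [dF est1]]] := strict_diff hd.
have [r2 r20 hr2] := (nbhs_rnP _ _).1 hD.
pose r := Num.min r1 r2; have r0 : 0 < r by rewrite lt_min r10.
have est (t : R) x y : t < r -> rn (x - x0) <= t -> rn (y - x0) <= t -> rn (F y - F x - cd F x0 (y - x)) <= K * t * rn (y - x).
  by rewrite lt_min => /andP[tr _]; exact: est1.
have K1 : 0 < 1 + K by rewrite ltr_pwDl.
(* The second bound makes K t <= 1/2, the contraction ratio. *)
pose t := Num.min (r / 2) (1 / (2 * (1 + K))).
have t0 : 0 < t by rewrite lt_min; apply/andP; split; apply: divr_gt0 => //; exact: mulr_gt0.
have tr : t < r by apply: le_lt_trans (half_lt r0); rewrite ge_min lexx.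
have Kt : K * t <= 2^-1.
  have h : t <= 1 / (2 * (1 + K)) by rewrite ge_min lexx orbT.
  apply: (@le_trans _ _ ((1 + K) * (1 / (2 * (1 + K))))).
    by apply: ler_pM => //; [exact: ltW|rewrite lerDr].
  by apply: eq_leW; field; rewrite gt_eqF.
have half x y : rn (x - x0) <= t -> rn (y - x0) <= t -> rn (F y - F x - (y - x)) <= 2^-1 * rn (y - x).
  move=> xt yt; have := est t x y tr xt yt; rewrite hid => /le_trans; apply.
  by apply: ler_wpM2r => //; exact: rn_ge0.
have ex (w : V) : exists z, rn (w - F x0) <= t / 2 -> rn (z - x0) <= t /\ F z = w.
  have [hw|hw] := leP (rn (w - F x0)) (t / 2); last by exists 0.
  pose f (x : V) : V := x - (F x - w).
  have fE x y : f x - f y = - (F x - F y - (x - y)) by rewrite /f; apply/rowP => k; rewrite !mxE; ring.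
  have x00 : rn (x0 - x0) <= t by rewrite subrr rn0 ltW.
  have con x y : rn (x - x0) <= t -> rn (y - x0) <= t -> rn (f x - f y) <= 2^-1 * rn (x - y).
    by move=> xt yt; rewrite fE rnN; exact: half.
  have fK x : rn (x - x0) <= t -> rn (f x - x0) <= t.
    move=> xt; apply: le_trans (rn_trans _ _ (f x0)) _.
    have h1 := con _ _ xt x00; have -> : f x0 - x0 = w - F x0 by rewrite /f addrAC subrr add0r opprB.
    exact: half_sum h1 hw xt.
  have [|||||||||||y yt fy] := @contraction_fixpoint R V (fun x y => rn (x - y)) [set x | rn (x - x0) <= t] f x0 2^-1.
  - by move=> x y; exact: rn_ge0.
  - by move=> x y; exact: rnB.
  - by move=> x y z; exact: rn_trans.
  - by move=> x y /rn_eq0/eqP; rewrite subr_eq0 => /eqP.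
  - by move=> x e e0; apply/nbhs_rnP; exists e => // y; rewrite rnB.
  - exact: rball_compact.
  - exact: x00.
  - exact: fK.
  - by rewrite invr_gt0.
  - by rewrite invf_lt1 // ltr1n.
  - exact: con.
  exists y => _; split=> //; apply/eqP; rewrite -subr_eq0; apply/eqP.
  by move: fy; rewrite /f => /eqP; rewrite -subr_eq0 addrAC subrr add0r oppr_eq0 => /eqP.
have /choice[G hG] := ex; exists t => //; exists G; split=> //.
  by move=> x xt; apply: hr2; apply: le_lt_trans xt (lt_le_trans tr _); rewrite ge_min lexx orbT.
move=> x y xt yt; have h := half _ _ xt yt.
have := rn_trans (y - x) 0 (F y - F x); rewrite !subr0 [rn (y - x - _)]rnB; exact: half_lip h.
Qed.

(** The Lipschitz bound on G converts the first order error of F at G w into one in terms of w' - w;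
    applying the inverse Jacobian gives the expansion of G. *)
Lemma inverse_diff F G (w : V) : differentiable F (G w) -> (forall v, cd F (G w) v = 0 -> v = 0) ->
  (exists2 e : R, 0 < e & forall w', rn (w' - w) < e -> F (G w') = w' /\ rn (G w' - G w) <= 2 * rn (w' - w)) ->
  differentiable G w.
Proof.
move=> dF inj [e0 e00 hG]; pose J := jacobian F (G w).
have JE v : v *m J = cd F (G w) v by exact: cd_jacobian.
have uJ : J \in unitmx.
  rewrite -row_free_unit -kermx_eq0; apply/eqP/row_matrixP => i; rewrite row0; apply: inj.
  by rewrite -JE -row_mul mulmx_ker row0.
have FG : F (G w) = w by have [] := hG w; rewrite ?subrr ?rn0.
pose N := 1 + \sum_k \sum_l rn (invmx J k l : C).
have N0 : 0 < N by rewrite ltr_pwDl // sumr_ge0 // => k _; rewrite sumr_ge0 // => l _; exact: rn_ge0.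
have hN (v : V) : rn (v *m invmx J) <= N * rn v.
  apply: le_trans (rn_mulmx _ _) _; apply: ler_wpM2r; first exact: rn_ge0.
  by rewrite lerDr.
have [_ _ est] := differentiable_has_cd dF.
apply: (@has_cd_diff _ _ _ _ _ (fun v => v *m invmx J)); split.
- by move=> a u v; rewrite mulmxDl -scalemxAl.
- by exists N.
move=> e ep; have e1 : 0 < e / (2 * N) by rewrite divr_gt0 // mulr_gt0.
have [d d0 dP] := est _ e1; exists (Num.min e0 (d / 2)); first by rewrite lt_min e00 divr_gt0.
move=> h; rewrite lt_min => /andP[he hd].
have wh : rn (w + h - w) < e0 by rewrite addrAC subrr add0r.
have [FGh lip] := hG _ wh; rewrite [w + h - w]addrAC subrr add0r in lip.
set k := G (w + h) - G w in lip *.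
have kd : rn k < d by lraH lip hd.
have EF : F (G (w + h)) - F (G w) = h by rewrite FGh FG addrAC subrr add0r.
have := dP k kd; rewrite {1 2}/k subrKC EF -JE => h1.
have -> : k - h *m invmx J = - ((h - k *m J) *m invmx J).
  by rewrite mulmxBl mulmxK // opprB.
rewrite rnN; apply: le_trans (hN _) _.
have h2 : rn (h - k *m J) <= e / (2 * N) * (2 * rn h).
  by apply: le_trans h1 _; rewrite ler_pM2l.
apply: le_trans (ler_wpM2l (ltW N0) h2) _; apply: eq_leW; field; rewrite gt_eqF //.
Qed.

End LocalInverse.

Lemma geo_step (R : realType) (s : R) j : s < 1 -> (1 - s ^+ j) / (1 - s) + s ^+ j = (1 - s ^+ j.+1) / (1 - s).
Proof. by move=> s1; rewrite exprS; field; rewrite subr_eq0 gt_eqF. Qed.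

Lemma geo_le (R : realType) (s : R) j : 0 < s -> s < 1 -> (1 - s ^+ j) / (1 - s) <= (1 - s)^-1.
Proof.
move=> s0 s1; rewrite -[leRHS]mul1r ler_pM2r; first by rewrite gerBl exprn_ge0 // ltW.
by rewrite invr_gt0 subr_gt0.
Qed.

Section GeometricLimit.
Variables (R : realType) (n : nat).
Local Notation V := 'rV[Cx R]_n.

Lemma geometric_lim (a : nat -> V) (s B : R) k0 : 0 < s -> s < 1 ->
  (forall k j, (k0 <= k)%N -> rn (a (k + j)%N - a k) <= B * s ^+ k) -> exists l, cvgs a l.
Proof.
move=> s0 s1 ha.
have hc e : 0 < e -> exists N, forall i j, (N <= i)%N -> (N <= j)%N -> rn (a i - a j) <= e.
  move=> e0; have e2 : 0 < e / 2 by rewrite divr_gt0.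
  have [N hN] := geo_half B s0 s1 e2; exists (maxn k0 N) => i j hi hj.
  have h k : (maxn k0 N <= k)%N -> rn (a k - a (maxn k0 N)) <= e / 2.
    move=> hk; rewrite -(subnKC hk); apply: le_trans (ha _ _ (leq_maxl _ _)) _.
    by rewrite mulrC; apply: hN; exact: leq_maxr.
  apply: le_trans (rn_trans _ _ (a (maxn k0 N))) _; rewrite [e]splitr; apply: lerD; first exact: h.
  by rewrite rnB; exact: h.
have /choice[l hl] (c : 'I_n) : exists l, cvgs (fun k => a k 0 c : Cx R) l.
  apply: cauchy_lim => e /hc[N hN]; exists N => i j hi hj.
  by apply: le_trans (hN i j hi hj); have := rn_coord (a i - a j) c; rewrite !mxE.
exists (\row_c l c) => e e0.
have /choice[N hN] c := hl c e e0.
exists (\max_c N c)%N => i hi; apply: rn_le; first exact: ltW.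
move=> c; rewrite !mxE; apply: hN; apply: leq_trans hi.
exact: (leq_bigmax c).
Qed.

Lemma geometric_tail (a : nat -> V) (s B : R) k j : s < 1 ->
  (forall i, rn (a (k + i).+1 - a (k + i)%N) <= B * s ^+ (k + i)) ->
  rn (a (k + j)%N - a k) <= B * s ^+ k * ((1 - s ^+ j) / (1 - s)).
Proof.
move=> s1 ha; elim: j => [|j IH]; first by rewrite addn0 subrr rn0 expr0 subrr mul0r mulr0.
rewrite addnS -(geo_step j s1) mulrDr [leRHS]addrC; apply: le_trans (rn_trans _ _ (a (k + j)%N)) _.
by apply: lerD => //; rewrite -mulrA -exprD.
Qed.

End GeometricLimit.

(** * Koenigs' approximations and their limit *)

Section Koenigs.
Variables (R : realType) (n : nat).
Local Notation C := (Cx R).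
Local Notation V := 'rV[C]_n.
Variables (Y : complexManifold R n) (g : tensor Y).
Hypothesis hg : hermitian_metric_on setT g.
Hypothesis pc : path_connected R Y.
Local Notation d := (dist g).
Local Notation phi i := (cmap (mchart (i : mindex Y))).
Variables (al : Y -> Y) (s : R) (y0 : Y).
Hypothesis hal : homothety g al s.
Hypothesis s1 : s < 1.
Hypothesis fix0 : al y0 = y0.
Local Notation i0 := (chart_at y0).
Local Notation p0 := (phi i0 y0).
Local Notation H := (g i0 y0).
Local Notation it k := (iter k al).

Lemma scale_gt0 : 0 < s.
Proof. by case: hal. Qed.

Lemma posH : posdef_hermitian H.
Proof. exact: (metric_posdef hg (dom_chart_at y0)). Qed.

Lemma it_hom k : homothety g (it k) (s ^+ k).
Proof.
elim: k => [|k IH]; first exact: homothety_id.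
by rewrite exprS; exact: (homothety_comp hg hal IH).
Qed.

Lemma it_fix k : it k y0 = y0.
Proof. by elim: k => //= k ->. Qed.

Lemma it_dist k y : d y0 (it k y) = s ^+ k * d y0 y.
Proof. by rewrite -{1}(it_fix k); exact: (homothety_dist hg pc y0 y (it_hom k)). Qed.

Definition KA : 'M[C]_n := jacobian (local_rep al i0 i0) p0.
Definition KB : 'M[C]_n := invmx KA.
Definition Bk k (v : V) : V := iter k (fun u => u *m KB) v.
Definition Ak k (v : V) : V := iter k (fun u => u *m KA) v.

Lemma KA_dF v : v *m KA = dF al i0 i0 y0 v.
Proof. exact: cd_jacobian. Qed.

Lemma nKA v : nH H (v *m KA) = s * nH H v.
Proof.
have da : dom (mchart i0) (al y0) by rewrite fix0; exact: dom_chart_at.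
have := homothety_nH hg v hal (dom_chart_at y0) da; rewrite fix0 KA_dF; exact.
Qed.

Lemma KA_unit : KA \in unitmx.
Proof.
rewrite -row_free_unit -kermx_eq0; apply/eqP/row_matrixP => i; rewrite row0.
set v := row i _; have vA : v *m KA = 0 by rewrite -row_mul mulmx_ker row0.
apply: contrapT => /eqP/rn_gt0 v0; have [c c0 hc] := nH_lower posH.
have := nKA v; rewrite vA nH0 => /esym/eqP; rewrite mulf_eq0 gt_eqF ?scale_gt0 //=.
by rewrite gt_eqF //; apply: lt_le_trans (hc v); rewrite mulr_gt0.
Qed.

Lemma nKB v : nH H (v *m KB) = s^-1 * nH H v.
Proof.
have h : nH H v = s * nH H (v *m KB) := etrans (congr1 (nH H) (esym (mulmxKV KA_unit v))) (nKA (v *m KB)).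
by rewrite h mulKf // gt_eqF // scale_gt0.
Qed.

Lemma nBk k v : nH H (Bk k v) = s^-1 ^+ k * nH H v.
Proof. by elim: k => [|k IH]; [rewrite mul1r|rewrite /= nKB IH exprS mulrA]. Qed.

Lemma nAk k v : nH H (Ak k v) = s ^+ k * nH H v.
Proof. by elim: k => [|k IH]; [rewrite mul1r|rewrite /= nKA IH exprS mulrA]. Qed.

Lemma Bk_lin k a u v : Bk k (a *: u + v) = a *: Bk k u + Bk k v.
Proof. by elim: k => //= k ->; rewrite mulmxDl -scalemxAl. Qed.

Lemma BkB k u v : Bk k (u - v) = Bk k u - Bk k v.
Proof. by rewrite addrC -scaleN1r Bk_lin scaleN1r addrC. Qed.

Lemma Bk_A k v : Bk k.+1 (v *m KA) = Bk k v.
Proof. by rewrite /Bk iterSr mulmxK // KA_unit. Qed.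

Lemma Ak_mx k : exists M : 'M[C]_n, forall v, Ak k v = v *m M.
Proof.
elim: k => [|k [M hM]]; first by exists 1%:M => v; rewrite mulmx1.
by exists (M *m KA) => v; rewrite /= hM mulmxA.
Qed.

Lemma Bk_mx k : exists M : 'M[C]_n, forall v, Bk k v = v *m M.
Proof.
elim: k => [|k [M hM]]; first by exists 1%:M => v; rewrite mulmx1.
by exists (M *m KB) => v; rewrite /= hM mulmxA.
Qed.

Lemma BkK k v : Bk k (Ak k v) = v.
Proof. by elim: k => // k IH; rewrite /Ak [iter _ _ _]/= Bk_A. Qed.

(* Koenigs' approximations psi o al^k o A^-k: they converge because al differs from its
   linear part A by a quadratic error, of size s^2k on the orbit, while A^-1 expands only by s^-1. *)
Definition Phik k (y : Y) : V := Bk k (phi i0 (it k y) - p0).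

(** [strict_diff] is used with t equal to the coordinate distance from z to y0, so the error of the
    linear part is quadratic; c converts coordinates into distance. *)
Lemma koenigs_step : exists2 del : R, 0 < del & exists2 c : R, 0 < c & exists2 K : R, 0 <= K & forall z, d y0 z < del ->
  [/\ dom (mchart i0) z, c * rn (phi i0 z - p0) <= d y0 z &
      rn (phi i0 (al z) - p0 - (phi i0 z - p0) *m KA) <= K * (d y0 z) ^+ 2].
Proof.
have d0 := dom_chart_at y0; have [c c0 [r r0 [hr hd]]] := dist_lower hg pc y0.
pose f := local_rep al i0 i0.
have [s0 [hol _] _] := hal.
have da : dom (mchart i0) (al y0) by rewrite fix0.
have df : nbhs p0 [set x | differentiable f x].
  have h1 : nbhs y0 [set z | dom (mchart i0) (al z)].
    by apply: (cont_nbhs (hol.1 y0 Logic.I)); apply: open_nbhs_nbhs; split => //; exact: dom_open.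
  have h2 := chart_nbhs d0 h1; apply: (@filterS _ (nbhs p0) _ _ _ _ h2) => x /= [cx dx].
  by have := hol.2 _ i0 i0 Logic.I (cinv_dom cx) dx; rewrite cinvK.
have [r' r'0 [K K0 [_ est]]] := strict_diff df.
exists (Num.min (c * r) (c * r')); first by rewrite lt_min !mulr_gt0.
exists c => //; exists (K / c ^+ 2); first by rewrite divr_ge0 // exprn_ge0 // ltW.
move=> z; rewrite lt_min => /andP[z1 z2]; have [dz hz] := hd z z1; split=> //.
have z3 : rn (phi i0 z - p0) < r' by rewrite -(ltr_pM2l c0); exact: le_lt_trans z2.
have z4 : rn (p0 - p0) <= rn (phi i0 z - p0) by rewrite subrr rn0 rn_ge0.
have := est _ p0 (phi i0 z) z3 z4 (lexx _).
rewrite /f /local_rep /= !cmapK // fix0 -/(local_rep al i0 i0) KA_dF => /le_trans; apply.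
rewrite -mulrA -expr2 -mulrA ler_wpM2l // mulrC ler_pdivlMr ?exprn_gt0 // -exprMn.
apply: lerXn2r; rewrite ?nnegrE.
- by rewrite mulr_ge0 ?rn_ge0 // ltW.
- exact: dist_ge0.
- by rewrite mulrC.
Qed.

Lemma koenigs_constants : exists2 del : R, 0 < del & exists2 Q : R, 0 <= Q &
  [/\ forall z, d y0 z < del -> dom (mchart i0) z,
      forall k y, s ^+ k * d y0 y < del -> rn (Phik k y) <= Q * d y0 y &
      forall k y, s ^+ k * d y0 y < del -> rn (Phik k.+1 y - Phik k y) <= Q * d y0 y ^+ 2 * s ^+ k].
Proof.
have [del d0 [c c0 [K K0 hs]]] := koenigs_step.
have s0 := scale_gt0; have [c1 c10 hc1] := nH_lower posH; have [c2 c20 hc2] := nH_upper H.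
pose Q1 := c2 / (c * c1); pose Q2 := c2 * K / (s * c1).
have Q10 : 0 <= Q1 by apply: divr_ge0; [exact: ltW|exact: ltW (mulr_gt0 c0 c10)].
have Q20 : 0 <= Q2 by apply: divr_ge0; [exact: mulr_ge0 (ltW c20) K0|exact: ltW (mulr_gt0 s0 c10)].
have sk k : 0 < s ^+ k by exact: exprn_gt0.
have bnd k v b : rn v <= b -> rn (Bk k v) <= s^-1 ^+ k * (c2 / c1 * b).
  move=> vb; rewrite -(ler_pM2l c10); apply: le_trans (hc1 _) _; rewrite nBk.
  have -> : c1 * (s^-1 ^+ k * (c2 / c1 * b)) = s^-1 ^+ k * (c2 * b) by field; rewrite gt_eqF.
  apply: ler_wpM2l; first by rewrite exprn_ge0 // invr_ge0 ltW.
  by apply: le_trans (hc2 _) _; rewrite ler_pM2l.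
exists del => //; exists (Q1 + Q2); first exact: addr_ge0.
split=> [z /hs[]//|k y hk|k y hk]; rewrite -it_dist in hk; have [dz h1 h2] := hs _ hk.
  have h3 : rn (phi i0 (it k y) - p0) <= c^-1 * (s ^+ k * d y0 y) by rewrite -it_dist ler_pdivlMl.
  apply: le_trans (bnd k _ _ h3) _; apply: (@le_trans _ _ (Q1 * d y0 y)); last first.
    by apply: ler_wpM2r; [exact: dist_ge0|rewrite lerDl].
  by apply: eq_leW; rewrite /Q1 exprVn; field; rewrite !gt_eqF.
have -> : Phik k.+1 y - Phik k y = Bk k.+1 (phi i0 (al (it k y)) - p0 - (phi i0 (it k y) - p0) *m KA).
  by rewrite BkB Bk_A.
rewrite it_dist in h2; apply: le_trans (bnd k.+1 _ _ h2) _.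
apply: (@le_trans _ _ (Q2 * d y0 y ^+ 2 * s ^+ k)); last first.
  have d2 : 0 <= d y0 y ^+ 2 by apply: exprn_ge0; exact: dist_ge0.
  by apply: (ler_wpM2r (ltW (sk k))); apply: (ler_wpM2r d2); rewrite lerDr.
by apply: eq_leW; rewrite /Q2 exprVn exprMn exprS; field; rewrite !gt_eqF.
Qed.

Lemma koenigs_limit : exists2 del : R, 0 < del & exists2 Q : R, 0 <= Q & exists Phi : Y -> V,
  [/\ forall z, d y0 z < del -> dom (mchart i0) z,
      forall k y, s ^+ k * d y0 y < del -> rn (Phik k y) <= Q * d y0 y,
      forall y, cvgs (Phik^~ y) (Phi y) &
      forall k y, s ^+ k * d y0 y < del -> rn (Phik k y - Phi y) <= Q * d y0 y ^+ 2 * s ^+ k].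
Proof.
have [del d0 [Q Q0 [h1 h2 h3]]] := koenigs_constants; have s0 := scale_gt0.
have m1 : 0 < 1 - s by rewrite subr_gt0.
pose Q' := Q / (1 - s).
have QQ : Q <= Q' by rewrite /Q' ler_pdivlMr // ler_piMr // gerBl ltW.
have sk k : 0 < s ^+ k by exact: exprn_gt0.
have small k j y : s ^+ k * d y0 y < del -> s ^+ (k + j) * d y0 y < del.
  apply: le_lt_trans; apply: ler_wpM2r; first exact: dist_ge0.
  by rewrite exprD ler_piMr ?(ltW (sk _)) // exprn_ile1 // ltW.
have tail k j y : s ^+ k * d y0 y < del -> rn (Phik (k + j) y - Phik k y) <= Q * d y0 y ^+ 2 * s ^+ k * ((1 - s ^+ j) / (1 - s)).
  move=> hk; apply: (geometric_tail (a := Phik^~ y) j s1) => i.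
  exact: (h3 _ _ (small k i y hk)).
have tail2 k j y : s ^+ k * d y0 y < del -> rn (Phik (k + j) y - Phik k y) <= Q' * d y0 y ^+ 2 * s ^+ k.
  move=> hk; apply: le_trans (tail k j y hk) _.
  have -> : Q' * d y0 y ^+ 2 * s ^+ k = Q * d y0 y ^+ 2 * s ^+ k * (1 - s)^-1 by rewrite /Q'; ring.
  by apply: ler_wpM2l (geo_le j s0 s1); rewrite !mulr_ge0 // ?exprn_ge0 ?(ltW s0) //; exact: dist_ge0.
have ex y : exists l, cvgs (Phik^~ y) l.
  have del2 : 0 < del / 2 by rewrite divr_gt0.
  have [N hN] := geo_half (d y0 y) s0 s1 del2.
  apply: (geometric_lim (B := Q' * d y0 y ^+ 2) (k0 := N) s0 s1) => k j hk.
  by apply: tail2; apply: le_lt_trans (hN k hk) (half_lt d0).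
have /choice[Phi hPhi] := ex.
exists del => //; exists Q'; first by rewrite divr_ge0 // ltW.
exists Phi; split=> // [k y hk|k y hk].
  by apply: le_trans (h2 k y hk) _; apply: ler_wpM2r QQ; exact: dist_ge0.
apply/ler_addgt0Pr => e e0; have [N hN] := hPhi y e e0.
apply: le_trans (rn_trans _ _ (Phik (k + N) y)) _; apply: lerD; last by apply: hN; exact: leq_addl.
by rewrite rnB; exact: tail2.
Qed.

End Koenigs.

Lemma scale_le (R : realType) (t a b G : R) : 0 < t -> (a * b <= t * G -> a * (t^-1 * b) <= G) /\ (t * G <= a * b -> G <= a * (t^-1 * b)).
Proof. by move=> t0; split=> h; rewrite mulrCA; [rewrite ler_pdivrMl|rewrite ler_pdivlMl]. Qed.

Lemma squeeze_eq (R : realType) (G x : R) : 0 <= x ->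
  (forall e, 0 < e -> e <= 1 -> exists2 a, `|a - x| <= e & (1 - e) * a <= G /\ G <= (1 + e) * a) -> G = x.
Proof.
move=> x0 h; apply/eqP; rewrite eq_le; apply/andP; split; apply/ler_addgt0Pr => e e0.
  pose t := Num.min 1 (e / (2 + x)); have x2 : 0 < 2 + x by rewrite ltr_pwDl.
  have t0 : 0 < t by rewrite lt_min ltr01 divr_gt0.
  have t1 : t <= 1 by rewrite ge_min lexx.
  have te : t * (2 + x) <= e by rewrite -ler_pdivlMr // ge_min lexx orbT.
  have [a + [_ h2]] := h t t0 t1; rewrite ler_norml => /andP[_ ax].
  have h3 : (1 + t) * a <= (1 + t) * (x + t) by rewrite ler_pM2l ?addr_gt0 //; lraH ax.
  have h4 : t * t <= t by rewrite ler_piMl // ltW.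
  have E : (1 + t) * (x + t) = x + t * (2 + x) - t + t * t by ring.
  by rewrite E in h3; lraH h2 h3 h4 te.
pose t := Num.min 1 (e / (2 + x)); have x2 : 0 < 2 + x by rewrite ltr_pwDl.
have t0 : 0 < t by rewrite lt_min ltr01 divr_gt0.
have t1 : t <= 1 by rewrite ge_min lexx.
have te : t * (2 + x) <= e by rewrite -ler_pdivlMr // ge_min lexx orbT.
have [a + [h2 _]] := h t t0 t1; rewrite ler_norml => /andP[ax _].
have h3 : (1 - t) * (x - t) <= (1 - t) * a by apply: ler_wpM2l; [rewrite subr_ge0|lraH ax].
have h4 : 0 <= t * t by rewrite mulr_ge0 // ltW.
have E : (1 - t) * (x - t) = x - t * (2 + x) + t + t * t by ring.
by rewrite E in h3; lraH h2 h3 h4 te t0.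
Qed.

Section CvgMx.
Variables (R : realType) (n : nat).
Local Notation V := 'rV[Cx R]_n.

Lemma cvgs_mulmx (a : nat -> V) l (M : 'M[Cx R]_n) : cvgs a l -> cvgs (fun k => a k *m M) (l *m M).
Proof.
pose S := 1 + \sum_i \sum_j rn (M i j : Cx R).
have S0 : 0 < S by rewrite ltr_pwDl // sumr_ge0 // => i _; rewrite sumr_ge0 // => j _; exact: rn_ge0.
move=> ha e e0; have [N hN] := ha _ (divr_gt0 e0 S0); exists N => i /hN; rewrite ler_pdivlMr // => h.
rewrite -mulmxBl; apply: le_trans (rn_mulmx _ _) _; apply: le_trans h; rewrite mulrC.
by apply: ler_wpM2l; [exact: rn_ge0|rewrite lerDr].
Qed.

Lemma cvgs_coord (a : nat -> V) (l : V) : (forall c, cvgs (fun k => a k 0 c : Cx R) (l 0 c : Cx R)) -> cvgs a l.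
Proof.
move=> h e e0; have /choice[N hN] c := h c e e0.
exists (\max_c N c)%N => i hi; apply: rn_le; first exact: ltW.
by move=> c; rewrite !mxE; apply: hN; apply: leq_trans hi; exact: (leq_bigmax c).
Qed.

End CvgMx.

Section KoenigsMap.
Variables (R : realType) (n : nat).
Local Notation C := (Cx R).
Local Notation V := 'rV[C]_n.
Variables (Y : complexManifold R n) (g : tensor Y).
Hypothesis hg : hermitian_metric_on setT g.
Hypothesis pc : path_connected R Y.
Local Notation d := (dist g).
Local Notation phi i := (cmap (mchart (i : mindex Y))).
Variables (al : Y -> Y) (s : R) (y0 : Y).
Hypothesis hal : homothety g al s.
Hypothesis s1 : s < 1.
Hypothesis fix0 : al y0 = y0.
Local Notation i0 := (chart_at y0).
Local Notation p0 := (phi i0 y0).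
Local Notation H := (g i0 y0).
Local Notation it k := (iter k al).
Local Notation KA := (KA al y0).
Local Notation Ak := (Ak al y0).
Local Notation Bk := (Bk al y0).
Local Notation phk := (Phik al y0).
Variables (del Q : R) (Phi : Y -> V).
Hypothesis d0 : 0 < del.
Hypothesis Q0 : 0 <= Q.
Hypothesis hdom : forall z, d y0 z < del -> dom (mchart i0) z.
Hypothesis hbd : forall k y, s ^+ k * d y0 y < del -> rn (phk k y) <= Q * d y0 y.
Hypothesis hlim : forall y, cvgs (phk^~ y) (Phi y).
Hypothesis hunif : forall k y, s ^+ k * d y0 y < del -> rn (phk k y - Phi y) <= Q * d y0 y ^+ 2 * s ^+ k.

(** Applying al shifts the index of the approximation by one and multiplies by A, so the limit
    conjugates al to its linear part. *)
Lemma Phi_al y : Phi (al y) = Phi y *m KA.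
Proof.
have h1 := hlim (al y).
have h2 : cvgs (fun k => phk k.+1 y *m KA) (Phi y *m KA).
  apply: cvgs_mulmx => e /(hlim y)[N hN]; exists N => i Ni; apply: hN; exact: leqW.
have E : (fun k => phk k.+1 y *m KA) = phk^~ (al y).
  apply/funext => k; rewrite /Phik -iterSr.
  by apply: mulmxKV; exact: (KA_unit hg hal fix0).
by rewrite E in h2; exact: (cvgs_uniq h1 h2).
Qed.

Lemma Phi_it k y : Phi (it k y) = Ak k (Phi y).
Proof. by elim: k => //= k IH; rewrite Phi_al IH. Qed.

Lemma Phi0 : Phi y0 = 0.
Proof.
have h : s ^+ 0 * d y0 y0 < del by rewrite expr0 mul1r (dist_xx hg pc).
have := hunif h; rewrite (dist_xx hg pc) expr0n mulr0 mul0r /Phik /= subrr sub0r rnN => h2.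
by apply: rn_eq0; apply/eqP; rewrite eq_le h2 rn_ge0.
Qed.

Lemma Phik_cd k i x : cod (mchart i) x -> dom (mchart i0) (it k (cinv (mchart i) x)) ->
  has_cd (fun x => phk k (cinv (mchart i) x)) x (fun v => Bk k (dF (it k) i i0 (cinv (mchart i) x) v)).
Proof.
move=> cx dx; have [_ [hol _] _] := it_hom hg hal k.
have := holp_diff (hol_on_holp hol (Logic.I : setT (cinv (mchart i) x))) (cinv_dom cx) dx; rewrite (cinvK cx) => h.
have [M hM] := Bk_mx al y0 k.
have hB : has_cd (fun v : V => Bk k v) (local_rep (it k) i i0 x - p0) (fun v => Bk k v).
  apply: has_cd_lin; first by move=> a u v; exact: Bk_lin.
  by exists (\sum_i \sum_j rn (M i j : C)) => v; rewrite hM; exact: rn_mulmx.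
have h2 : has_cd (fun z => local_rep (it k) i i0 z - p0) x (fun v => dF (it k) i i0 (cinv (mchart i) x) v).
  have := has_cdB h (has_cd_cst p0 x); rewrite /dF (cinvK cx).
  by have -> : (fun v => cd (local_rep (it k) i i0) x v - 0) = (fun v => cd (local_rep (it k) i i0) x v) by apply/funext => v; rewrite subr0.
exact: (has_cd_comp h2 hB).
Qed.

(** After k0 iterations the whole ball of radius D, a neighbourhood of y, lies in the chart at y0.
    From there on the approximants are defined in coordinates, uniformly bounded and uniformly
    convergent, and [weierstrass] gives convergence of the differentials. *)
Lemma Phi_cd i y : dom (mchart i) y -> exists2 k0, forall k, s ^+ (k + k0) * d y0 y < del &
  differentiable (Phi \o cinv (mchart i)) (phi i y) /\
  forall v, cvgs (fun k => Bk (k + k0) (dF (it (k + k0)) i i0 y v)) (cd (Phi \o cinv (mchart i)) (phi i y) v).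
Proof.
move=> di; have s0 := scale_gt0 hal; have del2 : 0 < del / 2 by rewrite divr_gt0.
pose D := d y0 y + 1; have D0 : 0 < D by apply: ltr_wpDl; [exact: dist_ge0|exact: ltr01].
have [k0 hk0] := geo_half D s0 s1 del2.
have small k z : d y0 z <= D -> s ^+ (k + k0) * d y0 z < del.
  move=> zD; apply: le_lt_trans (half_lt d0); apply: le_trans (hk0 (k + k0)%N (leq_addl _ _)).
  by apply: ler_wpM2l => //; rewrite exprn_ge0 // ltW.
have yD : d y0 y <= D by rewrite lerDl.
have hn : nbhs y [set z | d y z < 1] := near_dist hg pc y ltr01.
have [r r0 hr] := (nbhs_rnP _ _).1 (chart_nbhs di hn).
have xD x : rn (x - phi i y) < r -> cod (mchart i) x /\ d y0 (cinv (mchart i) x) <= D.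
  move=> /hr[cx hx]; split=> //; apply: le_trans (dist_tri hg pc _ y _) _.
  by rewrite lerD2l; exact: ltW.
have itdom k z : s ^+ k * d y0 z < del -> dom (mchart i0) (it k z).
  by move=> h; apply: hdom; rewrite (it_dist hg pc hal fix0).
have der k x : rn (x - phi i y) < r -> has_cd (fun x => phk (k + k0) (cinv (mchart i) x)) x
    (fun v => Bk (k + k0) (dF (it (k + k0)) i i0 (cinv (mchart i) x) v)).
  by move=> /xD[cx hx]; apply: Phik_cd => //; apply: itdom; exact: small.
have hol c k : bholo (fun x => phk (k + k0) (cinv (mchart i) x) 0 c : C) (phi i y) r (Q * D).
  move=> x xr; have [cx hx] := xD x xr; split.
    exact: has_cd_diff (has_cd_coord c (der k x xr)).
  apply: le_trans (rn_coord _ _) _; apply: le_trans (hbd (small k _ hx)) _.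
  by apply: ler_wpM2l.
have unif e : 0 < e -> exists N, forall k, (N <= k)%N -> forall x, rn (x - phi i y) < r ->
    rn (phk (k + k0) (cinv (mchart i) x) - Phi (cinv (mchart i) x)) <= e.
  move=> e0; have [N hN] := geo_half (Q * D ^+ 2) s0 s1 e0; exists N => k Nk x xr.
  have [cx hx] := xD x xr; apply: le_trans (hunif (small k _ hx)) _.
  apply: le_trans (hN (k + k0)%N (leq_trans Nk (leq_addr _ _))); rewrite [leRHS]mulrC.
  apply: ler_wpM2r; first by rewrite exprn_ge0 // ltW.
  by apply: ler_wpM2l => //; apply: lerXn2r; rewrite ?nnegrE ?(ltW D0) //; exact: dist_ge0.
have W c := weierstrass (f := fun x => Phi (cinv (mchart i) x) 0 c : C) r0 (hol c).
have W' c : differentiable (fun x => Phi (cinv (mchart i) x) 0 c : C) (phi i y) /\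
    forall v, cvgs (fun k => cd (fun x => phk (k + k0) (cinv (mchart i) x) 0 c : C) (phi i y) v)
      (cd (fun x => Phi (cinv (mchart i) x) 0 c : C) (phi i y) v).
  apply: W => e /unif[N hN]; exists N => k Nk x xr; apply: le_trans (hN k Nk x xr).
  by have := rn_coord (phk (k + k0) (cinv (mchart i) x) - Phi (cinv (mchart i) x)) c; rewrite !mxE.
have dP : differentiable (Phi \o cinv (mchart i)) (phi i y).
  by apply/differentiable_coordP => c; exact: (W' c).1.
exists k0; first by move=> k; exact: small.
split=> // v; apply: cvgs_coord => c; rewrite (cd_coord v c dP).
have := (W' c).2 v; have q0 : rn (phi i y - phi i y) < r by rewrite subrr rn0.
have E : (fun k => cd (fun x => phk (k + k0) (cinv (mchart i) x) 0 c : C) (phi i y) v) =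
    (fun k => Bk (k + k0) (dF (it (k + k0)) i i0 y v) 0 c).
  apply/funext => k; have := has_cd_val v (has_cd_coord c (der k _ q0)); by rewrite (cmapK di).
by rewrite E.
Qed.

(** The differential of al^m multiplies lengths by s^m and lands near y0, where the metric is within
    a factor 1 + e or 1 - e of its value H at y0; A^-m multiplies H-lengths by s^-m. The factors
    cancel, and e is arbitrary. *)
Lemma Phi_isometry i y v : dom (mchart i) y -> nH H (cd (Phi \o cinv (mchart i)) (phi i y) v) = nH (g i y) v.
Proof.
move=> di; have s0 := scale_gt0 hal; have dy0 := dom_chart_at y0; have pH := posH hg y0.
have [k0 small [_ lim]] := Phi_cd di; have [c2 c20 hc2] := nH_upper H.
apply/esym; apply: squeeze_eq => [|e e0 e1]; first exact: nH_ge0.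
have hm := metric_near openT hg (Logic.I : setT y0) dy0 e0 e1.
have [t t0 ht] := (nbhs_dist hg pc y0 _).1 hm.
have t2 : 0 < t / 2 by rewrite divr_gt0.
have [N hN] := geo_half (d y0 y) s0 s1 t2.
have [M hM] := lim v _ (divr_gt0 e0 c20).
pose k := maxn N M; pose m := (k + k0)%N; pose u := dF (it m) i i0 y v.
have close := hM k (leq_maxr _ _); rewrite ler_pdivlMr // mulrC -/m -/u in close.
exists (nH H (Bk m u)).
  apply: norm_le_of.
    apply: le_trans (nH_dist _ (cd (Phi \o cinv (mchart i)) (phi i y) v) pH) _.
    by rewrite lerD2l; apply: le_trans (hc2 _) _.
  apply: le_trans (nH_dist _ (Bk m u) pH) _; rewrite lerD2l nHB.
  by apply: le_trans (hc2 _) _.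
have dm : d y0 (it m y) < t.
  rewrite (it_dist hg pc hal fix0); apply: le_lt_trans (half_lt t0); apply: hN.
  by apply: leq_trans (leq_maxl N M) _; exact: leq_addr.
have di0 : dom (mchart i0) (it m y) by apply: hdom; rewrite (it_dist hg pc hal fix0); exact: small.
have sm : 0 < s ^+ m by exact: exprn_gt0.
have [h1 h2] := ht _ dm u; have h3 := homothety_nH hg v (it_hom hg hal m) di di0.
rewrite -/u in h3; rewrite h3 in h1 h2.
rewrite (nBk hg hal fix0) exprVn; split; first exact: (scale_le _ _ _ sm).1 h1.
exact: (scale_le _ _ _ sm).2 h2.
Qed.

(** At the fixed point al^k has differential A^k, so every approximant already has the identity as
    differential. *)
Lemma Phi_cd0 v : cd (Phi \o cinv (mchart i0)) p0 v = v.
Proof.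
have dy0 := dom_chart_at y0; have [k0 small [_ lim]] := Phi_cd dy0.
have E k : Bk k (dF (it k) i0 i0 y0 v) = v.
  have -> : dF (it k) i0 i0 y0 v = Ak k v; last exact: (BkK hg hal fix0).
  elim: k => [|k IH]; first exact: dF_id.
  have [_ [hk _] _] := it_hom hg hal k; have [_ [ha _] _] := hal.
  have dk : dom (mchart i0) (it k y0) by rewrite (it_fix fix0).
  have dk1 : dom (mchart i0) (al (it k y0)) by rewrite (it_fix fix0) fix0.
  have := dF_comp v (hol_on_holp hk (Logic.I : setT y0)) (hol_on_holp ha (Logic.I : setT (it k y0))) dy0 dk dk1.
  by rewrite /comp -[X in dF X _ _ _ _ = _]/(it k.+1) IH => ->; rewrite (it_fix fix0) /Ak /= (KA_dF al y0).
have h := lim v; have E2 : (fun k => Bk (k + k0) (dF (it (k + k0)) i0 i0 y0 v)) = fun=> v by apply/funext => k; exact: E.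
rewrite E2 in h; apply: cvgs_uniq h _ => e e0; exists 0%N => i _; by rewrite subrr rn0 ltW.
Qed.

End KoenigsMap.

Section ToComplexSpace.
Variables (R : realType) (n : nat).
Local Notation C := (Cx R).
Local Notation V := 'rV[C]_n.
Local Notation CS := (complex_space R n).

Lemma holp_to_space (Y : complexManifold R n) (F : Y -> V) y (i : mindex Y) : dom (mchart i) y ->
  differentiable (F \o cinv (mchart i)) (cmap (mchart i) y) -> @holp R n Y CS F y.
Proof.
move=> di dF; apply: (@holp1 R n Y CS F y i tt _ di Logic.I dF) => N hN.
have hN' : nbhs ((F \o cinv (mchart i)) (cmap (mchart i) y)) N by rewrite /comp (cmapK di).
have hc : nbhs (cmap (mchart i) y) [set x | N (F (cinv (mchart i) x))] := differentiable_continuous dF hN'.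
have nb := chart_nbhsV di hc; apply: (@filterS _ (nbhs y) _ _ _ _ nb) => q /= [dq].
by rewrite (cmapK dq).
Qed.

Lemma holp_from_space (Y : complexManifold R n) (i : mindex Y) (G : V -> V) (v : V) : differentiable G v ->
  cod (mchart i) (G v) -> @holp R n CS Y (fun v => cinv (mchart i) (G v)) v.
Proof.
move=> dG cG; apply: (@holp1 R n CS Y _ v tt i) => //; last 2 first.
- exact: cinv_dom.
- have nc : nbhs v [set w | cod (mchart i) (G w)].
    have oc : nbhs (G v) (cod (mchart i)) by apply: open_nbhs_nbhs; split=> //; exact: cod_open.
    exact: (differentiable_continuous dG oc).
  have nE : nbhs v [set w | G w = cmap (mchart i) (cinv (mchart i) (G w))].
    by apply: filterS nc => w /= cw; rewrite cinvK.
  by have [] := differentiable_near nE dG.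
move=> N hN; have h1 : nbhs (G v) [set x | N (cinv (mchart i) x)] := cinv_continuous cG hN.
exact: (differentiable_continuous dG h1).
Qed.

Lemma linear_diff (M : 'M[C]_n) (v : V) : differentiable (fun v : V => v *m M) v.
Proof.
apply: has_cd_diff; apply: has_cd_lin; first by move=> a u w; rewrite mulmxDl -scalemxAl.
by exists (\sum_i \sum_j rn (M i j : C)) => w; exact: rn_mulmx.
Qed.

Lemma diff_comp (F G : V -> V) v : differentiable F v -> differentiable G (F v) -> differentiable (G \o F) v.
Proof. by move=> dF dG; exact: has_cd_diff (has_cd_comp (differentiable_has_cd dF) (differentiable_has_cd dG)). Qed.

Lemma flat_hermitian : hermitian_metric_on setT (flat_metric R n).
Proof.
have p1 : posdef_hermitian (1%:M : 'M[C]_n).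
  split; first by apply/matrixP => i j; rewrite !mxE eq_sym; case: eqP => _; rewrite ?rmorph1 ?rmorph0.
  move=> u /eqP nu; rewrite hermE.
  have E : \sum_k \sum_l u 0 k * (1%:M : 'M[C]_n) k l * Num.conj (u 0 l) = ((\sum_k rn (u 0 k : C) ^+ 2)%:C : C).
    rewrite rmorph_sum /=; apply: eq_bigr => k _; rewrite (bigD1 k) //= big1 ?addr0; last first.
      by move=> l lk; rewrite mxE eq_sym (negbTE lk) mulr0 mul0r.
    by rewrite mxE eqxx mulr1 -mul_conj.
  rewrite E -[ltLHS]/((0 : R)%:C) ltcR_ lt_def sumr_ge0 => [|k _]; last by rewrite sqr_ge0.
  rewrite andbT; apply/negP => /eqP/psumr_eq0P h; apply: nu; apply/rowP => k; rewrite mxE.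
  apply: rn_eq0; apply/eqP; rewrite -sqrf_eq0; apply/eqP; apply: h => // l _; exact: sqr_ge0.
apply: metric_of => [i p _ _|i j p u v _ di dj|i k l p _ _].
- exact: p1.
- apply: herm_eq2; rewrite -[LHS](dF_id (i := tt) (p := p) _ Logic.I); by case: i di; case: j dj.
- by exists setT => // m; exact: Csm_cst.
Qed.

End ToComplexSpace.

Section Linearization.
Variables (R : realType) (n : nat).
Local Notation C := (Cx R).
Local Notation V := 'rV[C]_n.
Local Notation CS := (complex_space R n).
Variables (Y : complexManifold R n) (g : tensor Y).
Hypothesis hg : hermitian_metric_on setT g.
Hypothesis pc : path_connected R Y.
Local Notation d := (dist g).
Local Notation phi i := (cmap (mchart (i : mindex Y))).
Variables (al : Y -> Y) (s : R) (y0 : Y).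
Hypothesis hal : homothety g al s.
Hypothesis s1 : s < 1.
Hypothesis fix0 : al y0 = y0.
Local Notation i0 := (chart_at y0).
Local Notation p0 := (phi i0 y0).
Local Notation H := (g i0 y0).
Local Notation it k := (iter k al).
Local Notation Ak := (Ak al y0).
Variable Phi : Y -> V.
Hypothesis hit : forall k y, Phi (it k y) = Ak k (Phi y).
Hypothesis h0 : Phi y0 = 0.
Hypothesis hdf : forall i y, dom (mchart i) y -> differentiable (Phi \o cinv (mchart i)) (phi i y).
Hypothesis hiso : forall i y v, dom (mchart i) y -> nH H (cd (Phi \o cinv (mchart i)) (phi i y) v) = nH (g i y) v.
Hypothesis hcd0 : forall v, cd (Phi \o cinv (mchart i0)) p0 v = v.

Lemma Ak_small v e : 0 < e -> exists N, forall k, (N <= k)%N -> rn (Ak k v) <= e.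
Proof.
move=> e0; have [c c0 hc] := nH_lower (posH hg y0); have s0 := scale_gt0 hal.
have [N hN] := geo_half (nH H v) s0 s1 (mulr_gt0 c0 e0); exists N => k /hN h.
by rewrite -(ler_pM2l c0); apply: le_trans (hc _) _; rewrite (nAk hg hal fix0).
Qed.

Lemma it_near N y : nbhs y0 N -> exists k0, forall k, (k0 <= k)%N -> N (it k y).
Proof.
move=> /(nbhs_dist hg pc)[e e0 he]; have s0 := scale_gt0 hal; have e2 : 0 < e / 2 by rewrite divr_gt0.
have [k0 hk] := geo_half (d y0 y) s0 s1 e2; exists k0 => k kk; apply: he.
by rewrite (it_dist hg pc hal fix0); apply: le_lt_trans (hk k kk) (half_lt e0).
Qed.

Lemma it_inj k : injective (it k).
Proof.
have [_ [_ [ai [_ aK _]]] _] := hal.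
by elim: k => // k IH x y /= /(can_inj aK)/IH.
Qed.

Lemma linearization_local : exists2 r : R, 0 < r & exists G0 : V -> V,
  [/\ forall x, rn (x - p0) <= r -> cod (mchart i0) x,
      forall z z', dom (mchart i0) z -> dom (mchart i0) z' -> rn (phi i0 z - p0) <= r -> rn (phi i0 z' - p0) <= r ->
        Phi z = Phi z' -> z = z',
      forall w, rn w <= r / 2 -> rn (G0 w - p0) <= r /\ Phi (cinv (mchart i0) (G0 w)) = w &
      forall w, rn w < r / 2 -> differentiable G0 w].
Proof.
have dy0 := dom_chart_at y0; pose F := Phi \o cinv (mchart i0).
have nc : nbhs p0 (cod (mchart i0)) by apply: open_nbhs_nbhs; split; [exact: cod_open|exact: cmap_cod].
have dF x : cod (mchart i0) x -> differentiable F x by move=> cx; have := hdf (cinv_dom cx); rewrite (cinvK cx).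
have [r r0 [G0 [hc lip hG]]] := local_inverse nc dF hcd0.
have F0 : F p0 = 0 by rewrite /F /= (cmapK dy0).
rewrite F0 in hG; have hG' w : rn w <= r / 2 -> rn (G0 w - p0) <= r /\ F (G0 w) = w.
  by move=> hw; apply: hG; rewrite subr0.
exists r => //; exists G0; split=> // [z z' dz dz' hz hz' e|w hw].
  have := lip _ _ hz hz'; rewrite /F /= !cmapK // e subrr rn0 mulr0 => h.
  have : phi i0 z' - phi i0 z = 0 by apply: rn_eq0; apply/eqP; rewrite eq_le h rn_ge0.
  by move=> /eqP; rewrite subr_eq0 => /eqP h'; rewrite -(cmapK dz) -(cmapK dz') h'.
have [gr Fg] := hG' w (ltW hw); have cg := hc _ gr.
apply: (@inverse_diff _ _ F); first exact: dF.
  move=> v hv; apply: contrapT => /eqP/rn_gt0 v0.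
  have := hiso v (cinv_dom cg); rewrite (cinvK cg) -/F hv nH0 => /esym/eqP.
  have [c c0 hcc] := nH_lower (metric_posdef hg (cinv_dom cg)).
  by rewrite gt_eqF //; apply: lt_le_trans (hcc v); rewrite mulr_gt0.
exists (r / 2 - rn w); first by rewrite subr_gt0.
move=> w' hw'; have w'r : rn w' <= r / 2.
  by rewrite -(subrK w w'); apply: le_trans (rnD _ _) _; apply: ltW; rewrite -ltrBrDr.
have [gr' Fg'] := hG' w' w'r; split=> //.
by have := lip _ _ gr gr'; rewrite Fg Fg'.
Qed.

(** The conjugacy makes local statements global: iterates of two points enter the ball where the map
    is injective, and v is inverted by moving it near 0 with A^k, inverting there, and going back
    with al^-k. *)
Theorem linearization_biholomorphic : @biholomorphic R n Y CS Phi.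
Proof.
have dy0 := dom_chart_at y0.
have hol : @holomorphic_on R n Y CS setT Phi.
  by apply/(@holomorphic_onP R n Y CS) => y _; exact: (holp_to_space (dom_chart_at y) (hdf (dom_chart_at y))).
have [r r0 [G0 [hc hinj hG dG]]] := linearization_local.
have r2 : 0 < r / 2 by rewrite divr_gt0.
have nr : nbhs y0 [set z | dom (mchart i0) z /\ rn (phi i0 z - p0) <= r].
  have h : nbhs p0 [set x | rn (x - p0) <= r] by apply/nbhs_rnP; exists r => // x /ltW.
  exact: chart_nbhsV dy0 h.
have inj y y' : Phi y = Phi y' -> y = y'.
  move=> e; have [k1 hk1] := it_near y nr; have [k2 hk2] := it_near y' nr.
  have [d1 b1] := hk1 _ (leq_maxl k1 k2); have [d2 b2] := hk2 _ (leq_maxr k1 k2).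
  by apply: (@it_inj (maxn k1 k2)); apply: hinj => //; rewrite !hit e.
have [_ [_ [ai [hai aK Ka]]] _] := hal.
have aiK k : cancel (iter k ai) (it k).
  by elim: k => // k IH y; rewrite [iter k.+1 ai y]iterSr [LHS]/= IH Ka.
have sol k v : rn (Ak k v) <= r / 2 -> Phi (iter k ai (cinv (mchart i0) (G0 (Ak k v)))) = v.
  move=> h; have [_ e] := hG _ h; set y := cinv _ _ in e *.
  have e2 := hit k (iter k ai y); rewrite aiK e in e2.
  by rewrite -[LHS](BkK hg hal fix0 k) -e2 (BkK hg hal fix0).
have /choice[G GP] (v : V) : exists y, Phi y = v.
  have [N hN] := Ak_small v r2; exists (iter N ai (cinv (mchart i0) (G0 (Ak N v)))).
  by apply: sol; exact: hN.
split=> //; exists G; split.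
- apply/(@holomorphic_onP R n CS Y) => v _.
  have r4 : 0 < r / 2 / 2 by rewrite divr_gt0.
  have [k hk] := Ak_small v r4; have hv : rn (Ak k v) < r / 2 by apply: le_lt_trans (hk k (leqnn _)) (half_lt r2).
  (* One k serves for all points near v, so near v the inverse is given by a single holomorphic
     formula. *)
  have [M hM] := Ak_mx al y0 k.
  have dA : differentiable (fun v => G0 (Ak k v)) v.
    have dL := linear_diff M v.
    have E : (fun v => G0 (Ak k v)) = G0 \o (fun v : V => v *m M) by apply/funext => w; rewrite /= hM.
    by rewrite E; apply: diff_comp dL _; rewrite -hM; exact: dG.
  have cA : cod (mchart i0) (G0 (Ak k v)) by apply: hc; have [] := hG _ (ltW hv).
  have hol1 := holp_from_space dA cA.
  have hai' j y : holp (iter j ai) y.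
    elim: j => [|j IH]; first exact: holp_id.
    exact: (holp_comp IH (hol_on_holp hai (Logic.I : setT (iter j ai y)))).
  have hol2 := holp_comp hol1 (hai' k _).
  have nv : nbhs v [set w | (iter k ai \o (fun v => cinv (mchart i0) (G0 (Ak k v)))) w = G w].
    have h : nbhs (v *m M) [set x : V | rn x < r / 2].
      apply/nbhs_rnP; exists (r / 2 - rn (v *m M)); first by rewrite subr_gt0 -hM.
      by move=> x hx /=; rewrite -(subrK (v *m M) x); apply: le_lt_trans (rnD _ _) _; rewrite -ltrBrDr.
    have h' : nbhs v [set w : V | rn (w *m M) < r / 2] := differentiable_continuous (linear_diff M v) h.
    apply: filterS h' => w /= hw; apply: inj; rewrite GP; apply: sol; rewrite hM; exact: ltW.
  exact: (holp_near nv hol2).1.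
- by move=> y; apply: inj; rewrite GP.
- by move=> v; exact: GP.
Qed.

End Linearization.

Lemma contraction_radius (R : realType) (D s r x : R) : s < 1 -> r = D / (1 - s) -> 0 < s -> x <= D + s * r -> x <= r.
Proof. by move=> s1 -> s0 h; apply: le_trans h _; apply: eq_leW; field; rewrite subr_eq0 gt_eqF. Qed.

Section Dichotomy.
Variables (R : realType) (n : nat).
Local Notation C := (Cx R).
Local Notation V := 'rV[C]_n.
Local Notation CS := (complex_space R n).
Variables (Y : complexManifold R n) (g : tensor Y).
Hypothesis hg : hermitian_metric_on setT g.
Hypothesis pc : path_connected R Y.
Local Notation d := (dist g).
Local Notation phi i := (cmap (mchart (i : mindex Y))).

Lemma homothety_fixpoint al s : homothety g al s -> s < 1 -> (forall y r, compact (cball g y r)) -> exists y0, al y0 = y0.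
Proof.
move=> hal s1 prop; have s0 := scale_gt0 hal; have [[x0 _] _] := pc.
(* The radius solves D + s r = r, so the closed ball is mapped into itself. *)
pose D := d x0 (al x0); pose r := D / (1 - s).
have D0 : 0 <= D by exact: dist_ge0.
have r0 : 0 <= r by rewrite divr_ge0 // subr_ge0 ltW.
have K0 : cball g x0 r x0 by rewrite /cball /= (dist_xx hg pc).
have dh x y : d (al x) (al y) = s * d x y := homothety_dist hg pc x y hal.
have stable x : cball g x0 r x -> cball g x0 r (al x).
  rewrite /cball /= => hx; apply: (contraction_radius (D := D) s1 erefl s0).
  apply: le_trans (dist_tri hg pc _ (al x0) _) _; rewrite lerD2l dh.
  by apply: ler_wpM2l => //; exact: ltW.
have [|||||||||||y _ fy] := @contraction_fixpoint R Y d (cball g x0 r) al x0 s.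
- exact: dist_ge0.
- exact: dist_sym.
- by move=> x y z; exact: dist_tri.
- by move=> x y; exact: (dist_sep hg pc).
- by move=> x e; exact: near_dist.
- exact: prop.
- exact: K0.
- exact: stable.
- exact: s0.
- exact: s1.
- by move=> x y _ _; apply: eq_leW; exact: dh.
by exists y.
Qed.

(** The linearization is an isometry onto C^n with the constant form H; writing H = P P^* and
    composing with v |-> v P makes the form standard. *)
Lemma contracting_flat al s : homothety g al s -> s < 1 -> (forall y r, compact (cball g y r)) ->
  exists2 F : Y -> V, @biholomorphic R n Y CS F &
    forall i p, dom (mchart i) p -> @pullback R n Y CS F (flat_metric R n) i p = g i p.
Proof.
move=> hal s1 prop; have [y0 fix0] := homothety_fixpoint hal s1 prop.
have [del d0 [Q Q0 [Phi [hdom hbd hlim hunif]]]] := koenigs_limit hg pc hal s1 fix0.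
have hit := Phi_it hg hal fix0 hlim.
have P0 := Phi0 hg pc d0 hunif.
have hdf i y (di : dom (mchart i) y) : differentiable (Phi \o cinv (mchart i)) (cmap (mchart i) y).
  by have [k0 _ []] := Phi_cd hg pc hal s1 fix0 d0 Q0 hdom hbd hunif di.
have hiso i y v (di : dom (mchart i) y) := Phi_isometry hg pc hal s1 fix0 d0 Q0 hdom hbd hunif v di.
have hcd0 v := Phi_cd0 hg pc hal s1 fix0 d0 Q0 hdom hbd hunif v.
have [hol [G [hG PK GK]]] := linearization_biholomorphic hg pc hal s1 fix0 hit P0 hdf hiso hcd0.
have [P uP HP] := posdef_factor (posH hg y0).
have linH (M : 'M[C]_n) : @holomorphic_on R n CS CS setT (fun v : V => v *m M).
  by apply/(@holomorphic_onP R n CS CS) => v _; apply: (@holp_to_space R n CS _ v tt Logic.I); exact: linear_diff.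
have bihol : @biholomorphic R n Y CS (fun y => Phi y *m P).
  split.
    exact: (@holomorphic_comp R n Y CS CS setT setT Phi (fun v : V => v *m P) hol (linH P)).
  exists (fun v : V => G (v *m invmx P)); split.
  - exact: (@holomorphic_comp R n CS CS Y setT setT (fun v : V => v *m invmx P) G (linH _) hG).
  - by move=> y; rewrite mulmxK.
  - by move=> v; rewrite GK mulmxKV.
exists (fun y => Phi y *m P) => // i p di; apply: herm_polar => u.
have hp := @hol_on_holp R n Y CS setT _ p bihol.1 Logic.I.
have E := @pullback_herm R n Y CS (fun y => Phi y *m P) setT (flat_metric R n) i tt p u u (@flat_hermitian R n) Logic.I hp di Logic.I.
have dE : @dF R n Y CS (fun y => Phi y *m P) i tt p u = cd (Phi \o cinv (mchart i)) (cmap (mchart i) p) u *m P.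
  have h1 := differentiable_has_cd (hdf i p di).
  have h2 : has_cd (fun v : V => v *m P) ((Phi \o cinv (mchart i)) (cmap (mchart i) p)) (fun v => v *m P).
    apply: has_cd_lin; first by move=> a x w; rewrite mulmxDl -scalemxAl.
    by exists (\sum_i \sum_j rn (P i j : C)) => w; exact: rn_mulmx.
  exact: (has_cd_val u (has_cd_comp h1 h2)).
apply: etrans E _; apply: etrans (herm_eq2 _ dE dE) _.
have gp := metric_posdef hg di.
set w := cd _ _ u in dE *; have hw := hiso i p u di; rewrite -/w in hw.
have e1 : herm (1%:M : 'M[C]_n) (w *m P) (w *m P) = herm (g (chart_at y0) y0) w w.
  by rewrite -herm_pull mulmx1 -HP.
apply: etrans e1 _; rewrite (herm_sqn w (posH hg y0)) (herm_sqn u gp); congr (_%:C).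
by rewrite -(nH_sqr w (posH hg y0)) -(nH_sqr u gp) hw.
Qed.

Theorem homothety_dichotomy : (exists2 u : Y -> R, smooth_pos_on setT u &
     forall al s y, homothety g al s -> u (al y) * s ^+ 2 = u y) \/
  exists2 F : Y -> V, @biholomorphic R n Y CS F &
    forall i p, dom (mchart i) p -> @pullback R n Y CS F (flat_metric R n) i p = g i p.
Proof.
have [[y hy]|np] := pselect (exists y, forall r, compact (cball g y r)); last first.
  left; apply: nonproper_invariant => // y; apply: contrapT => h; apply: np; exists y => r.
  apply: contrapT => nc; apply: h; exists r => //; rewrite leNgt; apply/negP => r0; apply: nc.
  have -> : cball g y r = set0; last exact: compact0.
  by apply/seteqP; split=> // z; rewrite /cball /= leNgt (lt_le_trans r0) // dist_ge0.
(* One centre with compact balls suffices, as every ball lies in a ball around it. *)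
have prop z r : compact (cball g z r).
  by apply: (cball_compact_sub hg pc (y := y) (r := d y z + r)) => //; exact: lexx.
have [h|h] := pselect (forall al s, homothety g al s -> s = 1).
  left; exists (fun=> 1); first exact: smooth_pos_cst.
  by move=> al s z /h ->; rewrite expr1n mulr1.
right; have [al [s hal sn]] : exists al, exists2 s, homothety g al s & s <> 1.
  by apply: contrapT => h2; apply: h => al s hal; apply: contrapT => sn; apply: h2; exists al, s.
have s0 := scale_gt0 hal.
have [s1|s1|//] := ltgtP s 1; first exact: contracting_flat hal s1 prop.
have [_ [_ [ai [hai aK Ka]]] _] := hal.
have hal' := homothety_inv hg hal hai aK Ka.
by apply: contracting_flat hal' _ prop; rewrite invf_lt1.
Qed.

End Dichotomy.

(** * Descent to the base *)

Section Descent.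
Variables (R : realType) (n : nat).
Local Notation C := (Cx R).
Local Notation V := 'rV[C]_n.
Variables (X Y : complexManifold R n) (h : tensor X) (p : Y -> X).
Hypothesis hh : hermitian_metric_on setT h.
Hypothesis connX : connected [set: X].
Hypothesis univ : universal_covering p.

(** An evenly covered open set that meets the image is contained in it, so the image is open and
    closed in the connected X. *)
Lemma covering_surjective x : exists y, p y = x.
Proof.
have [[[[y0 _] _] _] [_ cov]] := univ.
pose B : set X := [set x | exists y, p y = x].
have full x' : exists2 U : set X, open U /\ U x' & (U `&` B) !=set0 -> U `<=` B.
  have [U [oU Ux [K [Vk [s [oV tV pV hs]]]]]] := cov x'; exists U; first by split.
  move=> [x'' [Ux'' [y py]]] z Uz.
  have : (p @^-1` U) y by rewrite /= py.
  rewrite pV => -[k _ _]; exists (s k z); by have [_ _ -> ] := hs k.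
have oB : open B.
  rewrite openE => z Bz; have [U [oU Uz] UB] := full z; rewrite /interior.
  have nU : nbhs z U by apply: open_nbhs_nbhs.
  by apply: filterS nU; apply: UB; exists z.
have cB : closed B.
  rewrite -[B]setCK; apply: open_closedC; rewrite openE => z nBz; have [U [oU Uz] UB] := full z.
  have nU : nbhs z U by apply: open_nbhs_nbhs.
  apply: filterS nU => z' Uz' Bz'; apply: nBz; apply: UB => //; by exists z'.
suff E : B = setT by have : B x by rewrite E.
apply: connX; first by exists (p y0), y0.
- by exists B => //; rewrite setTI.
- by exists B => //; rewrite setTI.
Qed.

Variables (w : Y -> R) (u : Y -> R).
Hypothesis sw : smooth_pos_on setT w.
Hypothesis kw : kahler_on setT (scale_tensor w (pullback p h)).
Hypothesis su : smooth_pos_on setT u.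
Hypothesis hu : forall al s y, homothety (scale_tensor w (pullback p h)) al s -> u (al y) * s ^+ 2 = u y.
Hypothesis n2 : (2 <= n)%N.
Let v y := u y * w y.

(** The transformation law of v = u w under a lift al of a: its conformal factor on g is a constant
    c, so al is a homothety of ratio sqrt c, and the weight of u compensates c. *)
Lemma v_conformal a f y y1 : biholomorphic a -> smooth_pos_on setT f -> tensor_eq_on setT (pullback a h) (scale_tensor f h) ->
  p y1 = a (p y) -> v y1 * f (p y) = v y.
Proof.
move=> ba sf af e; have [al [bal pal alE]] := lift_biholomorphic univ ba e.
have [sc cp] := univ; have pc := sc.1; have hp := covering_hol cp.
have w0 z : 0 < w z := sw.2 z Logic.I.
(* As p al = a p, the pullback of w p^*h by al is w(al z) f(p z) p^*h, so c is the conformal factor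
   of al for g. *)
pose c z := w (al z) * f (p z) * (w z)^-1.
have scc : smooth_pos_on setT c.
  apply: smooth_posM; [exact: openT| |exact: (smooth_posV openT sw)].
  apply: smooth_posM; first exact: openT.
    exact: (smooth_pos_comp openT openT bal.1 (fun _ _ => Logic.I) sw).
  exact: (smooth_pos_comp openT openT hp (fun _ _ => Logic.I) sf).
have pE : p \o al = a \o p by apply/funext => z; exact: pal.
have key i z : dom (mchart i) z ->
    pullback al (scale_tensor w (pullback p h)) i z = (c z)%:C *: scale_tensor w (pullback p h) i z.
  move=> dz; have e1 := pullback_scale al w (pullback p h) i z.
  have hal z' := hol_on_holp bal.1 (Logic.I : setT z').
  have hpp z' := hol_on_holp hp (Logic.I : setT z').
  have e2 := pullback_comp hh (Logic.I : setT (p (al z))) (hal z) (hpp (al z)) dz.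
  have e3 := pullback_comp hh (Logic.I : setT (a (p z))) (hpp z) (hol_on_holp ba.1 (Logic.I : setT (p z))) dz.
  have e4 := pullback_ext i af (Logic.I : setT (p z)).
  have e5 := pullback_scale p f h i z.
  have e6 : pullback al (pullback p h) i z = (f (p z))%:C *: pullback p h i z.
    by apply: etrans (esym e2) _; rewrite pE; apply: etrans e3 _; apply: etrans e4 e5.
  apply: etrans e1 _; apply: etrans (congr1 (fun M => (w (al z))%:C *: M) e6) _.
  rewrite scalerA [in RHS]/scale_tensor scalerA -!rmorphM; congr (_%:C *: _).
  exact: (esym (divfK (lt0r_neq0 (w0 z)) (w (al z) * f (p z)))).
have cc := kahler_conformal_constant n2 pc kw bal scc key.
have c0 : 0 < c y := scc.2 y Logic.I.
have hom : homothety (scale_tensor w (pullback p h)) al (Num.sqrt (c y)).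
  split; [by rewrite sqrtr_gt0|exact: bal|move=> i z dz].
  by apply: etrans (key i z dz) _; rewrite sqr_sqrtr ?(ltW c0) // (cc z y).
have := hu y hom; rewrite sqr_sqrtr ?(ltW c0) // alE => hE.
by rewrite /v -[u y]hE /c alE; field; rewrite gt_eqF.
Qed.

(** The case a = id of [v_conformal] shows that v is constant on fibres, so the choice of preimages
    q is immaterial; on an evenly covered set v may be composed with a local inverse of p, whence
    smoothness. *)
Lemma conformal_factor : exists2 vX : X -> R, smooth_pos_on setT vX &
  forall a f x, biholomorphic a -> smooth_pos_on setT f -> tensor_eq_on setT (pullback a h) (scale_tensor f h) ->
    vX (a x) * f x = vX x.
Proof.
have [sc cp] := univ; have hp := covering_hol cp.
have /choice[q hq] := covering_surjective.
have bid : biholomorphic (@id X).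
  have hid : holomorphic_on setT (@id X) by apply/holomorphic_onP => z _; exact: holp_id.
  by split=> //; exists id; split.
have vE y y1 : p y1 = p y -> v y1 = v y.
  move=> e; rewrite -[LHS]mulr1.
  apply: (v_conformal (f := fun=> 1) bid) => //; first exact: smooth_pos_cst.
  move=> i z _ dz; rewrite /scale_tensor scale1r; exact: (pullback_id hh Logic.I dz).
have sv : smooth_pos_on setT v by apply: smooth_posM => //; exact: openT.
exists (v \o q).
  split; last by move=> x _; exact: sv.2.
  apply: smooth_fun_local => x _.
  have [_ cov] := cp; have [U [oU Ux [K [Vk [s [oV tV pV hs]]]]]] := cov x.
  have : (p @^-1` U) (q x) by rewrite /= hq.
  rewrite pV => -[k _ _]; exists U => //; have [hk _ pk _] := hs k.
  apply: (smooth_fun_ext oU _ (smooth_fun_comp oU openT hk (fun _ _ => Logic.I) sv.1)) => z Uz /=.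
  by apply: vE; rewrite hq pk.
move=> a f x ba sf af /=; have := v_conformal (y := q x) (y1 := q (a x)) ba sf af.
by rewrite !hq; apply.
Qed.

End Descent.

Lemma dim_ge2 n : (4 <= 2 * n)%N -> (2 <= n)%N.
Proof. by case: n => [|[|n]]. Qed.

Theorem corollary32 (R : realType) (n : nat) (X : complexManifold R n)
    (h : tensor X) (Y : complexManifold R n) (p : Y -> X)
    (dimX : (4 <= 2 * n)%N)
    (connX : connected [set: X])
    (lcKh : lcK h)
    (univ : universal_covering p)
    (notCn : ~ holomorphically_conformal (pullback p h) (flat_metric R n)) :
  exists h' : tensor X,
    [/\ lcK h', conformal_metric h h' & Iso h' = Conf h].
Proof.
have n2 := dim_ge2 dimX; have [hh [L [U [u0 [g0 [oU cov hl]]]]]] := lcKh.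
have [w sw kw] := global_kahler n2 lcKh univ.
have pc := univ.1.1.
have [[u su hu]|[F bF FE]] := homothety_dichotomy kw.1 pc; last first.
  by case: notCn; exists F; split=> //; exists w; split=> // i y _ dy; rewrite FE.
have [v sv hv] := conformal_factor hh connX univ sw kw su hu n2.
have v0 x : 0 < v x := sv.2 x Logic.I.
exists (scale_tensor v h); split.
- split; first by apply: metric_scale => //; exact: openT.
  exists L, U, (fun l x => v x * u0 l x), g0; split=> // l; have [sl kl el] := hl l; split=> //.
    by apply: smooth_posM => //; exact: smooth_pos_sub sv.
  move=> i x Ux dx; have e := congr1 (fun M => (v x)%:C *: M) (el i x Ux dx).
  exact: etrans e (scale_comp v (u0 l) (g0 l) i x).
- by exists v; split.
(* An isometry a of v h satisfies a^*h = (v / v o a) h. Conversely, if a^*h = f h, then the pullback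
   of v h has factor (v o a) f, which is v by [hv]. *)
apply/seteqP; split=> a [ba ha]; split=> //.
  exists (fun x => v x * (v (a x))^-1); split.
    apply: smooth_posM => //; first exact: openT.
    apply: (smooth_posV (f := v \o a) openT).
    exact: (smooth_pos_comp openT openT ba.1 (fun _ _ => Logic.I) sv).
  move=> i x _ dx; have e := etrans (esym (pullback_scale a v h i x)) (ha i x Logic.I dx).
  have va : (v (a x))%:C != 0 :> Cx R by rewrite -[0]/((0 : R)%:C) (inj_eq (@complexI R)) gt_eqF.
  apply: (scalerI va); apply: etrans e _.
  rewrite /scale_tensor scalerA -rmorphM; congr (_%:C *: _).
  by field; rewrite gt_eqF.
have [f [sf hf]] := ha.
move=> i x _ dx; apply: etrans (pullback_scale a v h i x) _.
apply: etrans (congr1 (fun M => (v (a x))%:C *: M) (hf i x Logic.I dx)) _.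
rewrite /scale_tensor scalerA -rmorphM; congr (_%:C *: _).
exact: hv ba sf hf.
Qed.
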